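(* Let $n,n_P,n_Q\in\mathbb{N}$, $T>0$, $\alpha\in(0,1)$, let $P\subset\mathbb{R}^{n_P}$, $Q\subset\mathbb{R}^{n_Q}$ be compact, and let $f:[0,T]\times\mathbb{R}^n\times P\times Q\to\mathbb{R}^n$, $\chi:[0,T]\times\mathbb{R}^n\times P\times Q\to\mathbb{R}$, $\sigma:AC^\alpha\to\mathbb{R}$ satisfy: (i) $f$ and $\chi$ are continuous. (ii) For any $R>0$ there exists $\lambda_*>0$ such that $\|f(t,x,u,v)-f(t,y,u,v)\|+|\chi(t,x,u,v)-\chi(t,y,u,v)|\le\lambda_*\|x-y\|$ for all $t\in[0,T]$, all $x,y\in\mathbb{R}^n$ with $\|x\|\le R$, $\|y\|\le R$, all $u\in P$, $v\in Q$. (iii) There is $c_*>0$ such that $\|f(t,x,u,v)\|\le c_*(1+\|x\|)$ for all $t\in[0,T]$, $x\in\mathbb{R}^n$, $u\in P$, $v\in Q$ (such a $c_*$ is fixed). (iv) For all $t\in[0,T]$ and $x,s\in\mathbb{R}^n$: $\min_{u\in P}\max_{v\in Q}(\langle s,f(t,x,u,v)\rangle+\chi(t,x,u,v))=\max_{v\in Q}\min_{u\in P}(\langle s,f(t,x,u,v)\rangle+\chi(t,x,u,v))$. (v) For any compact set $X\subset AC^\alpha$ there exists $\lambda^*>0$ such that $|\sigma(x(\cdot))-\sigma(y(\cdot))|\le\lambda^*\big(\|x(T)-y(T)\|+\int_0^T\|x(\tau)-y(\tau)\|\,\mathrm{d}\tau\big)$ for all $x(\cdot),y(\cdot)\in X$.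 Let $H(t,x,s)=\min_{u\in P}\max_{v\in Q}(\langle s,f(t,x,u,v)\rangle+\chi(t,x,u,v))$ for $t\in[0,T]$, $x,s\in\mathbb{R}^n$. Then the value functional $\rho:[0,T]\times AC^\alpha\to\mathbb{R}$ of the differential game with dynamics $$({}^CD^\alpha y)(\tau)=f(\tau,y(\tau),u(\tau),v(\tau))\ \text{ for a.e. }\tau\in[t,T],\qquad y(\cdot)\in Y(t,x(\cdot)),$$ and cost $J=\sigma(y(\cdot))+\int_t^T\chi(\tau,y(\tau),u(\tau),v(\tau))\,\mathrm{d}\tau$ (minimized by the first player choosing $u$, maximized by the second player choosing $v$) is a viscosity solution of the Cauchy problem $$\partial_t^\alpha\varphi(t,x(\cdot))+H\big(t,x(t),\nabla^\alpha\varphi(t,x(\cdot))\big)=0\quad\forall(t,x(\cdot))\in[0,T)\times AC^\alpha,\qquad \varphi(T,x(\cdot))=\sigma(x(\cdot))\quad\forall x(\cdot)\in AC^\alpha.$$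
   Context: Function space. $\|\cdot\|$, $\langle\cdot,\cdot\rangle$ are the Euclidean norm and inner product. $AC^\alpha$ is the set of all $x:[0,T]\to\mathbb{R}^n$ of the form $x(\tau)=x(0)+\frac1{\Gamma(\alpha)}\int_0^\tau\frac{f(\xi)}{(\tau-\xi)^{1-\alpha}}\,\mathrm{d}\xi$, $\tau\in[0,T]$, for some measurable essentially bounded $f:[0,T]\to\mathbb{R}^n$. Such functions are continuous; $AC^\alpha$ carries the uniform norm $\|x(\cdot)\|_\infty=\max_{\tau\in[0,T]}\|x(\tau)\|$, and $[0,T]\times AC^\alpha$ the product metric. The Caputo derivative $({}^CD^\alpha x)(\tau)=\frac1{\Gamma(1-\alpha)}\frac{\mathrm{d}}{\mathrm{d}\tau}\int_0^\tau\frac{x(\xi)-x(0)}{(\tau-\xi)^\alpha}\,\mathrm{d}\xi$ exists a.e. and equals $f(\tau)$ a.e. for $f$ in the representation above. $Y(t,x(\cdot))=\{y(\cdot)\in AC^\alpha: y(\tau)=x(\tau)\ \forall\tau\in[0,t]\}$. $ci$-derivatives. $\varphi:[0,T]\times AC^\alpha\to\mathbb{R}$ is $ci$-differentiable of order $\alpha$ at $(t,x(\cdot))\in[0,T)\times AC^\alpha$ if there exist $\partial_t^\alpha\varphi(t,x(\cdot))\in\mathbb{R}$ and $\nabla^\alpha\varphi(t,x(\cdot))\in\mathbb{R}^n$ such that for any $y(\cdot)\in Y(t,x(\cdot))$ and any $\tau\in(t,T)$: $\varphi(\tau,y(\cdot))-\varphi(t,x(\cdot))=\partial_t^\alpha\varphi(t,x(\cdot))(\tau-t)+\int_t^\tau\langle\nabla^\alpha\varphi(t,x(\cdot)),({}^CD^\alpha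 y)(\xi)\rangle\,\mathrm{d}\xi+o(\tau-t)$, where $o:(0,\infty)\to\mathbb{R}$ may depend on $t$ and $y(\cdot)$ and $o(\delta)/\delta\to0$ as $\delta\to0^+$. $\varphi$ is $ci$-smooth of order $\alpha$ if it is continuous, $ci$-differentiable of order $\alpha$ at every point of $[0,T)\times AC^\alpha$, and $\partial_t^\alpha\varphi$, $\nabla^\alpha\varphi$ are continuous on $[0,T)\times AC^\alpha$. Function $a$. $a(\tau\mid t,x(\cdot))=x(\tau)$ for $\tau\in[0,t]$ and $a(\tau\mid t,x(\cdot))=x(0)+\frac1{\Gamma(\alpha)}\int_0^t\frac{({}^CD^\alpha x)(\xi)}{(\tau-\xi)^{1-\alpha}}\,\mathrm{d}\xi$ for $\tau\in(t,T]$. Condition (L) for $\varphi:[0,T]\times AC^\alpha\to\mathbb{R}$: for any compact $X\subset AC^\alpha$ there exists $\Lambda>0$ such that $|\varphi(t,x(\cdot))-\varphi(t,y(\cdot))|\le\Lambda\big(\|a(T\mid t,x(\cdot))-a(T\mid t,y(\cdot))\|+\int_0^T\frac{\|a(\tau\mid t,x(\cdot))-a(\tau\mid t,y(\cdot))\|}{(T-\tau)^{1-\alpha}}\,\mathrm{d}\tau\big)$ for all $t\in[0,T]$, $x(\cdot),y(\cdot)\in X$. Sets $X_k$, $k\in\mathbb{N}$: $X_k=\{x(\cdot)\in AC^\alpha:\|x(0)\|\le k,\ \|({}^CD^\alpha x)(\tau)\|\le kc_*(1+\|x(\tau)\|)\text{ for a.e. }\tau\in[0,T]\}$, with $c_*$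 the number from (iii). Viscosity solution of the Cauchy problem: a continuous functional $\varphi:[0,T]\times AC^\alpha\to\mathbb{R}$ satisfying (L) and the boundary condition $\varphi(T,x(\cdot))=\sigma(x(\cdot))$ for all $x(\cdot)\in AC^\alpha$, such that for any $ci$-smooth of order $\alpha$ functional $\psi:[0,T]\times AC^\alpha\to\mathbb{R}$ and any $k\in\mathbb{N}$: $(V_+)$ if $\varphi-\psi$ attains its minimum on $[0,T]\times X_k$ at some $(t,x(\cdot))\in[0,T)\times X_k$, then $\partial_t^\alpha\psi(t,x(\cdot))+H(t,x(t),\nabla^\alpha\psi(t,x(\cdot)))\le0$; $(V_-)$ if $\varphi-\psi$ attains its maximum on $[0,T]\times X_k$ at some $(t,x(\cdot))\in[0,T)\times X_k$, then $\partial_t^\alpha\psi(t,x(\cdot))+H(t,x(t),\nabla^\alpha\psi(t,x(\cdot)))\ge0$. Value functional. For $(t,x(\cdot))\in[0,T)\times AC^\alpha$, let $\mathcal{U}_t$, $\mathcal{V}_t$ be the sets of measurable $u:[t,T]\to P$, $v:[t,T]\to Q$. For each $(u,v)\in\mathcal{U}_t\times\mathcal{V}_t$ there is a unique path $y(\cdot)\in Y(t,x(\cdot))$ satisfying the dynamics; let $J(t,x(\cdot),u,v)$ be the corresponding cost. A non-anticipative strategy of the first player is a map $\mathbf{a}:\mathcal{V}_t\to\mathcal{U}_t$ such that for every $\tau\in[t,T]$, if $v=v'$ a.e. on $[t,\tau]$ then $\mathbf{a}[v]=\mathbf{a}[v']$ a.e. on $[t,\tau]$; non-anticipative strategies $\mathbf{b}:\mathcal{U}_t\to\mathcal{V}_t$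 of the second player are defined analogously. Under (i)--(iv) with $\sigma$ continuous, the lower and upper values coincide, and $\rho(t,x(\cdot))=\inf_{\mathbf{a}}\sup_{v\in\mathcal{V}_t}J(t,x(\cdot),\mathbf{a}[v],v)=\sup_{\mathbf{b}}\inf_{u\in\mathcal{U}_t}J(t,x(\cdot),u,\mathbf{b}[u])$ for $t<T$, while $\rho(T,x(\cdot))=\sigma(x(\cdot))$. *)

(* Defs.v *)
From HB Require Import structures.
From mathcomp Require Import all_boot all_order all_algebra.
From mathcomp Require Import all_classical all_reals all_analysis.

Set Implicit Arguments.
Unset Strict Implicit.
Unset Printing Implicit Defensive.

Import Order.TTheory GRing.Theory Num.Theory.
Import numFieldNormedType.Exports.

Local Open Scope classical_set_scope.
Local Open Scope ring_scope.

(** Functions on an interval, and maps on a subset of a product, are represented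
    by total functions whose values off the domain are never used.  Paths are the
    exception: a functional on paths must not see the values of a path off
    [0, T], so [ACpath] fixes those values to [0], and equality of elements of
    [ACpath] is equality on [0, T].  "Measurable" is Borel measurable; up to null sets
    this is the same as Lebesgue measurable. *)

Section Vectors.
Context {R : realType} {n : nat}.

Definition dotv (x y : 'rV[R]_n) : R := \sum_(i < n) x ord0 i * y ord0 i.

Definition enorm (x : 'rV[R]_n) : R := Num.sqrt (dotv x x).

Definition vmeasurable (D : set R) (g : R -> 'rV[R]_n) : Prop :=
  forall i : 'I_n, measurable_fun D (fun t => g t ord0 i).

Definition vint (D : set R) (g : R -> 'rV[R]_n) : 'rV[R]_n :=
  \row_(i < n) \int[lebesgue_measure]_(t in D) g t ord0 i.

End Vectors.

Definition ae_on {R : realType} (a b : R) (A : R -> Prop) : Prop :=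
  {ae (@lebesgue_measure R), forall t, a <= t <= b -> A t}.

Definition Gamma {R : realType} (a : R) : R :=
  \int[lebesgue_measure]_(t in `]0, +oo[) (t `^ (a - 1) * expR (- t)).

(** The topology of uniform convergence on [0, T], i.e. that of the norm
    max_{[0, T]} ||x(.)||. *)
Definition pathsp {R : realType} (T : R) (n : nat) : uniformType :=
  {uniform` `[0, T]%classic -> 'rV[R]_n}.

Section Paths.
Context {R : realType} {n : nat} (T alpha : R).
Implicit Types (x y : R -> 'rV[R]_n) (t tau : R).

Definition frac_int (b tau : R) (g : R -> 'rV[R]_n) : 'rV[R]_n :=
  (Gamma alpha)^-1 *:
    vint `[0, b] (fun xi => ((tau - xi) `^ (1 - alpha))^-1 *: g xi).

Definition ACpath : set (R -> 'rV[R]_n) :=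
  [set x | (forall tau, ~~ (0 <= tau <= T) -> x tau = 0) /\
    exists g : R -> 'rV[R]_n,
      [/\ vmeasurable `[0, T] g,
          exists M : R, ae_on 0 T (fun tau => enorm (g tau) <= M)
        & forall tau, 0 <= tau <= T -> x tau = x 0 + frac_int tau tau g]].

(** Where the derivative does not exist (a null set when [ACpath x]) the value is
    arbitrary. *)
Definition caputo x tau : 'rV[R]_n :=
  (Gamma (1 - alpha))^-1 *:
    \row_(i < n)
      derive1 (fun s : R => vint `[0, s]
         (fun xi => ((s - xi) `^ alpha)^-1 *: (x xi - x 0)) ord0 i) tau.

Definition Yset t x : set (R -> 'rV[R]_n) :=
  [set y | ACpath y /\ forall tau, 0 <= tau <= t -> y tau = x tau].

Definition cylinder_closed : set (R * pathsp T n) :=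
  [set p : R * pathsp T n | 0 <= p.1 <= T /\ ACpath p.2].

Definition cylinder_open : set (R * pathsp T n) :=
  [set p : R * pathsp T n | 0 <= p.1 < T /\ ACpath p.2].

Definition continuous_on_cylinder {V : topologicalType}
    (D : set (R * pathsp T n)) (F : R -> (R -> 'rV[R]_n) -> V) : Prop :=
  {within D, continuous (fun p : R * pathsp T n => F p.1 p.2)}.

Definition ci_derivatives (phi : R -> (R -> 'rV[R]_n) -> R) t x
    (dt : R) (grad : 'rV[R]_n) : Prop :=
  forall y, Yset t x y ->
    exists o : R -> R,
      o delta / delta @[delta --> 0^'+] --> (0 : R) /\
      forall tau, t < tau < T ->
        phi tau y - phi t x =
          dt * (tau - t)
          + \int[lebesgue_measure]_(xi in `[t, tau]) dotv grad (caputo y xi)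
          + o (tau - t).

(** [dt] and [grad] are determined by [phi] on [0, T) x ACpath (test on paths [y]
    whose Caputo derivative is constant on [t, T]). *)
Definition ci_smooth (phi dt : R -> (R -> 'rV[R]_n) -> R)
    (grad : R -> (R -> 'rV[R]_n) -> 'rV[R]_n) : Prop :=
  [/\ continuous_on_cylinder cylinder_closed phi,
      forall t x, 0 <= t < T -> ACpath x ->
        ci_derivatives phi t x (dt t x) (grad t x),
      continuous_on_cylinder cylinder_open dt
    & continuous_on_cylinder cylinder_open grad].

Definition afun t x tau : 'rV[R]_n :=
  if tau <= t then x tau else x 0 + frac_int t tau (caputo x).

Definition condL (phi : R -> (R -> 'rV[R]_n) -> R) : Prop :=
  forall X : set (pathsp T n), X `<=` ACpath -> compact X ->
    exists2 Lambda : R, 0 < Lambda &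
      forall t x y, 0 <= t <= T -> X x -> X y ->
        `|phi t x - phi t y| <=
        Lambda * (enorm (afun t x T - afun t y T)
          + \int[lebesgue_measure]_(tau in `[0, T])
              (enorm (afun t x tau - afun t y tau) / (T - tau) `^ (1 - alpha))).

Definition Xset (c : R) (k : nat) : set (R -> 'rV[R]_n) :=
  [set x | [/\ ACpath x, enorm (x 0) <= k%:R
    & ae_on 0 T (fun tau =>
        enorm (caputo x tau) <= k%:R * c * (1 + enorm (x tau)))]].

(** Indices [k] start at 1: for [k = 0] the set would reduce to the zero path. *)
Definition viscosity_solution (c : R) (H : R -> 'rV[R]_n -> 'rV[R]_n -> R)
    (sigma : (R -> 'rV[R]_n) -> R) (phi : R -> (R -> 'rV[R]_n) -> R) : Prop :=
  [/\ continuous_on_cylinder cylinder_closed phi,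
      condL phi,
      forall x, ACpath x -> phi T x = sigma x
    & forall (psi dt : R -> (R -> 'rV[R]_n) -> R)
        (grad : R -> (R -> 'rV[R]_n) -> 'rV[R]_n) (k : nat),
        ci_smooth psi dt grad -> (0 < k)%N ->
        forall t x, 0 <= t < T -> Xset c k x ->
          ((forall s y, 0 <= s <= T -> Xset c k y ->
              phi t x - psi t x <= phi s y - psi s y) ->
            dt t x + H t (x t) (grad t x) <= 0) /\
          ((forall s y, 0 <= s <= T -> Xset c k y ->
              phi s y - psi s y <= phi t x - psi t x) ->
            0 <= dt t x + H t (x t) (grad t x))].

End Paths.

Section Game.
Context {R : realType} {n nP nQ : nat} (T alpha : R).
Context (P : set 'rV[R]_nP) (Q : set 'rV[R]_nQ).
Context (f : R -> 'rV[R]_n -> 'rV[R]_nP -> 'rV[R]_nQ -> 'rV[R]_n).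
Context (chi : R -> 'rV[R]_n -> 'rV[R]_nP -> 'rV[R]_nQ -> R).
Context (sigma : (R -> 'rV[R]_n) -> R).
Implicit Types (x y : R -> 'rV[R]_n) (t : R).

Definition data_domain : set (R * 'rV[R]_n * 'rV[R]_nP * 'rV[R]_nQ) :=
  [set z | [/\ 0 <= z.1.1.1 <= T, P z.1.2 & Q z.2]].

(** For [f], [chi] continuous and [P], [Q] compact and nonempty, all the
    suprema and infima below are attained, i.e. are maxima and minima. *)
Definition minmax t (x s : 'rV[R]_n) : R :=
  inf [set sup [set dotv s (f t x u v) + chi t x u v | v in Q] | u in P].

Definition maxmin t (x s : 'rV[R]_n) : R :=
  sup [set inf [set dotv s (f t x u v) + chi t x u v | u in P] | v in Q].

Definition controls {m : nat} (K : set 'rV[R]_m) t : set (R -> 'rV[R]_m) :=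
  [set w | vmeasurable `[t, T] w /\ forall tau, t <= tau <= T -> K (w tau)].

Definition motion t x (u : R -> 'rV[R]_nP) (v : R -> 'rV[R]_nQ) :
    set (R -> 'rV[R]_n) :=
  [set y | Yset T alpha t x y /\
    ae_on t T (fun tau =>
      caputo alpha y tau = f tau (y tau) (u tau) (v tau))].

(** [xget x] picks an element of [motion t x u v], which is a singleton under
    the assumptions on the game. *)
Definition cost t x (u : R -> 'rV[R]_nP) (v : R -> 'rV[R]_nQ) : R :=
  let y := xget x (motion t x u v) in
  sigma y
  + \int[lebesgue_measure]_(tau in `[t, T]) chi tau (y tau) (u tau) (v tau).

Definition strategies1 t :
    set ((R -> 'rV[R]_nQ) -> (R -> 'rV[R]_nP)) :=
  [set a | (forall v, controls Q t v -> controls P t (a v)) /\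
    forall tau v v', t <= tau <= T -> controls Q t v -> controls Q t v' ->
      ae_on t tau (fun s => v s = v' s) ->
      ae_on t tau (fun s => a v s = a v' s)].

(** The value is the common value of inf_a sup_v and sup_b inf_u; it is given
    here by the first of the two expressions. *)
Definition value t x : R :=
  if t < T then
    inf [set sup [set cost t x (a v) v | v in controls Q t]
        | a in strategies1 t]
  else sigma x.

End Game.

(* Main.v *)
Require Import Defs.
From HB Require Import structures.
From mathcomp Require Import all_boot all_order all_algebra.
From mathcomp Require Import all_classical all_reals all_analysis.
From mathcomp Require Import measurable_realfun ring lra.
Import Order.TTheory GRing.Theory Num.Theory.
Import numFieldNormedType.Exports.
Local Open Scope classical_set_scope.
Local Open Scope ring_scope.

Set Implicit Arguments.
Unset Strict Implicit.
Unset Printing Implicit Defensive.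

(** The value of the game is a viscosity solution for the following reasons.

    A path is determined by its initial value and a bounded Borel density: [mkpath z g] has
    Caputo derivative [g] almost everywhere ([caputo_mkpath]), a motion is a fixed point of
    an integral equation for its density, and the functional [afun], the continuation of a
    path past [t] with zero derivative, cuts the density off at [t] ([afun_cutoff]).  Two
    facts on fractional integrals then carry the analysis.

    - The continuation is, up to the initial value, an average of earlier values of the path
      against a positive kernel of mass at most one, by a Beta integral.  It is therefore
      bounded by these values ([cutoff_max_principle]), whatever the density.
    - In exponentially weighted norms the fractional integral is a contraction.  This gives
      existence and uniqueness of motions by Picard iteration, and Gronwall inequalities in
      the sup norm ([fractional_gronwall]) and in the integral norm with weight
      (T - s)^(alpha - 1), which is the norm of condition (L) ([weighted_gronwall]).

    Motions issuing from a compact set of paths stay in a compact set ([motions_compact]): a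
    motion is a continuation plus a fractional integral of a density with a uniform bound,
    and such integrals form a compact set.  Equicontinuity is clear; closedness holds since a
    uniform limit has a Lipschitz fractional integral of order 1 - alpha, a Lipschitz function
    is the integral of a bounded function (a Radon-Nikodym derivative of a Stieltjes measure),
    and Abel's integral equation has a unique solution.  Hence the hypothesis on the terminal
    cost applies to all motions at once, and the weighted Gronwall inequality turns it into
    condition (L) for the cost, uniformly in the controls, and so for the value
    ([value_condL]).

    Dynamic programming is used in two one-sided forms.  A strategy of the first player can
    be restarted at an intermediate position ([dpp_ge]); and a fixed control followed by a
    nearly optimal strategy for the position reached is a strategy ([dpp_le]), because that
    position depends on the past of the opponent's control only.  With condition (L) they
    give continuity in time; continuity in the path needs (L) on a convergent sequence and its
    limit only, which is a compact set ([value_continuous]).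

    For the viscosity inequalities, a smooth functional grows along a motion at a rate
    within [e] of the derivatives at the initial position, for a short time that does not
    depend on the controls ([chain_estimate]).  A motion is not close to the initial path on
    [0, T]; but the functional depends on the past only, so its derivatives may be taken at
    the path which follows the motion up to the current time and the density of the initial
    path afterwards, and this one is close.  If one of the two inequalities failed, one player
    could keep a constant control for a short time (an optimal one for the Hamiltonian, by the
    saddle point condition in one of the two cases), and dynamic programming with the
    extremality of the test point would bound the value away from itself. *)

(** * Improper integrals by the fundamental theorem of calculus *)
Section ImproperFTC.
Context {R : realType}.
Notation mu := (@lebesgue_measure R).
Implicit Types (f F : R -> R) (a b : R).

(** The antiderivative need only be regular inside: monotone convergence over an
    exhaustion by compact intervals covers endpoint singularities and half lines alike. *)
Lemma ge0_FTC_exhaust (D : set R) (u v : nat -> R) f F (L : R) :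
  (forall m n, (m <= n)%N -> u n <= u m /\ v m <= v n) ->
  (forall n, u n < v n) ->
  D = \bigcup_n `[u n, v n]%classic ->
  (forall x, D x -> 0 <= f x) ->
  (forall x, D x -> {for x, continuous f}) ->
  (forall x, D x -> is_derive x 1 F (f x)) ->
  F (v n) - F (u n) @[n --> \oo] --> L ->
  (\int[mu]_(x in D) (f x)%:E = L%:E)%E.
Proof.
move=> uv_mono uv DE f0 cf dF FL.
have subD n x : `[u n, v n]%classic x -> D x by rewrite DE => ?; exists n.
have cvD : (\int[mu]_(x in `[u n, v n]%classic) (f x)%:E @[n --> \oo]
   --> \int[mu]_(x in D) (f x)%:E)%E.
  rewrite DE; apply: ge0_nondecreasing_set_cvg_integral => //.
  - move=> m n mn; apply/subsetPset => x /=; rewrite !in_itv/=.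
    move=> /andP[h1 h2]; have [h3 h4] := uv_mono _ _ mn.
    by rewrite (le_trans h3 h1) (le_trans h2 h4).
  - move=> i; apply/measurable_EFinP; apply: subspace_continuous_measurable_fun => //.
    apply: continuous_in_subspaceT => x xi; apply: cf.
    by apply: (subD i); rewrite inE in xi.
  - by move=> i x xi; rewrite lee_fin; apply: f0; exact: (subD i).
have cvL : (\int[mu]_(x in `[u n, v n]%classic) (f x)%:E @[n --> \oo] --> L%:E)%E.
  rewrite (_ : (fun n => _) = EFin \o (fun n => F (v n) - F (u n))); last first.
    apply/funext => n /=; rewrite (@continuous_FTC2 _ f F)//.
    - apply: continuous_in_subspaceT => x xi; apply: cf.
      by apply: (subD n); rewrite inE in xi.
    - split.
      + move=> x; rewrite in_itv/= => /andP[/ltW h1 /ltW h2].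
        have [] // : is_derive x 1 F (f x).
        by apply/dF/(subD n); rewrite /= in_itv/= h1 h2.
      + apply/cvg_at_right_filter/differentiable_continuous/derivable1_diffP.
        have [] // : is_derive (u n) 1 F (f (u n)).
        by apply/dF/(subD n); rewrite /= in_itv/= lexx ltW.
      + apply/cvg_at_left_filter/differentiable_continuous/derivable1_diffP.
        have [] // : is_derive (v n) 1 F (f (v n)).
        by apply/dF/(subD n); rewrite /= in_itv/= lexx ltW.
    - move=> x; rewrite in_itv/= => /andP[/ltW h1 /ltW h2]; rewrite derive1E.
      by have [_ <-] : is_derive x 1 F (f x) by
        apply/dF/(subD n); rewrite /= in_itv/= h1 h2.
  by apply: cvg_comp FL _; exact: cvg_id.
exact: cvg_unique cvD cvL.
Qed.

Let invn (n : nat) : R := n.+2%:R^-1.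
Let invn_gt0 n : 0 < invn n. Proof. by rewrite invr_gt0 ltr0n. Qed.
Let invn_lt n : invn n <= 2^-1.
Proof. by rewrite lef_pV2 ?posrE ?ltr0n// ler_nat. Qed.
Let invn_mono m n : (m <= n)%N -> invn n <= invn m.
Proof. by move=> mn; rewrite lef_pV2 ?posrE ?ltr0n// ler_nat !ltnS. Qed.
Let invn_cvg0 : invn n @[n --> \oo] --> (0 : R).
Proof.
rewrite (_ : (fun n => _) = (fun n => [sequence harmonic n.+1]_n n)) //.
by rewrite (cvg_shiftS (@harmonic R)); exact: cvg_harmonic.
Qed.

Lemma ge0_FTC_oo a b f F (la lb : R) : a < b ->
  {in `]a, b[, forall x, 0 <= f x} ->
  {in `]a, b[, continuous f} ->
  (forall x, a < x < b -> is_derive x 1 F (f x)) ->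
  F x @[x --> a^'+] --> la -> F x @[x --> b^'-] --> lb ->
  (\int[mu]_(x in `]a, b[) (f x)%:E = (lb - la)%:E)%E.
Proof.
move=> ab f0 cf dF Fa Fb.
have ba0 : 0 < b - a by rewrite subr_gt0.
have au n : a < a + (b - a) * invn n by rewrite ltrDl mulr_gt0.
have vb n : b - (b - a) * invn n < b by rewrite ltrBlDr ltrDl mulr_gt0.
have cvu : a + (b - a) * invn n @[n --> \oo] --> a.
  rewrite -[X in _ --> X]addr0; apply: cvgD; first exact: cvg_cst.
  by rewrite -[X in _ --> X](mulr0 (b - a)); apply: cvgMr; exact: invn_cvg0.
have cvv : b - (b - a) * invn n @[n --> \oo] --> b.
  rewrite -[X in _ --> X]subr0; apply: cvgB; first exact: cvg_cst.
  by rewrite -[X in _ --> X](mulr0 (b - a)); apply: cvgMr; exact: invn_cvg0.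
apply: (@ge0_FTC_exhaust _ (fun n => a + (b - a) * invn n.+1)
          (fun n => b - (b - a) * invn n.+1) f F).
- move=> m n mn; split.
    by rewrite lerD2l ler_wpM2l ?invn_mono ?ltnS// ltW.
  by rewrite lerD2l lerN2 ler_wpM2l ?invn_mono ?ltnS// ltW.
- move=> n; rewrite -subr_gt0.
  rewrite (_ : _ - _ = (b - a) * (1 - 2 * invn n.+1)); last by ring.
  apply: mulr_gt0 => //; rewrite subr_gt0 -ltr_pdivlMl ?ltr0n// mulr1.
  by rewrite ltf_pV2 ?posrE ?ltr0n// ltr_nat.
- apply/seteqP; split => [x /=|x [n _] /=].
    rewrite in_itv/= => /andP[ax xb].
    have [N _ HN] : \forall n \near \oo, a + (b - a) * invn n <= x.
      by apply: (cvgr_le _ cvu).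
    have [N' _ HN'] : \forall n \near \oo, x <= b - (b - a) * invn n.
      by apply: (cvgr_ge _ cvv).
    exists (N + N')%N => //=; rewrite in_itv/= HN ?HN'//=; apply: leqW.
      exact: leq_addl.
    exact: leq_addr.
  rewrite !in_itv/= => /andP[h1 h2].
  by rewrite (lt_le_trans (au _) h1) (le_lt_trans h2 (vb _)).
- by move=> x xab; apply: f0.
- by move=> x xab; apply: cf.
- have shift (w : nat -> R) (l : R) : w n @[n --> \oo] --> l -> w n.+1 @[n --> \oo] --> l.
    by move=> wl; rewrite (cvg_shiftS w).
  apply: cvgB.
    have /cvg_at_leftP := Fb; apply; split; first by move=> n; exact: vb.
    exact: (shift (fun n => b - (b - a) * invn n) _ cvv).
  have /cvg_at_rightP := Fa; apply; split; first by move=> n; exact: au.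
  exact: (shift (fun n => a + (b - a) * invn n) _ cvu).
Qed.

Lemma ge0_FTC_0y f F (la lb : R) :
  {in `]0, +oo[, forall x : R, 0 <= f x} ->
  {in `]0, +oo[, continuous f} ->
  (forall x : R, 0 < x -> is_derive x 1 F (f x)) ->
  F x @[x --> 0^'+] --> la -> F x @[x --> +oo] --> lb ->
  (\int[mu]_(x in `]0%R, +oo[) (f x)%:E = (lb - la)%:E)%E.
Proof.
move=> f0 cf dF Fa Fb.
have invlt1 n : invn n < n.+1%:R.
  by rewrite (le_lt_trans (invn_lt n))// (@lt_le_trans _ _ 1) ?ler1n//; lra.
apply: (@ge0_FTC_exhaust _ invn (fun n => n.+1%:R) f F) => //.
- by move=> m n mn; split; [exact: invn_mono | rewrite ler_nat].
- apply/seteqP; split => [x /=|x [n _] /=].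
    rewrite in_itv/= andbT => x0.
    have [N _ HN] : \forall n \near \oo, invn n <= x.
      by apply: (cvgr_le _ invn_cvg0).
    have [N' _ HN'] : \forall n \near \oo, x <= n%:R.
      exact: nbhs_infty_ger.
    exists (N + N')%N => //=; rewrite in_itv/= HN ?HN'//=; last exact: leq_addr.
    by apply: leqW; exact: leq_addl.
  by rewrite !in_itv/= andbT => /andP[h1 h2]; rewrite (lt_le_trans (invn_gt0 n) h1).
- by move=> x; rewrite /= in_itv/= andbT; exact: dF.
- apply: cvgB.
    apply: (cvg_comp _ _ _ Fb).
    have h : (n%:R : R) @[n --> \oo] --> +oo by exact: cvgr_idn.
    by rewrite (cvg_shiftS (fun n => n%:R : R)).
  by have /cvg_at_rightP := Fa; apply; split => //; exact: invn_cvg0.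
Qed.

End ImproperFTC.

(** * Integrals of powers *)
Section PowerIntegrals.
Context {R : realType}.
Notation mu := (@lebesgue_measure R).
Implicit Types (a b tau beta : R).

Lemma continuous_powR_pos beta (x : R) : 0 < x ->
  {for x, continuous ((@powR R) ^~ beta)}.
Proof.
move=> x0; apply/differentiable_continuous/derivable1_diffP.
by apply: derivable_powR; rewrite in_itv/= x0.
Qed.

Lemma powR_cvg_left beta b tau : 0 < beta -> b <= tau ->
  (tau - x) `^ beta @[x --> b^'-] --> (tau - b) `^ beta.
Proof.
move=> b0; rewrite le_eqVlt => /predU1P[->|bt].
  rewrite subrr powR0 ?gt_eqF//; apply/cvg_at_leftP => u [ut uc].
  have /cvg_at_rightP := powR_cvg0 b0; apply; split.
    by move=> n; rewrite subr_gt0.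
  by rewrite -(subrr tau); apply: cvgB => //; exact: cvg_cst.
apply: cvg_at_left_filter.
apply: (@continuous_comp _ _ _ (fun x => tau - x) ((@powR R) ^~ beta)).
  by apply: continuousB; [exact: cvg_cst | exact: cvg_id].
by apply: continuous_powR_pos; rewrite subr_gt0.
Qed.

Lemma powR_cvg_right beta a tau : 0 < beta -> tau <= a ->
  (x - tau) `^ beta @[x --> a^'+] --> (a - tau) `^ beta.
Proof.
move=> b0; rewrite le_eqVlt => /predU1P[<-|bt].
  rewrite subrr powR0 ?gt_eqF//; apply/cvg_at_rightP => u [ut uc].
  have /cvg_at_rightP := powR_cvg0 b0; apply; split.
    by move=> n; rewrite subr_gt0.
  by rewrite -(subrr tau); apply: cvgB => //; exact: cvg_cst.
apply: cvg_at_right_filter.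
apply: (@continuous_comp _ _ _ (fun x => x - tau) ((@powR R) ^~ beta)).
  by apply: continuousB; [exact: cvg_id | exact: cvg_cst].
by apply: continuous_powR_pos; rewrite subr_gt0.
Qed.

Lemma powRB1_derive_left beta tau (x : R) : 0 < beta -> x < tau ->
  is_derive x 1 (fun x => - ((tau - x) `^ beta / beta)) ((tau - x) `^ (beta - 1)).
Proof.
move=> b0 xt.
have sx : 0 < tau - x by rewrite subr_gt0.
have h := is_derive1_powR beta sx.
have h2 : is_derive x 1 (fun x : R => tau - x) (-1).
  by apply: is_derive_eq; ring.
have h3 := @is_derive1_comp R ((@powR R) ^~ beta) (fun x => tau - x) x _ _ h h2.
rewrite (_ : (fun x => _) = (- beta^-1) *: (((@powR R) ^~ beta) \o (fun x => tau - x))); last first.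
  by apply/funext => z /=; rewrite !fctE /= /GRing.scale/= mulNr mulrC.
by apply: is_derive_eq; rewrite /GRing.scale/=; field; rewrite gt_eqF.
Qed.

Lemma powRB1_derive_right beta tau (x : R) : 0 < beta -> tau < x ->
  is_derive x 1 (fun x => (x - tau) `^ beta / beta) ((x - tau) `^ (beta - 1)).
Proof.
move=> b0 xt.
have sx : 0 < x - tau by rewrite subr_gt0.
have h := is_derive1_powR beta sx.
have h2 : is_derive x 1 (fun x : R => x - tau) 1.
  by apply: is_derive_eq; ring.
have h3 := @is_derive1_comp R ((@powR R) ^~ beta) (fun x => x - tau) x _ _ h h2.
rewrite (_ : (fun x => _) = beta^-1 *: (((@powR R) ^~ beta) \o (fun x => x - tau))); last first.
  by apply/funext => z /=; rewrite !fctE /= /GRing.scale/= mulrC.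
by apply: is_derive_eq; rewrite /GRing.scale/=; field; rewrite gt_eqF.
Qed.

Lemma integral_powR_left beta a b tau : 0 < beta -> a < b -> b <= tau ->
  (\int[mu]_(x in `]a, b[) ((tau - x) `^ (beta - 1))%:E =
   (((tau - a) `^ beta - (tau - b) `^ beta) / beta)%:E)%E.
Proof.
move=> b0 ab bt.
have dF x : a < x < b ->
    is_derive x 1 (fun x => - ((tau - x) `^ beta / beta)) ((tau - x) `^ (beta - 1)).
  by move=> /andP[_ xb]; apply: powRB1_derive_left => //; exact: lt_le_trans xb bt.
rewrite (ge0_FTC_oo (la := - ((tau - a) `^ beta / beta))
  (lb := - ((tau - b) `^ beta / beta)) ab _ _ dF)//.
- by rewrite opprK mulrBl addrC.
- by move=> x _; exact: powR_ge0.
- move=> x; rewrite in_itv/= => /andP[_ xb].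
  apply: (@continuous_comp _ _ _ (fun x => tau - x) ((@powR R) ^~ (beta - 1))).
    by apply: continuousB; [exact: cvg_cst | exact: cvg_id].
  by apply: continuous_powR_pos; rewrite subr_gt0 (lt_le_trans xb bt).
- apply: cvgN; apply: cvgMl; apply: cvg_at_right_filter.
  apply: (@continuous_comp _ _ _ (fun x => tau - x) ((@powR R) ^~ beta)).
    by apply: continuousB; [exact: cvg_cst | exact: cvg_id].
  by apply: continuous_powR_pos; rewrite subr_gt0 (lt_le_trans ab bt).
- by apply: cvgN; apply: cvgMl; exact: powR_cvg_left.
Qed.

Lemma integral_powR_right beta a b tau : 0 < beta -> a < b -> tau <= a ->
  (\int[mu]_(x in `]a, b[) ((x - tau) `^ (beta - 1))%:E =
   (((b - tau) `^ beta - (a - tau) `^ beta) / beta)%:E)%E.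
Proof.
move=> b0 ab ta.
have dF x : a < x < b ->
    is_derive x 1 (fun x => (x - tau) `^ beta / beta) ((x - tau) `^ (beta - 1)).
  by move=> /andP[ax _]; apply: powRB1_derive_right => //; exact: le_lt_trans ta ax.
rewrite (ge0_FTC_oo (la := (a - tau) `^ beta / beta)
  (lb := (b - tau) `^ beta / beta) ab _ _ dF)//.
- by rewrite mulrBl.
- by move=> x _; exact: powR_ge0.
- move=> x; rewrite in_itv/= => /andP[ax _].
  apply: (@continuous_comp _ _ _ (fun x => x - tau) ((@powR R) ^~ (beta - 1))).
    by apply: continuousB; [exact: cvg_id | exact: cvg_cst].
  by apply: continuous_powR_pos; rewrite subr_gt0 (le_lt_trans ta ax).
- by apply: cvgMl; exact: powR_cvg_right.
- apply: cvgMl; apply: cvg_at_left_filter.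
  apply: (@continuous_comp _ _ _ (fun x => x - tau) ((@powR R) ^~ beta)).
    by apply: continuousB; [exact: cvg_id | exact: cvg_cst].
  by apply: continuous_powR_pos; rewrite subr_gt0 (le_lt_trans ta ab).
Qed.

End PowerIntegrals.

(** * Primitives and iterated integrals of nonnegative functions *)
Section Primitive.
Context {R : realType}.
Notation mu := (@lebesgue_measure R).
Variables (h : R -> R) (B : R).
Hypothesis mh : measurable_fun setT h.
Hypothesis h0 : forall x, 0 <= h x.
Hypothesis ch : forall x, 0 < x -> {for x, continuous h}.
Hypothesis hB : (\int[mu]_(x in `]0%R, +oo[) (h x)%:E = B%:E)%E.

Let H (p : R) : R := \int[mu]_(x in `[0, p]) h x.

Let hB0 : (\int[mu]_(x in `[0%R, +oo[) (h x)%:E = B%:E)%E.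
Proof.
rewrite -hB integral_itv_obnd_cbnd//.
by apply/measurable_EFinP; exact: measurable_funTS.
Qed.

Lemma ge0_integrable_0y : mu.-integrable `[0%R, +oo[ (EFin \o h).
Proof.
apply/integrableP; split; first by apply/measurable_EFinP; exact: measurable_funTS.
under eq_integral do rewrite /= ger0_norm//.
by rewrite hB0 ltry.
Qed.

Lemma ge0_integrable_0p p : mu.-integrable `[0, p] (EFin \o h).
Proof.
apply: (integrableS _ _ _ ge0_integrable_0y) => //.
by move=> x /=; rewrite !in_itv/= => /andP[->].
Qed.

(** Together with the two limits below this makes the primitive of an integrable function
    usable for substitutions in improper integrals. *)
Lemma primitive_derive (p : R) : 0 < p -> is_derive p 1 H (h p).
Proof.
move=> p0; have [d1 d2] := @continuous_FTC1_closed R h 0 p (p + 1)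
  (ltr_pwDr ltr01 (lexx _)) (ge0_integrable_0p _) p0 (ch p0).
by split => //; rewrite -derive1E.
Qed.

Lemma primitive_cvg0 : H x @[x --> 0^'+] --> 0.
Proof.
have := @parameterized_integral_cvg_left R 0 1 h ltr01 (ge0_integrable_0p _).
by move=> Hc; apply: cvg_within_filter; exact: Hc.
Qed.

Lemma primitive_cvgy : H x @[x --> +oo] --> B.
Proof.
have EH p : (H p)%:E = (\int[mu]_(x in `[0%R, p]) (h x)%:E)%E.
  by rewrite /H /Rintegral fineK//; exact: integrable_fin_num (ge0_integrable_0p _).
have Hmono p q : p <= q -> H p <= H q.
  move=> pq; rewrite -lee_fin !EH; apply: ge0_subset_integral => //.
  - by apply/measurable_EFinP; exact: measurable_funTS.
  - by move=> x _; rewrite lee_fin.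
  - by move=> x /=; rewrite !in_itv/= => /andP[-> /le_trans]; exact.
have HB p : H p <= B.
  rewrite -lee_fin EH -hB0; apply: ge0_subset_integral => //.
  - by apply/measurable_EFinP; exact: measurable_funTS.
  - by move=> x _; rewrite lee_fin.
  - by move=> x /=; rewrite !in_itv/= => /andP[->].
have cvn : H n%:R @[n --> \oo] --> B.
  have : (\int[mu]_(x in `[0%R, n%:R%R]) (h x)%:E @[n --> \oo] -->
       \int[mu]_(x in \bigcup_n `[0%R, n%:R%R]%classic) (h x)%:E)%E.
    apply: ge0_nondecreasing_set_cvg_integral.
    - move=> m n mn; apply/subsetPset => x /=; rewrite !in_itv/= => /andP[-> /le_trans]; apply.
      by rewrite ler_nat.
    - by [].
    - by move=> i; apply/measurable_EFinP; exact: measurable_funTS.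
    - by move=> i x _; rewrite lee_fin.
  rewrite (_ : \bigcup_n _ = `[0, +oo[%classic) ?hB0; last first.
    apply/seteqP; split => [x [n _]|x]; rewrite /= !in_itv/=; first by case/andP => ->.
    rewrite andbT => x0; have [N _ HN] := nbhs_infty_ger x.
    by exists N => //=; rewrite in_itv/= x0 HN/=.
  under eq_fun do rewrite -EH.
  by move/fine_cvgP => [_]; exact.
apply/cvgrPdist_le => e e0.
have /cvgrPdist_le/(_ _ e0)[N _ HN] := cvn.
near=> x; have xN : N%:R <= x by near: x; exact: nbhs_pinfty_ge.
rewrite ger0_norm ?subr_ge0//; apply: (le_trans _ (HN N (leqnn _))).
by rewrite ger0_norm ?subr_ge0// lerD2l lerN2 Hmono.
Unshelve. all: by end_near. Qed.

End Primitive.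

Section TonelliRect.
Context {R : realType}.
Notation mu := (@lebesgue_measure R).

Lemma tonelli_rect (A B : set R) (f : R * R -> R) :
  measurable A -> measurable B -> measurable_fun setT f -> (forall z, 0 <= f z) ->
  (\int[mu]_(x in A) \int[mu]_(y in B) (f (x, y))%:E =
   \int[mu]_(y in B) \int[mu]_(x in A) (f (x, y))%:E)%E.
Proof.
move=> mA mB mf f0.
pose g (z : R * R) := ((f z)%:E * (\1_A z.1)%:E * (\1_B z.2)%:E)%E.
have mg : measurable_fun setT g.
  apply: emeasurable_funM; first apply: emeasurable_funM.
  - exact/measurable_EFinP.
  - by apply/measurable_EFinP; apply: measurableT_comp.
  - by apply/measurable_EFinP; apply: measurableT_comp.
have g0 z : (0 <= g z)%E by rewrite /g !mule_ge0 ?lee_fin.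
have := @fubini_tonelli _ _ _ _ R mu mu g mg g0.
have EB x : (\int[mu]_y g (x, y) = \int[mu]_(y in B) (f (x, y))%:E * (\1_A x)%:E)%E.
  rewrite [RHS]muleC -ge0_integralZl ?lee_fin//; last 2 first.
  - by apply/measurable_EFinP/measurable_funTS; exact: (measurableT_comp mf (pair1_measurable x)).
  - by move=> y _; rewrite lee_fin.
  rewrite [RHS]integral_mkcond; apply: eq_integral => y _; rewrite /g /patch/=.
  by rewrite [in LHS]/indic; case: ifPn => yB; rewrite ?(mem_set yB) ?mule1 ?mule0// muleC.
have EA y : (\int[mu]_x g (x, y) = \int[mu]_(x in A) (f (x, y))%:E * (\1_B y)%:E)%E.
  rewrite [RHS]muleC -ge0_integralZl ?lee_fin//; last 2 first.
  - by apply/measurable_EFinP/measurable_funTS; exact: (measurableT_comp mf (pair2_measurable y)).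
  - by move=> x _; rewrite lee_fin.
  rewrite [RHS]integral_mkcond; apply: eq_integral => x _; rewrite /g /patch/=.
  by rewrite [in LHS]/indic; case: ifPn => yB; rewrite ?mule1 ?mule0 ?mul0e// muleC.
under eq_integral do rewrite EB.
under [X in _ = X -> _]eq_integral do rewrite EA.
rewrite [in X in _ -> X = _]integral_mkcond [in X in _ -> _ = X]integral_mkcond => E.
transitivity (\int[mu]_x (\int[mu]_(y in B) (f (x, y))%:E * (\1_A x)%:E))%E.
  apply: eq_integral => x _; rewrite /patch/= /indic.
  by case: ifPn => xA; rewrite ?mule1 ?mule0.
rewrite E; apply: eq_integral => x _; rewrite /patch/= /indic.
by case: ifPn => xA; rewrite ?mule1 ?mule0.
Qed.

End TonelliRect.

(** * The Gamma function and its reflection integral *)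
Section GammaBeta.
Context {R : realType}.
Notation mu := (@lebesgue_measure R).

Lemma measurable_powR_comp {d} {S : measurableType d} (p : R) (D : set S) (g : S -> R) :
  measurable_fun D g -> measurable_fun D (fun x => g x `^ p).
Proof. by move=> mg; apply: (measurableT_comp (measurable_powR p) mg). Qed.

Lemma integral_expR_0y (c : R) : 0 < c ->
  (\int[mu]_(x in `]0%R, +oo[) (expR (- (c * x)))%:E = (c^-1)%:E)%E.
Proof.
move=> c0.
have dF (x : R) : 0 < x -> is_derive x 1 (fun x => - (expR (- (c * x)) / c)) (expR (- (c * x))).
  move=> _.
  have h2 : is_derive x 1 (fun x : R => - (c * x)) (- c).
    by apply: is_derive_eq; rewrite /GRing.scale/=; ring.
  have h := @is_derive1_comp R (@expR R) (fun x => - (c * x)) x _ _ (is_derive_expR _) h2.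
  rewrite (_ : (fun x => _) = (- c^-1) *: ((@expR R) \o (fun x => - (c * x)))); last first.
    by apply/funext => z /=; rewrite !fctE /= /GRing.scale/= mulNr mulrC.
  by apply: is_derive_eq; rewrite /GRing.scale/=; field; rewrite gt_eqF.
rewrite (ge0_FTC_0y (la := - c^-1) (lb := 0) _ _ dF)//.
- by rewrite sub0r opprK.
- move=> x _; apply: continuous_comp; last exact: continuous_expR.
  by apply: continuousN; apply: continuousM; [exact: cvg_cst|exact: cvg_id].
- have cE (x : R) : {for x, continuous (fun x => - (expR (- (c * x)) / c))}.
    apply: continuousN; apply: continuousM; last exact: cvg_cst.
    apply: continuous_comp; last exact: continuous_expR.
    by apply: continuousN; apply: continuousM; [exact: cvg_cst|exact: cvg_id].
  rewrite [X in _ --> X](_ : _ = - (expR (- (c * 0)) / c)).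
    by apply: cvg_at_right_filter; exact: cE.
  by rewrite mulr0 oppr0 expR0 div1r.
- rewrite -[X in _ --> X]oppr0 -[X in _ --> - X](mul0r c^-1).
  apply: cvgN; apply: cvgMl; apply: (@cvg_comp _ _ _ (fun x : R => c * x) (fun y => expR (- y)) _ +oo).
    by apply: gt0_cvgMry => //; exact: cvg_id.
  exact: cvgr_expR.
Qed.

Definition Gamma_kernel (a t : R) : R := t `^ (a - 1) * expR (- t).

Lemma measurable_Gamma_kernel a : measurable_fun setT (Gamma_kernel a).
Proof.
apply: measurable_funM; first exact: measurable_powR.
by apply: measurableT_comp => //; exact: measurableT_comp.
Qed.

Lemma Gamma_kernel_ge0 a t : 0 <= Gamma_kernel a t.
Proof. by rewrite mulr_ge0 ?powR_ge0 ?expR_ge0. Qed.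

Lemma Gamma_integral (a : R) : 0 < a < 1 ->
  (\int[mu]_(x in `]0%R, +oo[) (Gamma_kernel a x)%:E = (Gamma a)%:E)%E.
Proof.
move=> /andP[a0 a1].
rewrite /Gamma /Rintegral fineK//.
rewrite ge0_fin_numE; last by apply: integral_ge0 => x _; rewrite lee_fin Gamma_kernel_ge0.
have mp : measurable_fun [set: R] (fun x : R => x `^ (a - 1)) by exact: measurable_powR.
have me : measurable_fun [set: R] (fun x : R => expR (- x)).
  by apply: measurableT_comp => //; exact: measurableT_comp.
apply: (@le_lt_trans _ _ (\int[mu]_(x in `]0%R, +oo[)
    ((x `^ (a - 1) * \1_(`]0%R, 1%R[%classic : set R) x)%:E + (expR (- x))%:E))%E).
  apply: ge0_le_integral => //.
  - by move=> x _; rewrite lee_fin Gamma_kernel_ge0.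
  - by apply/measurable_EFinP; apply: measurable_funTS; exact: measurable_Gamma_kernel.
  - apply: emeasurable_funD; apply/measurable_EFinP; apply: measurable_funTS => //.
    by apply: measurable_funM.
  - move=> x /=; rewrite in_itv/= andbT => x0; rewrite -EFinD lee_fin.
    have [x1|x1] := ltP x 1.
      rewrite indicE mem_set ?mulr1; last by rewrite /= in_itv/= x0 x1.
      rewrite ler_wpDr ?expR_ge0// ler_piMr ?powR_ge0// -expR0 ler_expR; lra.
    rewrite ler_wpDl ?mulr_ge0 ?powR_ge0//.
    rewrite /Gamma_kernel ler_piMl ?expR_ge0//.
    rewrite -[X in _ <= X](powRr0 x); apply: ler_powR => //; lra.
rewrite ge0_integralD//.
- rewrite (_ : \int[mu]_(x in `]0%R, +oo[) (expR (- x))%:E = (1^-1)%:E)%E; last first.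
    rewrite -integral_expR_0y//; apply: eq_integral => x _; by rewrite mul1r.
  apply: lte_add_pinfty; last by rewrite ltry.
  rewrite (_ : \int[mu]_(x in _) _ = \int[mu]_(x in `]0%R, 1%R[) (x `^ (a - 1))%:E)%E.
    have -> : (\int[mu]_(x in `]0%R, 1%R[) (x `^ (a - 1))%:E =
        \int[mu]_(x in `]0%R, 1%R[) ((x - 0) `^ (a - 1))%:E)%E.
      by apply: eq_integral => x _; rewrite subr0.
    by rewrite (integral_powR_right a0 ltr01 (lexx _)) ltry.
  rewrite [RHS]integral_mkcond [LHS]integral_mkcond; apply: eq_integral => x _.
  rewrite /patch indicE; case: ifPn => h; case: ifPn => h' //=; rewrite ?mulr1 ?mulr0//.
  exfalso; move/negP: h; apply; rewrite inE/= in_itv/= andbT.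
  by move: h'; rewrite inE/= in_itv/= => /andP[].
- by move=> x ?; rewrite lee_fin mulr_ge0// powR_ge0.
- by apply/measurable_EFinP; apply: measurable_funTS; apply: measurable_funM.
- by apply/measurable_EFinP; apply: measurable_funTS.
Qed.

End GammaBeta.

Section BetaIntegral.
Context {R : realType}.
Notation mu := (@lebesgue_measure R).

Lemma ge0_integral_scale (D : set R) (f g : R -> R) (k : R) :
  measurable D -> measurable_fun setT f -> (forall x, 0 <= f x) -> 0 <= k ->
  (forall x, D x -> g x = k * f x) ->
  (\int[mu]_(x in D) (g x)%:E = k%:E * \int[mu]_(x in D) (f x)%:E)%E.
Proof.
move=> mD mf f0 k0 gE; rewrite -ge0_integralZl_EFin; last 4 first.
- exact: mD.
- by move=> x _; rewrite lee_fin.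
- by apply/measurable_EFinP; exact: measurable_funTS.
- exact: k0.
by apply: eq_integral => x; rewrite inE => Dx; rewrite gE// EFinM.
Qed.

Lemma powRN_inv1 (x a : R) : 0 < x -> x `^ (- a) = (x `^ (a - 1) * x)^-1.
Proof.
move=> x0; rewrite powRN; congr (_^-1).
rewrite powRB; last by rewrite (gt_eqF x0) implybT.
by rewrite (powRr1 (ltW x0)) divfK// gt_eqF.
Qed.

Lemma continuous_Gamma_kernel (a x : R) : 0 < x -> {for x, continuous (@Gamma_kernel R a)}.
Proof.
move=> x0; apply: continuousM; first exact: continuous_powR_pos.
apply: continuous_comp; last exact: continuous_expR.
by apply: continuousN; exact: cvg_id.
Qed.

Lemma Gamma_gt0 (a : R) : 0 < a < 1 -> 0 < Gamma a.
Proof.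
move=> a01; have /andP[a0 a1] := a01; rewrite -lte_fin -Gamma_integral//.
apply: (@lt_le_trans _ _ (\int[mu]_(x in `]0%R, 1%R[) ((expR (-1))%:E * ((x - 0) `^ (a - 1))%:E))%E).
  rewrite ge0_integralZl//.
  - rewrite integral_powR_right// mule_gt0// lte_fin ?expR_gt0//.
    by rewrite !subr0 powR1 powR0 ?gt_eqF// subr0 divr_gt0.
  - apply/measurable_EFinP; apply: measurable_powR_comp.
    by apply: measurable_funTS; apply: measurable_funB.
  - by move=> x ?; rewrite lee_fin powR_ge0.
apply: (@le_trans _ _ (\int[mu]_(x in `]0%R, 1%R[) (Gamma_kernel a x)%:E)%E).
  apply: ge0_le_integral => //.
  - by move=> x ?; rewrite mule_ge0// lee_fin ?powR_ge0 ?expR_ge0.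
  - apply: measurable_funeM; apply/measurable_EFinP; apply: measurable_powR_comp.
    by apply: measurable_funTS; apply: measurable_funB.
  - by apply/measurable_EFinP/measurable_funTS; exact: measurable_Gamma_kernel.
  - move=> x /=; rewrite in_itv/= => /andP[x0 x1]; rewrite -EFinM lee_fin subr0 mulrC.
    by rewrite ler_wpM2l ?powR_ge0// ler_expR; lra.
apply: ge0_subset_integral => //.
- by apply/measurable_EFinP/measurable_funTS; exact: measurable_Gamma_kernel.
- by move=> x ?; rewrite lee_fin Gamma_kernel_ge0.
- by move=> x /=; rewrite !in_itv/= => /andP[->].
Qed.

(** Differentiate the primitive of the Gamma kernel composed with q |-> x q, instead of a
    change of variables for improper integrals. *)
Lemma Gamma_scale (a x : R) : 0 < a < 1 -> 0 < x ->
  (\int[mu]_(q in `]0%R, +oo[) (Gamma_kernel a (x * q) * x)%:E = (Gamma a)%:E)%E.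
Proof.
move=> a01 x0.
pose H p : R := \int[mu]_(y in `[0, p]) Gamma_kernel a y.
have mg := @measurable_Gamma_kernel R a.
have g0 := @Gamma_kernel_ge0 R a.
have cg := @continuous_Gamma_kernel a.
have gG := Gamma_integral a01.
have dF (q : R) : 0 < q -> is_derive q 1 (fun q => H (x * q)) (Gamma_kernel a (x * q) * x).
  move=> q0.
  have xq0 : 0 < x * q by rewrite mulr_gt0.
  have h := primitive_derive mg g0 cg gG xq0.
  have h2 : is_derive q 1 (fun q : R => x * q) x.
    by apply: is_derive_eq; rewrite /GRing.scale/=; ring.
  exact: (@is_derive1_comp R H (fun q => x * q) q _ _ h h2).
rewrite (ge0_FTC_0y (la := 0) (lb := Gamma a) _ _ dF)//.
- by rewrite subr0.
- by move=> q _; rewrite mulr_ge0 ?Gamma_kernel_ge0// ltW.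
- move=> q; rewrite in_itv/= andbT => q0; apply: (@continuousM R R (fun q => Gamma_kernel a (x * q)) (fun=> x)); last exact: cvg_cst.
  apply: (@continuous_comp _ _ _ (fun q => x * q) (Gamma_kernel a)).
    by apply: continuousM; [exact: cvg_cst|exact: cvg_id].
  by apply: continuous_Gamma_kernel; rewrite mulr_gt0.
- apply/cvg_at_rightP => u [u0 uc].
  have /cvg_at_rightP := primitive_cvg0 mg g0 gG; apply; split.
    by move=> n; rewrite mulr_gt0.
  by rewrite -(mulr0 x); apply: cvgM => //; exact: cvg_cst.
- apply: (@cvg_comp _ _ _ (fun q => x * q) H _ +oo).
    by apply: gt0_cvgMry => //; exact: cvg_id.
  exact: (primitive_cvgy mg g0 gG).
Qed.

(** The absolute value makes the denominator positive on the whole line, hence the kernel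
    measurable and nonnegative there. *)
Definition reflection_kernel (a r : R) : R := r `^ (- a) / (1 + `|r|).

Lemma reflection_kernel_ge0 a r : 0 <= reflection_kernel a r.
Proof. by rewrite divr_ge0 ?powR_ge0// addr_ge0. Qed.

Lemma continuous_inv_1norm (x : R) : {for x, continuous (fun r : R => (1 + `|r|)^-1)}.
Proof.
apply: (@continuousV R R (fun r : R => 1 + `|r|) x).
  by rewrite gt_eqF// ltr_pwDl.
apply: (@continuousD R R R (fun=> 1) (fun r : R => `|r|) x); first exact: cvg_cst.
exact: norm_continuous.
Qed.

Lemma measurable_reflection_kernel a : measurable_fun setT (reflection_kernel a).
Proof.
apply: measurable_funM; first exact: measurable_powR.
by apply: continuous_measurable_fun => x; exact: continuous_inv_1norm.
Qed.

Lemma continuous_reflection_kernel a x : 0 < x -> {for x, continuous (reflection_kernel a)}.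
Proof.
move=> x0; apply: continuousM; first exact: continuous_powR_pos.
exact: continuous_inv_1norm.
Qed.

Lemma measurable_expRNM (c : R) : measurable_fun setT (fun x : R => expR (- (c * x))).
Proof.
apply: continuous_measurable_fun => x; apply: continuous_comp; last exact: continuous_expR.
by apply: continuousN; apply: continuousM; [exact: cvg_cst|exact: cvg_id].
Qed.

(** Write 1 / (1 + q) as the integral of exp (- (1 + q) x) over x > 0 and exchange the
    integrals: the scaling q = y / x turns the inner one into Gamma (1 - a), and the outer
    one becomes Gamma a. *)
Lemma reflection_kernel_integral (a : R) : 0 < a < 1 ->
  (\int[mu]_(q in `]0%R, +oo[) (reflection_kernel a q)%:E = (Gamma a * Gamma (1 - a))%:E)%E.
Proof.
move=> a01; have /andP[a0 a1] := a01.
have a01' : 0 < 1 - a < 1 by apply/andP; split; lra.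
pose f (z : R * R) := z.2 `^ (- a) * expR (- ((1 + `|z.2|) * z.1)).
have mf : measurable_fun setT f.
  apply: measurable_funM; first by apply: measurable_powR_comp.
  apply: measurableT_comp => //; apply: measurableT_comp => //.
  apply: measurable_funM => //; apply: measurable_funD => //.
  exact: measurableT_comp.
have f0 z : 0 <= f z by rewrite mulr_ge0 ?powR_ge0 ?expR_ge0.
have m0 : measurable (`]0, +oo[%classic : set R) by [].
have Htt := tonelli_rect m0 m0 mf f0.
transitivity (\int[mu]_(y in `]0%R, +oo[) \int[mu]_(x in `]0%R, +oo[) (f (x, y))%:E)%E.
  apply: eq_integral => q; rewrite inE/= in_itv/= andbT => q0.
  have -> : reflection_kernel a q = q `^ (- a) * (1 + `|q|)^-1 by [].
  rewrite EFinM -integral_expR_0y; last by rewrite ltr_pwDl.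
  apply/esym/ge0_integral_scale.
  - exact: measurable_itv.
  - exact: measurable_expRNM.
  - by move=> x; exact: expR_ge0.
  - exact: powR_ge0.
  - by [].
rewrite -Htt mulrC EFinM -(Gamma_integral a01).
rewrite -(@ge0_integral_scale _ _ (fun x => Gamma (1 - a) * Gamma_kernel a x)); last 5 first.
- exact: measurable_itv.
- exact: measurable_Gamma_kernel.
- by move=> x; exact: Gamma_kernel_ge0.
- by apply/ltW/Gamma_gt0.
- by [].
apply: eq_integral => x; rewrite inE/= in_itv/= andbT => x0.
rewrite mulrC EFinM -(Gamma_scale a01' x0).
apply: ge0_integral_scale.
- exact: measurable_itv.
- apply: measurable_funM; last exact: measurable_cst.
  by apply: measurableT_comp; [exact: measurable_Gamma_kernel | exact: measurable_funM].
- by move=> q; exact: mulr_ge0 (Gamma_kernel_ge0 _ _) (ltW x0).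
- exact: Gamma_kernel_ge0.
move=> q; rewrite /= in_itv/= andbT => q0.
rewrite /f/= /Gamma_kernel.
rewrite (powRM _ (ltW x0) (ltW q0)).
have -> : 1 - a - 1 = - a by ring.
have -> : x `^ (- a) = (x `^ (a - 1) * x)^-1 by exact: powRN_inv1.
have -> : expR (- ((1 + `|q|) * x)) = expR (- x) * expR (- (x * q)).
  by rewrite -expRD (ger0_norm (ltW q0)); congr expR; ring.
have := powR_gt0 (a - 1) x0.
move: (x `^ (a - 1)) (expR _) (expR _) (q `^ _) => u e1 e2 v u0.
by field; rewrite !gt_eqF.
Qed.

End BetaIntegral.

(** * Beta integrals *)
Section BetaKernel.
Context {R : realType}.
Notation mu := (@lebesgue_measure R).
Implicit Types (a eta t xi kappa : R).

(** All Beta integrals needed come from the one substitution r = kappa (t - xi) / (xi -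
    eta) in the reflection integral; [kappa] is chosen according to the kernel. *)
Lemma beta_substitution a eta t kappa : 0 < a < 1 -> eta < t -> 0 < kappa ->
  (\int[mu]_(xi in `]eta, t[)
     (reflection_kernel a (kappa * (t - xi) / (xi - eta)) * (kappa * (t - eta) / (xi - eta) ^+ 2))%:E
   = (Gamma a * Gamma (1 - a))%:E)%E.
Proof.
move=> a01 et k0.
pose H p : R := \int[mu]_(y in `[0, p]) reflection_kernel a y.
have mg := @measurable_reflection_kernel R a.
have g0 := @reflection_kernel_ge0 R a.
have cg := @continuous_reflection_kernel R a.
have gG := reflection_kernel_integral a01.
pose q xi := kappa * (t - xi) / (xi - eta).
have q0 xi : eta < xi < t -> 0 < q xi.
  by move=> /andP[h1 h2]; rewrite divr_gt0 ?subr_gt0// mulr_gt0 ?subr_gt0.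
have dq xi : eta < xi -> is_derive xi 1 q (- (kappa * (t - eta) / (xi - eta) ^+ 2)).
  move=> h1; have h3 : xi - eta != 0 by rewrite subr_eq0 gt_eqF.
  have dV : is_derive xi 1 (fun z : R => (z - eta)^-1) (- (xi - eta) ^- 2 *: 1).
    have d1 : is_derive xi 1 (fun z : R => z - eta) 1 by apply: is_derive_eq; ring.
    exact: (is_deriveV (f := fun z => z - eta) h3 d1).
  have dN : is_derive xi 1 (fun z : R => kappa * (t - z)) (- kappa).
    by apply: is_derive_eq; rewrite /GRing.scale/=; ring.
  apply: (is_derive_eq (is_deriveM dN dV)).
  by rewrite /GRing.scale/=; field.
have cq xi : eta < xi -> {for xi, continuous q}.
  move=> h1; apply/differentiable_continuous/derivable1_diffP.
  by have [] := dq _ h1.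
have dF xi : eta < xi < t -> is_derive xi 1 (fun xi => - H (q xi))
    (reflection_kernel a (q xi) * (kappa * (t - eta) / (xi - eta) ^+ 2)).
  move=> h; have h1 := primitive_derive mg g0 cg gG (q0 _ h).
  have /andP[h2 _] := h.
  have h3 := @is_derive1_comp R H q xi _ _ h1 (dq _ h2).
  apply: (is_derive_eq (is_deriveN h3)).
  by rewrite mulrN opprK.
rewrite (ge0_FTC_oo (la := - (Gamma a * Gamma (1 - a))) (lb := - 0) et _ _ dF).
- by rewrite oppr0 sub0r opprK.
- move=> xi; rewrite in_itv/= => /andP[h1 h2]; rewrite mulr_ge0 ?reflection_kernel_ge0//.
  by rewrite divr_ge0 ?sqr_ge0// mulr_ge0 ?ltW// subr_gt0.
- move=> xi; rewrite in_itv/= => h; have /andP[h1 h2] := h.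
  apply: (@continuousM R R (fun xi => reflection_kernel a (q xi)) (fun xi => kappa * (t - eta) / (xi - eta) ^+ 2)).
    apply: (@continuous_comp _ _ _ q (reflection_kernel a)); first exact: cq.
    by apply: cg; exact: q0.
  apply: (@continuousM R R (fun=> kappa * (t - eta)) (fun xi => ((xi - eta) ^+ 2)^-1)).
    exact: cvg_cst.
  apply: (@continuousV R R (fun xi => (xi - eta) ^+ 2)).
    by rewrite sqrf_eq0 subr_eq0 gt_eqF.
  apply: (@continuousM R R (fun xi => xi - eta) (fun xi => xi - eta));
    by apply: continuousB; [exact: cvg_id|exact: cvg_cst].
- apply: cvgN.
  apply/cvg_at_rightP => u [u0 uc].
  apply: (@cvg_comp _ _ _ (fun n => q (u n)) H _ +oo); last exact: (primitive_cvgy mg g0 gG).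
  have uc0 : u n - eta @[n --> \oo] --> 0.
    by rewrite -(subrr eta); apply: cvgB => //; exact: cvg_cst.
  apply/cvgryPge => A.
  have A1 : 0 < (`|A| + 1) by rewrite ltr_wpDl.
  have e0 : 0 < Num.min ((t - eta) / 2) (kappa * (t - eta) / 2 / (`|A| + 1)).
    by rewrite lt_min !divr_gt0 ?mulr_gt0 ?subr_gt0.
  near=> n.
  have un : u n - eta < Num.min ((t - eta) / 2) (kappa * (t - eta) / 2 / (`|A| + 1)).
    by near: n; exact: cvgr_lt uc0 _ e0.
  move: un; rewrite lt_min => /andP[un1 un2].
  have une : 0 < u n - eta by rewrite subr_gt0.
  rewrite /q ler_pdivlMr//.
  apply: (@le_trans _ _ ((`|A| + 1) * (u n - eta))).
    rewrite (ler_wpM2r (ltW une))//; apply: (le_trans (ler_norm A)).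
    by rewrite lerDl.
  apply: (@le_trans _ _ (kappa * (t - eta) / 2)).
    by move: un2; rewrite ltr_pdivlMr// mulrC => /ltW.
  by rewrite -mulrA ler_wpM2l ?(ltW k0)//; lra.
- apply: cvgN; apply/cvg_at_leftP => u [u0 uc].
  (* the sequence may start to the left of eta, where q is not positive *)
  have [N _ HN] : \forall n \near \oo, eta < u n by exact: cvgr_gt uc _ et.
  rewrite -(cvg_shiftn N (fun n => H (q (u n)))).
  have /cvg_at_rightP := primitive_cvg0 mg g0 gG; apply; split.
    by move=> n; apply: q0; rewrite u0 HN//=; exact: leq_addl.
  have cqu : q (u n) @[n --> \oo] --> q t.
    by apply: (@cvg_comp _ _ _ u q _ _ _ uc); exact: cq.
  have qt0 : q t = 0 by rewrite /q subrr mulr0 mul0r.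
  by rewrite qt0 in cqu; rewrite (cvg_shiftn N (fun n => q (u n))); exact: cqu.
Unshelve. all: by end_near. Qed.

Lemma powRN_div (x y a : R) : 0 < x -> 0 < y ->
  (y / x) `^ (- a) = y `^ (- a) * (x * x `^ (a - 1)).
Proof.
move=> x0 y0; rewrite powRM; [|exact: ltW|by rewrite invr_ge0; exact: ltW].
rewrite -(powR_inv1 (ltW x0)) -powRrM mulN1r opprK; congr (_ * _).
rewrite powRB; last by rewrite (gt_eqF x0) implybT.
by rewrite (powRr1 (ltW x0)) mulrCA divff ?mulr1// gt_eqF.
Qed.

Lemma beta_integral a eta t : 0 < a < 1 -> eta < t ->
  (\int[mu]_(xi in `]eta, t[) ((t - xi) `^ (- a) * (xi - eta) `^ (a - 1))%:E
   = (Gamma a * Gamma (1 - a))%:E)%E.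
Proof.
move=> a01 et; rewrite -(beta_substitution a01 et ltr01).
apply: eq_integral => xi; rewrite inE/= in_itv/= => /andP[h1 h2]; congr EFin.
have x0 : 0 < xi - eta by rewrite subr_gt0.
have y0 : 0 < t - xi by rewrite subr_gt0.
have -> : t - eta = (xi - eta) + (t - xi) by ring.
rewrite mul1r /reflection_kernel (ger0_norm (ltW (divr_gt0 y0 x0))) (powRN_div _ x0 y0).
move: (_ `^ (a - 1)) (_ `^ (- a)) x0 y0 => u v.
move: (xi - eta) (t - xi) => x y x0 y0.
by field; rewrite !gt_eqF ?addr_gt0.
Qed.

(** The choice kappa = (tau - eta) / (tau - t) produces the kernel which expresses the
    continuation of a path by its past. *)
Lemma beta_integral_shift a eta t tau : 0 < a < 1 -> eta < t -> t < tau ->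
  (\int[mu]_(xi in `]eta, t[)
     ((tau - t) `^ a * (t - xi) `^ (- a) / (tau - xi) * (xi - eta) `^ (a - 1))%:E
   = (Gamma a * Gamma (1 - a) * (tau - eta) `^ (a - 1))%:E)%E.
Proof.
move=> a01 et tt.
have w0 : 0 < tau - eta by rewrite subr_gt0 (lt_trans et).
have z0 : 0 < tau - t by rewrite subr_gt0.
have k0 : 0 < (tau - eta) / (tau - t) by rewrite divr_gt0.
rewrite mulrC EFinM -(beta_substitution a01 et k0).
pose M (xi : R) := reflection_kernel a ((tau - eta) / (tau - t) * (t - xi) / (xi - eta)) *
  ((tau - eta) / (tau - t) * (t - eta) / (xi - eta) ^+ 2).
have mB := @measurable_reflection_kernel R a.
have mM : measurable_fun (`]eta, t[%classic : set R) M.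
  apply: open_continuous_measurable_fun; first exact: interval_open.
  move=> xi; rewrite inE/= in_itv/= => /andP[h1 h2].
  have x0 : 0 < xi - eta by rewrite subr_gt0.
  have y0 : 0 < t - xi by rewrite subr_gt0.
  have cV : {for xi, continuous (fun z : R => (z - eta)^-1)}.
    apply: (@continuousV R R (fun z => z - eta)); first by rewrite gt_eqF.
    by apply: continuousB; [exact: cvg_id|exact: cvg_cst].
  apply: (@continuousM R R (fun xi => reflection_kernel a ((tau - eta) / (tau - t) * (t - xi) / (xi - eta)))
     (fun xi => (tau - eta) / (tau - t) * (t - eta) / (xi - eta) ^+ 2)).
    apply: (@continuous_comp _ _ _ (fun xi => (tau - eta) / (tau - t) * (t - xi) / (xi - eta)) (reflection_kernel a)).
      apply: (@continuousM R R (fun xi => (tau - eta) / (tau - t) * (t - xi)) (fun xi => (xi - eta)^-1)) => //.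
      apply: (@continuousM R R (fun xi => (tau - eta) / (tau - t)) (fun xi => (t - xi))).
        exact: cvg_cst.
      by apply: continuousB; [exact: cvg_cst|exact: cvg_id].
    by apply: continuous_reflection_kernel; exact: divr_gt0 (mulr_gt0 k0 y0) x0.
  apply: (@continuousM R R (fun=> (tau - eta) / (tau - t) * (t - eta)) (fun xi => ((xi - eta) ^+ 2)^-1)).
    exact: cvg_cst.
  apply: (@continuousV R R (fun xi => (xi - eta) ^+ 2)); first by rewrite sqrf_eq0 gt_eqF.
  by apply: (@continuousM R R (fun xi => xi - eta) (fun xi => xi - eta));
    apply: continuousB; [exact: cvg_id|exact: cvg_cst|exact: cvg_id|exact: cvg_cst].
rewrite -ge0_integralZl_EFin; last 4 first.
- exact: measurable_itv.
- move=> xi; rewrite /= in_itv/= => /andP[h1 h2]; rewrite lee_fin.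
  apply: mulr_ge0; first exact: reflection_kernel_ge0.
  by rewrite divr_ge0 ?sqr_ge0// mulr_ge0 ?(ltW k0)// subr_ge0 ltW.
- exact/measurable_EFinP.
- exact: powR_ge0.
apply: eq_integral => xi; rewrite inE/= in_itv/= => /andP[h1 h2]; rewrite -EFinM; congr EFin.
have x0 : 0 < xi - eta by rewrite subr_gt0.
have y0 : 0 < t - xi by rewrite subr_gt0.
have yz0 : 0 < (t - xi) / (tau - t) by rewrite divr_gt0.
rewrite /reflection_kernel.
have -> : (tau - eta) / (tau - t) * (t - xi) / (xi - eta) =
    (tau - eta) * ((t - xi) / (tau - t)) / (xi - eta) by ring.
rewrite (ger0_norm (ltW (divr_gt0 (mulr_gt0 w0 yz0) x0))).
rewrite (powRN_div _ x0 (mulr_gt0 w0 yz0)) (powRM _ (ltW w0) (ltW yz0)).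
rewrite (powRN_div _ z0 y0) (powRN_inv1 _ w0).
have -> : (tau - t) `^ a = (tau - t) * (tau - t) `^ (a - 1).
  by rewrite mulr_powRB1 ?(ltW z0)//; case/andP: a01.
have := powR_gt0 (a - 1) w0; have := powR_gt0 (a - 1) z0.
have -> : t - eta = (xi - eta) + (t - xi) by ring.
have -> : tau - xi = (t - xi) + (tau - t) by ring.
have E : tau - eta = (xi - eta) + (t - xi) + (tau - t) by ring.
move: (_ `^ (a - 1)) (_ `^ (a - 1)) (_ `^ (a - 1)) (_ `^ (- a)) => u v w p.
rewrite E; move: w0 z0 x0 y0; rewrite E {E yz0 k0}.
move: (xi - eta) (t - xi) (tau - t) => x y z w0 z0 x0 y0 v0 w0'.
by field; rewrite !gt_eqF ?addr_gt0 ?mulr_gt0.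
Qed.

End BetaKernel.

(** * Integrals over compact intervals *)
Section AeCongruence.
Context d (T : measurableType d) (R : realType).
Variable mu : {measure set T -> \bar R}.
Local Open Scope ereal_scope.
Import HBNNSimple.

Let ae_nnintegral_le (f g : T -> \bar R) : (forall x, 0 <= f x) -> (forall x, 0 <= g x) ->
  {ae mu, forall x, f x = g x} -> \int[mu]_x f x <= \int[mu]_x g x.
Proof.
move=> f0 g0 [N [mN N0 fgN]].
rewrite !ge0_integralTE//; apply: ge_ereal_sup => _ [h hf <-].
have mNC : measurable (~` N) by exact: measurableC.
apply: (@le_trans _ _ (sintegral mu (proj_nnsfun h mNC))); last first.
  apply: ereal_sup_ubound; exists (proj_nnsfun h mNC) => // x; rewrite /= mindicE.
  have [xN|xN] := boolP (x \in ~` N); last by rewrite mulr0.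
  rewrite mulr1; have -> : g x = f x; last exact: hf.
  apply/esym; apply: contrapT => fgx; move: xN; rewrite inE; apply; exact: fgN.
rewrite -!integralT_nnsfun; rewrite le_eqVlt; apply/orP; left; apply/eqP; apply: ae_eq_integral => //.
- by apply/measurable_EFinP.
- by apply/measurable_EFinP.
- exists N; split => // x /= hx; apply: contrapT => xN; apply: hx => _.
  by rewrite /= mindicE mem_set// mulr1.
Qed.

(** Neither function is assumed measurable. This matters because a Caputo derivative is
    only known up to null sets: an integral of it can be replaced by that of a Borel
    density. A simple function below the one is below the other after being set to zero on
    a null set. *)
Lemma ae_congr_integral (D : set T) (f g : T -> \bar R) :
  {ae mu, forall x, D x -> f x = g x} -> \int[mu]_(x in D) f x = \int[mu]_(x in D) g x.
Proof.
move=> fg; rewrite integral_mkcond [RHS]integral_mkcond.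
have {}fg : {ae mu, forall x, (f \_ D) x = (g \_ D) x}.
  apply: filterS fg => x h; rewrite /patch; case: ifPn => //; rewrite inE; exact: h.
rewrite integralE [RHS]integralE; congr (_ - _); apply/le_anti/andP; split;
  apply: ae_nnintegral_le => //; apply: filterS fg => x;
  by rewrite ?funeposE ?funenegE => ->.
Qed.

End AeCongruence.
Notation rI a b f := (Rintegral (@lebesgue_measure _) [set` `[a, b]] f).
Notation iI a b f := ((@lebesgue_measure _).-integrable [set` `[a, b]] (EFin \o f)).

Section IntervalIntegrals.
Context {R : realType}.
Notation mu := (@lebesgue_measure R).
Implicit Types (f g : R -> R) (a b M : R).

(** Bounds and measurability are required on the whole line, so that no side condition on
    the domain arises; functions on an interval are extended by zero. *)
Definition bmeas g M := measurable_fun setT g /\ forall x, `|g x| <= M.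

Lemma rI_eq a b f g : (forall x, a <= x <= b -> f x = g x) -> rI a b f = rI a b g.
Proof.
by move=> fg; apply: eq_Rintegral => x; rewrite inE/= in_itv/=; exact: fg.
Qed.

Lemma ae_onW a b (A B : R -> Prop) : (forall x, a <= x <= b -> A x -> B x) ->
  ae_on a b A -> ae_on a b B.
Proof.
move=> AB; rewrite /ae_on; apply: (@filterS _ _ (ae_filter_ringOfSetsType mu)).
by move=> x h xab; apply: AB => //; exact: h.
Qed.

Lemma ae_on_and a b (A B : R -> Prop) : ae_on a b A -> ae_on a b B ->
  ae_on a b (fun x => A x /\ B x).
Proof.
rewrite /ae_on => hA hB.
have := @filterI _ _ (ae_filter_ringOfSetsType mu) _ _ hA hB.
apply: (@filterS _ _ (ae_filter_ringOfSetsType mu)).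
by move=> x [h1 h2] xab; split; [exact: h1|exact: h2].
Qed.

Lemma ae_on_sub a b a' b' (A : R -> Prop) : a <= a' -> b' <= b ->
  ae_on a b A -> ae_on a' b' A.
Proof.
move=> aa bb; rewrite /ae_on; apply: (@filterS _ _ (ae_filter_ringOfSetsType mu)).
by move=> x h /andP[h1 h2]; apply: h; rewrite (le_trans aa h1) (le_trans h2 bb).
Qed.

Lemma ae_on_all a b (A : R -> Prop) : (forall x, a <= x <= b -> A x) -> ae_on a b A.
Proof. by move=> h; apply: aeW => x; exact: h. Qed.

Lemma ae_on_neq (c a b : R) : ae_on a b (fun x => x != c).
Proof.
exists [set c]; split; [exact: measurable_set1|exact: lebesgue_measure_set1|].
move=> x /= h; apply: contrapT => xc; apply: h => _; exact/eqP.
Qed.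

Lemma ae_on_cat a b c (A : R -> Prop) : ae_on a b A -> ae_on b c A -> ae_on a c A.
Proof.
rewrite /ae_on => hA hB.
have := @filterI _ _ (ae_filter_ringOfSetsType mu) _ _ hA hB.
apply: (@filterS _ _ (ae_filter_ringOfSetsType mu)).
move=> x [h1 h2] /andP[ax xc]; have [xb|/ltW bx] := leP x b.
  by apply: h1; rewrite ax.
by apply: h2; rewrite bx.
Qed.

Lemma rI_ae a b f g : ae_on a b (fun x => f x = g x) -> rI a b f = rI a b g.
Proof.
rewrite /ae_on => fg; congr fine; apply: ae_congr_integral; move: fg.
apply: (@filterS _ _ (ae_filter_ringOfSetsType mu)).
move=> x h; by rewrite /= in_itv/= => xab; rewrite h.
Qed.

Lemma rI_ge0 a b f : (forall x, a <= x <= b -> 0 <= f x) -> 0 <= rI a b f.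
Proof. by move=> f0; apply: Rintegral_ge0 => x; rewrite /= in_itv/=; exact: f0. Qed.

Lemma rI_le a b f g : iI a b f -> iI a b g -> (forall x, a <= x <= b -> f x <= g x) ->
  rI a b f <= rI a b g.
Proof.
by move=> f0 g0 fg; apply: le_Rintegral => //.
Qed.

Lemma rI_normr a b f : iI a b f -> `|rI a b f| <= rI a b (fun x => `|f x|).
Proof. by move=> f0; apply: le_normr_Rintegral => //. Qed.

Lemma rID a b f g : iI a b f -> iI a b g ->
  rI a b (fun x => f x + g x) = rI a b f + rI a b g.
Proof. by move=> f0 g0; apply: RintegralD => //. Qed.

Lemma rIB a b f g : iI a b f -> iI a b g ->
  rI a b (fun x => f x - g x) = rI a b f - rI a b g.
Proof. by move=> f0 g0; apply: RintegralB => //. Qed.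

Lemma rIZl a b c f : iI a b f -> rI a b (fun x => c * f x) = c * rI a b f.
Proof. by move=> f0; apply: RintegralZl => //. Qed.

Lemma iID a b f g : iI a b f -> iI a b g -> iI a b (fun x => f x + g x).
Proof. by move=> f0 g0; exact: (@integrableD _ _ _ mu _ (measurable_itv `[a, b]) _ _ f0 g0). Qed.

Lemma iIB a b f g : iI a b f -> iI a b g -> iI a b (fun x => f x - g x).
Proof. by move=> f0 g0; exact: (@integrableB _ _ _ mu _ (measurable_itv `[a, b]) _ _ f0 g0). Qed.

Lemma iIZl a b c f : iI a b f -> iI a b (fun x => c * f x).
Proof. by move=> f0; exact: (@integrableZl _ _ _ mu _ (measurable_itv `[a, b]) c _ f0). Qed.

Lemma iI_normr a b f : iI a b f -> iI a b (fun x => `|f x|).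
Proof. by move=> f0; exact: (integrable_norm f0). Qed.

Lemma iI_eq a b f g : (forall x, a <= x <= b -> f x = g x) -> iI a b f -> iI a b g.
Proof.
move=> fg; apply: eq_integrable; first exact: measurable_itv.
by move=> x; rewrite inE/= in_itv/= => xab; rewrite /= fg.
Qed.

Lemma iI_sub a b a' b' f : a <= a' -> b' <= b -> iI a b f -> iI a' b' f.
Proof.
move=> aa bb; apply: integrableS; [exact: measurable_itv|exact: measurable_itv|].
move=> x; rewrite /= !in_itv/= => /andP[h1 h2].
by rewrite (le_trans aa h1) (le_trans h2 bb).
Qed.

Lemma rI_point a b f : b <= a -> rI a b f = 0.
Proof.
rewrite le_eqVlt => /predU1P[->|ba]; first by rewrite set_itv1 Rintegral_set1.
by rewrite set_itv_ge ?Rintegral_set0// bnd_simp -ltNge.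
Qed.

Lemma rI_chasles b a c f : a <= b -> b <= c -> iI a c f ->
  rI a c f = rI a b f + rI b c f.
Proof.
move=> ab bc f0; apply/eqP; rewrite addrC -subr_eq.
rewrite (@Rintegral_itvB _ f (BLeft a) (BRight c)) ?bnd_simp//.
rewrite Rintegral_itv_obnd_cbnd//.
apply: (@integrableS _ _ _ _ _ _ _ _ _ _ f0); try exact: measurable_itv.
move=> x; rewrite /= !in_itv/= => /andP[h1 ->]; rewrite andbT.
by rewrite (le_trans ab (ltW h1)).
Qed.

Lemma integral_cc_oo a b f : measurable_fun (`]a, b[%classic : set R) f ->
  (\int[mu]_(x in `[a, b]) (f x)%:E = \int[mu]_(x in `]a, b[) (f x)%:E)%E.
Proof. by move=> mf; apply: integral_itv_bndoo; exact/measurable_EFinP. Qed.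

Lemma mu_cc_lty a b : (mu (`[a, b]%classic : set R) < +oo)%E.
Proof. by rewrite lebesgue_measure_itv/=; case: ifP => _; rewrite ?ltry// -EFinB ltry. Qed.

Lemma iI_triv a b f : measurable_fun setT f -> b <= a -> iI a b f.
Proof.
move=> mf ba; apply/integrableP; split.
  by apply/measurable_EFinP/measurable_funTS.
apply: (@le_lt_trans _ _ (\int[mu]_(x in `[a, b]) (`|f x|)%:E)%E); first exact: lexx.
rewrite integral_cc_oo; last by apply: measurable_funTS; exact: measurableT_comp.
by rewrite set_itv_ge ?integral_set0// bnd_simp -leNgt.
Qed.

Lemma bmeas_int a b g M : bmeas g M -> iI a b g.
Proof.
move=> [mg gM]; apply: measurable_bounded_integrable.
- exact: measurable_itv.
- exact: mu_cc_lty.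
- exact: measurable_funTS.
- exists M; split; first exact: num_real.
  by move=> N MN x _; exact: (le_trans (gM x) (ltW MN)).
Qed.

Lemma cst_int a b (c : R) : iI a b (fun=> c).
Proof. by apply: (@bmeas_int _ _ _ `|c|); split => //; exact: measurable_cst. Qed.

Lemma rI_cst a b (c : R) : a <= b -> rI a b (fun=> c) = c * (b - a).
Proof.
move=> ab; rewrite Rintegral_cst; last exact: measurable_itv.
congr (_ * _); have -> : fine (mu (`[a, b]%classic : set R)) = b - a.
  rewrite lebesgue_measure_itv/=; case: ifPn; rewrite lte_fin//.
  by rewrite -leNgt => ba; apply/esym/eqP; rewrite subr_eq0 eq_le ab ba.
by [].
Qed.

Lemma bmeas_mul a b f g M : iI a b f -> bmeas g M -> iI a b (fun x => f x * g x).
Proof.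
move=> f0 [mg gM]; apply: (@integrableMl _ _ _ mu _ (measurable_itv `[a, b]) _ g f0).
  exact: measurable_funTS.
exists M; split; first exact: num_real.
by move=> N MN x _; exact: (le_trans (gM x) (ltW MN)).
Qed.

Lemma rI_mul_le a b f g M : iI a b f -> bmeas g M -> (forall x, a <= x <= b -> 0 <= f x) ->
  `|rI a b (fun x => f x * g x)| <= M * rI a b f.
Proof.
move=> f0 gM fge; have fg := bmeas_mul f0 gM.
apply: (le_trans (rI_normr fg)); rewrite -rIZl//.
apply: rI_le; [exact: iI_normr|exact: iIZl|move=> x xab].
by rewrite normrM mulrC (ger0_norm (fge _ xab)) (ler_wpM2r (fge _ xab))//; case: gM.
Qed.

Lemma rI_bmeas_le a b g M : a <= b -> bmeas g M -> `|rI a b g| <= M * (b - a).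
Proof.
move=> ab gM; have := rI_mul_le (cst_int a b 1) gM (fun _ _ => ler01).
rewrite rI_cst// mul1r; congr (_ <= _).
by congr (`| _ |); apply: rI_eq => x _; rewrite mul1r.
Qed.

Lemma bmeas_ge0 M g : bmeas g M -> 0 <= M.
Proof. by move=> [_ /(_ 0)]; exact: le_trans. Qed.

Lemma bmeasD M M' f g : bmeas f M -> bmeas g M' -> bmeas (fun x => f x + g x) (M + M').
Proof.
move=> [mf fM] [mg gM]; split; first exact: measurable_funD.
by move=> x; apply: (le_trans (ler_normD _ _)); exact: lerD.
Qed.

Lemma bmeasB M M' f g : bmeas f M -> bmeas g M' -> bmeas (fun x => f x - g x) (M + M').
Proof.
move=> [mf fM] [mg gM]; split; first exact: measurable_funB.
by move=> x; apply: (le_trans (ler_normB _ _)); exact: lerD.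
Qed.

Section kernels.
Variables (beta tau : R).
Hypothesis beta0 : 0 < beta.

Lemma measurable_kern_l : measurable_fun setT (fun x : R => (tau - x) `^ (beta - 1)).
Proof. by apply: measurable_powR_comp; exact: measurable_funB. Qed.

Lemma measurable_kern_r : measurable_fun setT (fun x : R => (x - tau) `^ (beta - 1)).
Proof. by apply: measurable_powR_comp; exact: measurable_funB. Qed.

Lemma kern_l_int a b : b <= tau -> iI a b (fun x : R => (tau - x) `^ (beta - 1)).
Proof.
move=> bt; have [ab|ba] := ltP a b; last first.
  by apply: iI_triv => //; exact: measurable_kern_l.
apply/integrableP; split.
  by apply/measurable_EFinP/measurable_funTS; exact: measurable_kern_l.
apply: (@le_lt_trans _ _ (\int[mu]_(x in `[a, b]) ((tau - x) `^ (beta - 1))%:E)%E).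
  have -> // : (\int[mu]_(x in `[a, b]) ((tau - x) `^ (beta - 1))%:E =
    \int[mu]_(x in `[a, b]) `|((tau - x) `^ (beta - 1))%:E|)%E.
  by apply: eq_integral => x _; rewrite /= ger0_norm// powR_ge0.
rewrite integral_cc_oo; last by apply: measurable_funTS; exact: measurable_kern_l.
by rewrite integral_powR_left// ltry.
Qed.

Lemma rI_kern_l a b : a <= b -> b <= tau ->
  rI a b (fun x : R => (tau - x) `^ (beta - 1)) = ((tau - a) `^ beta - (tau - b) `^ beta) / beta.
Proof.
rewrite le_eqVlt => /predU1P[->|ab] bt; first by rewrite rI_point// subrr mul0r.
rewrite /Rintegral integral_cc_oo; last by apply: measurable_funTS; exact: measurable_kern_l.
by rewrite integral_powR_left.
Qed.

Lemma kern_r_int a b : tau <= a -> iI a b (fun x : R => (x - tau) `^ (beta - 1)).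
Proof.
move=> bt; have [ab|ba] := ltP a b; last first.
  by apply: iI_triv => //; exact: measurable_kern_r.
apply/integrableP; split.
  by apply/measurable_EFinP/measurable_funTS; exact: measurable_kern_r.
apply: (@le_lt_trans _ _ (\int[mu]_(x in `[a, b]) ((x - tau) `^ (beta - 1))%:E)%E).
  have -> // : (\int[mu]_(x in `[a, b]) ((x - tau) `^ (beta - 1))%:E =
    \int[mu]_(x in `[a, b]) `|((x - tau) `^ (beta - 1))%:E|)%E.
  by apply: eq_integral => x _; rewrite /= ger0_norm// powR_ge0.
rewrite integral_cc_oo; last by apply: measurable_funTS; exact: measurable_kern_r.
by rewrite integral_powR_right// ltry.
Qed.

Lemma rI_kern_r a b : a <= b -> tau <= a ->
  rI a b (fun x : R => (x - tau) `^ (beta - 1)) = ((b - tau) `^ beta - (a - tau) `^ beta) / beta.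
Proof.
rewrite le_eqVlt => /predU1P[->|ab] bt; first by rewrite rI_point// subrr mul0r.
rewrite /Rintegral integral_cc_oo; last by apply: measurable_funTS; exact: measurable_kern_r.
by rewrite integral_powR_right.
Qed.

End kernels.

End IntervalIntegrals.

(** * Riemann-Liouville integrals *)
Section PowerInequalities.
Context {R : realType}.
Implicit Types (x y beta : R).

(** Concavity of the power; it yields the Hoelder continuity of fractional integrals. *)
Lemma powR_subadditive x y beta : 0 <= x -> 0 <= y -> 0 < beta <= 1 ->
  (x + y) `^ beta <= x `^ beta + y `^ beta.
Proof.
move=> x0 y0 /andP[b0 b1].
have [->|xn0] := eqVneq x 0; first by rewrite add0r lerDr powR_ge0.
have [->|yn0] := eqVneq y 0; first by rewrite addr0 lerDl powR_ge0.
have xp : 0 < x by rewrite lt_neqAle eq_sym xn0.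
have yp : 0 < y by rewrite lt_neqAle eq_sym yn0.
have sp : 0 < x + y by exact: addr_gt0.
have h z : 0 < z -> z <= x + y -> z / (x + y) * (x + y) `^ beta <= z `^ beta.
  move=> z0 zs.
  have -> : z `^ beta = (z / (x + y)) `^ beta * (x + y) `^ beta.
    by rewrite -powRM ?divfK ?gt_eqF ?divr_ge0 ?(ltW sp) ?(ltW z0).
  rewrite ler_wpM2r ?powR_ge0//; apply: ger1_powR => //.
  by rewrite divr_gt0//= ler_pdivrMr// mul1r.
apply: (le_trans _ (lerD (h x xp _) (h y yp _))); try lra.
by rewrite -mulrDl -mulrDl divff ?mul1r// gt_eqF.
Qed.

Lemma powR_diff_le x y beta : 0 <= x -> x <= y -> 0 < beta <= 1 ->
  y `^ beta - x `^ beta <= (y - x) `^ beta.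
Proof.
move=> x0 xy b; rewrite lerBlDr.
have -> : y = (y - x) + x by rewrite subrK.
by rewrite addrK; apply: powR_subadditive => //; rewrite subr_ge0.
Qed.

Lemma powR_anti x y beta : 0 < x -> x <= y -> beta <= 1 -> y `^ (beta - 1) <= x `^ (beta - 1).
Proof.
move=> x0 xy b1; have y0 := lt_le_trans x0 xy.
have -> : beta - 1 = - (1 - beta) by ring.
rewrite !powRN lef_pV2 ?posrE ?powR_gt0//.
by apply: ge0_ler_powR; rewrite ?nnegrE ?subr_ge0 ?(ltW x0) ?(ltW y0).
Qed.

End PowerInequalities.

Section OpenInterval.
Context {R : realType}.
Notation mu := (@lebesgue_measure R).
Implicit Types (f g : R -> R) (a b M : R).

Lemma rI_eq_oo a b f g : (forall x, a < x < b -> f x = g x) -> rI a b f = rI a b g.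
Proof.
move=> fg; apply: rI_ae.
apply: (ae_onW _ (ae_on_and (ae_on_neq a a b) (ae_on_neq b a b))) => x /andP[h1 h2] [h3 h4].
by apply: fg; rewrite !lt_neqAle h1 h2 h4 eq_sym h3.
Qed.

Lemma rI_le_oo a b f g : iI a b f -> iI a b g -> (forall x, a < x < b -> f x <= g x) ->
  rI a b f <= rI a b g.
Proof.
move=> fi gi fg.
have S : `]a, b[%classic `<=` (`[a, b]%classic : set R).
  by move=> x; rewrite /= !in_itv/= => /andP[/ltW -> /ltW ->].
have oi h : iI a b h -> mu.-integrable (`]a, b[%classic : set R) (EFin \o h).
  by apply: integrableS => //; exact: measurable_itv.
have E h : iI a b h -> rI a b h = Rintegral mu (`]a, b[%classic : set R) h.
  move=> hi; rewrite /Rintegral integral_cc_oo//.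
  by have /integrableP[/measurable_EFinP] := oi _ hi.
rewrite (E f)// (E g)//; apply: le_Rintegral; [exact: measurable_itv|exact: oi|exact: oi|].
by move=> x; rewrite /= in_itv/=; exact: fg.
Qed.

Lemma rI_mul_le_oo a b f g M : iI a b f -> bmeas g M -> (forall x, a < x < b -> 0 <= f x) ->
  `|rI a b (fun x => f x * g x)| <= M * rI a b f.
Proof.
move=> f0 gM fge; have fg := bmeas_mul f0 gM.
apply: (le_trans (rI_normr fg)); rewrite -rIZl//.
apply: rI_le_oo; [exact: iI_normr|exact: iIZl|move=> x xab].
by rewrite normrM mulrC (ger0_norm (fge _ xab)) (ler_wpM2r (fge _ xab))//; case: gM.
Qed.

Lemma ge0_fin_rI a b f (c : R) : measurable_fun (`]a, b[%classic : set R) f ->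
  (forall x, a < x < b -> 0 <= f x) ->
  (\int[mu]_(x in `]a, b[) (f x)%:E = c%:E)%E -> measurable_fun setT f ->
  iI a b f /\ rI a b f = c.
Proof.
move=> mf f0 E mfT; split; last by rewrite /Rintegral integral_cc_oo// E.
apply/integrableP; split; first by apply/measurable_EFinP; exact: measurable_funTS.
apply: (@le_lt_trans _ _ (\int[mu]_(x in `[a, b]) (`|f x|)%:E)%E); first exact: lexx.
rewrite integral_cc_oo; last exact: measurableT_comp.
have -> : (\int[mu]_(x in `]a, b[) (`|f x|)%:E = c%:E)%E.
  rewrite -E; apply: eq_integral => x; rewrite inE/= in_itv/= => h.
  by rewrite ger0_norm ?f0.
exact: ltry.
Qed.

End OpenInterval.

Section TriangleFubini.
Context {R : realType}.
Notation mu := (@lebesgue_measure R).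

(** Tonelli's theorem on the triangle 0 < eta < xi < t, encoded by the indicator of xi -
    eta > 0. *)
Lemma tonelli_triangle (t : R) (h k g : R -> R) :
  measurable_fun setT h -> measurable_fun setT k -> measurable_fun setT g ->
  (forall x, 0 <= h x) -> (forall x, 0 <= k x) -> (forall x, 0 <= g x) ->
  (\int[mu]_(xi in `]0%R, t[) ((h xi)%:E * \int[mu]_(eta in `]0%R, xi[) (k (xi - eta) * g eta)%:E) =
   \int[mu]_(eta in `]0%R, t[) ((g eta)%:E * \int[mu]_(xi in `]eta, t[) (h xi * k (xi - eta))%:E))%E.
Proof.
move=> mh mk mg h0 k0 g0.
pose f (z : R * R) := h z.1 * k (z.1 - z.2) * g z.2 * \1_(`]0, +oo[%classic : set R) (z.1 - z.2).
have mkd : measurable_fun setT (fun z : R * R => k (z.1 - z.2)).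
  by apply: (measurableT_comp mk); apply: measurable_funB.
have mf : measurable_fun setT f.
  apply: measurable_funM.
    apply: measurable_funM; last exact: (measurableT_comp mg).
    by apply: measurable_funM => //; exact: (measurableT_comp mh).
  have mi : measurable_fun setT (\1_(`]0, +oo[%classic : set R) : R -> R).
    exact: measurable_indic.
  by apply: (measurableT_comp mi); apply: measurable_funB.
have f0 z : 0 <= f z by rewrite /f !mulr_ge0.
have m0 : measurable (`]0, t[%classic : set R) by exact: measurable_itv.
have Ht := tonelli_rect m0 m0 mf f0.
transitivity (\int[mu]_(x in `]0%R, t[) \int[mu]_(y in `]0%R, t[) (f (x, y))%:E)%E.
  apply: eq_integral => xi; rewrite inE/= in_itv/= => /andP[x0 xt].
  have mkg : measurable_fun setT (fun eta : R => k (xi - eta) * g eta).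
    exact: (measurable_funM (measurableT_comp mk (measurable_funB (measurable_cst _) (@measurable_id _ _ _))) mg).
  rewrite -(@ge0_integral_scale _ _ _ (fun eta : R => h xi * (k (xi - eta) * g eta))); last 5 first.
  - exact: measurable_itv.
  - exact: mkg.
  - by move=> x; exact: mulr_ge0.
  - exact: h0.
  - by [].
  rewrite integral_mkcond [RHS]integral_mkcond; apply: eq_integral => eta _.
  rewrite /patch !mem_setE/= !in_itv/= /f/= indicE mem_setE/= in_itv/= andbT subr_gt0.
  case: ifPn => [/andP[e0 ex]|].
    by rewrite e0 (lt_trans ex xt)/= ex mulr1 mulrA.
  rewrite negb_and => /orP[/negbTE ->//|/negbTE ->]; by rewrite mulr0; case: ifP.
rewrite Ht; apply: eq_integral => eta; rewrite inE/= in_itv/= => /andP[e0 et].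
have mhk : measurable_fun setT (fun xi : R => h xi * k (xi - eta)).
  exact: (measurable_funM mh (measurableT_comp mk (measurable_funB (@measurable_id _ _ _) (measurable_cst _)))).
rewrite -(@ge0_integral_scale _ _ _ (fun xi : R => g eta * (h xi * k (xi - eta)))); last 5 first.
- exact: measurable_itv.
- exact: mhk.
- by move=> x; exact: mulr_ge0.
- exact: g0.
- by [].
rewrite integral_mkcond [RHS]integral_mkcond; apply: eq_integral => xi _.
rewrite /patch !mem_setE/= !in_itv/= /f/= indicE mem_setE/= in_itv/= andbT subr_gt0.
case: ifPn => [/andP[x0 xt]|]; case: ifPn.
- by move=> /andP[-> _]; rewrite mulr1 mulrC.
- by rewrite xt andbT => /negbTE ->; rewrite mulr0.
- by move=> /andP[ex xt]; rewrite (lt_trans e0 ex) xt.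
- by [].
Qed.

End TriangleFubini.

Section RiemannLiouville.
Context {R : realType}.
Notation mu := (@lebesgue_measure R).
Implicit Types (g h P : R -> R) (b t tau M beta : R).

Lemma holder_small (C beta e : R) : 0 <= C -> 0 < beta -> 0 < e ->
  exists2 d : R, 0 < d & forall x, 0 <= x -> x <= d -> C * x `^ beta <= e.
Proof.
move=> C0 b0 e0; have C1 : 0 < C + 1 by rewrite ltr_wpDl.
exists ((e / (C + 1)) `^ beta^-1); first by rewrite powR_gt0// divr_gt0.
move=> x x0 xd.
have h : x `^ beta <= e / (C + 1).
  apply: (@le_trans _ _ (((e / (C + 1)) `^ beta^-1) `^ beta)).
    by apply: ge0_ler_powR; rewrite ?nnegrE ?powR_ge0// ltW.
  by rewrite -powRrM mulVf ?gt_eqF// powRr1// ltW// divr_gt0.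
apply: (@le_trans _ _ ((C + 1) * (e / (C + 1)))).
  by apply: ler_pM => //; [exact: powR_ge0|rewrite lerDl].
by rewrite mulrCA divff ?mulr1// gt_eqF.
Qed.

Lemma holder_continuous (F : R -> R) (C beta : R) : 0 <= C -> 0 < beta ->
  (forall x y, x <= y -> `|F y - F x| <= C * (y - x) `^ beta) -> continuous F.
Proof.
move=> C0 b0 FC x; apply/cvgrPdist_le => e e0.
have [d d0 hd] := holder_small C0 b0 e0.
near=> y.
have xy : `|x - y| <= d.
  by near: y; apply: (@cvgr_dist_le _ _ _ _ _ id) => //; exact: cvg_id.
have [le|/ltW le] := leP x y.
  rewrite distrC; apply: (le_trans (FC _ _ le)); apply: hd; first by rewrite subr_ge0.
  by rewrite -(ger0_norm (x := y - x)) ?subr_ge0// distrC.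
apply: (le_trans (FC _ _ le)); apply: hd; first by rewrite subr_ge0.
by rewrite -(ger0_norm (x := x - y)) ?subr_ge0.
Unshelve. all: by end_near. Qed.

(** The fractional integral without its normalizing factor, with separate upper limit [b]
    and evaluation point [tau]; for b < tau this is the continuation by zero derivative. *)
Definition RL beta b tau g : R := rI 0 b (fun xi => (tau - xi) `^ (beta - 1) * g xi).

Lemma RL_int beta a b tau g M : 0 < beta -> b <= tau -> bmeas g M ->
  iI a b (fun xi => (tau - xi) `^ (beta - 1) * g xi).
Proof. by move=> b0 bt gM; apply: (bmeas_mul _ gM); exact: kern_l_int. Qed.

Lemma RL_tail beta a b tau g M : 0 < beta <= 1 -> a <= b -> b <= tau -> bmeas g M ->
  `|rI a b (fun xi => (tau - xi) `^ (beta - 1) * g xi)| <= M * ((b - a) `^ beta / beta).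
Proof.
move=> b01 ab bt gM; have /andP[b0 b1] := b01.
have k1 := @kern_l_int R beta tau b0 a b bt.
apply: (le_trans (rI_mul_le_oo k1 gM _)); first by move=> x _; exact: powR_ge0.
apply: ler_wpM2l; first exact: bmeas_ge0 gM.
rewrite rI_kern_l// ler_wpM2r ?invr_ge0 ?(ltW b0)//.
have -> : b - a = (tau - a) - (tau - b) by ring.
by apply: powR_diff_le => //; rewrite ?subr_ge0// lerD2l lerN2.
Qed.

Lemma RL_chasles beta a b tau g M : 0 < beta -> 0 <= a -> a <= b -> b <= tau -> bmeas g M ->
  RL beta b tau g = RL beta a tau g + rI a b (fun xi => (tau - xi) `^ (beta - 1) * g xi).
Proof. by move=> b0 a0 ab bt gM; apply: rI_chasles => //; exact: RL_int gM. Qed.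

Lemma RL_bound beta b tau g M : 0 < beta <= 1 -> 0 <= b -> b <= tau -> bmeas g M ->
  `|RL beta b tau g| <= M * (b `^ beta / beta).
Proof.
by move=> b01 bb bt gM; have := RL_tail b01 bb bt gM; rewrite subr0.
Qed.

Lemma RL_neg beta b tau g : b <= 0 -> RL beta b tau g = 0.
Proof. exact: rI_point. Qed.

Lemma RL_shift beta a tau tau' g M : 0 < beta <= 1 -> 0 <= a -> a <= tau -> tau <= tau' ->
  bmeas g M ->
  `|RL beta a tau' g - RL beta a tau g| <= M * ((tau' - tau) `^ beta / beta).
Proof.
move=> b01 a0 aT tt gM; have /andP[b0 b1] := b01.
have i1 := @RL_int beta 0 a tau g M b0 aT gM.
have i2 := @RL_int beta 0 a tau' g M b0 (le_trans aT tt) gM.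
rewrite distrC /RL -rIB//.
have k1 := @kern_l_int R beta tau b0 0 a aT.
have k2 := @kern_l_int R beta tau' b0 0 a (le_trans aT tt).
rewrite (@rI_eq _ _ _ _ (fun xi => ((tau - xi) `^ (beta - 1) - (tau' - xi) `^ (beta - 1)) * g xi)); last first.
  by move=> xi _; rewrite mulrBl.
apply: (le_trans (rI_mul_le_oo (iIB k1 k2) gM _)).
  move=> xi /andP[_ xa]; rewrite subr_ge0; apply: powR_anti => //; first by rewrite subr_gt0; lra.
  by rewrite lerD2r.
apply: ler_wpM2l; first exact: bmeas_ge0 gM.
rewrite rIB// !rI_kern_l//; last exact: le_trans tt.
rewrite -mulrBl ler_wpM2r ?invr_ge0 ?(ltW b0)// !subr0.
have h1 : tau `^ beta <= tau' `^ beta.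
  by apply: ge0_ler_powR; rewrite ?nnegrE//; lra.
have : (tau' - a) `^ beta - (tau - a) `^ beta <= (tau' - tau) `^ beta.
  have -> : tau' - tau = (tau' - a) - (tau - a) by ring.
  by apply: powR_diff_le => //; lra.
lra.
Qed.

(** Split at the smaller time: the tail is bounded by the integral of the kernel, the rest
    by the integral of the difference of the kernels. *)
Lemma RL_modulus beta tau tau' g M : 0 < beta <= 1 -> tau <= tau' -> bmeas g M ->
  `|RL beta tau' tau' g - RL beta tau tau g| <= 2 * M / beta * (tau' - tau) `^ beta.
Proof.
move=> b01 tt gM; have /andP[b0 b1] := b01.
have M0 := bmeas_ge0 gM.
have [t0|/ltW t0] := leP tau' 0.
  rewrite !RL_neg ?(le_trans tt)// subrr normr0.
  by rewrite !mulr_ge0 ?powR_ge0 ?invr_ge0 ?(ltW b0).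
have -> : 2 * M / beta * (tau' - tau) `^ beta =
  M * ((tau' - tau) `^ beta / beta) + M * ((tau' - tau) `^ beta / beta) by ring.
have [tn|tp] := leP tau 0.
  rewrite (RL_neg _ _ _ tn) subr0.
  apply: (le_trans (RL_bound b01 t0 (lexx _) gM)).
  apply: (@le_trans _ _ (M * ((tau' - tau) `^ beta / beta))); last first.
    by rewrite lerDl !mulr_ge0 ?powR_ge0 ?invr_ge0 ?(ltW b0).
  rewrite ler_wpM2l// ler_wpM2r ?invr_ge0 ?(ltW b0)//.
  by apply: ge0_ler_powR; rewrite ?nnegrE ?(ltW b0)//; lra.
rewrite (RL_chasles b0 (ltW tp) tt (lexx _) gM).
rewrite addrAC; apply: (le_trans (ler_normD _ _)); apply: lerD.
  exact: RL_shift (ltW tp) _ tt gM.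
exact: RL_tail gM.
Qed.

Lemma RL_continuous beta g M : 0 < beta <= 1 -> bmeas g M ->
  continuous (fun x => RL beta x x g).
Proof.
move=> b01 gM; have /andP[b0 _] := b01.
apply: (@holder_continuous _ (2 * M / beta) beta) => //.
  by rewrite !mulr_ge0 ?invr_ge0 ?(ltW b0)// (bmeas_ge0 gM).
by move=> x y xy; exact: RL_modulus.
Qed.

Lemma RL_measurable beta g M : 0 < beta <= 1 -> bmeas g M ->
  measurable_fun setT (fun x => RL beta x x g).
Proof. by move=> b01 gM; apply: continuous_measurable_fun; exact: RL_continuous gM. Qed.

Lemma rI_EFin a b (f : R -> R) : iI a b f ->
  (rI a b f)%:E = (\int[mu]_(x in `]a, b[) (f x)%:E)%E.
Proof.
move=> fi; rewrite /Rintegral integral_cc_oo; last first.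
  have /integrableP[/measurable_EFinP + _] := fi.
  apply: measurable_funS => //.
  by move=> x; rewrite /= !in_itv/= => /andP[/ltW -> /ltW ->].
have oi : mu.-integrable (`]a, b[%classic : set R) (EFin \o f).
  apply: integrableS fi => //.
  by move=> x; rewrite /= !in_itv/= => /andP[/ltW -> /ltW ->].
by rewrite fineK//; exact: integrable_fin_num oi.
Qed.

Section fubini.
Variables (beta t : R) (h P : R -> R).
Hypothesis b01 : 0 < beta <= 1.
Hypothesis mh : measurable_fun setT h.
Hypothesis h0 : forall x, 0 < x < t -> 0 <= h x.
Hypothesis hP : forall eta, 0 < eta < t ->
  (\int[mu]_(xi in `]eta, t[) (h xi * (xi - eta) `^ (beta - 1))%:E = (P eta)%:E)%E.
Hypothesis iP : iI 0 t P.

Let b0 : 0 < beta. Proof. by case/andP: b01. Qed.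

Let RL_fubini_ge0 g M : bmeas g M -> (forall x, 0 <= g x) ->
  iI 0 t (fun xi => h xi * RL beta xi xi g) /\
  rI 0 t (fun xi => h xi * RL beta xi xi g) = rI 0 t (fun eta => P eta * g eta).
Proof.
move=> gM g0.
pose D : set R := `]0, t[%classic.
have mD : measurable D by exact: measurable_itv.
pose h' x := h x * \1_D x.
have mh' : measurable_fun setT h' by apply: measurable_funM => //; exact: measurable_indic.
have h'0 x : 0 <= h' x.
  rewrite /h' indicE; case: (boolP (x \in D)) => xD; last by rewrite mulr0.
  by rewrite mulr1 h0//; move: xD; rewrite inE/D/= in_itv/=.
have mk : measurable_fun setT (fun x : R => x `^ (beta - 1)) by exact: measurable_powR.
have gm : measurable_fun setT g by case: gM.
have := tonelli_triangle t mh' mk gm h'0 (fun x => powR_ge0 _ _) g0.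
set L := (X in X = _ -> _); set Rt := (X in _ = X -> _).
have -> : L = (\int[mu]_(x in D) (h x * RL beta x x g)%:E)%E.
  apply: eq_integral => xi; rewrite inE/= in_itv/= => /andP[x0 xt].
  have xD : xi \in D by rewrite inE/D/= in_itv/= x0.
  rewrite /h' indicE xD mulr1 EFinM; congr (_ * _)%E.
  have ii := @RL_int beta 0 xi xi g M b0 (lexx _) gM.
  by rewrite /RL rI_EFin.
have PgI : iI 0 t (fun eta => P eta * g eta) by exact: (bmeas_mul iP gM).
have -> : Rt = (rI 0 t (fun eta => P eta * g eta))%:E.
  rewrite rI_EFin//.
  apply: eq_integral => eta; rewrite inE/= in_itv/= => /andP[e0 et].
  rewrite mulrC EFinM -hP ?e0//; congr (_ * _)%E.
  apply: eq_integral => xi; rewrite inE/= in_itv/= => /andP[ex xt].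
  by rewrite /h' indicE mem_set ?mulr1// /D/= in_itv/= xt (lt_trans e0 ex).
move=> E; apply: ge0_fin_rI => //.
- apply: measurable_funTS; apply: measurable_funM => //; exact: RL_measurable gM.
- move=> x x0t; rewrite mulr_ge0 ?h0//.
  by apply: rI_ge0 => y _; rewrite mulr_ge0 ?powR_ge0.
- by apply: measurable_funM => //; exact: RL_measurable gM.
Qed.

(** Integrating a fractional integral against [h] amounts to integrating [g] against [P],
    the adjoint image of [h]; sign changing [g] is reduced to [g + M] and the constant
    [M]. *)
Lemma RL_fubini g M : bmeas g M ->
  iI 0 t (fun xi => h xi * RL beta xi xi g) /\
  rI 0 t (fun xi => h xi * RL beta xi xi g) = rI 0 t (fun eta => P eta * g eta).
Proof.
move=> gM; have M0 := bmeas_ge0 gM.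
have cM : bmeas (fun=> M) M by split => // x; rewrite ger0_norm.
have sM := bmeasD gM cM.
have sM0 x : 0 <= g x + M.
  by have [_ /(_ x)] := gM; rewrite ler_norml => /andP[]; lra.
have [i1 e1] := RL_fubini_ge0 sM sM0.
have [i2 e2] := RL_fubini_ge0 cM (fun=> M0).
have RLE x : RL beta x x g = RL beta x x (fun y => g y + M) - RL beta x x (fun=> M).
  rewrite /RL -rIB.
  - by apply: rI_eq => y _; ring.
  - exact: RL_int sM.
  - exact: RL_int cM.
have hE x : h x * RL beta x x (fun y => g y + M) - h x * RL beta x x (fun=> M) =
    h x * RL beta x x g by rewrite RLE; ring.
split; first by apply: iI_eq (iIB i1 i2) => x _; exact: hE.
rewrite -(rI_eq (f := fun x => _ - _) (fun x _ => hE x)) rIB// e1 e2 -rIB.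
- by apply: rI_eq => y _; ring.
- exact: (bmeas_mul iP sM).
- exact: (bmeas_mul iP cM).
Qed.
End fubini.

End RiemannLiouville.

(** * Abel inversion and the maximum principle *)
Section Domination.
Context {R : realType}.
Notation mu := (@lebesgue_measure R).

Lemma dominated_iI (a b : R) (f G : R -> R) : measurable_fun setT f -> (forall x, 0 <= f x) ->
  iI a b G -> (forall x, a < x < b -> f x <= G x) -> iI a b f.
Proof.
move=> mf f0 GI fG.
have f0' x : a < x < b -> 0 <= f x by [].
have mf' : measurable_fun (`]a, b[%classic : set R) f by exact: measurable_funTS.
suff E : (\int[mu]_(x in `]a, b[) (f x)%:E = (fine (\int[mu]_(x in `]a, b[) (f x)%:E))%:E)%E.
  by have [] := ge0_fin_rI mf' f0' E mf.
rewrite fineK// ge0_fin_numE; last by apply: integral_ge0 => x _; rewrite lee_fin.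
have gi : mu.-integrable (`]a, b[%classic : set R) (EFin \o G).
  apply: integrableS GI => //.
  by move=> x; rewrite /= !in_itv/= => /andP[/ltW -> /ltW ->].
have := @le_integrable _ _ _ mu (`]a, b[%classic : set R) (measurable_itv _) (EFin \o f) (EFin \o G).
move=> /(_ _ _ gi) h.
have /integrableP[_] : mu.-integrable (`]a, b[%classic : set R) (EFin \o f).
  apply: h; first exact/measurable_EFinP.
  move=> x; rewrite /= in_itv/= => xab; rewrite lee_fin ger0_norm//.
  by apply: (le_trans (fG _ xab)); exact: ler_norm.
apply: le_lt_trans; apply: ge0_le_integral => //.
- by apply/measurable_EFinP; exact: measurable_funTS.
- by apply/measurable_EFinP; apply: measurable_funTS; exact: measurableT_comp.
- by move=> x _; rewrite lee_fin ler_norm.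
Qed.

End Domination.

Section AbelInversion.
Context {R : realType}.
Notation mu := (@lebesgue_measure R).
Variable alpha : R.
Hypothesis a01 : 0 < alpha < 1.
Implicit Types (g : R -> R) (t s tau M : R).

Let a0 : 0 < alpha. Proof. by case/andP: a01. Qed.
Let a1 : 0 < alpha <= 1. Proof. by case/andP: a01 => -> /ltW ->. Qed.

Definition reflection_const : R := Gamma alpha * Gamma (1 - alpha).

Lemma reflection_const_gt0 : 0 < reflection_const.
Proof. by apply: mulr_gt0; apply: Gamma_gt0 => //; have := a01; lra. Qed.

(** By the Beta integral the adjoint image of the kernel (s - xi)^(- alpha) is constant. *)
Lemma abel_inversion s g M : bmeas g M ->
  rI 0 s (fun xi => (s - xi) `^ (- alpha) * RL alpha xi xi g) = reflection_const * rI 0 s g.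
Proof.
move=> gM.
have mh : measurable_fun setT (fun xi : R => (s - xi) `^ (- alpha)).
  by apply: measurable_powR_comp; exact: measurable_funB.
have hP eta : 0 < eta < s ->
    (\int[mu]_(xi in `]eta, s[) ((s - xi) `^ (- alpha) * (xi - eta) `^ (alpha - 1))%:E = reflection_const%:E)%E.
  by move=> /andP[_ es]; exact: beta_integral.
have [_ ->] := RL_fubini a1 mh (fun _ _ => powR_ge0 _ _) hP (cst_int 0 s reflection_const) gM.
by rewrite rIZl//; exact: bmeas_int gM.
Qed.

Lemma abel_integrable s g M : bmeas g M ->
  iI 0 s (fun xi => (s - xi) `^ (- alpha) * RL alpha xi xi g).
Proof.
move=> gM.
have mh : measurable_fun setT (fun xi : R => (s - xi) `^ (- alpha)).
  by apply: measurable_powR_comp; exact: measurable_funB.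
have hP eta : 0 < eta < s ->
    (\int[mu]_(xi in `]eta, s[) ((s - xi) `^ (- alpha) * (xi - eta) `^ (alpha - 1))%:E = reflection_const%:E)%E.
  by move=> /andP[_ es]; exact: beta_integral.
by have [] := RL_fubini a1 mh (fun _ _ => powR_ge0 _ _) hP (cst_int 0 s reflection_const) gM.
Qed.

(** The analogue of the Poisson kernel: averaging the values of a fractional integral on
    [0, t] against it gives, up to a constant factor, the value at tau > t of the
    continuation by zero derivative. *)
Definition poisson t tau (xi : R) : R := (tau - t) `^ alpha * (t - xi) `^ (- alpha) *
  (tau - xi) `^ (- 1).

Lemma measurable_poisson t tau : measurable_fun setT (poisson t tau).
Proof.
apply: measurable_funM.
  apply: measurable_funM; first exact: measurable_cst.
  by apply: measurable_powR_comp; exact: measurable_funB.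
by apply: measurable_powR_comp; exact: measurable_funB.
Qed.

Lemma poisson_ge0 t tau xi : 0 <= poisson t tau xi.
Proof. by rewrite /poisson !mulr_ge0 ?powR_ge0. Qed.

Lemma poisson_beta eta t tau : eta < t -> t < tau ->
  (\int[mu]_(xi in `]eta, t[) (poisson t tau xi * (xi - eta) `^ (alpha - 1))%:E
     = (reflection_const * (tau - eta) `^ (alpha - 1))%:E)%E.
Proof.
move=> et tt; rewrite -(beta_integral_shift a01 et tt).
apply: eq_integral => xi; rewrite inE/= in_itv/= => /andP[_ xt].
by rewrite /poisson powR_inv1//; lra.
Qed.

Lemma powR_1BM (x : R) : 0 < x -> x `^ (1 - alpha) * x `^ (alpha - 1) = 1.
Proof.
move=> x0; have -> : alpha - 1 = - (1 - alpha) by ring.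
by rewrite powRN divff// gt_eqF// powR_gt0.
Qed.

(** The total mass is compared with the Beta integral started at eta = -1, whose value is
    explicit; the powers of (xi + 1) and (t + 1) which this introduces combine to a factor
    at most one. *)
Lemma poisson_mass t tau : 0 <= t -> t < tau ->
  iI 0 t (poisson t tau) /\ rI 0 t (poisson t tau) <= reflection_const.
Proof.
move=> t0 tt.
have m1 : (-1 : R) < t by lra.
have E := poisson_beta m1 tt.
pose F xi := poisson t tau xi * (xi - -1) `^ (alpha - 1).
have mF : measurable_fun setT F.
  by apply: measurable_funM; [exact: measurable_poisson | exact: measurable_kern_r].
have F0 x : -1 < x < t -> 0 <= F x.
  by move=> _; rewrite mulr_ge0 ?powR_ge0// poisson_ge0.
have [iF rF] := ge0_fin_rI (measurable_funTS mF) F0 E mF.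
have iF0 : iI 0 t F by apply: iI_sub iF => //; lra.
pose w := (t + 1) `^ (1 - alpha).
have w0 : 0 < w by rewrite powR_gt0; lra.
have le1 x : 0 < x < t -> poisson t tau x <= w * F x.
  move=> /andP[x0 xt]; rewrite /F mulrCA.
  have p0 := poisson_ge0 t tau x.
  rewrite ler_peMr// opprK.
  rewrite -[X in X <= _](@powR_1BM (t + 1)); last lra.
  rewrite ler_wpM2l ?(ltW w0)//; apply: powR_anti; last by case/andP: a1.
    lra.
  lra.
have ip : iI 0 t (poisson t tau).
  have [tz|tp] := leP t 0; first by apply: iI_triv => //; exact: measurable_poisson.
  exact: (dominated_iI (measurable_poisson t tau) (poisson_ge0 t tau) (iIZl w iF0) le1).
split => //.
apply: (@le_trans _ _ (w * rI (-1) t F)).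
  rewrite -rIZl//.
  rewrite (@rI_chasles _ 0 (-1) t (fun x => w * F x)) ?lerN10 ?oppr_le0//; last exact: iIZl.
  apply: (le_trans (rI_le_oo ip (iIZl w iF0) le1)).
  rewrite lerDr; apply: rI_ge0 => x /andP[x1 x2].
  by rewrite mulr_ge0 ?(ltW w0)// /F mulr_ge0 ?powR_ge0// poisson_ge0.
rewrite rF -/reflection_const opprK mulrCA ler_piMr ?(ltW reflection_const_gt0)//.
rewrite -[X in _ <= X](@powR_1BM (tau + 1)); last lra.
rewrite ler_wpM2r ?powR_ge0//; apply: ge0_ler_powR; rewrite ?nnegrE; have := a01; lra.
Qed.

Lemma poisson_formula t tau g M : 0 <= t -> t < tau -> bmeas g M ->
  rI 0 t (fun xi => poisson t tau xi * RL alpha xi xi g) = reflection_const * RL alpha t tau g.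
Proof.
move=> t0 tt gM.
have hP eta : 0 < eta < t ->
    (\int[mu]_(xi in `]eta, t[) (poisson t tau xi * (xi - eta) `^ (alpha - 1))%:E
     = (reflection_const * (tau - eta) `^ (alpha - 1))%:E)%E.
  by move=> /andP[_ es]; exact: poisson_beta.
have h0 x : 0 < x < t -> 0 <= poisson t tau x by move=> _; exact: poisson_ge0.
have k1 := kern_l_int a0 0 (ltW tt).
have [_ ->] := RL_fubini a1 (measurable_poisson t tau) h0 hP (iIZl reflection_const k1) gM.
rewrite -rIZl; first by apply: rI_eq => x _; rewrite mulrA.
exact: RL_int a0 (ltW tt) gM.
Qed.

(** The continuation is an average of earlier values against a nonnegative kernel of mass
    at most [reflection_const], the factor in front of it in [poisson_formula]. *)
Lemma RL_max_principle t tau g M S : 0 <= t -> t < tau -> bmeas g M ->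
  (forall xi, 0 <= xi <= t -> `|RL alpha xi xi g| <= S) -> `|RL alpha t tau g| <= S.
Proof.
move=> t0 tt gM gS.
have S0 : 0 <= S by apply: le_trans (gS 0 _); rewrite ?lexx ?t0.
have [pI pB] := poisson_mass t0 tt.
(* cut off outside [0, t] to be bounded on the whole line *)
pose rl xi := RL alpha xi xi g * \1_(`[0, t]%classic : set R) xi.
have rS : bmeas rl S.
  split.
    apply: measurable_funM; first exact: RL_measurable gM.
    exact: measurable_indic.
  move=> x; rewrite /rl indicE; case: (boolP (_ \in _)); last by rewrite mulr0 normr0.
  by rewrite inE/= in_itv/= mulr1; exact: gS.
have := poisson_formula t0 tt gM.
rewrite (@rI_eq _ _ _ _ (fun xi => poisson t tau xi * rl xi)); last first.
  by move=> x xt; rewrite /rl indicE mem_set ?mulr1// /= in_itv.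
move=> E; rewrite -(ler_pM2l reflection_const_gt0) -[reflection_const in X in X <= _]ger0_norm ?(ltW reflection_const_gt0)//.
rewrite -normrM -E; apply: (le_trans (rI_mul_le_oo pI rS _)).
  by move=> x _; exact: poisson_ge0.
by rewrite mulrC ler_wpM2r.
Qed.

End AbelInversion.

(** * Fractional integrals of vector functions *)
Local Opaque Rintegral Gamma.

Section Norms.
Context {R : realType} {n : nat}.
Implicit Types (x y : 'rV[R]_n) (M : R).

Lemma rv_eqP x y : (forall i, x ord0 i = y ord0 i) -> x = y.
Proof. by move=> xy; apply/rowP => i; exact: xy. Qed.

Lemma norm_coord x i : `|x ord0 i| <= `|x|.
Proof.
rewrite [leRHS](_ : _ = mx_norm x)// mx_normrE.
by rewrite (le_bigmax _ (fun ij : 'I_1 * 'I_n => `|x ij.1 ij.2|) (ord0, i)).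
Qed.

Lemma norm_leP x M : 0 <= M -> (forall i, `|x ord0 i| <= M) -> `|x| <= M.
Proof.
move=> M0 h; rewrite [leLHS](_ : _ = mx_norm x)// mx_normrE.
by apply: bigmax_le => // -[i j] _ /=; rewrite (ord1 i).
Qed.

Lemma dotv_norm_le x y : `|dotv x y| <= n%:R * (`|x| * `|y|).
Proof.
rewrite /dotv; apply: (le_trans (ler_norm_sum _ _ _)).
apply: (@le_trans _ _ (\sum_(i < n) `|x| * `|y|)).
  by apply: ler_sum => i _; rewrite normrM ler_pM// norm_coord.
by rewrite sumr_const card_ord mulr_natl.
Qed.

Lemma enorm_le_norm x : enorm x <= n%:R * `|x|.
Proof.
have h : 0 <= n%:R * `|x| by rewrite mulr_ge0.
rewrite -(ger0_norm h) -sqrtr_sqr; apply: ler_wsqrtr.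
apply: (le_trans (ler_norm _)); apply: (le_trans (dotv_norm_le x x)).
rewrite expr2 mulrACA; apply: ler_wpM2r; first by rewrite mulr_ge0.
by rewrite -natrM ler_nat; case: (n) => // m; rewrite leq_pmulr.
Qed.

Lemma coord_le_enorm x i : `|x ord0 i| <= enorm x.
Proof.
rewrite -sqrtr_sqr; apply: ler_wsqrtr.
rewrite /dotv (bigD1 i)//= -expr2 lerDl.
by apply: sumr_ge0 => j _; rewrite -expr2 sqr_ge0.
Qed.

Lemma enorm_ge0 x : 0 <= enorm x.
Proof. exact: sqrtr_ge0. Qed.

Lemma norm_le_enorm x : `|x| <= enorm x.
Proof. by apply: norm_leP; [exact: enorm_ge0|exact: coord_le_enorm]. Qed.

Lemma dotvBl x y z : dotv (x - y) z = dotv x z - dotv y z.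
Proof. by rewrite /dotv -sumrB; apply: eq_bigr => i _; rewrite !mxE mulrBl. Qed.

Lemma dotvBr x y z : dotv x (y - z) = dotv x y - dotv x z.
Proof. by rewrite /dotv -sumrB; apply: eq_bigr => i _; rewrite !mxE mulrBr. Qed.

End Norms.

Section FracInt.
Context {R : realType} {n : nat} (alpha : R).
Hypothesis a01 : 0 < alpha < 1.
Implicit Types (g : R -> 'rV[R]_n) (b t tau M : R).

Let a0 : 0 < alpha. Proof. by case/andP: a01. Qed.
Let a1 : 0 < alpha <= 1. Proof. by case/andP: a01 => -> /ltW ->. Qed.

Definition coordf g (i : 'I_n) (t : R) : R := g t ord0 i.

(** The sup norm is used for all estimates of vectors; the Euclidean norm is compared with
    it where the two meet. *)
Definition vbm g M := (forall i, measurable_fun setT (coordf g i)) /\ forall t, `|g t| <= M.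

Lemma vbm_coord g M i : vbm g M -> bmeas (coordf g i) M.
Proof. by move=> [mg gM]; split => // x; apply: (le_trans (norm_coord _ _)). Qed.

Lemma vbm_ge0 g M : vbm g M -> 0 <= M.
Proof. by move=> [_ /(_ 0)]; exact: le_trans. Qed.

Lemma vbmB g g' M M' : vbm g M -> vbm g' M' -> vbm (fun t => g t - g' t) (M + M').
Proof.
move=> [mg gM] [mg' gM']; split; last first.
  by move=> t; apply: (le_trans (ler_normB _ _)); exact: lerD.
move=> i; rewrite (_ : coordf _ i = fun t => coordf g i t - coordf g' i t).
  exact: measurable_funB.
by apply/funext => t; rewrite /coordf !mxE.
Qed.

Lemma vbmD g g' M M' : vbm g M -> vbm g' M' -> vbm (fun t => g t + g' t) (M + M').
Proof.
move=> [mg gM] [mg' gM']; split; last first.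
  by move=> t; apply: (le_trans (ler_normD _ _)); exact: lerD.
move=> i; rewrite (_ : coordf _ i = fun t => coordf g i t + coordf g' i t).
  exact: measurable_funD.
by apply/funext => t; rewrite /coordf !mxE.
Qed.

Lemma vbmW g M M' : vbm g M -> M <= M' -> vbm g M'.
Proof. by move=> [mg gM] MM; split => // t; exact: le_trans (gM t) MM. Qed.

Lemma vbm_if (A : set R) g g' M : measurable A -> vbm g M -> vbm g' M ->
  vbm (fun t => if t \in A then g t else g' t) M.
Proof.
move=> mA [mg gM] [mg' gM']; split; last by move=> x; case: ifP.
move=> i; rewrite (_ : coordf _ i = fun t => if t \in A then coordf g i t else coordf g' i t).
  apply: measurable_fun_ifT => //; apply: (measurable_fun_bool true); rewrite setTI.
  by rewrite (_ : _ @^-1` _ = A)//; apply/seteqP; split => x; [move=> /set_mem|move=> /mem_set].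
by apply/funext => t; rewrite /coordf; case: ifP.
Qed.

Lemma vbm0 M : 0 <= M -> vbm (fun=> 0) M.
Proof.
move=> M0; split; last by move=> t; rewrite normr0.
by move=> i; rewrite /coordf; exact: measurable_cst.
Qed.

Local Notation GA := (Gamma alpha).

Lemma Gamma_alpha_gt0 : 0 < GA. Proof. exact: Gamma_gt0. Qed.

Lemma invGamma_ge0 : 0 <= GA^-1. Proof. by rewrite invr_ge0; exact: ltW Gamma_alpha_gt0. Qed.

Lemma invGamma_norm : `|GA^-1| = GA^-1. Proof. exact: ger0_norm invGamma_ge0. Qed.

Lemma frac_intE b tau g i :
  frac_int alpha b tau g ord0 i = GA^-1 * RL alpha b tau (coordf g i).
Proof.
rewrite /frac_int !mxE; congr (_ * _); apply: rI_eq => xi _.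
by rewrite mxE -powRN opprB.
Qed.
Local Opaque frac_int.

(** The fractional integral of the constant 1 over [0, b], evaluated at [b], is frac_const
    * b^alpha. *)
Definition frac_const : R := (GA * alpha)^-1.

Lemma frac_const_gt0 : 0 < frac_const. Proof. by rewrite invr_gt0 mulr_gt0// Gamma_alpha_gt0. Qed.

Lemma frac_int_bound b tau g M : 0 <= b -> b <= tau -> vbm g M ->
  `|frac_int alpha b tau g| <= frac_const * M * b `^ alpha.
Proof.
move=> b0 bt gM; apply: norm_leP => [|i].
  by rewrite !mulr_ge0 ?powR_ge0 ?(ltW frac_const_gt0)// (vbm_ge0 gM).
rewrite frac_intE normrM invGamma_norm.
have -> : frac_const * M * b `^ alpha = GA^-1 * (M * (b `^ alpha / alpha)).
  by rewrite /frac_const; field; rewrite !gt_eqF// Gamma_alpha_gt0.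
apply: (ler_wpM2l invGamma_ge0).
exact: RL_bound (vbm_coord i gM).
Qed.

Lemma subvE (x y : 'rV[R]_n) i : (x - y) ord0 i = x ord0 i - y ord0 i.
Proof. by rewrite !mxE. Qed.

Lemma addvE (x y : 'rV[R]_n) i : (x + y) ord0 i = x ord0 i + y ord0 i.
Proof. by rewrite !mxE. Qed.

Lemma frac_constE (M p : R) : GA^-1 * (M * (p / alpha)) = frac_const * M * p.
Proof. by rewrite /frac_const; field; rewrite !gt_eqF// Gamma_alpha_gt0. Qed.

Lemma frac_int_subE b tau g b' tau' g' i :
  (frac_int alpha b tau g - frac_int alpha b' tau' g') ord0 i =
  GA^-1 * (RL alpha b tau (coordf g i) - RL alpha b' tau' (coordf g' i)).
Proof. by rewrite subvE mulrBr; congr (_ - _); exact: frac_intE. Qed.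

Lemma frac_int_modulus tau tau' g M : tau <= tau' -> vbm g M ->
  `|frac_int alpha tau' tau' g - frac_int alpha tau tau g| <= 2 * frac_const * M * (tau' - tau) `^ alpha.
Proof.
move=> tt gM; apply: norm_leP => [|i].
  by rewrite !mulr_ge0 ?powR_ge0 ?(ltW frac_const_gt0)// (vbm_ge0 gM).
rewrite frac_int_subE normrM invGamma_norm.
have -> : 2 * frac_const * M * (tau' - tau) `^ alpha = GA^-1 * (2 * M / alpha * (tau' - tau) `^ alpha).
  by rewrite /frac_const; field; rewrite !gt_eqF// Gamma_alpha_gt0.
apply: (ler_wpM2l invGamma_ge0).
exact: RL_modulus (vbm_coord i gM).
Qed.

Lemma frac_int_tail a b tau g M : 0 <= a -> a <= b -> b <= tau -> vbm g M ->
  `|frac_int alpha b tau g - frac_int alpha a tau g| <= frac_const * M * (b - a) `^ alpha.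
Proof.
move=> aa ab bt gM; apply: norm_leP => [|i].
  by rewrite !mulr_ge0 ?powR_ge0 ?(ltW frac_const_gt0)// (vbm_ge0 gM).
have gi := vbm_coord i gM.
rewrite frac_int_subE normrM invGamma_norm.
rewrite -frac_constE; apply: (ler_wpM2l invGamma_ge0).
rewrite (RL_chasles a0 aa ab bt gi) addrAC subrr add0r.
exact: RL_tail gi.
Qed.

Lemma frac_intB b tau g g' M M' : b <= tau -> vbm g M -> vbm g' M' ->
  frac_int alpha b tau (fun s => g s - g' s) = frac_int alpha b tau g - frac_int alpha b tau g'.
Proof.
move=> bt gM gM'; apply: rv_eqP => i; rewrite frac_int_subE frac_intE; congr (_ * _).
rewrite /RL -rIB.
- by apply: rI_eq => s _; rewrite /coordf subvE mulrBr.
- exact: RL_int (vbm_coord i gM).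
- exact: RL_int (vbm_coord i gM').
Qed.

Lemma frac_int_ae b tau g g' : ae_on 0 b (fun s => g s = g' s) ->
  frac_int alpha b tau g = frac_int alpha b tau g'.
Proof.
move=> gg; apply: rv_eqP => i; rewrite !frac_intE; congr (_ * _).
by apply: rI_ae; apply: ae_onW gg => x _ e; rewrite /coordf e.
Qed.

Lemma frac_int_neg b tau g : b <= 0 -> frac_int alpha b tau g = 0.
Proof. by move=> b0; apply: rv_eqP => i; rewrite frac_intE RL_neg// mulr0 mxE. Qed.

Lemma frac_int_zero b tau : frac_int alpha b tau (fun=> 0 : 'rV[R]_n) = 0.
Proof.
apply: rv_eqP => i; rewrite frac_intE mxE /RL (@rI_eq _ _ _ _ (fun=> 0)).
  have [b0|b0] := leP 0 b; first by rewrite rI_cst// mul0r mulr0.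
  by rewrite rI_point ?mulr0// ltW.
by move=> x _; rewrite /coordf mxE mulr0.
Qed.

(** A path with density [cutoff t g] has zero derivative after [t]. *)
Definition cutoff t g (s : R) : 'rV[R]_n := if s \in (`]-oo, t]%classic : set R) then g s else 0.

Lemma vbm_cutoff t g M : vbm g M -> vbm (cutoff t g) M.
Proof. by move=> gM; apply: vbm_if => //; apply: vbm0; exact: vbm_ge0 gM. Qed.

Lemma frac_int_cutoff t tau g M : 0 <= t -> t <= tau -> vbm g M ->
  frac_int alpha tau tau (cutoff t g) = frac_int alpha t tau g.
Proof.
move=> t0 tt gM; apply: rv_eqP => i; rewrite !frac_intE; congr (_ * _).
have ci := vbm_coord i (vbm_cutoff t gM).
rewrite (RL_chasles a0 t0 tt (lexx _) ci) (@rI_eq_oo _ t tau _ (fun=> 0)); last first.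
  move=> x /andP[tx _]; rewrite /coordf /cutoff memNset ?mxE ?mulr0//.
  by rewrite /= in_itv/= leNgt tx.
rewrite rI_cst// mul0r addr0; apply: rI_eq => x /andP[_ xt].
by rewrite /coordf /cutoff mem_set// /= in_itv.
Qed.

Lemma frac_int_cutoff_lt t tau g : tau <= t ->
  frac_int alpha tau tau (cutoff t g) = frac_int alpha tau tau g.
Proof.
move=> tt; apply: frac_int_ae; apply: ae_on_all => x /andP[_ xt].
by rewrite /cutoff mem_set// /= in_itv/= (le_trans xt).
Qed.

End FracInt.

(** * Paths, their densities and Caputo derivatives *)
Local Opaque Rintegral Gamma frac_int.

Section Paths.
Context {R : realType} {n : nat} (T alpha : R).
Notation mu := (@lebesgue_measure R).
Hypothesis T0 : 0 < T.
Hypothesis a01 : 0 < alpha < 1.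
Implicit Types (g : R -> 'rV[R]_n) (z : 'rV[R]_n) (x : R -> 'rV[R]_n) (b t tau M : R).

Let a0 : 0 < alpha. Proof. by case/andP: a01. Qed.
Let a1 : 0 < alpha <= 1. Proof. by case/andP: a01 => -> /ltW ->. Qed.

(** The path with initial value [z] and density [g]; it vanishes outside [0, T], as
    elements of [ACpath] do, so that equality of functions is equality of paths. *)
Definition mkpath z g tau : 'rV[R]_n :=
  if 0 <= tau <= T then z + frac_int alpha tau tau g else 0.

Lemma mkpathE z g tau :
  mkpath z g tau = if 0 <= tau <= T then z + frac_int alpha tau tau g else 0.
Proof. by []. Qed.

Lemma mkpath_in z g tau : 0 <= tau <= T -> mkpath z g tau = z + frac_int alpha tau tau g.
Proof. by rewrite /mkpath => ->. Qed.

Lemma mkpath0 z g : mkpath z g 0 = z.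
Proof. by rewrite mkpath_in ?lexx ?(ltW T0)// frac_int_neg// addr0. Qed.

Lemma mkpath_out z g tau : ~~ (0 <= tau <= T) -> mkpath z g tau = 0.
Proof. by rewrite /mkpath => /negbTE ->. Qed.

Lemma mkpath_ae z g g' : ae_on 0 T (fun s => g s = g' s) -> mkpath z g = mkpath z g'.
Proof.
move=> gg; apply/funext => tau; rewrite /mkpath; case: ifP => // /andP[t0 tT].
by congr (_ + _); apply: frac_int_ae; apply: ae_on_sub gg.
Qed.

Lemma mkpath_ACpath z g M : vbm g M -> ACpath T alpha (mkpath z g).
Proof.
move=> gM; split; first exact: mkpath_out.
exists g; split.
- by move=> i; apply: measurable_funTS; have [mg _] := gM; exact: mg.
- exists (n%:R * M); apply: ae_on_all => t _.
  by apply: (le_trans (enorm_le_norm _)); rewrite ler_wpM2l//; case: gM.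
- by move=> tau tt; rewrite mkpath0 mkpath_in.
Qed.

(** An essentially bounded density is truncated coordinatewise at its bound, which changes
    it on a null set only. *)
Lemma ACpathP x : ACpath T alpha x -> exists g M, vbm g M /\ x = mkpath (x 0) g.
Proof.
move=> [xout [g0 [mg0 [M0 gM0] xE]]].
pose M := `|M0|.
pose g (s : R) : 'rV[R]_n := if s \in (`[0, T]%classic : set R) then
  \row_i Num.max (- M) (Num.min (g0 s ord0 i) M) else 0.
have M_ge0 : 0 <= M by exact: normr_ge0.
have gM : vbm g M.
  split; last first.
    move=> t; apply: norm_leP => // i; rewrite /g; case: ifP => _; rewrite mxE ?normr0//.
    rewrite ler_norml le_max lexx/= ge_max ge_min lexx orbT andbT; lra.
  move=> i.
  have -> : coordf g i = (fun s => Num.max (- M) (Num.min (g0 s ord0 i) M)) \_ (`[0, T]%classic : set R).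
    by apply/funext => s; rewrite /coordf /g /patch; case: ifP => _; rewrite mxE.
  apply/(measurable_restrictT _ _).1; first exact: measurable_itv.
  apply: measurable_maxr; first exact: measurable_cst.
  by apply: measurable_minr; [exact: mg0|exact: measurable_cst].
exists g, M; split => //; apply/funext => tau; rewrite /mkpath.
case: ifP => [tt|/negbT/xout//]; rewrite xE//; congr (_ + _).
apply: frac_int_ae; have /andP[_ tT] := tt.
apply: (ae_onW _ (ae_on_sub (lexx 0) tT gM0)) => s /andP[s0 st] sM.
rewrite /g mem_set /=; last by rewrite in_itv/= s0 (le_trans st).
apply: rv_eqP => i; rewrite mxE.
have : `|g0 s ord0 i| <= M.
  apply: (le_trans (coord_le_enorm _ _)); apply: (le_trans sM); exact: ler_norm.
rewrite ler_norml => /andP[h1 h2].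
by rewrite min_l// max_r.
Qed.

Lemma mkpath_modulus z g M tau tau' : vbm g M -> 0 <= tau -> tau <= tau' -> tau' <= T ->
  `|mkpath z g tau' - mkpath z g tau| <= 2 * frac_const alpha * M * (tau' - tau) `^ alpha.
Proof.
move=> gM t0 tt tT; rewrite !mkpath_in ?t0 ?tT ?(le_trans t0)// ?(le_trans tt)//.
rewrite opprD addrACA subrr add0r; exact: frac_int_modulus.
Qed.

Lemma mkpath_bound z g M tau : vbm g M -> 0 <= tau <= T ->
  `|mkpath z g tau| <= `|z| + frac_const alpha * M * T `^ alpha.
Proof.
move=> gM tt; have /andP[t0 tT] := tt; rewrite mkpath_in//.
apply: (le_trans (ler_normD _ _)); rewrite lerD2l.
apply: (le_trans (frac_int_bound a01 t0 (lexx _) gM)).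
apply: ler_wpM2l; first by rewrite mulr_ge0 ?(ltW (frac_const_gt0 a01))// (vbm_ge0 gM).
by apply: ge0_ler_powR; rewrite ?nnegrE ?(ltW a0) ?(ltW T0).
Qed.

(** The fractional integral of order 1 - alpha inverts that of order alpha up to one
    integration. *)
Lemma caputo_primitive z g M i s : vbm g M -> 0 <= s <= T ->
  vint `[0, s] (fun xi => ((s - xi) `^ alpha)^-1 *: (mkpath z g xi - mkpath z g 0)) ord0 i
  = Gamma (1 - alpha) * rI 0 s (coordf g i).
Proof.
move=> gM /andP[s0 sT]; rewrite mxE.
have gi := vbm_coord i gM.
have GG : Gamma (1 - alpha) = (Gamma alpha)^-1 * reflection_const alpha.
  by rewrite /reflection_const mulrA mulVf ?mul1r// gt_eqF// Gamma_gt0.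
rewrite GG -mulrA -(abel_inversion a01 s gi) -rIZl; last first.
  exact: abel_integrable gi.
apply: rI_eq => xi /andP[x00 xs].
rewrite mxE mkpath0 mkpath_in; last by rewrite x00 (le_trans xs).
by rewrite addrAC subrr add0r (frac_intE) powRN mulrCA.
Qed.

(** By [caputo_primitive] the function under the derivative is a multiple of the primitive
    of the density, so Lebesgue differentiation applies. *)
Lemma caputo_mkpath z g M : vbm g M -> ae_on 0 T (fun tau => caputo alpha (mkpath z g) tau = g tau).
Proof.
move=> gM.
(* Lebesgue differentiation of the primitive, in each coordinate *)
have ftc (i : 'I_n) : {ae mu, forall x : R, 0 < x ->
    derivable (fun s : R => rI 0 s (coordf g i)) x 1 /\
    derive1 (fun s : R => rI 0 s (coordf g i)) x = coordf g i x}.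
  have gi := vbm_coord i gM.
  have loc : locally_integrable setT (coordf g i).
    split; [by case: gi|exact: openT|move=> K _ cK].
    have mK : measurable K by exact: compact_measurable.
    have : mu.-integrable K (EFin \o coordf g i).
      apply: measurable_bounded_integrable => //; first exact: compact_finite_measure.
        by apply: measurable_funTS; case: gi.
      exists M; split; first exact: num_real.
      by move=> N MN x _; apply: (le_trans _ (ltW MN)); case: gi.
    by case/integrableP.
  have := @FTC1 R (coordf g i) (BLeft 0) (fun y => bmeas_int 0 y gi) loc.
  apply: (@filterS _ _ (ae_filter_ringOfSetsType mu)) => x h x0'.
  apply: h; have : (BLeft (0 : R) < BRight (x : R))%O by rewrite bnd_simp ltW.
  by [].
have ftc' : {ae mu, forall x : R, forall i, 0 < x ->
    derivable (fun s : R => rI 0 s (coordf g i)) x 1 /\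
    derive1 (fun s : R => rI 0 s (coordf g i)) x = coordf g i x}.
  apply: (@filter_forall _ _ (fun i => [set x : R | 0 < x ->
    derivable (fun s : R => rI 0 s (coordf g i)) x 1 /\
    derive1 (fun s : R => rI 0 s (coordf g i)) x = coordf g i x]) _ (ae_filter_ringOfSetsType mu)).
  exact: ftc.
have tn : ae_on 0 T (fun r : R => r != 0 /\ r != T) by apply: ae_on_and; exact: ae_on_neq.
have {}ftc' : ae_on 0 T (fun r : R => forall i, 0 < r ->
    derivable (fun s : R => rI 0 s (coordf g i)) r 1 /\
    derive1 (fun s : R => rI 0 s (coordf g i)) r = coordf g i r).
  rewrite /ae_on; move: ftc'.
  by apply: (@filterS _ _ (ae_filter_ringOfSetsType mu)) => r h _.
apply: (ae_onW _ (ae_on_and tn ftc')) => tau /andP[t0 tT] [[tn0 tnT] h].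
have tp : 0 < tau by rewrite lt_neqAle eq_sym tn0.
have tlT : tau < T by rewrite lt_neqAle tnT.
apply: rv_eqP => i; rewrite /caputo !mxE; have [d1 d2] := h i tp.
rewrite derive1E (@near_eq_derive _ _ _ _ (fun s : R => Gamma (1 - alpha) * rI 0 s (coordf g i))); last first.
  near=> s; apply: caputo_primitive; first exact: gM.
  apply/andP; split; apply: ltW; near: s; [exact: lt_nbhsr|exact: lt_nbhsl].
rewrite (_ : (fun s => _) = Gamma (1 - alpha) *: (fun s : R => rI 0 s (coordf g i)))//.
rewrite deriveZ// -derive1E d2 /GRing.scale/= mulrA mulVf ?mul1r//.
rewrite gt_eqF// Gamma_gt0//; have := a01; lra.
Unshelve. all: by end_near. Qed.

End Paths.

Section PathCalculus.
Context {R : realType} {n : nat} (T alpha : R).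
Notation mu := (@lebesgue_measure R).
Hypothesis T0 : 0 < T.
Hypothesis a01 : 0 < alpha < 1.
Implicit Types (g h d : R -> 'rV[R]_n) (z : 'rV[R]_n) (x y : R -> 'rV[R]_n) (b t tau M S : R).

Let a0 : 0 < alpha. Proof. by case/andP: a01. Qed.
Local Notation mkpath := (mkpath T alpha).

Definition glued t g h (s : R) : 'rV[R]_n := if s \in (`]-oo, t[%classic : set R) then g s else h s.

Lemma glue_lt t g h s : s < t -> glued t g h s = g s.
Proof. by move=> st; rewrite /glued mem_set//= in_itv/=. Qed.

Lemma glue_ge t g h s : t <= s -> glued t g h s = h s.
Proof. by move=> st; rewrite /glued memNset//= in_itv/= ltNge st. Qed.

Lemma vbm_glue t g h M M' : vbm g M -> vbm h M' -> vbm (glued t g h) (M + M').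
Proof.
move=> gM hM; apply: vbm_if => //.
  by apply: (vbmW gM); rewrite lerDl (vbm_ge0 hM).
by apply: (vbmW hM); rewrite lerDr (vbm_ge0 gM).
Qed.

Lemma frac_int_support a b tau d M : 0 <= a -> a <= b ->
  (forall s, 0 <= s -> s < a -> d s = 0) -> (forall s, b < s -> d s = 0) -> vbm d M ->
  `|frac_int alpha tau tau d| <= frac_const alpha * M * (b - a) `^ alpha.
Proof.
move=> aa ab da db dM.
have K0 : 0 <= frac_const alpha * M by rewrite mulr_ge0 ?(ltW (frac_const_gt0 a01))// (vbm_ge0 dM).
have z0 c s : c <= a -> frac_int alpha c s d = 0.
  move=> ca; rewrite -[RHS](@frac_int_zero R n alpha c s); apply: frac_int_ae.
  apply: (ae_onW _ (ae_on_neq c 0 c)) => r /andP[r0 rc] rn; apply: da => //.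
  by apply: lt_le_trans ca; rewrite lt_neqAle rn.
have [ta|/ltW at_] := leP tau a; first by rewrite z0// normr0 mulr_ge0 ?powR_ge0.
have [tb|/ltW bt] := leP tau b.
  rewrite -[X in `|X|]subr0 -(z0 a tau)//.
  apply: (le_trans (frac_int_tail a01 aa at_ (lexx _) dM)).
  apply: ler_wpM2l => //.
  by apply: ge0_ler_powR; rewrite ?nnegrE ?subr_ge0 ?(ltW a0)//; lra.
have -> : frac_int alpha tau tau d = frac_int alpha b tau d.
  rewrite -(frac_int_cutoff a01 (le_trans aa ab) bt dM).
  apply: frac_int_ae; apply: ae_on_all => s _.
  case: (leP s b) => [sb|/db ds]; first by rewrite /cutoff mem_set//= in_itv.
  by rewrite /cutoff ds; case: (_ \in _).
rewrite -[X in `|X|]subr0 -(z0 a tau)//.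
exact: frac_int_tail dM.
Qed.

(** Densities which differ only on a short interval give uniformly close paths, also after
    that interval, because the kernel decreases. *)
Lemma mkpath_support a b z g g' M M' tau : 0 <= a -> a <= b ->
  (forall s, 0 <= s -> s < a -> g s = g' s) -> (forall s, b < s -> g s = g' s) ->
  vbm g M -> vbm g' M' ->
  `|mkpath z g tau - mkpath z g' tau| <= frac_const alpha * (M + M') * (b - a) `^ alpha.
Proof.
move=> aa ab ga gb gM gM'.
have dM := vbmB gM gM'.
rewrite !mkpathE; case: ifP => _; last first.
  rewrite subrr normr0 !mulr_ge0 ?powR_ge0 ?(ltW (frac_const_gt0 a01))//.
  by rewrite (vbm_ge0 dM).
rewrite opprD addrACA subrr add0r -(frac_intB a01 (lexx tau) gM gM').
apply: frac_int_support aa ab _ _ dM.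
- by move=> s s0 sa; rewrite ga// subrr.
- by move=> s s0; rewrite gb// subrr.
Qed.

(** This replaces the functional [afun], defined through the Caputo derivative, by a path
    with an explicit density. *)
Lemma afun_cutoff t z g M tau : vbm g M -> 0 <= t <= T -> 0 <= tau <= T ->
  afun alpha t (mkpath z g) tau = mkpath z (cutoff t g) tau.
Proof.
move=> gM /andP[t0 tT] tt; rewrite /afun.
have /andP[tau0 tauT] := tt.
case: leP => [le|/ltW lt]; first by rewrite !mkpath_in// frac_int_cutoff_lt.
rewrite mkpath0// (mkpath_in _ _ _ tt) (frac_int_cutoff a01 t0 lt gM); congr (_ + _).
by apply: frac_int_ae; apply: ae_on_sub (caputo_mkpath T0 a01 z gM).
Qed.

Lemma mkpath_cutoff_le t z g tau : tau <= t -> mkpath z (cutoff t g) tau = mkpath z g tau.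
Proof. by move=> tt; rewrite !mkpathE frac_int_cutoff_lt. Qed.

(** The constant 3 comes from subtracting the initial values before applying the maximum
    principle and adding them back afterwards. *)
Lemma cutoff_max_principle t z z' g g' M M' S tau :
  vbm g M -> vbm g' M' -> 0 <= t <= T -> 0 <= tau <= T ->
  (forall xi, 0 <= xi <= t -> `|mkpath z g xi - mkpath z' g' xi| <= S) ->
  `|mkpath z (cutoff t g) tau - mkpath z' (cutoff t g') tau| <= 3 * S.
Proof.
move=> gM gM' /andP[t0 tT] tt hS; have /andP[tau0 tauT] := tt.
have S0 : 0 <= S by apply: le_trans (hS 0 _); rewrite ?lexx ?t0.
have [le|lt] := leP tau t.
  rewrite !mkpath_cutoff_le//; apply: (le_trans (hS _ _)); first by rewrite tau0.
  by rewrite ler_peMl//; lra.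
have dM := vbmB gM gM'.
have zz : `|z - z'| <= S by have := hS 0; rewrite !mkpath0//; apply; rewrite lexx t0.
have E (w : 'rV[R]_n) h N : vbm h N -> mkpath w (cutoff t h) tau = w + frac_int alpha t tau h.
  by move=> hN; rewrite (mkpath_in _ _ _ tt) (frac_int_cutoff a01 t0 (ltW lt) hN).
rewrite (E z g M)// (E z' g' M')// opprD addrACA -(frac_intB a01 (ltW lt) gM gM').
apply: (@le_trans _ _ (S + 2 * S)); last lra.
apply: (le_trans (ler_normD _ _)); apply: lerD => //.
apply: norm_leP => [|i]; first lra.
rewrite frac_intE normrM (invGamma_norm a01).
rewrite ler_pdivrMl ?Gamma_alpha_gt0//.
apply: (RL_max_principle a01 t0 lt (vbm_coord i dM)) => xi /andP[xi0 xit].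
have xiT : 0 <= xi <= T by rewrite xi0 (le_trans xit).
rewrite -ler_pdivrMl ?Gamma_alpha_gt0// -{1}(invGamma_norm a01) -normrM -frac_intE.
apply: (le_trans (norm_coord _ _)).
rewrite (frac_intB a01 (lexx xi) gM gM').
have -> : frac_int alpha xi xi g - frac_int alpha xi xi g' =
    (mkpath z g xi - mkpath z' g' xi) - (z - z').
  by rewrite !(mkpath_in _ _ _ xiT) opprD addrACA [RHS]addrAC subrr add0r.
apply: (le_trans (ler_normB _ _)).
have := hS xi; rewrite xi0 xit => /(_ isT); lra.
Qed.

Lemma caputo_coord x tau i : caputo alpha x tau ord0 i = (Gamma (1 - alpha))^-1 *
  derive1 (fun s : R => rI 0 s (fun xi => (((s - xi) `^ alpha)^-1 *: (x xi - x 0)) ord0 i)) tau.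
Proof.
rewrite /caputo mxE mxE; congr (_ * _); congr (derive1 _ tau); apply/funext => s.
by rewrite mxE.
Qed.

Lemma caputo_local t x y tau : 0 < tau < t -> (forall s, 0 <= s <= t -> x s = y s) ->
  caputo alpha x tau = caputo alpha y tau.
Proof.
move=> /andP[t0 tt] xy; apply: rv_eqP => i.
have E : derive1 (fun s : R => rI 0 s (fun xi => (((s - xi) `^ alpha)^-1 *: (x xi - x 0)) ord0 i)) tau
  = derive1 (fun s : R => rI 0 s (fun xi => (((s - xi) `^ alpha)^-1 *: (y xi - y 0)) ord0 i)) tau.
  rewrite 2!derive1E; apply: near_eq_derive; near=> s.
  have st : s < t by near: s; exact: lt_nbhsl.
  apply: rI_eq => r /andP[r0 rs].
  have -> : x r = y r by apply: xy; rewrite r0 (le_trans rs (ltW st)).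
  by have -> : x 0 = y 0 by apply: xy; rewrite lexx (le_trans (ltW t0) (ltW tt)).
exact: (eq_trans (caputo_coord x tau i)
  (eq_trans (f_equal (fun r => _ * r) E) (esym (caputo_coord y tau i)))).
Unshelve. all: by end_near. Qed.

Lemma caputo_ae_local t x y : (forall s, 0 <= s <= t -> x s = y s) ->
  ae_on 0 t (fun tau => caputo alpha x tau = caputo alpha y tau).
Proof.
move=> xy; apply: (ae_onW _ (ae_on_and (ae_on_neq 0 0 t) (ae_on_neq t 0 t))) => s.
move=> /andP[s0 st] [sn0 snt]; apply: (@caputo_local t) => //.
by rewrite !lt_neqAle eq_sym sn0 s0 snt.
Qed.

Lemma density_unique t z z' g h M M' : vbm g M -> vbm h M' -> t <= T ->
  (forall s, 0 <= s <= t -> mkpath z g s = mkpath z' h s) -> ae_on 0 t (fun s => g s = h s).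
Proof.
move=> gM hM tT gh.
have := ae_on_and (caputo_ae_local gh) (ae_on_and
  (ae_on_sub (lexx 0) tT (caputo_mkpath T0 a01 z gM))
  (ae_on_sub (lexx 0) tT (caputo_mkpath T0 a01 z' hM))).
by apply: ae_onW => s _ [-> [<- <-]].
Qed.

(** Two paths which agree on [0, t] have the same density there, so a continuation is
    described by the new density alone. *)
Lemma Yset_glueP t z g M y : vbm g M -> 0 <= t <= T -> Yset T alpha t (mkpath z g) y ->
  exists h M', [/\ vbm h M', y = mkpath z (glued t g h) &
    ae_on 0 T (fun s => caputo alpha y s = h s)].
Proof.
move=> gM /andP[t0 tT] [yA yx]; have [h [M' [hM yE]]] := ACpathP yA.
have y0 : y 0 = z by rewrite yx ?lexx// mkpath0.
exists h, M'; split => //; last by rewrite yE; exact: caputo_mkpath hM.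
rewrite yE y0; apply: mkpath_ae.
have gh : ae_on 0 t (fun s => g s = h s).
  apply: (density_unique (z := z) (z' := z) gM hM tT) => s st.
  by rewrite -yx// {1}yE y0.
have tTT : ae_on t T (fun s => h s = glued t g h s).
  by apply: ae_on_all => s /andP[ts _]; rewrite glue_ge.
apply: (ae_on_cat _ tTT).
apply: (ae_onW _ gh) => s /andP[s0 st] e.
by rewrite /glued; case: ifP.
Qed.

Lemma mkpath_glue_Yset t z g h M M' : vbm g M -> vbm h M' -> 0 <= t <= T ->
  Yset T alpha t (mkpath z g) (mkpath z (glued t g h)).
Proof.
move=> gM hM /andP[t0 tT]; split; first by apply: mkpath_ACpath => //; exact: vbm_glue gM hM.
move=> s /andP[s0 st]; rewrite !mkpath_in ?s0 ?(le_trans st)//; congr (_ + _).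
apply: frac_int_ae.
apply: (ae_onW _ (ae_on_neq t 0 s)) => r /andP[r0 rs] rt.
by rewrite glue_lt// lt_neqAle rt (le_trans rs).
Qed.

Lemma mkpath_vmeasurable z g M : vbm g M -> vmeasurable `[0, T] (mkpath z g).
Proof.
move=> gM i.
apply: (eq_measurable_fun (fun tau => z ord0 i + (Gamma alpha)^-1 * RL alpha tau tau (coordf g i))).
  move=> tau; rewrite inE/= in_itv/= => tt.
  by rewrite mkpath_in// addvE frac_intE.
apply: measurable_funTS; apply: measurable_funD; first exact: measurable_cst.
apply: measurable_funM; first exact: measurable_cst.
by apply: RL_measurable (vbm_coord i gM); case/andP: a01 => -> /ltW ->.
Qed.

End PathCalculus.

(** * Measurability of compositions with continuous data *)
Section MeasurableComposition.
Context {R : realType} (E : pseudoMetricType R) (K : finType) (c : K -> E -> R).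
Hypothesis c_ball : forall (x y : E) r, 0 < r -> (forall k, `|c k x - c k y| < r) -> ball x r y.

(** An open set is a countable union of boxes with rational centers, and membership in a
    box is measurable coordinate by coordinate. The [c k] are coordinates which control
    the metric of [E]. *)
Lemma measurable_preimage_open (A : set R) (G : R -> E) (U : set E) :
  measurable A -> (forall k, measurable_fun A (fun t => c k (G t))) -> open U ->
  measurable (A `&` G @^-1` U).
Proof.
move=> mA mG oU.
pose box (mq : nat * {ffun K -> rat}) : set E :=
  [set y | forall k, `|ratr (mq.2 k) - c k y| < (mq.1.+1%:R)^-1].
have -> : A `&` G @^-1` U = \bigcup_mq
    [set t | [/\ A t, (box mq `<=` U) & forall k, `|ratr (mq.2 k) - c k (G t)| < (mq.1.+1%:R)^-1]].
  apply/seteqP; split; last first.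
    by move=> t [mq _ [At bU h]]; split => //; apply: bU.
  move=> t [At UGt].
  have [r r0 rU] : exists2 r : R, 0 < r & ball (G t) r `<=` U.
    have /nbhs_ballP[r r0 rU] : nbhs (G t) U by apply: open_nbhs_nbhs.
    by exists r.
  pose m := Num.truncn (2 / r).
  have m0 : 0 < (m.+1%:R : R)^-1 by rewrite invr_gt0 ltr0n.
  have mr : 2 * (m.+1%:R)^-1 < r.
    by rewrite ltr_pdivrMr ?ltr0n// mulrC -ltr_pdivrMr// Num.Theory.truncnS_gt.
  have /choice[q hq] : forall k, exists q : rat, `|ratr q - c k (G t)| < (m.+1%:R)^-1.
    move=> k; have lt : c k (G t) - (m.+1%:R)^-1 < c k (G t) + (m.+1%:R)^-1.
      by rewrite ltrBlDr -addrA ltrDl addr_gt0.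
    have [q] := rat_in_itvoo lt.
    rewrite in_itv/= => /andP[h1 h2]; exists q.
    by rewrite ltr_norml ltrBrDl h1 ltrBlDl h2.
  exists (m, [ffun k => q k]) => //; split => //=; last by move=> k; rewrite ffunE.
  move=> y hy; apply: rU; apply: c_ball => // k.
  have h1 := hq k; have := hy k; rewrite /= ffunE => h2.
  apply: lt_trans mr; move: h1 h2; set e := _^-1 => h1 h2.
  have -> : c k (G t) - c k y = (c k (G t) - ratr (q k)) + (ratr (q k) - c k y) by ring.
  apply: (le_lt_trans (ler_normD _ _)); rewrite mulr2n mulrDl mul1r.
  by apply: ltrD => //; rewrite distrC.
apply: countable_bigcupT_measurable; first exact: countableP.
move=> [m q]; have [bU|nbU] := pselect (box (m, q) `<=` U); last first.
  by rewrite (_ : [set t | _] = set0)//; apply/seteqP; split => // t [].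
rewrite (_ : [set t | _] = A `&` \bigcap_(k in [set: K]) (A `&` [set t | `|ratr (q k) - c k (G t)| < (m.+1%:R)^-1])).
  apply: measurableI => //; apply: fin_bigcap_measurable; first exact: finite_finset.
  move=> k _.
  have mf : measurable_fun A (fun t => `|ratr (q k) - c k (G t)|).
    apply: (measurableT_comp (@normr_measurable R setT)).
    by apply: measurable_funB => //; exact: measurable_cst.
  have := mf mA `]-oo, (m.+1%:R)^-1[%classic (measurable_itv _).
  congr (measurable (A `&` _)); apply/seteqP; split => t /=; by rewrite in_itv.
apply/seteqP; split => t.
  by move=> [At _ h]; split => // k _; split => //; exact: h.
by move=> [At h]; split => // k; have [] := h k I.
Qed.

Lemma measurable_comp_within (A : set R) (G : R -> E) (D : set E) (F : E -> R) :
  measurable A -> (forall k, measurable_fun A (fun t => c k (G t))) ->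
  {within D, continuous F} -> (forall t, A t -> D (G t)) -> measurable_fun A (F \o G).
Proof.
move=> mA mG cF AD.
apply: (measurability _ (RGenOInfty.measurableE R)) => _ [_ [x ->] <-].
have oF : open (F @^-1` `]x, +oo[%classic : set (subspace D)).
  by move/continuousP : cF; apply; exact: interval_open.
have /open_subspaceP[U oU DU] := oF.
rewrite (_ : A `&` _ = A `&` G @^-1` U); first exact: measurable_preimage_open.
apply/seteqP; split => t [At h]; split => //.
  have : (U `&` D) (G t) by rewrite DU; split => //; exact: AD.
  by case.
have : (F @^-1` `]x, +oo[%classic `&` D) (G t) by rewrite -DU; split => //; exact: AD.
by case.
Qed.

End MeasurableComposition.

(** * Gronwall inequalities for weakly singular kernels *)

Section Gronwall.
Context {R : realType}.
Variable alpha : R.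
Hypothesis a01 : 0 < alpha < 1.
Implicit Types (T K mu tau b M : R) (phi : R -> R).

Let a0 : 0 < alpha. Proof. by case/andP: a01. Qed.
Let ha0 : 0 < alpha / 2. Proof. by rewrite divr_gt0. Qed.

Lemma powR_le_expR (gam x : R) : 0 < gam <= 1 -> 0 < x -> x `^ gam <= expR x.
Proof.
move=> /andP[g0 g1] x0; have [x1|/ltW x1] := leP x 1.
  apply: (@le_trans _ _ 1).
    rewrite -[leRHS](_ : 1 `^ gam = 1); last by rewrite powR1.
    apply: ge0_ler_powR; rewrite ?nnegrE ?(ltW g0) ?(ltW x0)//.
  by rewrite -expR0 ler_expR ltW.
apply: (@le_trans _ _ x); first exact: ler1_powR.
by apply: (le_trans _ (expR_ge1Dx x)); rewrite lerDr.
Qed.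

(** Half of the singularity is traded for a negative power of [mu], by s^(alpha / 2) <=
    exp s. *)
Lemma damped_kernel_le mu (s : R) : 0 < mu -> 0 < s ->
  s `^ (alpha - 1) * expR (- (mu * s)) <= mu `^ (- (alpha / 2)) * s `^ (alpha / 2 - 1).
Proof.
move=> m0 s0; have ms : 0 < mu * s by rewrite mulr_gt0.
have g : 0 < alpha / 2 <= 1 by rewrite ha0/=; have /andP[_ a1] := a01; lra.
have h := powR_le_expR g ms.
have -> : s `^ (alpha - 1) = s `^ (alpha / 2 - 1) * s `^ (alpha / 2).
  rewrite -powRD; last by rewrite (gt_eqF s0) implybT.
  by congr (_ `^ _); field.
rewrite [leRHS]mulrC -mulrA; apply: ler_wpM2l; first exact: powR_ge0.
rewrite expRN powRN ler_pdivrMr ?expR_gt0// [leRHS]mulrC ler_pdivlMr ?powR_gt0//.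
by rewrite [leLHS]mulrC -powRM ?(ltW m0) ?(ltW s0).
Qed.

(** The smallness required of [mu] in all that follows: the damped kernel has integral at
    most 1 / (2 K). *)
Lemma exists_damping T K : 0 < T -> 0 <= K ->
  exists2 mu, 0 < mu & K * (mu `^ (- (alpha / 2)) * (T `^ (alpha / 2) / (alpha / 2))) <= 2^-1.
Proof.
move=> T0 K0; set c := T `^ (alpha / 2) / (alpha / 2).
have c0 : 0 <= c by rewrite divr_ge0 ?powR_ge0 ?(ltW ha0).
pose q := 2 * K * c + 1.
have kc : 0 <= 2 * K * c by exact: mulr_ge0 (mulr_ge0 (ler0n R 2) K0) c0.
have q0 : 0 < q by rewrite /q; lra.
exists (q `^ ((alpha / 2)^-1)); first by rewrite powR_gt0.
rewrite powRN -powRrM mulVf ?gt_eqF// powRr1 ?(ltW q0)//.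
rewrite mulrCA ler_pdivrMl// /q; nra.
Qed.

Lemma damped_left T K mu : 0 < mu -> 0 <= K ->
  K * (mu `^ (- (alpha / 2)) * (T `^ (alpha / 2) / (alpha / 2))) <= 2^-1 ->
  forall a tau, 0 <= a -> a <= tau -> tau <= T ->
  iI a tau (fun xi => (tau - xi) `^ (alpha - 1) * expR (- (mu * (tau - xi)))) /\
  K * rI a tau (fun xi => (tau - xi) `^ (alpha - 1) * expR (- (mu * (tau - xi)))) <= 2^-1.
Proof.
move=> m0 K0 hK a tau aa at_ tT.
have mE : measurable_fun setT (fun xi : R => expR (- (mu * (tau - xi)))).
  apply: continuous_measurable_fun => x; apply: continuous_comp; last exact: continuous_expR.
  apply: continuousN; apply: continuousM; first exact: cvg_cst.
  by apply: continuousB; [exact: cvg_cst|exact: cvg_id].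
have kI := iIZl (mu `^ (- (alpha / 2))) (kern_l_int ha0 a (lexx tau)).
have le1 x : a < x < tau -> (tau - x) `^ (alpha - 1) * expR (- (mu * (tau - x))) <=
   mu `^ (- (alpha / 2)) * (tau - x) `^ (alpha / 2 - 1).
  by move=> /andP[_ xt]; apply: damped_kernel_le => //; rewrite subr_gt0.
have iI1 : iI a tau (fun xi => (tau - xi) `^ (alpha - 1) * expR (- (mu * (tau - xi)))).
  apply: dominated_iI kI le1.
    by apply: measurable_funM => //; exact: measurable_kern_l.
  by move=> x; exact: mulr_ge0 (powR_ge0 _ _) (expR_ge0 _).
split => //; apply: le_trans hK; apply: (ler_wpM2l K0).
apply: (le_trans (rI_le_oo iI1 kI le1)).
rewrite rIZl; last exact: kern_l_int.
apply: ler_wpM2l; first exact: powR_ge0.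
rewrite rI_kern_l// subrr powR0 ?gt_eqF// subr0.
rewrite ler_wpM2r ?invr_ge0 ?(ltW ha0)//.
by apply: ge0_ler_powR; rewrite ?nnegrE ?(ltW ha0)//; lra.
Qed.

Lemma damped_right T K mu : 0 < mu -> 0 <= K ->
  K * (mu `^ (- (alpha / 2)) * (T `^ (alpha / 2) / (alpha / 2))) <= 2^-1 ->
  forall a tau, 0 <= a -> a <= tau -> tau <= T ->
  iI a tau (fun xi => (xi - a) `^ (alpha - 1) * expR (- (mu * (xi - a)))) /\
  K * rI a tau (fun xi => (xi - a) `^ (alpha - 1) * expR (- (mu * (xi - a)))) <= 2^-1.
Proof.
move=> m0 K0 hK a tau aa at_ tT.
have mE : measurable_fun setT (fun xi : R => expR (- (mu * (xi - a)))).
  apply: continuous_measurable_fun => x; apply: continuous_comp; last exact: continuous_expR.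
  apply: continuousN; apply: continuousM; first exact: cvg_cst.
  by apply: continuousB; [exact: cvg_id|exact: cvg_cst].
have kI := iIZl (mu `^ (- (alpha / 2))) (kern_r_int ha0 tau (lexx a)).
have le1 x : a < x < tau -> (x - a) `^ (alpha - 1) * expR (- (mu * (x - a))) <=
   mu `^ (- (alpha / 2)) * (x - a) `^ (alpha / 2 - 1).
  by move=> /andP[xt _]; apply: damped_kernel_le => //; rewrite subr_gt0.
have iI1 : iI a tau (fun xi => (xi - a) `^ (alpha - 1) * expR (- (mu * (xi - a)))).
  apply: dominated_iI kI le1.
    by apply: measurable_funM => //; exact: measurable_kern_r.
  by move=> x; exact: mulr_ge0 (powR_ge0 _ _) (expR_ge0 _).
split => //; apply: le_trans hK; apply: (ler_wpM2l K0).
apply: (le_trans (rI_le_oo iI1 kI le1)).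
rewrite rIZl; last exact: kern_r_int.
apply: ler_wpM2l; first exact: powR_ge0.
rewrite rI_kern_r// subrr powR0 ?gt_eqF// subr0.
rewrite ler_wpM2r ?invr_ge0 ?(ltW ha0)//.
by apply: ge0_ler_powR; rewrite ?nnegrE ?(ltW ha0)//; lra.
Qed.

(** In the sup norm with weight exp (- mu s) the kernel becomes damped, and [K] times the
    fractional integral is a contraction with factor 1/2. *)
Lemma RL_bielecki T K mu : 0 < mu -> 0 <= K ->
  K * (mu `^ (- (alpha / 2)) * (T `^ (alpha / 2) / (alpha / 2))) <= 2^-1 ->
  forall phi M m tau, bmeas phi M -> 0 <= tau <= T -> 0 <= m ->
  (forall s, 0 <= s <= tau -> `|phi s| <= m * expR (mu * s)) ->
  K * `|RL alpha tau tau phi| <= m / 2 * expR (mu * tau).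
Proof.
move=> m0 K0 hK phi M m tau pM /andP[t0 tT] mm pm.
have [i1 h1] := damped_left m0 K0 hK (lexx 0) t0 tT.
have iR := @RL_int R alpha 0 tau tau phi M a0 (lexx tau) pM.
apply: (@le_trans _ _ (K * (m * expR (mu * tau) *
   rI 0 tau (fun xi => (tau - xi) `^ (alpha - 1) * expR (- (mu * (tau - xi))))))); last first.
  rewrite mulrCA; have -> : m / 2 * expR (mu * tau) = m * expR (mu * tau) * 2^-1 by ring.
  by apply: ler_wpM2l => //; exact: mulr_ge0 mm (expR_ge0 _).
apply: (ler_wpM2l K0); apply: (le_trans (rI_normr iR)).
rewrite -rIZl//; apply: rI_le; [exact: iI_normr|exact: iIZl|move=> s st].
rewrite normrM (ger0_norm (powR_ge0 _ _)) mulrCA; apply: ler_wpM2l; first exact: powR_ge0.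
rewrite -mulrA -expRD; have -> : mu * tau + - (mu * (tau - s)) = mu * s by ring.
exact: pm.
Qed.

(** Taking the supremum of phi with weight exp (- mu s), the integral term is absorbed on
    the left. *)
Lemma fractional_gronwall T K : 0 < T -> 0 <= K -> exists2 C, 0 < C &
  forall t1 phi M b, t1 <= T -> bmeas phi M -> (forall s, 0 <= phi s) -> 0 <= b ->
  (forall tau, 0 <= tau <= t1 -> phi tau <= b + K * RL alpha tau tau phi) ->
  forall tau, 0 <= tau <= t1 -> phi tau <= C * b.
Proof.
move=> T0 K0; have [mu m0 hK] := exists_damping T0 K0.
exists (2 * expR (mu * T)); first by rewrite mulr_gt0 ?expR_gt0.
move=> t1 phi M b t1T pM p0 b0 hphi.
pose W := [set phi s * expR (- (mu * s)) | s in [set s | 0 <= s <= t1]].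
have Wb s : 0 <= s <= t1 -> phi s * expR (- (mu * s)) <= M.
  move=> /andP[s0 _]; have [_ /(_ s)] := pM; rewrite ger0_norm// => pm.
  apply: le_trans pm; apply: ler_piMr => //.
  by rewrite -expR0 ler_expR oppr_le0 mulr_ge0 ?(ltW m0).
move=> tau tt; have /andP[tau0 tau1] := tt.
have Wub : has_ubound W by exists M => _ [s hs <-]; exact: Wb.
have W0 : W !=set0 by exists (phi tau * expR (- (mu * tau))), tau.
have supP s : 0 <= s <= t1 -> phi s * expR (- (mu * s)) <= sup W.
  by move=> hs; apply: ub_le_sup => //; exists s.
have supP' s : 0 <= s <= t1 -> phi s <= sup W * expR (mu * s).
  move=> hs; have := supP _ hs; rewrite expRN ler_pdivrMr ?expR_gt0//.
have s0 : 0 <= sup W.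
  by apply: le_trans (supP tau tt); rewrite mulr_ge0 ?expR_ge0.
have key s : 0 <= s <= t1 -> phi s * expR (- (mu * s)) <= b + sup W / 2.
  move=> hs; have /andP[sp st] := hs.
  have sT : 0 <= s <= T by rewrite sp (le_trans st).
  have h := RL_bielecki m0 K0 hK pM sT s0.
  have {}h : K * `|RL alpha s s phi| <= sup W / 2 * expR (mu * s).
    apply: h => r /andP[r0 rs]; rewrite ger0_norm//; apply: supP'.
    by rewrite r0 (le_trans rs).
  rewrite expRN ler_pdivrMr ?expR_gt0//; apply: (le_trans (hphi _ hs)).
  rewrite mulrDl; apply: lerD.
    by rewrite ler_peMr// -expR0 ler_expR mulr_ge0 ?(ltW m0).
  by apply: le_trans h; apply: ler_wpM2l => //; exact: ler_norm.
have sb : sup W <= b + sup W / 2.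
  by apply: ge_sup => // _ [s hs <-]; exact: key.
apply: (le_trans (supP' _ tt)).
have -> : 2 * expR (mu * T) * b = (2 * b) * expR (mu * T) by ring.
apply: ler_pM; rewrite ?expR_ge0//; first lra.
by rewrite ler_expR ler_wpM2l ?(ltW m0)// (le_trans tau1).
Qed.

End Gronwall.

Section NonmeasurableMonotone.
Context d (T : measurableType d) (R : realType).
Variable mu : {measure set T -> \bar R}.
Local Open Scope ereal_scope.

(** The integral of a nonnegative function is a supremum over simple functions below it,
    so monotonicity needs no measurability. *)
Lemma ge0_integral_mono (D : set T) (f g : T -> \bar R) :
  (forall x, D x -> 0 <= f x) -> (forall x, D x -> f x <= g x) ->
  \int[mu]_(x in D) f x <= \int[mu]_(x in D) g x.
Proof.
move=> f0 fg; rewrite integral_mkcond [leRHS]integral_mkcond.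
have f0' x : 0 <= (f \_ D) x by apply: erestrict_ge0 => y; exact: f0.
have g0' x : 0 <= (g \_ D) x.
  by apply: erestrict_ge0 => y Dy; exact: le_trans (f0 _ Dy) (fg _ Dy).
rewrite !ge0_integralTE//; apply: ge_ereal_sup => _ [h hf <-].
apply: ereal_sup_ubound; exists h => // x; apply: (le_trans (hf x)).
by rewrite /patch; case: ifPn => //; rewrite inE; exact: fg.
Qed.

End NonmeasurableMonotone.

Section WeightedGronwall.
Context {R : realType}.
Notation leb := (@lebesgue_measure R).
Variable alpha : R.
Hypothesis a01 : 0 < alpha < 1.
Implicit Types (T K mu tau b M : R) (phi : R -> R).

Let a0 : 0 < alpha. Proof. by case/andP: a01. Qed.
Let a1 : 0 < alpha <= 1. Proof. by case/andP: a01 => -> /ltW ->. Qed.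

(** For [mu] large this weight is contracted by the adjoint of the fractional integral,
    while it stays comparable to (T - tau)^(alpha - 1), the weight which occurs in
    condition (L). *)
Definition wght T mu (tau : R) : R := (T - tau) `^ (alpha - 1) * expR (mu * (T - tau)).

Lemma wght_ge0 T mu tau : 0 <= wght T mu tau.
Proof. exact: mulr_ge0 (powR_ge0 _ _) (expR_ge0 _). Qed.

Lemma measurable_expRMB T mu : measurable_fun setT (fun tau : R => expR (mu * (T - tau))).
Proof.
apply: continuous_measurable_fun => x; apply: continuous_comp; last exact: continuous_expR.
apply: continuousM; first exact: cvg_cst.
by apply: continuousB; [exact: cvg_cst|exact: cvg_id].
Qed.

Lemma measurable_wght T mu : measurable_fun setT (wght T mu).
Proof. by apply: measurable_funM; [exact: measurable_kern_l|exact: measurable_expRMB]. Qed.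

Lemma wght_lower T mu tau : 0 < mu -> tau <= T -> (T - tau) `^ (alpha - 1) <= wght T mu tau.
Proof.
move=> m0 tT; rewrite /wght ler_peMr ?powR_ge0// -expR0 ler_expR.
by rewrite mulr_ge0 ?(ltW m0)// subr_ge0.
Qed.

Lemma wght_upper T mu tau : 0 < mu -> 0 <= tau ->
  wght T mu tau <= expR (mu * T) * (T - tau) `^ (alpha - 1).
Proof.
move=> m0 tT; rewrite /wght mulrC ler_wpM2r ?powR_ge0// ler_expR ler_wpM2l ?(ltW m0)//.
lra.
Qed.

(** One of the two singular factors is at distance at least (T - eta) / 2 from its pole,
    and there it is comparable to (T - eta)^(alpha - 1). *)
Lemma wght_kernel_le T mu eta xi : 0 < mu -> eta < xi -> xi < T ->
  wght T mu xi * (xi - eta) `^ (alpha - 1) <=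
  2 * wght T mu eta * ((T - xi) `^ (alpha - 1) * expR (- (mu * (T - xi))) +
     (xi - eta) `^ (alpha - 1) * expR (- (mu * (xi - eta)))).
Proof.
move=> m0 ex xT.
have r0 : 0 < T - xi by lra.
have q0 : 0 < xi - eta by lra.
have s0 : 0 < T - eta by lra.
have b1 : alpha <= 1 by case/andP: a1.
have half : ((T - eta) / 2) `^ (alpha - 1) <= 2 * (T - eta) `^ (alpha - 1).
  rewrite powRM ?(ltW s0)//.
  rewrite mulrC ler_wpM2r ?powR_ge0//.
  have -> : alpha - 1 = - (1 - alpha) by ring.
  rewrite powRN -[X in X `^ _]powR_inv1// -powRrM mulN1r powRN invrK.
  by apply: ler1_powR; have := a0; lra.
rewrite /wght.
have E1 : expR (mu * (T - xi)) = expR (mu * (T - eta)) * expR (- (mu * (xi - eta))).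
  by rewrite -expRD; congr expR; ring.
have ee := expR_gt0 (mu * (T - eta)).
set A := (T - xi) `^ (alpha - 1); set B := (xi - eta) `^ (alpha - 1).
set C := (T - eta) `^ (alpha - 1) in half *.
set D := expR (- (mu * (xi - eta))); set F := expR (- (mu * (T - xi))).
rewrite E1 -/D; set E := expR (mu * (T - eta)).
have A0 : 0 <= A := powR_ge0 _ _.
have B0 : 0 <= B := powR_ge0 _ _.
have C0 : 0 <= C := powR_ge0 _ _.
have D0 : 0 <= D := expR_ge0 _.
have F0 : 0 <= F := expR_ge0 _.
have E0 : 0 <= E := expR_ge0 _.
have [le|lt] := leP (T - xi) (xi - eta).
  (* closer to T: the singularity at eta is harmless, and conversely below *)
  have h1 : B <= 2 * C by apply: le_trans half; apply: powR_anti => //; lra.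
  have h2 : D <= F by rewrite ler_expR lerN2 ler_wpM2l ?(ltW m0).
  apply: (@le_trans _ _ (2 * (C * E) * (A * F))); last first.
    by apply: ler_wpM2l; [exact: mulr_ge0 (ler0n R 2) (mulr_ge0 C0 E0)|rewrite lerDl; exact: mulr_ge0].
  have := ler_wpM2l (mulr_ge0 A0 E0) (ler_pM B0 D0 h1 h2).
  by congr (_ <= _); ring.
have h1 : A <= 2 * C by apply: le_trans half; apply: powR_anti => //; lra.
apply: (@le_trans _ _ (2 * (C * E) * (B * D))); last first.
  by apply: ler_wpM2l; [exact: mulr_ge0 (ler0n R 2) (mulr_ge0 C0 E0)|rewrite lerDr; exact: mulr_ge0].
have := ler_wpM2l (mulr_ge0 (mulr_ge0 E0 D0) B0) h1.
by congr (_ <= _); ring.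
Qed.

Lemma wght_int T mu (a b : R) : 0 < mu -> 0 <= a -> b <= T -> iI a b (wght T mu).
Proof.
move=> m0 aa bT; have kI := iIZl (expR (mu * T)) (@kern_l_int R alpha T a0 a b bT).
apply: (dominated_iI (measurable_wght T mu) (wght_ge0 T mu) kI) => x /andP[ax xb].
by apply: wght_upper => //; apply: le_trans aa (ltW ax).
Qed.

(** Each of the two terms of [wght_kernel_le] has a damped kernel. *)
Lemma wght_adjoint T K mu : 0 < T -> 0 < mu -> 0 < K ->
  K * (mu `^ (- (alpha / 2)) * (T `^ (alpha / 2) / (alpha / 2))) <= 2^-1 ->
  forall eta, 0 < eta < T ->
  (\int[leb]_(xi in `]eta, T[) (wght T mu xi * (xi - eta) `^ (alpha - 1))%:E <=
   (2 / K * wght T mu eta)%:E)%E.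
Proof.
move=> T0 m0 K0 hK eta /andP[e0 eT].
have [i1 h1] := damped_left a01 m0 (ltW K0) hK (ltW e0) (ltW eT) (lexx T).
have [i2 h2] := damped_right a01 m0 (ltW K0) hK (ltW e0) (ltW eT) (lexx T).
have i3 := iIZl (2 * wght T mu eta) (iID i1 i2).
apply: (@le_trans _ _ (rI eta T (fun xi => 2 * wght T mu eta * ((T - xi) `^ (alpha - 1) * expR (- (mu * (T - xi))) +
     (xi - eta) `^ (alpha - 1) * expR (- (mu * (xi - eta))))))%:E); last first.
  rewrite lee_fin rIZl; last exact: iID.
  rewrite rID//.
  have -> : 2 / K * wght T mu eta = 2 * wght T mu eta * K^-1 by ring.
  apply: ler_wpM2l; first by rewrite mulr_ge0 ?wght_ge0.
  rewrite -[K^-1]mulr1 ler_pdivlMl// mulrDr; lra.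
rewrite rI_EFin//; apply: ge0_integral_mono => x; rewrite /= in_itv/= => /andP[ex xT].
  by rewrite lee_fin; exact: mulr_ge0 (wght_ge0 _ _ _) (powR_ge0 _ _).
by rewrite lee_fin; apply: wght_kernel_le.
Qed.

(** The inequality is integrated against [wght] and the integrals are exchanged: the
    adjoint moves onto the weight, which it contracts, and the resulting term is absorbed. *)
Lemma weighted_gronwall T K : 0 < T -> 0 <= K -> exists2 C, 0 < C &
  forall phi d M N, bmeas phi M -> bmeas d N -> (forall s, 0 <= phi s) -> (forall s, 0 <= d s) ->
  (forall tau, 0 <= tau <= T -> phi tau <= d tau + K * RL alpha tau tau phi) ->
  rI 0 T (fun s => (T - s) `^ (alpha - 1) * phi s) <=
  C * rI 0 T (fun s => (T - s) `^ (alpha - 1) * d s).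
Proof.
(* with this constant the absorbed term has factor K * (2 / K') <= 1/2; adding 1 makes it
   positive *)
move=> T0 K0; pose K' := 4 * K + 1.
have K'0 : 0 < K' by rewrite /K'; lra.
have [mu m0 hK] := exists_damping a01 T0 (ltW K'0).
exists (2 * expR (mu * T)); first by rewrite mulr_gt0 ?expR_gt0.
move=> phi d M N pM dN p0 d0 hp.
have wI := @wght_int T mu 0 T m0 (lexx _) (lexx _).
have wp := bmeas_mul wI pM.
have wd := bmeas_mul wI dN.
have mw := measurable_wght T mu.
have mk : measurable_fun setT (fun x : R => x `^ (alpha - 1)) by exact: measurable_powR.
have mp : measurable_fun setT phi by case: pM.
have RLm := RL_measurable a1 pM.
have RL0 x : 0 <= RL alpha x x phi by apply: rI_ge0 => y _; rewrite mulr_ge0 ?powR_ge0.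
(* the double integral is finite, being bounded by the adjoint estimate *)
have key : (\int[leb]_(xi in `]0%R, T[) (wght T mu xi * RL alpha xi xi phi)%:E <=
   (2 / K' * rI 0 T (fun s => wght T mu s * phi s))%:E)%E.
  have Ht := tonelli_triangle T mw mk mp (wght_ge0 T mu) (fun x => powR_ge0 _ _) p0.
  apply: (@le_trans _ _ (\int[leb]_(xi in `]0%R, T[) ((wght T mu xi)%:E *
      \int[leb]_(eta in `]0%R, xi[) ((xi - eta) `^ (alpha - 1) * phi eta)%:E))%E).
    apply: ge0_integral_mono => x; rewrite /= in_itv/= => /andP[x0 xT].
      by rewrite lee_fin; exact: mulr_ge0 (wght_ge0 _ _ _) (RL0 x).
    rewrite EFinM lee_wpmul2l ?lee_fin ?wght_ge0// /RL rI_EFin//.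
    exact: (@RL_int R alpha 0 x x phi M a0 (lexx _) pM).
  rewrite Ht -rIZl// rI_EFin; last exact: iIZl.
  apply: ge0_integral_mono => x; rewrite /= in_itv/= => xx.
    apply: mule_ge0; first by rewrite lee_fin.
    apply: integral_ge0 => y _; rewrite lee_fin.
    exact: mulr_ge0 (wght_ge0 _ _ _) (powR_ge0 _ _).
  have -> : 2 / K' * (wght T mu x * phi x) = phi x * (2 / K' * wght T mu x) by ring.
  rewrite EFinM; apply: lee_wpmul2l; first by rewrite lee_fin.
  exact: wght_adjoint T0 m0 K'0 hK x xx.
have iwr : iI 0 T (fun xi => wght T mu xi * RL alpha xi xi phi).
  have RLb := RL_continuous a1 pM.
  pose rl xi := RL alpha xi xi phi * \1_(`[0, T]%classic : set R) xi.
  have rS : bmeas rl (M * (T `^ alpha / alpha)).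
    split; first by apply: measurable_funM => //; exact: measurable_indic.
    move=> x; rewrite /rl indicE; case: (boolP (_ \in _)); last first.
      by move=> _; rewrite mulr0 normr0 !mulr_ge0 ?powR_ge0 ?invr_ge0 ?(ltW a0)// (bmeas_ge0 pM).
    rewrite inE/= in_itv/= mulr1 => /andP[x0 xT].
    apply: (le_trans (RL_bound a1 x0 (lexx _) pM)).
    apply: ler_wpM2l; first exact: bmeas_ge0 pM.
    rewrite ler_wpM2r ?invr_ge0 ?(ltW a0)//.
    by apply: ge0_ler_powR; rewrite ?nnegrE ?(ltW a0) ?(ltW T0)//.
  apply: iI_eq (bmeas_mul wI rS) => x xT.
  by rewrite /rl indicE mem_set ?mulr1// /= in_itv.
have {}key : rI 0 T (fun xi => wght T mu xi * RL alpha xi xi phi) <=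
    2 / K' * rI 0 T (fun s => wght T mu s * phi s).
  by rewrite -lee_fin rI_EFin.
have main : rI 0 T (fun s => wght T mu s * phi s) <=
    rI 0 T (fun s => wght T mu s * d s) + K * (2 / K' * rI 0 T (fun s => wght T mu s * phi s)).
  apply: (@le_trans _ _ (rI 0 T (fun s => wght T mu s * d s) +
      K * rI 0 T (fun xi => wght T mu xi * RL alpha xi xi phi))); last first.
    by rewrite lerD2l; exact: ler_wpM2l.
  rewrite -rIZl// -rID//; last exact: iIZl.
  apply: rI_le => //; first by apply: iID => //; exact: iIZl.
  move=> x xT; rewrite mulrCA -mulrDr; apply: ler_wpM2l; first exact: wght_ge0.
  exact: hp.
set I := rI 0 T (fun s => wght T mu s * phi s) in main *.
set J := rI 0 T (fun s => wght T mu s * d s) in main *.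
have I0 : 0 <= I by apply: rI_ge0 => x _; rewrite mulr_ge0 ?wght_ge0.
have KK : K * (2 / K') <= 2^-1.
  by rewrite mulrA ler_pdivrMr// /K'; lra.
have IJ : I <= 2 * J.
  have : K * (2 / K') * I <= 2^-1 * I by exact: ler_wpM2r.
  rewrite mulrA in main; lra.
apply: (@le_trans _ _ I).
  apply: rI_le => //; first exact: (bmeas_mul (@kern_l_int R alpha T a0 0 T (lexx _)) pM).
  move=> x /andP[x0 xT]; apply: ler_wpM2r => //; exact: wght_lower.
apply: (le_trans IJ); rewrite -mulrA; apply: ler_wpM2l => //.
rewrite -rIZl; last exact: (bmeas_mul (@kern_l_int R alpha T a0 0 T (lexx _)) dN).
apply: rI_le => //.
  by apply: iIZl; exact: (bmeas_mul (@kern_l_int R alpha T a0 0 T (lexx _)) dN).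
move=> x /andP[x0 xT]; rewrite mulrA; apply: ler_wpM2r => //; exact: wght_upper.
Qed.

End WeightedGronwall.

(** * The data of the game *)

Section Clamp.
Context {R : realType} {n : nat}.
Implicit Types (a b : 'rV[R]_n) (rho x y : R).

(** Truncating the state makes the dynamics globally Lipschitz and bounded; the truncation
    is inactive on solutions, thanks to their a priori bound. *)
Definition clampr rho x : R := Num.max (- rho) (Num.min x rho).
Definition clampv rho a : 'rV[R]_n := \row_i clampr rho (a ord0 i).

Lemma clampr_norm rho x : 0 <= rho -> `|clampr rho x| <= rho.
Proof.
by move=> r0; rewrite /clampr ler_norml le_max lexx/= ge_max ge_min lexx orbT andbT; lra.
Qed.

Lemma clampr_id rho x : `|x| <= rho -> clampr rho x = x.
Proof. by rewrite ler_norml /clampr => /andP[h1 h2]; rewrite min_l// max_r. Qed.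

Lemma clampr_lip rho x y : 0 <= rho -> `|clampr rho x - clampr rho y| <= `|x - y|.
Proof.
move=> r0; have h1 := ler_norm (x - y); have h2 := ler_norm (y - x); rewrite distrC in h2.
have h3 := normr_ge0 (x - y).
rewrite ler_norml /clampr; case: (leP x rho) => ?; case: (leP y rho) => ?;
  case: (leP (- rho) x) => ?; case: (leP (- rho) y) => ?; 
  try (apply/andP; split; lra).
all: rewrite (@max_r _ _ (- rho) rho); last lra.
all: apply/andP; split; lra.
Qed.

Lemma clampr_le rho x : 0 <= rho -> `|clampr rho x| <= `|x|.
Proof.
move=> r0; have := clampr_lip x 0 r0; rewrite (clampr_id (x := 0)) ?normr0//.
by rewrite !subr0.
Qed.

Lemma clampv_norm rho a : 0 <= rho -> `|clampv rho a| <= rho.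
Proof. by move=> r0; apply: norm_leP => // i; rewrite mxE; exact: clampr_norm. Qed.

Lemma clampv_id rho a : `|a| <= rho -> clampv rho a = a.
Proof.
move=> ar; apply: rv_eqP => i; rewrite mxE; apply: clampr_id.
exact: le_trans (norm_coord _ _) ar.
Qed.

Lemma clampv_lip rho a b : 0 <= rho -> `|clampv rho a - clampv rho b| <= `|a - b|.
Proof.
move=> r0; apply: norm_leP => // i; rewrite subvE !mxE.
by apply: (le_trans (clampr_lip _ _ r0)); rewrite -subvE; exact: norm_coord.
Qed.

Lemma clampv_le rho a : 0 <= rho -> `|clampv rho a| <= `|a|.
Proof.
move=> r0; apply: norm_leP => // i; rewrite mxE.
by apply: (le_trans (clampr_le _ r0)); exact: norm_coord.
Qed.

End Clamp.

Section Domination.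
Context {R : realType} {n : nat} (alpha : R).
Hypothesis a01 : 0 < alpha < 1.
Let a0 : 0 < alpha. Proof. by case/andP: a01. Qed.

Lemma frac_int_dom (d : R -> 'rV[R]_n) (del : R -> R) M N (b tau : R) : vbm d M -> bmeas del N ->
  0 <= b -> b <= tau -> (forall s, 0 <= s <= b -> `|d s| <= del s) ->
  `|frac_int alpha b tau d| <= (Gamma alpha)^-1 * RL alpha b tau del.
Proof.
move=> dM dN b0 bt dd.
have h i : `|frac_int alpha b tau d ord0 i| <= (Gamma alpha)^-1 * RL alpha b tau del.
  rewrite frac_intE normrM (invGamma_norm a01); apply: (ler_wpM2l (invGamma_ge0 a01)).
  have i1 := @RL_int R alpha 0 b tau _ M a0 bt (vbm_coord i dM).
  have i2 := @RL_int R alpha 0 b tau _ N a0 bt dN.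
  apply: (le_trans (rI_normr i1)); apply: rI_le => //; first exact: iI_normr.
  move=> s hs; rewrite normrM (ger0_norm (powR_ge0 _ _)); apply: ler_wpM2l; first exact: powR_ge0.
  by apply: le_trans (dd _ hs); exact: norm_coord.
apply: norm_leP => //; apply: mulr_ge0; first exact: invGamma_ge0.
apply: rI_ge0 => s hs; apply: mulr_ge0; first exact: powR_ge0.
by apply: le_trans (dd _ hs).
Qed.

End Domination.

(** The standing assumptions on the data of the game, apart from the saddle point
    condition and the regularity of the terminal cost. *)
Record admissible_game {R : realType} {n nP nQ : nat} (T alpha : R)
  (P : set 'rV[R]_nP) (Q : set 'rV[R]_nQ)
  (f : R -> 'rV[R]_n -> 'rV[R]_nP -> 'rV[R]_nQ -> 'rV[R]_n)
  (chi : R -> 'rV[R]_n -> 'rV[R]_nP -> 'rV[R]_nQ -> R) (c : R) : Prop := AdmissibleGame {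
  ag_n : (0 < n)%N;
  ag_T : 0 < T;
  ag_alpha : 0 < alpha < 1;
  ag_P : compact P;
  ag_Q : compact Q;
  ag_P0 : P !=set0;
  ag_Q0 : Q !=set0;
  ag_f : {within data_domain T P Q, continuous
     (fun z : R * 'rV[R]_n * 'rV[R]_nP * 'rV[R]_nQ => f z.1.1.1 z.1.1.2 z.1.2 z.2)};
  ag_chi : {within data_domain T P Q, continuous
     (fun z : R * 'rV[R]_n * 'rV[R]_nP * 'rV[R]_nQ => chi z.1.1.1 z.1.1.2 z.1.2 z.2)};
  ag_lip : forall r : R, 0 < r -> exists2 lambda : R, 0 < lambda &
     forall (t : R) (x y : 'rV[R]_n) u v, 0 <= t <= T -> enorm x <= r -> enorm y <= r -> P u -> Q v ->
       enorm (f t x u v - f t y u v) + `|chi t x u v - chi t y u v|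
         <= lambda * enorm (x - y);
  ag_c : 0 < c;
  ag_growth : forall (t : R) (x : 'rV[R]_n) u v, 0 <= t <= T -> P u -> Q v ->
     enorm (f t x u v) <= c * (1 + enorm x) }.

Section GameData.
Context {R : realType} {n nP nQ : nat} (T alpha : R)
  (P : set 'rV[R]_nP) (Q : set 'rV[R]_nQ)
  (f : R -> 'rV[R]_n -> 'rV[R]_nP -> 'rV[R]_nQ -> 'rV[R]_n)
  (chi : R -> 'rV[R]_n -> 'rV[R]_nP -> 'rV[R]_nQ -> R) (c : R).
Hypothesis G : admissible_game T alpha P Q f chi c.
Notation mu := (@lebesgue_measure R).
Implicit Types (y w : R -> 'rV[R]_n) (u : R -> 'rV[R]_nP) (v : R -> 'rV[R]_nQ) (t s : R).

Let n0 : 1 <= n%:R :> R. Proof. by rewrite ler1n; exact: ag_n G. Qed.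
Let T0 : 0 < T := ag_T G.

Lemma data_lip (r : R) : 0 < r -> exists2 L : R, 0 < L &
  forall t (x y : 'rV[R]_n) (p : 'rV[R]_nP) (q : 'rV[R]_nQ), 0 <= t <= T -> `|x| <= r -> `|y| <= r -> P p -> Q q ->
   `|f t x p q - f t y p q| <= L * `|x - y| /\ `|chi t x p q - chi t y p q| <= L * `|x - y|.
Proof.
move=> r0; have nr0 : 0 < n%:R * r by rewrite mulr_gt0// (lt_le_trans ltr01).
have [L L0 hL] := ag_lip G nr0.
exists (L * n%:R); first by rewrite mulr_gt0// (lt_le_trans ltr01).
move=> t x y u v tT xr yr Pu Qv.
have er (w : 'rV[R]_n) : `|w| <= r -> enorm w <= n%:R * r.
  by move=> wr; apply: (le_trans (enorm_le_norm _)); rewrite ler_wpM2l.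
have := hL t x y u v tT (er _ xr) (er _ yr) Pu Qv.
have h1 : L * enorm (x - y) <= L * n%:R * `|x - y|.
  by rewrite -mulrA ler_wpM2l ?(ltW L0)//; exact: enorm_le_norm.
have h2 := norm_le_enorm (f t x u v - f t y u v).
have h3 := normr_ge0 (chi t x u v - chi t y u v).
have h4 := enorm_ge0 (f t x u v - f t y u v).
by move=> h5; split; lra.
Qed.

Lemma data_growth : exists2 C : R, 0 < C &
  forall t (x : 'rV[R]_n) (p : 'rV[R]_nP) (q : 'rV[R]_nQ), 0 <= t <= T -> P p -> Q q -> `|f t x p q| <= C * (1 + `|x|).
Proof.
exists (c * n%:R); first by rewrite mulr_gt0 ?(ag_c G)// (lt_le_trans ltr01).
move=> t x u v tT Pu Qv; apply: (le_trans (norm_le_enorm _)).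
apply: (le_trans (ag_growth G x tT Pu Qv)); rewrite -mulrA ler_wpM2l ?(ltW (ag_c G))//.
rewrite mulrDr mulr1 lerD//; exact: enorm_le_norm.
Qed.

Let coords (k : unit + 'I_n + 'I_nP + 'I_nQ) (z : R * 'rV[R]_n * 'rV[R]_nP * 'rV[R]_nQ) : R :=
  match k with
  | inl (inl (inl _)) => z.1.1.1
  | inl (inl (inr i)) => z.1.1.2 ord0 i
  | inl (inr i) => z.1.2 ord0 i
  | inr i => z.2 ord0 i
  end.

Let coords_ball (x y : R * 'rV[R]_n * 'rV[R]_nP * 'rV[R]_nQ) (r : R) : 0 < r ->
  (forall k, `|coords k x - coords k y| < r) -> ball x r y.
Proof.
move=> r0 h; split; [split; [split|]|].
- exact: (h (inl (inl (inl tt)))).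
- by split => // i j; rewrite (ord1 i); exact: (h (inl (inl (inr j)))).
- by split => // i j; rewrite (ord1 i); exact: (h (inl (inr j))).
- by split => // i j; rewrite (ord1 i); exact: (h (inr j)).
Qed.

Lemma data_measurable (F : R -> 'rV[R]_n -> 'rV[R]_nP -> 'rV[R]_nQ -> R) t w u v :
  {within data_domain T P Q, continuous
    (fun z : R * 'rV[R]_n * 'rV[R]_nP * 'rV[R]_nQ => F z.1.1.1 z.1.1.2 z.1.2 z.2)} ->
  0 <= t -> controls T P t u -> controls T Q t v -> vmeasurable `[t, T] w ->
  measurable_fun (`[t, T]%classic : set R) (fun s => F s (w s) (u s) (v s)).
Proof.
move=> cF t0 [mu_ Pu] [mv Qv] mw.
pose g s := (s, w s, u s, v s).
apply: (measurable_comp_within coords_ball (G := g) _ _ cF).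
- exact: measurable_itv.
- case=> [[[[]|i]|i]|i] /=; [exact: measurable_id|exact: mw|exact: mu_|exact: mv].
- move=> s; rewrite /= in_itv/= => /andP[ts sT].
  by split => /=; [rewrite (le_trans t0 ts)|apply: Pu; rewrite ts|apply: Qv; rewrite ts].
Qed.

Lemma f_coord_continuous i : {within data_domain T P Q, continuous
    (fun z : R * 'rV[R]_n * 'rV[R]_nP * 'rV[R]_nQ => f z.1.1.1 z.1.1.2 z.1.2 z.2 ord0 i)}.
Proof.
move=> z; apply: (@continuous_comp (subspace (data_domain T P Q)) _ _
  (fun z : R * 'rV[R]_n * 'rV[R]_nP * 'rV[R]_nQ => f z.1.1.1 z.1.1.2 z.1.2 z.2)
  (fun a : 'rV[R]_n => a ord0 i)).
  exact: ag_f G z.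
exact: coord_continuous.
Qed.

End GameData.

(** * Existence of motions *)

Section GeometricSequences.
Context {R : realType}.

Lemma geometric0 (C : R) : C * 2^-1 ^+ m @[m --> \oo] --> 0.
Proof. by apply: cvg_geometric; rewrite ger0_norm; lra. Qed.

Lemma le_geometric0 (x C : R) : (forall m, x <= C * 2^-1 ^+ m) -> x <= 0.
Proof. by move=> h; apply: (cvgr_to_ge (geometric0 C)); exact: nearW. Qed.

(** The constant 2 D bounds the tail of the geometric series. *)
Lemma geometric_cvg (u : nat -> R) (D : R) :
  (forall m, `|u m.+1 - u m| <= D * 2^-1 ^+ m) ->
  exists l, u m @[m --> \oo] --> l /\ forall m, `|l - u m| <= 2 * D * 2^-1 ^+ m.
Proof.
move=> hu.
have D0 : 0 <= D by have := hu 0%N; rewrite expr0 mulr1; exact: le_trans.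
have cs : cvgn (series (telescope u)).
  apply: normed_cvg.
  apply: (@series_le_cvg _ (fun k => `|telescope u k|) (geometric D 2^-1)).
  - by move=> k; exact: normr_ge0.
  - by move=> k; rewrite /geometric/= mulr_ge0// exprn_ge0.
  - by move=> k; exact: hu.
  - by apply: is_cvg_geometric_series; rewrite ger0_norm; lra.
have cu : cvgn u.
  have -> : u = (fun k => u 0%N + series (telescope u) k).
    by apply/funext => k; exact: eq_sum_telescope.
  by apply: is_cvgD => //; exact: is_cvg_cst.
exists (lim (u k @[k --> \oo])); split => // m.
have hk k : `|u (k + m)%N - u m| <= 2 * D * 2^-1 ^+ m - 2 * D * 2^-1 ^+ (k + m).
  elim: k => [|k IH]; first by rewrite add0n !subrr normr0.
  rewrite addSn; have -> : u (k + m).+1 - u m = (u (k + m).+1 - u (k + m)%N) + (u (k + m)%N - u m).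
    by rewrite addrA subrK.
  apply: (le_trans (ler_normD _ _)); apply: (le_trans (lerD (hu _) IH)).
  rewrite exprS; lra.
have : `|u (k + m)%N - u m| @[k --> \oo] --> `|lim (u k @[k --> \oo]) - u m|.
  apply: cvg_norm; apply: cvgB; last exact: cvg_cst.
  by rewrite (cvg_shiftn m u).
move/cvgr_to_le; apply; apply: nearW => k; apply: (le_trans (hk k)).
by rewrite lerBlDr lerDl !mulr_ge0// exprn_ge0.
Qed.

Lemma geometric_cvgv (n : nat) (u : nat -> 'rV[R]_n) (D : R) :
  (forall m, `|u m.+1 - u m| <= D * 2^-1 ^+ m) ->
  exists l : 'rV[R]_n, (forall i, u m ord0 i @[m --> \oo] --> l ord0 i) /\
    forall m, `|l - u m| <= 2 * D * 2^-1 ^+ m.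
Proof.
move=> hu.
have D0 : 0 <= D by have := hu 0%N; rewrite expr0 mulr1; exact: le_trans.
have /choice[l hl] : forall i, exists l : R, u m ord0 i @[m --> \oo] --> l /\
    forall m, `|l - u m ord0 i| <= 2 * D * 2^-1 ^+ m.
  move=> i; apply: geometric_cvg => m; rewrite -subvE.
  by apply: le_trans (hu m); exact: norm_coord.
exists (\row_i l i); split => [i|m]; first by rewrite mxE; case: (hl i).
apply: norm_leP => [|i]; first by rewrite !mulr_ge0// exprn_ge0.
by rewrite subvE mxE; case: (hl i).
Qed.

End GeometricSequences.

Section Motions.
Context {R : realType} {n nP nQ : nat} (T alpha : R)
  (P : set 'rV[R]_nP) (Q : set 'rV[R]_nQ)
  (f : R -> 'rV[R]_n -> 'rV[R]_nP -> 'rV[R]_nQ -> 'rV[R]_n)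
  (chi : R -> 'rV[R]_n -> 'rV[R]_nP -> 'rV[R]_nQ -> R) (c : R).
Hypothesis G : admissible_game T alpha P Q f chi c.
Implicit Types (y w g : R -> 'rV[R]_n) (z : 'rV[R]_n) (u : R -> 'rV[R]_nP) (v : R -> 'rV[R]_nQ) (t s M : R).

Let T0 : 0 < T := ag_T G.
Let a01 : 0 < alpha < 1 := ag_alpha G.
Local Notation mkpath := (mkpath T alpha).

(** The truncated dynamics, extended by zero outside [t, T]. *)
Definition dyn rho t w u v s : 'rV[R]_n :=
  if s \in (`[t, T]%classic : set R) then f s (clampv rho (w s)) (u s) (v s) else 0.

Lemma vmeasurable_clamp rho (A : set R) w : measurable A -> vmeasurable A w ->
  vmeasurable A (fun s => clampv rho (w s)).
Proof.
move=> mA mw i; rewrite (_ : (fun s => _) = fun s => Num.max (- rho) (Num.min (w s ord0 i) rho)).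
  apply: measurable_maxr; first exact: measurable_cst.
  by apply: measurable_minr; [exact: mw|exact: measurable_cst].
by apply/funext => s; rewrite mxE.
Qed.

Lemma dyn_vbm : exists2 C : R, 0 < C & forall rho t w u v, 0 <= t -> 0 <= rho ->
  controls T P t u -> controls T Q t v -> vmeasurable `[t, T] w ->
  vbm (dyn rho t w u v) (C * (1 + rho)).
Proof.
have [C C0 hC] := data_growth G; exists C => // rho t w u v t0 r0 cu cv mw.
have B0 : 0 <= C * (1 + rho) by rewrite mulr_ge0 ?(ltW C0) ?addr_ge0.
split.
  move=> i; rewrite (_ : coordf _ i =
      (fun s => f s (clampv rho (w s)) (u s) (v s) ord0 i) \_ (`[t, T]%classic : set R)).
    apply/(measurable_restrictT _ _).1; first exact: measurable_itv.
    have mcw : vmeasurable `[t, T] (fun s => clampv rho (w s)).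
      by apply: vmeasurable_clamp => //; exact: measurable_itv.
    have := data_measurable (F := fun s x p q => f s x p q ord0 i)
      (f_coord_continuous G (i := i)) t0 cu cv mcw.
    exact.
  by apply/funext => s; rewrite /coordf /dyn /patch; case: ifP => // _; rewrite mxE.
move=> s; rewrite /dyn; case: ifPn => [|_]; last by rewrite normr0.
rewrite inE/= in_itv/= => ts; have /andP[h1 h2] := ts.
apply: (@le_trans _ _ (C * (1 + `|clampv rho (w s)|))).
  apply: hC; [by rewrite (le_trans t0 h1)|by have [_] := cu; exact|by have [_] := cv; exact].
by rewrite ler_wpM2l ?(ltW C0)// lerD2l clampv_norm.
Qed.

Definition picard rho t z g u v w : R -> 'rV[R]_n := mkpath z (glued t g (dyn rho t w u v)).

(** [mu] depends on the Lipschitz constant on the truncation ball only, so one weight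
    serves all initial paths and all controls. *)
Lemma picard_contraction rho : 0 <= rho -> exists2 mu : R, 0 < mu &
  forall z g M t u v w w' a, vbm g M -> 0 <= t <= T -> controls T P t u -> controls T Q t v ->
  vmeasurable `[t, T] w -> vmeasurable `[t, T] w' -> 0 <= a ->
  (forall s, 0 <= s <= T -> `|w s - w' s| <= a * expR (mu * s)) ->
  forall s, 0 <= s <= T -> `|picard rho t z g u v w s - picard rho t z g u v w' s| <= a / 2 * expR (mu * s).
Proof.
move=> r0; have r1 : 0 < rho + 1 by rewrite ltr_wpDl.
have [L L0 hL] := data_lip G r1.
have K0 : 0 <= (Gamma alpha)^-1 * L by rewrite mulr_ge0 ?(ltW L0)//; exact: invGamma_ge0.
have [mu m0 hK] := exists_damping a01 T0 K0.
exists mu => // z g M t u v w w' a gM /andP[t0 tT] cu cv mw mw' a_ge0 ww' tau tt.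
have /andP[tau0 tauT] := tt.
have [C _ hC] := dyn_vbm.
have d1 := hC _ _ _ _ _ t0 r0 cu cv mw.
have d2 := hC _ _ _ _ _ t0 r0 cu cv mw'.
have g1 := vbm_glue t gM d1; have g2 := vbm_glue t gM d2.
rewrite /picard !mkpath_in// opprD addrACA subrr add0r -(frac_intB a01 (lexx tau) g1 g2).
(* the time is clamped to make the weight bounded on the whole line *)
pose e s := a * expR (mu * clampr T s).
have me : bmeas e (a * expR (mu * T)).
  split.
    apply: measurable_funM; first exact: measurable_cst.
    apply: measurableT_comp => //; apply: measurable_funM; first exact: measurable_cst.
    apply: measurable_maxr; first exact: measurable_cst.
    by apply: measurable_minr; [exact: measurable_id|exact: measurable_cst].
  move=> s; rewrite /e ger0_norm ?mulr_ge0 ?expR_ge0// ler_wpM2l// ler_expR ler_wpM2l ?(ltW m0)//.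
  by apply: (le_trans (ler_norm _)); apply: clampr_norm; exact: ltW.
have eE s : 0 <= s <= T -> e s = a * expR (mu * s).
  move=> /andP[s0 sT]; rewrite /e clampr_id// ger0_norm//.
have mLe : bmeas (fun s => L * e s) (L * (a * expR (mu * T))).
  case: me => me1 me2; split; first by apply: measurable_funM => //; exact: measurable_cst.
  by move=> s; rewrite normrM (ger0_norm (ltW L0)) ler_wpM2l ?(ltW L0).
have dle s : 0 <= s <= tau ->
    `|glued t g (dyn rho t w u v) s - glued t g (dyn rho t w' u v) s| <= L * e s.
  move=> /andP[s0 st]; have sT := le_trans st tauT.
  rewrite eE ?s0//; have [lt|ge] := ltP s t.
    by rewrite !glue_lt// subrr normr0 !mulr_ge0 ?expR_ge0 ?(ltW L0).
  rewrite !glue_ge// /dyn mem_set/=; last by rewrite in_itv/= ge.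
  have Pu : P (u s) by have [_] := cu; apply; rewrite ge.
  have Qv : Q (v s) by have [_] := cv; apply; rewrite ge.
  have cl (x : 'rV[R]_n) : `|clampv rho x| <= rho + 1.
    by apply: (le_trans (clampv_norm _ r0)); rewrite lerDl.
  have sTT : 0 <= s <= T by rewrite s0.
  have [h _] := hL s _ _ _ _ sTT (cl (w s)) (cl (w' s)) Pu Qv.
  apply: (le_trans h); apply: ler_wpM2l; first exact: ltW.
  by apply: (le_trans (clampv_lip _ _ r0)); exact: ww'.
apply: (le_trans (frac_int_dom a01 (vbmB g1 g2) mLe tau0 (lexx _) dle)).
have /andP[a0 _] := a01.
have ei := @RL_int R alpha 0 tau tau e _ a0 (lexx _) me.
have -> : RL alpha tau tau (fun s => L * e s) = L * RL alpha tau tau e.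
  rewrite /RL -rIZl//; by apply: rI_eq => s _; rewrite mulrCA.
rewrite mulrA; apply: (le_trans (ler_wpM2l K0 (ler_norm _))).
apply: (RL_bielecki a01 m0 K0 hK me tt a_ge0) => s /andP[s0 st].
have sT : 0 <= s <= T by rewrite s0 (le_trans st).
by rewrite eE// ger0_norm// mulr_ge0 ?expR_ge0.
Qed.

(** The iterates converge geometrically in the weighted sup norm, uniformly on [0, T]; the
    limit is measurable as a pointwise limit. *)
Lemma picard_fixpoint rho z g M t u v : 0 <= rho -> vbm g M -> 0 <= t <= T ->
  controls T P t u -> controls T Q t v ->
  exists2 w, w = picard rho t z g u v w & vmeasurable `[t, T] w.
Proof.
move=> r0 gM tT cu cv; have /andP[t0 tT'] := tT.
have [mu m0 hmu] := picard_contraction r0.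
have [C _ hC] := dyn_vbm.
have subt : (`[t, T]%classic : set R) `<=` `[0, T]%classic.
  by move=> s; rewrite /= !in_itv/= => /andP[h1 h2]; rewrite (le_trans t0 h1).
have mk g' M' : vbm g' M' -> vmeasurable `[t, T] (mkpath z g').
  by move=> h i; apply: (measurable_funS (measurable_itv _) subt); exact: (mkpath_vmeasurable a01 z h i).
pose w_ m := iter m (picard rho t z g u v) (mkpath z g).
have mw m : vmeasurable `[t, T] (w_ m).
  elim: m => [|m IH]; first exact: mk gM.
  by rewrite /w_ /= /picard; apply: (mk _ _ (vbm_glue t gM (hC _ _ _ _ _ t0 r0 cu cv IH))).
have wpath m : exists g' M', vbm g' M' /\ w_ m = mkpath z g'.
  case: m => [|m]; first by exists g, M.
  by exists (glued t g (dyn rho t (w_ m) u v)), (M + C * (1 + rho)); split => //;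
    apply: vbm_glue => //; exact: hC.
have [D D0 hD] : exists2 D, 0 <= D & forall s, 0 <= s <= T -> `|w_ 1%N s - w_ 0%N s| <= D.
  have [g0 [M0 [h0 e0]]] := wpath 0%N; have [g1 [M1 [h1 e1]]] := wpath 1%N.
  exists ((`|z| + frac_const alpha * M1 * T `^ alpha) + (`|z| + frac_const alpha * M0 * T `^ alpha)).
    by rewrite !addr_ge0 ?mulr_ge0 ?powR_ge0 ?(ltW (frac_const_gt0 a01)) ?(vbm_ge0 h0) ?(vbm_ge0 h1).
  move=> s sT; apply: (le_trans (ler_normB _ _)); rewrite e0 e1.
  by apply: lerD; exact: mkpath_bound.
have step m s : 0 <= s <= T -> `|w_ m.+1 s - w_ m s| <= D * 2^-1 ^+ m * expR (mu * s).
  elim: m s => [|m IH] s sT.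
    rewrite expr0 mulr1; apply: (le_trans (hD _ sT)); rewrite ler_peMr// -expR0 ler_expR.
    by rewrite mulr_ge0 ?(ltW m0)//; case/andP: sT.
  have Dm : 0 <= D * 2^-1 ^+ m by rewrite mulr_ge0// exprn_ge0.
  have := hmu z g M t u v _ _ _ gM tT cu cv (mw m.+1) (mw m) Dm IH s sT.
  by rewrite exprS (_ : D * (2^-1 * _) = D * 2^-1 ^+ m / 2)//; ring.
pose E := D * expR (mu * T).
have E0 : 0 <= E by rewrite mulr_ge0 ?expR_ge0.
have step' m s : 0 <= s <= T -> `|w_ m.+1 s - w_ m s| <= E * 2^-1 ^+ m.
  move=> sT; apply: (le_trans (step _ _ sT)); rewrite /E mulrAC.
  rewrite ler_wpM2r ?exprn_ge0// ler_wpM2l// ler_expR ler_wpM2l ?(ltW m0)//.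
  by case/andP: sT.
have /choice[w0 hw0] : forall s, exists l : 'rV[R]_n, 0 <= s <= T ->
    (forall i, w_ m s ord0 i @[m --> \oo] --> l ord0 i) /\ forall m, `|l - w_ m s| <= 2 * E * 2^-1 ^+ m.
  move=> s; have [sT|nsT] := boolP (0 <= s <= T); last by exists 0.
  have [l hl] := geometric_cvgv (u := fun m => w_ m s) (fun m => step' m s sT).
  by exists l.
pose w s := if 0 <= s <= T then w0 s else 0.
have wE s : 0 <= s <= T -> w s = w0 s by rewrite /w => ->.
have mwl : vmeasurable `[t, T] w.
  move=> i; apply: (measurable_fun_cvg (h := fun m s => w_ m s ord0 i)) => [m|s]; first exact: mw.
  rewrite /= in_itv/= => /andP[ts sT]; have sTT : 0 <= s <= T by rewrite (le_trans t0 ts).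
  rewrite wE//; have [hl _] := hw0 s sTT.
  exact: hl.
exists w => //; apply/funext => s; have [sT|nsT] := boolP (0 <= s <= T); last first.
  by rewrite /w (negbTE nsT) /picard mkpath_out.
apply/eqP; rewrite -subr_eq0 -normr_le0.
apply: (@le_geometric0 _ _ (2 * E + E * expR (mu * T))) => m.
have pm : 0 <= 2^-1 ^+ m :> R by exact: exprn_ge0.
have -> : w s - picard rho t z g u v w s = (w s - w_ m.+1 s) + (w_ m.+1 s - picard rho t z g u v w s).
  by rewrite addrA subrK.
apply: (le_trans (ler_normD _ _)); rewrite mulrDl; apply: lerD.
  rewrite wE//; have [_ /(_ m.+1) h] := hw0 s sT; apply: (le_trans h).
  by rewrite ler_wpM2l ?mulr_ge0// exprS ler_piMl//; lra.
have am : 0 <= 2 * E * 2^-1 ^+ m by rewrite !mulr_ge0.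
have hh r : 0 <= r <= T -> `|w_ m r - w r| <= 2 * E * 2^-1 ^+ m * expR (mu * r).
  move=> rT; rewrite wE// distrC; have [_ /(_ m) h] := hw0 r rT; apply: (le_trans h).
  rewrite ler_peMr// -expR0 ler_expR mulr_ge0 ?(ltW m0)//; by case/andP: rT.
apply: (le_trans (hmu z g M t u v _ _ _ gM tT cu cv (mw m) mwl am hh s sT)).
have -> : 2 * E * 2^-1 ^+ m / 2 * expR (mu * s) = E * 2^-1 ^+ m * expR (mu * s) by field.
rewrite mulrAC; apply: (ler_wpM2r pm); apply: (ler_wpM2l E0).
by rewrite ler_expR ler_wpM2l ?(ltW m0)//; case/andP: sT.
Qed.

End Motions.

(** * Estimates for motions *)

Section VectorMeasurability.
Context {R : realType} {n : nat}.

Lemma vmeasurable_norm (D : set R) (w : R -> 'rV[R]_n) : measurable D ->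
  vmeasurable D w -> measurable_fun D (fun s => `|w s|).
Proof.
move=> mD mw.
have mb (r : seq ('I_1 * 'I_n)) :
    measurable_fun D (fun s => \big[Num.max/0]_(ij <- r) `|w s ij.1 ij.2|).
  elim: r => [|ij r IH].
    by apply: (eq_measurable_fun (fun=> 0 : R)) => [s _|]; [rewrite big_nil|exact: measurable_cst].
  apply: (eq_measurable_fun (fun s => Num.max `|w s ij.1 ij.2|
      (\big[Num.max/0]_(ij <- r) `|w s ij.1 ij.2|))) => [s _|]; first by rewrite big_cons.
  apply: measurable_maxr => //; apply: measurableT_comp; first exact: normr_measurable.
  by rewrite (ord1 ij.1); exact: mw.
apply: (eq_measurable_fun (fun s => \big[Num.max/0]_(ij <- index_enum _) `|w s ij.1 ij.2|)) => [s _|//].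
by rewrite -mx_normrE.
Qed.

End VectorMeasurability.

Section Motions.
Context {R : realType} {n nP nQ : nat} (T alpha : R)
  (P : set 'rV[R]_nP) (Q : set 'rV[R]_nQ)
  (f : R -> 'rV[R]_n -> 'rV[R]_nP -> 'rV[R]_nQ -> 'rV[R]_n)
  (chi : R -> 'rV[R]_n -> 'rV[R]_nP -> 'rV[R]_nQ -> R) (c : R).
Hypothesis G : admissible_game T alpha P Q f chi c.
Implicit Types (y w g : R -> 'rV[R]_n) (z : 'rV[R]_n) (u : R -> 'rV[R]_nP) (v : R -> 'rV[R]_nQ) (t s M : R).

Let T0 : 0 < T := ag_T G.
Let a01 : 0 < alpha < 1 := ag_alpha G.
Let a0 : 0 < alpha. Proof. by case/andP: a01. Qed.
Let a1 : 0 < alpha <= 1. Proof. by case/andP: a01 => -> /ltW ->. Qed.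
Local Notation mkpath := (mkpath T alpha).
Local Notation motion := (motion T alpha f).

Lemma mkpath_norm_bmeas z g M : vbm g M ->
  bmeas (fun s => `|mkpath z g s|) (`|z| + frac_const alpha * M * T `^ alpha).
Proof.
move=> gM; split; last first.
  move=> s; rewrite normr_id; have [sT|/mkpath_out ->] := boolP (0 <= s <= T).
    exact: mkpath_bound gM sT.
  by rewrite normr0 addr_ge0 ?mulr_ge0 ?powR_ge0 ?(ltW (frac_const_gt0 a01)) ?(vbm_ge0 gM).
have e : (fun s => `|mkpath z g s|) = (fun s => `|mkpath z g s|) \_ (`[0, T]%classic : set R).
  apply/funext => s; rewrite /patch; case: ifPn => //.
  rewrite notin_setE/= in_itv/= => /negP sT.
  by rewrite mkpath_out ?normr0.
rewrite e; apply/(measurable_restrictT _ _).1; first exact: measurable_itv.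
by apply: vmeasurable_norm; [exact: measurable_itv|exact: (mkpath_vmeasurable a01 z gM)].
Qed.

(** The initial part contributes its continuation by zero derivative, and the rest is
    linear in the new density. *)
Lemma mkpath_glued_diff z z' t g g' h h' M M' N N' tau :
  vbm g M -> vbm g' M' -> vbm h N -> vbm h' N' -> 0 <= t <= T -> 0 <= tau <= T ->
  mkpath z (glued t g h) tau - mkpath z' (glued t g' h') tau =
  (mkpath z (cutoff t g) tau - mkpath z' (cutoff t g') tau) +
    frac_int alpha tau tau (fun s => glued t (fun=> 0) h s - glued t (fun=> 0) h' s).
Proof.
move=> gM gM' hN hN' tT tauT.
have zN := vbm_glue t (vbm0 (lexx 0)) hN.
have zN' := vbm_glue t (vbm0 (lexx 0)) hN'.
have E (w g1 h1 : R -> 'rV[R]_n) M1 N1 (z1 : 'rV[R]_n) : vbm g1 M1 -> vbm h1 N1 ->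
    mkpath z1 (glued t g1 h1) tau = mkpath z1 (cutoff t g1) tau + frac_int alpha tau tau (glued t (fun=> 0) h1).
  move=> g1M h1M; rewrite !(mkpath_in _ _ _ tauT) -addrA; congr (_ + _).
  have -> : frac_int alpha tau tau (cutoff t g1) =
      frac_int alpha tau tau (fun s => glued t g1 h1 s - glued t (fun=> 0) h1 s).
    apply: frac_int_ae; apply: (ae_onW _ (ae_on_neq t 0 tau)) => s _ st.
    have [lt|gt|e] := ltgtP s t; last by rewrite e eqxx in st.
      by rewrite !glue_lt// subr0 /cutoff mem_set//= in_itv/= ltW.
    by rewrite !glue_ge ?(ltW gt)// subrr /cutoff memNset//= in_itv/= leNgt gt.
  rewrite (frac_intB a01 (lexx tau) (vbm_glue t g1M h1M) (vbm_glue t (vbm0 (lexx 0)) h1M)).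
  by rewrite subrK.
rewrite (E g g h M N)// (E g' g' h' M' N')// (frac_intB a01 (lexx tau) zN zN').
by rewrite opprD addrACA.
Qed.

(** The density of a motion after [t]: the right-hand side of the equation along [w]. *)
Definition fdyn t w u v s : 'rV[R]_n :=
  if s \in (`[t, T]%classic : set R) then f s (w s) (u s) (v s) else 0.

Lemma fdyn_in t w u v s : t <= s <= T -> fdyn t w u v s = f s (w s) (u s) (v s).
Proof. by move=> ts; rewrite /fdyn mem_set//= in_itv. Qed.

Lemma fdyn_dyn rho t w u v : 0 <= t -> (forall s, 0 <= s <= T -> `|w s| <= rho) ->
  dyn T f rho t w u v = fdyn t w u v.
Proof.
move=> t0 wr; apply/funext => s; rewrite /dyn /fdyn; case: ifPn => //.
rewrite inE/= in_itv/= => /andP[ts sT].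
by rewrite clampv_id// wr// (le_trans t0 ts).
Qed.

(** By the maximum principle the continuation of the initial part is at most 3 S, and the
    linear growth of the new density is handled by Gronwall. The bound does not involve
    the density [g] of the initial part. *)
Lemma apriori_bound (C : R) : 0 < C -> exists2 C1 : R, 0 < C1 &
  forall t z g M h M' S, vbm g M -> vbm h M' -> 0 <= t <= T ->
  (forall s, 0 <= s <= t -> `|mkpath z g s| <= S) ->
  (forall s, t <= s <= T -> `|h s| <= C * (1 + `|mkpath z (glued t g h) s|)) ->
  forall s, 0 <= s <= T -> `|mkpath z (glued t g h) s| <= C1 * (1 + S).
Proof.
move=> C0; have K0 : 0 <= (Gamma alpha)^-1 * C by rewrite mulr_ge0 ?(ltW C0)//; exact: invGamma_ge0.
have [C1 C10 hC1] := fractional_gronwall a01 T0 K0.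
pose B := (Gamma alpha)^-1 * C * (1 * (T `^ alpha / alpha)).
have B0 : 0 <= B.
  rewrite /B mul1r; apply: mulr_ge0 => //; apply: mulr_ge0; first exact: powR_ge0.
  by rewrite invr_ge0 ltW.
exists (C1 * (3 + B)); first by rewrite mulr_gt0// ltr_wpDr.
move=> t z g M h M' S gM hM tT hS hh s sT.
have S0 : 0 <= S by apply: le_trans (hS 0 _) => //; rewrite lexx; case/andP: tT.
set y := mkpath z (glued t g h).
have yb := mkpath_norm_bmeas z (vbm_glue t gM hM); rewrite -/y in yb.
apply: (@le_trans _ _ (C1 * (3 * S + B))); last first.
  rewrite -mulrA ler_wpM2l ?(ltW C10)//.
  have := mulr_ge0 B0 S0; lra.
apply: (hC1 T _ _ (3 * S + B) (lexx T) yb _ _ _ _ sT) => [r||tau tt]; first exact: normr_ge0.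
  exact: addr_ge0 (mulr_ge0 (ler0n R 3) S0) B0.
have := mkpath_glued_diff z 0 gM (vbm0 (lexx 0)) hM (vbm0 (lexx 0)) tT tt.
have E0 (k : R -> 'rV[R]_n) : (forall s, k s = 0) -> mkpath 0 k tau = 0.
  move=> k0; rewrite mkpath_in// add0r; have -> : k = fun=> 0 by apply/funext.
  exact: frac_int_zero.
rewrite (E0 (glued t _ _)); last by move=> r; rewrite /glued; case: ifP.
rewrite (E0 (cutoff t _)); last by move=> r; rewrite /cutoff; case: ifP.
rewrite !subr0 -/(y tau) => ->; apply: (le_trans (ler_normD _ _)).
rewrite -addrA; apply: lerD.
  have := cutoff_max_principle T0 a01 (z := z) (z' := 0) gM (vbm0 (lexx 0)) tT tt (S := S).
  rewrite (E0 (cutoff t _)) ?subr0; last by move=> r; rewrite /cutoff; case: ifP.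
  apply=> xi xit; have xiT : 0 <= xi <= T.
    by case/andP: xit => -> /= xt; apply: (le_trans xt); case/andP: tT.
  have -> : mkpath (0 : 'rV[R]_n) (fun=> 0) xi = 0.
    by rewrite mkpath_in// add0r frac_int_zero.
  by rewrite subr0; exact: hS.
have d1 := vbm_glue t (vbm0 (lexx 0)) hM.
have d2 := vbm_glue t (vbm0 (lexx 0)) (vbm0 (lexx 0) : vbm (fun=> 0 : 'rV[R]_n) 0).
have ob : bmeas (fun=> 1 : R) 1 by split; [exact: measurable_cst|move=> r; rewrite normr1].
have db := bmeasD ob yb.
pose N := 1 + (`|z| + frac_const alpha * (M + M') * T `^ alpha).
have cb : bmeas (fun s => C * (1 + `|y s|)) (C * N).
  case: db => db1 db2; split; first by apply: measurable_funM => //; exact: measurable_cst.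
  by move=> r; rewrite normrM (ger0_norm (ltW C0)) ler_wpM2l ?(ltW C0)//; exact: db2.
have /andP[t0 tT'] := tT; have /andP[tau0 tauT] := tt.
have dle r : 0 <= r <= tau ->
   `|glued t (fun=> 0) h r - glued t (fun=> 0) (fun=> 0) r| <= C * (1 + `|y r|).
  move=> /andP[r0 rt]; have [lt|ge] := ltP r t.
    by rewrite !glue_lt// subrr normr0 mulr_ge0 ?(ltW C0) ?addr_ge0.
  by rewrite !glue_ge// subr0; apply: hh; rewrite ge (le_trans rt).
apply: (le_trans (frac_int_dom a01 (vbmB d1 d2) cb tau0 (lexx _) dle)).
have yi := @RL_int R alpha 0 tau tau _ _ a0 (lexx _) yb.
have oi := @RL_int R alpha 0 tau tau _ _ a0 (lexx _) ob.
have -> : RL alpha tau tau (fun s => C * (1 + `|y s|)) =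
    C * (RL alpha tau tau (fun=> 1) + RL alpha tau tau (fun s => `|y s|)).
  rewrite /RL -rID// -rIZl; last exact: iID.
  by apply: rI_eq => r _; ring.
rewrite mulrA mulrDr lerD2r /B; apply: ler_wpM2l => //.
apply: (le_trans (ler_norm _)); apply: (le_trans (RL_bound a1 tau0 (lexx _) ob)).
rewrite mul1r [leRHS]mul1r ler_wpM2r ?invr_ge0 ?(ltW a0)//.
by apply: ge0_ler_powR; rewrite ?nnegrE ?(ltW a0) ?(ltW T0).
Qed.

Lemma fdyn_vbm : exists2 C : R, 0 < C & forall rho t w u v, 0 <= t <= T ->
  controls T P t u -> controls T Q t v -> vmeasurable `[0, T] w ->
  (forall s, 0 <= s <= T -> `|w s| <= rho) -> vbm (fdyn t w u v) (C * (1 + rho)).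
Proof.
have [C C0 hC] := dyn_vbm G; exists C => // rho t w u v /andP[t0 tT] cu cv mw wr.
rewrite -(fdyn_dyn u v t0 wr); apply: hC => //.
  by apply: le_trans (wr 0 _) => //; rewrite lexx ltW.
move=> i; apply: (measurable_funS (measurable_itv _) _ (mw i)) => s.
by rewrite /= !in_itv/= => /andP[ts ->]; rewrite (le_trans t0 ts).
Qed.

(** With the truncation level equal to the a priori bound, the fixed point of the
    truncated map solves the untruncated equation. Conversely any motion has the
    right-hand side as its density. *)
Lemma motion_bound : exists2 C1 : R, 0 < C1 &
  forall t z g M S u v, vbm g M -> 0 <= t <= T -> controls T P t u -> controls T Q t v ->
  (forall s, 0 <= s <= t -> `|mkpath z g s| <= S) ->
  (exists y, motion t (mkpath z g) u v y) /\
  forall y, motion t (mkpath z g) u v y ->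
  [/\ vbm (fdyn t y u v) (C1 * (1 + S)), y = mkpath z (glued t g (fdyn t y u v)) &
    forall s, 0 <= s <= T -> `|y s| <= C1 * (1 + S)].
Proof.
have [C C0 hC] := data_growth G.
have [C1 C10 hC1] := apriori_bound C0.
have [C2 C20 hC2] := fdyn_vbm.
have [C3 _ hC3] := dyn_vbm G.
pose C4 := C1 + C2 * (1 + C1).
have C40 : 0 < C4.
  by rewrite ltr_pwDl// mulr_ge0 ?(ltW C20) ?addr_ge0 ?(ltW C10).
exists C4 => // t z g M S u v gM tT cu cv hS.
have S0 : 0 <= S by apply: le_trans (hS 0 _) => //; rewrite lexx; case/andP: tT.
have /andP[t0 tT'] := tT.
pose rho := C1 * (1 + S).
have rho0 : 0 <= rho by rewrite mulr_ge0 ?(ltW C10) ?addr_ge0.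
have rho4 : rho <= C4 * (1 + S).
  rewrite ler_wpM2r ?addr_ge0// /C4 lerDl mulr_ge0 ?(ltW C20)//.
  by rewrite addr_ge0 ?(ltW C10).
have rho4' : C2 * (1 + rho) <= C4 * (1 + S).
  rewrite /rho /C4; have p1 := mulr_ge0 (ltW C20) S0; have p2 := mulr_ge0 (ltW C10) S0.
  rewrite mulrDl; apply: (@le_trans _ _ (C2 * (1 + C1) * (1 + S))).
    rewrite -mulrA ler_wpM2l ?(ltW C20)//; lra.
  by rewrite lerDr mulr_ge0 ?(ltW C10) ?addr_ge0.
have Pu s : t <= s <= T -> P (u s) by case: cu => _; exact.
have Qv s : t <= s <= T -> Q (v s) by case: cv => _; exact.
have tsT s : t <= s <= T -> 0 <= s <= T by case/andP => h ->; rewrite (le_trans t0 h).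
split.
  have [w wE mw] := picard_fixpoint G z rho0 gM tT cu cv.
  have dv := hC3 rho t w u v t0 rho0 cu cv mw.
  have wr s : 0 <= s <= T -> `|w s| <= rho.
    rewrite {1}wE /picard => sT; apply: (hC1 _ _ _ _ _ _ _ gM dv tT hS) sT => r rt.
    rewrite /dyn mem_set/=; last by rewrite in_itv.
    apply: (le_trans (hC r _ _ _ (tsT _ rt) (Pu _ rt) (Qv _ rt))).
    rewrite ler_wpM2l ?(ltW C0)// lerD2l -[X in _ <= `|X|](congr1 (fun k => k r) wE).
    exact: clampv_le.
  have fd := fdyn_dyn u v t0 wr.
  have wE' : w = mkpath z (glued t g (fdyn t w u v)) by rewrite -fd.
  rewrite fd in dv.
  exists w; split; first by rewrite wE'; exact: (mkpath_glue_Yset alpha T0 z gM dv tT).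
  have := ae_on_sub t0 (lexx T) (caputo_mkpath T0 a01 z (vbm_glue t gM dv)).
  rewrite -wE'; apply: ae_onW => s ts ->.
  by rewrite glue_ge ?fdyn_in//; case/andP: ts.
move=> y [yY yf].
have [h [M' [hM yE yh]]] := Yset_glueP T0 a01 gM tT yY.
have my : vmeasurable `[0, T] y by rewrite yE; exact: (mkpath_vmeasurable a01 z (vbm_glue t gM hM)).
have hf : ae_on t T (fun s => h s = fdyn t y u v s).
  apply: (ae_onW _ (ae_on_and (ae_on_sub t0 (lexx T) yh) yf)) => s ts [<- ->].
  by rewrite fdyn_in.
have yb s : 0 <= s <= T -> `|y s| <= `|z| + frac_const alpha * (M + M') * T `^ alpha.
  by rewrite yE => sT; exact: (mkpath_bound T0 a01 z (vbm_glue t gM hM) sT).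
have fv := hC2 _ _ _ _ _ tT cu cv my yb.
have yE' : y = mkpath z (glued t g (fdyn t y u v)).
  rewrite {1}yE; apply: mkpath_ae; apply: (@ae_on_cat _ _ t).
    apply: (ae_onW _ (ae_on_neq t 0 t)) => s /andP[_ st] sn.
    by rewrite !glue_lt// lt_neqAle sn.
  by apply: (ae_onW _ hf) => s /andP[ts _] e; rewrite !glue_ge.
have yr s : 0 <= s <= T -> `|y s| <= rho.
  rewrite {1}yE' => sT; apply: (hC1 _ _ _ _ _ _ _ gM fv tT hS) sT => r rt.
  by rewrite -yE' fdyn_in//; apply: hC => //; [exact: tsT|exact: Pu|exact: Qv].
split => //; first exact: vbmW (hC2 _ _ _ _ _ tT cu cv my yr) rho4'.
by move=> s sT; exact: le_trans (yr s sT) rho4.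
Qed.

(** Only the initial parts and the Lipschitz constant on the ball of radius [r] enter.
    Controls that agree almost everywhere give the same density, so the second motion may
    be rewritten with the controls of the first. *)
Lemma motion_difference (r : R) : 0 < r -> exists2 K : R, 0 < K &
  forall t t1 z z' g g' M M' u v u' v' y y', vbm g M -> vbm g' M' -> 0 <= t <= t1 -> t1 <= T ->
  controls T P t u -> controls T Q t v -> controls T P t u' -> controls T Q t v' ->
  ae_on t t1 (fun s => u s = u' s) -> ae_on t t1 (fun s => v s = v' s) ->
  motion t (mkpath z g) u v y -> motion t (mkpath z' g') u' v' y' ->
  (forall s, 0 <= s <= T -> `|y s| <= r) -> (forall s, 0 <= s <= T -> `|y' s| <= r) ->
  (exists N, bmeas (fun s => `|y s - y' s|) N) /\
  forall tau, 0 <= tau <= t1 ->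
  `|y tau - y' tau| <= `|mkpath z (cutoff t g) tau - mkpath z' (cutoff t g') tau|
     + K * RL alpha tau tau (fun s => `|y s - y' s|).
Proof.
move=> r0; have [L L0 hL] := data_lip G r0.
have [C1 C10 hC1] := motion_bound.
have [C2 C20 hC2] := fdyn_vbm.
exists ((Gamma alpha)^-1 * L); first by rewrite mulr_gt0// invr_gt0 Gamma_alpha_gt0.
move=> t t1 z z' g g' M M' u v u' v' y y' gM gM' /andP[t0 tt1] t1T cu cv cu' cv' uu vv my my' yr yr'.
have tT : 0 <= t <= T by rewrite t0 (le_trans tt1).
have hS (z1 : 'rV[R]_n) (g1 : R -> 'rV[R]_n) M1 : vbm g1 M1 ->
    forall s, 0 <= s <= t -> `|mkpath z1 g1 s| <= `|z1| + frac_const alpha * M1 * T `^ alpha.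
  move=> h s /andP[s0 st]; apply: mkpath_bound => //; rewrite s0 (le_trans st)//.
  exact: le_trans tt1 t1T.
have [_ /(_ y my)[fv yE _]] := hC1 t z g M _ u v gM tT cu cv (hS _ _ _ gM).
have [_ /(_ y' my')[fv' yE' _]] := hC1 t z' g' M' _ u' v' gM' tT cu' cv' (hS _ _ _ gM').
have db : exists N, bmeas (fun s => `|y s - y' s|) N.
  have gd := vbm_glue t gM fv; have gd' := vbm_glue t gM' fv'.
  have /= := mkpath_norm_bmeas (z - z') (vbmB gd gd').
  set N := (X in bmeas _ X) => h; exists N; move: h; congr bmeas.
  apply/funext => s; congr `| _ |; rewrite {2}yE {2}yE'.
  have [sT|sT] := boolP (0 <= s <= T); last by rewrite !mkpath_out// subrr.
  by rewrite !mkpath_in// (frac_intB a01 (lexx s) gd gd') opprD addrACA.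
split => // tau /andP[tau0 taut].
have [N dN] := db.
have tauT : 0 <= tau <= T by rewrite tau0 (le_trans taut).
have my0 : vmeasurable `[0, T] y'.
  by rewrite yE'; exact: (mkpath_vmeasurable a01 z' (vbm_glue t gM' fv')).
have fw := hC2 _ _ _ _ _ tT cu cv my0 yr'.
have e' : y' tau = mkpath z' (glued t g' (fdyn t y' u v)) tau.
  rewrite {1}yE' !(mkpath_in _ _ _ tauT); congr (_ + _); apply: frac_int_ae; apply: (@ae_on_cat _ _ t).
    apply: (ae_onW _ (ae_on_neq t 0 t)) => s /andP[_ st] sn.
    by rewrite !glue_lt// lt_neqAle sn.
  have sub := ae_on_sub (lexx t) taut (ae_on_and uu vv).
  apply: (ae_onW _ sub) => s /andP[ts st] [eu ev].
  have tsT : t <= s <= T by rewrite ts (le_trans st)//; case/andP: tauT.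
  by rewrite !glue_ge// !fdyn_in// -eu -ev.
rewrite {1}yE e' (mkpath_glued_diff z z' gM gM' fv fw tT tauT).
apply: (le_trans (ler_normD _ _)); rewrite lerD2l.
have b1 := vbm_glue t (vbm0 (lexx 0)) fv.
have b2 := vbm_glue t (vbm0 (lexx 0)) fw.
have Lb : bmeas (fun s => L * `|y s - y' s|) (L * N).
  case: dN => d1 d2; split; first by apply: measurable_funM => //; exact: measurable_cst.
  by move=> s; rewrite normrM (ger0_norm (ltW L0)) ler_wpM2l ?(ltW L0)//; exact: d2.
have dle s : 0 <= s <= tau -> `|glued t (fun=> 0) (fdyn t y u v) s -
    glued t (fun=> 0) (fdyn t y' u v) s| <= L * `|y s - y' s|.
  move=> /andP[s0 st]; have sT : s <= T by case/andP: tauT => _; exact: le_trans.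
  have [lt|ge] := ltP s t; first by rewrite !glue_lt// subrr normr0 mulr_ge0 ?(ltW L0).
  have tsT : t <= s <= T by rewrite ge.
  have sTT : 0 <= s <= T by rewrite s0.
  rewrite !glue_ge// !fdyn_in//.
  have [_ Pu] := cu; have [_ Qv] := cv.
  by have [] := hL s _ _ _ _ sTT (yr s sTT) (yr' s sTT) (Pu s tsT) (Qv s tsT).
apply: (le_trans (frac_int_dom a01 (vbmB b1 b2) Lb tau0 (lexx _) dle)).
have di := @RL_int R alpha 0 tau tau _ _ a0 (lexx _) dN.
have -> : RL alpha tau tau (fun s => L * `|y s - y' s|) = L * RL alpha tau tau (fun s => `|y s - y' s|).
  by rewrite /RL -rIZl//; apply: rI_eq => s _; rewrite mulrCA.
by rewrite mulrA.
Qed.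

End Motions.

Section Controls.
Context {R : realType} (T : R).

Lemma controls_glue {m : nat} (K : set 'rV[R]_m) t tau (u u' : R -> 'rV[R]_m) : t <= tau <= T ->
  controls T K t u -> controls T K tau u' -> controls T K t (glued tau u u').
Proof.
move=> /andP[tt tT] [mu Ku] [mu' Ku']; split; last first.
  move=> s /andP[ts sT]; have [lt|ge] := ltP s tau.
    by rewrite glue_lt//; apply: Ku; rewrite ts.
  by rewrite glue_ge//; apply: Ku'; rewrite ge.
move=> i; rewrite (_ : `[t, T]%classic = `[t, tau[%classic `|` `[tau, T]%classic); last first.
  apply/seteqP; split => s; rewrite /= !in_itv/=.
    by move=> /andP[ts sT]; case: (ltP s tau) => h; [left; rewrite ts|right].
  by case=> /andP[h1 h2]; [rewrite h1 (le_trans (ltW h2))|rewrite (le_trans tt h1)].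
apply/measurable_funU; [exact: measurable_itv|exact: measurable_itv|split].
  apply: (eq_measurable_fun (fun s => u s ord0 i)) => [s|].
    by rewrite inE/= in_itv/= => /andP[_ st]; rewrite glue_lt.
  apply: (measurable_funS (measurable_itv `[t, T]) _ (mu i)) => s.
  by rewrite /= !in_itv/= => /andP[-> h]; rewrite (le_trans (ltW h)).
apply: (eq_measurable_fun (fun s => u' s ord0 i)) => [s|].
  by rewrite inE/= in_itv/= => /andP[st _]; rewrite glue_ge.
exact: mu'.
Qed.

Lemma controls_sub {m : nat} (K : set 'rV[R]_m) t tau (u : R -> 'rV[R]_m) : t <= tau ->
  controls T K t u -> controls T K tau u.
Proof.
move=> tt [mu Ku]; split; last by move=> s /andP[ts sT]; apply: Ku; rewrite (le_trans tt ts).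
move=> i; apply: (measurable_funS (measurable_itv `[t, T]) _ (mu i)) => s.
by rewrite /= !in_itv/= => /andP[h ->]; rewrite (le_trans tt h).
Qed.

Lemma controls_cst {m : nat} (K : set 'rV[R]_m) t (p : 'rV[R]_m) : K p -> controls T K t (fun=> p).
Proof. by move=> Kp; split => // i; exact: measurable_cst. Qed.

End Controls.

Section Motions.
Context {R : realType} {n nP nQ : nat} (T alpha : R)
  (P : set 'rV[R]_nP) (Q : set 'rV[R]_nQ)
  (f : R -> 'rV[R]_n -> 'rV[R]_nP -> 'rV[R]_nQ -> 'rV[R]_n)
  (chi : R -> 'rV[R]_n -> 'rV[R]_nP -> 'rV[R]_nQ -> R) (c : R).
Hypothesis G : admissible_game T alpha P Q f chi c.
Implicit Types (x y w g : R -> 'rV[R]_n) (z : 'rV[R]_n) (u : R -> 'rV[R]_nP) (v : R -> 'rV[R]_nQ) (t s M S : R).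

Let T0 : 0 < T := ag_T G.
Let a01 : 0 < alpha < 1 := ag_alpha G.
Let a0 : 0 < alpha. Proof. by case/andP: a01. Qed.
Let a1 : 0 < alpha <= 1. Proof. by case/andP: a01 => -> /ltW ->. Qed.
Local Notation mkpath := (mkpath T alpha).
Local Notation motion := (motion T alpha f).
Local Notation ACpath := (ACpath T alpha).

Lemma ACpath_bounded x : ACpath x -> exists S, forall s, `|x s| <= S.
Proof.
move=> /ACpathP[g [M [gM xE]]]; exists (`|x 0| + frac_const alpha * M * T `^ alpha) => s.
by rewrite {1}xE; have [_ /(_ s)] := mkpath_norm_bmeas G (x 0) gM; rewrite normr_id.
Qed.

Lemma ACpath_vmeasurable x : ACpath x -> vmeasurable `[0, T] x.
Proof. by move=> /ACpathP[g [M [gM ->]]]; exact: (mkpath_vmeasurable a01 _ gM). Qed.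

Lemma motion_AC t x u v y : motion t x u v y -> ACpath y.
Proof. by case=> -[]. Qed.

Lemma motion_initial t x u v y s : motion t x u v y -> 0 <= s <= t -> y s = x s.
Proof. by case=> -[_ h] _; exact: h. Qed.

Lemma motion_exists t x u v : ACpath x -> 0 <= t <= T -> controls T P t u -> controls T Q t v ->
  exists y, motion t x u v y.
Proof.
move=> xA tT cu cv; have [S hS] := ACpath_bounded xA.
have [g [M [gM xE]]] := ACpathP xA; have [C1 _ hC1] := motion_bound G.
have hS' s : 0 <= s <= t -> `|mkpath (x 0) g s| <= S by rewrite -xE.
by have [] := hC1 t (x 0) g M S u v gM tT cu cv hS'; rewrite -xE.
Qed.

(** This separates a motion into a part determined by the initial path and a fractional
    integral of a density with a uniform bound; the two parts range over compact sets. *)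
Lemma motion_decomposition : exists2 C1 : R, 0 < C1 &
  forall t x u v y S, ACpath x -> 0 <= t <= T -> controls T P t u -> controls T Q t v ->
  (forall s, 0 <= s <= t -> `|x s| <= S) -> motion t x u v y ->
  (forall s, 0 <= s <= T -> `|y s| <= C1 * (1 + S)) /\
  exists h, vbm h (C1 * (1 + S)) /\
    forall s, 0 <= s <= T -> y s = afun alpha t x s + mkpath 0 h s.
Proof.
have [C1 C10 hC1] := motion_bound G; exists C1 => // t x u v y S xA tT cu cv hS my.
have [g [M [gM xE]]] := ACpathP xA.
have hS' s : 0 <= s <= t -> `|mkpath (x 0) g s| <= S by rewrite -xE; exact: hS.
have [_ /(_ y)] := hC1 t (x 0) g M S u v gM tT cu cv hS'.
rewrite -xE => /(_ my)[fv yE yS].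
split => //; exists (glued t (fun=> 0) (fdyn T f t y u v)); split.
  by rewrite -[_ * _]add0r; apply: vbm_glue => //; exact: vbm0.
move=> s sT.
have zb : vbm (fun=> 0 : 'rV[R]_n) 0 by exact: vbm0.
have := mkpath_glued_diff G (x 0) 0 gM zb fv zb tT sT.
have E0 (k : R -> 'rV[R]_n) : (forall r, k r = 0) -> mkpath 0 k s = 0.
  move=> k0; rewrite (mkpath_in _ _ _ sT) add0r; have -> : k = fun=> 0 by apply/funext.
  exact: frac_int_zero.
rewrite (E0 (glued t _ _)); last by move=> r; rewrite /glued; case: ifP.
rewrite (E0 (cutoff t _)); last by move=> r; rewrite /cutoff; case: ifP.
rewrite -yE !subr0 => ->.
rewrite {2}xE (afun_cutoff T0 a01 (x 0) gM tT sT); congr (_ + _).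
rewrite (mkpath_in _ _ _ sT) add0r; congr (frac_int _ _ _ _); apply/funext => r.
by rewrite [X in _ - X](_ : _ = 0) ?subr0// /glued; case: ifP.
Qed.

Lemma motion_afun_difference (r : R) : 0 < r -> exists2 K : R, 0 < K &
  forall t t1 x x' u v u' v' y y', ACpath x -> ACpath x' -> 0 <= t <= t1 -> t1 <= T ->
  controls T P t u -> controls T Q t v -> controls T P t u' -> controls T Q t v' ->
  ae_on t t1 (fun s => u s = u' s) -> ae_on t t1 (fun s => v s = v' s) ->
  motion t x u v y -> motion t x' u' v' y' ->
  (forall s, 0 <= s <= T -> `|y s| <= r) -> (forall s, 0 <= s <= T -> `|y' s| <= r) ->
  (exists N, bmeas (fun s => `|y s - y' s|) N) /\
  forall tau, 0 <= tau <= t1 ->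
  `|y tau - y' tau| <= `|afun alpha t x tau - afun alpha t x' tau|
     + K * RL alpha tau tau (fun s => `|y s - y' s|).
Proof.
move=> r0; have [K K0 hK] := motion_difference G r0; exists K => //.
move=> t t1 x x' u v u' v' y y' xA xA' tt tT cu cv cu' cv' uu vv my my' yr yr'.
have [g [M [gM xE]]] := ACpathP xA; have [g' [M' [gM' xE']]] := ACpathP xA'.
have [] := hK t t1 (x 0) (x' 0) g g' M M' u v u' v' y y' gM gM' tt tT cu cv cu' cv' uu vv.
- by rewrite -xE.
- by rewrite -xE'.
- exact: yr.
- exact: yr'.
move=> h1 h2; split => // tau tauT.
have tT' : 0 <= t <= T by case/andP: tt => -> /le_trans; apply.
have tauT' : 0 <= tau <= T by case/andP: tauT => -> /le_trans; apply.
by rewrite {1}xE {1}xE' (afun_cutoff T0 a01 _ gM tT' tauT') (afun_cutoff T0 a01 _ gM' tT' tauT'); exact: h2.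
Qed.

Lemma afun_sup t x x' S tau : ACpath x -> ACpath x' -> 0 <= t <= T -> 0 <= tau <= T ->
  (forall s, 0 <= s <= t -> `|x s - x' s| <= S) -> `|afun alpha t x tau - afun alpha t x' tau| <= 3 * S.
Proof.
move=> xA xA' tT tauT hS.
have [g [M [gM xE]]] := ACpathP xA; have [g' [M' [gM' xE']]] := ACpathP xA'.
rewrite {1}xE {1}xE' (afun_cutoff T0 a01 _ gM tT tauT) (afun_cutoff T0 a01 _ gM' tT tauT).
by apply: (cutoff_max_principle T0 a01 gM gM' tT tauT) => xi; rewrite -xE -xE'; exact: hS.
Qed.

(** Motions do not anticipate: neither the controls after [t1] nor the initial path after
    [t] influence them on [0, t1]. *)
Lemma motion_unique_local t t1 x x' u v u' v' y y' : ACpath x -> ACpath x' -> 0 <= t <= t1 -> t1 <= T ->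
  controls T P t u -> controls T Q t v -> controls T P t u' -> controls T Q t v' ->
  ae_on t t1 (fun s => u s = u' s) -> ae_on t t1 (fun s => v s = v' s) ->
  (forall s, 0 <= s <= t -> x s = x' s) ->
  motion t x u v y -> motion t x' u' v' y' ->
  forall tau, 0 <= tau <= t1 -> y tau = y' tau.
Proof.
move=> xA xA' tt tT cu cv cu' cv' uu vv xx my my'.
have [S1 hS1] := ACpath_bounded (motion_AC my).
have [S2 hS2] := ACpath_bounded (motion_AC my').
pose r := Num.max S1 S2 + 1.
have S1r : S1 <= r by rewrite /r (le_trans (_ : _ <= Num.max S1 S2)) ?le_max ?lexx// lerDl.
have S2r : S2 <= r by rewrite /r (le_trans (_ : _ <= Num.max S1 S2)) ?le_max ?lexx ?orbT// lerDl.
have r0 : 0 < r.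
  by rewrite /r ltr_wpDl// le_max (le_trans _ (hS1 0))// .
have [K K0 hK] := motion_afun_difference r0.
have [C C0 hC] := fractional_gronwall a01 T0 (ltW K0).
have [[N hN] hd] := hK t t1 x x' u v u' v' y y' xA xA' tt tT cu cv cu' cv' uu vv my my'
  (fun s _ => le_trans (hS1 s) S1r) (fun s _ => le_trans (hS2 s) S2r).
move=> tau tauT; apply/eqP; rewrite -subr_eq0 -normr_le0 -(mulr0 C).
apply: (hC t1 (fun s => `|y s - y' s|) N 0 tT hN (fun s => normr_ge0 _) (lexx 0) _ tau tauT) => s st.
apply: (le_trans (hd s st)); rewrite lerD2r.
rewrite -(mulr0 3); apply: (afun_sup xA xA') => [||xi xit].
- by case/andP: tt => -> /le_trans; apply.
- by case/andP: st => -> /le_trans; apply.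
- by rewrite xx// subrr normr0.
Qed.

Lemma motion_unique t x u v y y' : ACpath x -> 0 <= t <= T -> controls T P t u -> controls T Q t v ->
  motion t x u v y -> motion t x u v y' -> y = y'.
Proof.
move=> xA tT cu cv my my'; apply/funext => s.
have [sT|sT] := boolP (0 <= s <= T); last by have [h _] := motion_AC my; have [h' _] := motion_AC my'; rewrite h// h'.
apply: (motion_unique_local xA xA tT (lexx T) cu cv cu cv _ _ _ my my' sT) => //.
- exact: ae_on_all.
- exact: ae_on_all.
Qed.

Lemma motion_xget t x u v y x' : ACpath x -> 0 <= t <= T -> controls T P t u -> controls T Q t v ->
  motion t x u v y -> xget x' (motion t x u v) = y.
Proof.
move=> xA tT cu cv my; apply: (motion_unique xA tT cu cv) => //.
by apply: xgetPex; exists y.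
Qed.

Lemma motion_restrict t tau x u v y : t <= tau -> motion t x u v y -> motion tau y u v y.
Proof. by move=> tt [[yA _] yf]; split; [split|exact: ae_on_sub yf]. Qed.

(** The Caputo derivative at almost every time before [tau] depends on the path before
    [tau] only. *)
Lemma motion_concat t tau x u v y u' v' w : 0 <= t <= tau -> tau <= T ->
  motion t x u v y -> motion tau y u' v' w -> motion t x (glued tau u u') (glued tau v v') w.
Proof.
move=> /andP[t0 tt] tT my [[wA wy] wf]; have [[yA yx] yf] := my.
split.
  split => // s /andP[s0 st]; rewrite wy ?s0 ?(le_trans st)//.
  by rewrite yx// s0.
apply: (@ae_on_cat _ _ tau).
  have := ae_on_and (ae_on_neq tau t tau) (ae_on_and (ae_on_sub t0 (lexx tau) (caputo_ae_local alpha wy)) (ae_on_sub (lexx t) tT yf)).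
  apply: ae_onW => s /andP[ts st] [sn [-> ->]].
  have lt : s < tau by rewrite lt_neqAle sn.
  by rewrite !glue_lt// wy// (le_trans t0 ts).
by apply: (ae_onW _ wf) => s /andP[ts sT] ->; rewrite !glue_ge.
Qed.

Lemma motion_ae t x u v u' v' : ae_on t T (fun s => u s = u' s) -> ae_on t T (fun s => v s = v' s) ->
  motion t x u v `<=` motion t x u' v'.
Proof.
move=> uu vv y [yY yf]; split => //.
by apply: (ae_onW _ (ae_on_and (ae_on_and uu vv) yf)) => s _ [[-> ->] ->].
Qed.

End Motions.

(** * Lipschitz functions are integrals of bounded functions *)

Section LipschitzDensity.
Context {R : realType}.
Notation leb := (@lebesgue_measure R).
Implicit Types (F : R -> R) (L : R).

Lemma lipschitz_continuous F L : 0 < L -> (forall s t, `|F s - F t| <= L * `|s - t|) -> continuous F.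
Proof.
move=> L0 FL x; apply/cvgrPdist_lt => e e0; near=> t.
apply: (le_lt_trans (FL x t)); rewrite -ltr_pdivlMl// mulrC.
by near: t; apply: cvgr_dist_lt; [exact: cvg_id|exact: divr_gt0].
Unshelve. all: by end_near. Qed.

Lemma stieltjes_itv (c : cumulative R R) (a b : R) : a <= b ->
  lebesgue_stieltjes_measure c (`]a, b]%classic : set R) = (c b - c a)%:E.
Proof.
move=> ab; have -> : lebesgue_stieltjes_measure c (`]a, b]%classic : set R) = wlength c `]a, b]%classic.
  by rewrite /lebesgue_stieltjes_measure/= /measure_extension/= measurable_mu_extE//; exact: is_ocitv.
by rewrite wlength_itv_bnd.
Qed.

(** Both [F + L id] and [L id - F] are nondecreasing, and their Stieltjes measures add
    up to [2 L] times the Lebesgue measure: the first one is thus dominated by it. *)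
Lemma lipschitz_measure F L : 0 < L -> (forall s t, `|F s - F t| <= L * `|s - t|) ->
  exists nu : {measure set (measurableTypeR R) -> \bar R},
    (forall a b : R, a <= b -> nu `]a, b]%classic = (F b - F a + L * (b - a))%:E) /\
    (forall A, measurable A -> (nu A <= (2 * L)%:E * leb A)%E).
Proof.
move=> L0 FL.
have cF := lipschitz_continuous L0 FL.
have cid : continuous (fun s : R => L * s) by move=> x; apply: cvgZr; exact: cvg_id.
have n1 : {homo (fun s => F s + L * s) : x y / x <= y}.
  move=> x y xy; have := FL x y; rewrite (distrC x) (ger0_norm (x := y - x)) ?subr_ge0//.
  by move/ler_normlP => [h1 h2]; lra.
have n2 : {homo (fun s => L * s - F s) : x y / x <= y}.
  move=> x y xy; have := FL x y; rewrite (distrC x) (ger0_norm (x := y - x)) ?subr_ge0//.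
  by move/ler_normlP => [h1 h2]; lra.
have r1 : right_continuous (fun s => F s + L * s).
  by apply: right_continuousW => x; apply: cvgD; [exact: cF|exact: cid].
have r2 : right_continuous (fun s => L * s - F s).
  by apply: right_continuousW => x; apply: cvgB; [exact: cid|exact: cF].
pose c1 : cumulative R R := HB.pack (fun s => F s + L * s) (isCumulative.Build R _ R _ n1 r1).
pose c2 : cumulative R R := HB.pack (fun s => L * s - F s) (isCumulative.Build R _ R _ n2 r2).
pose nu1 := lebesgue_stieltjes_measure c1; pose nu2 := lebesgue_stieltjes_measure c2.
have k0 : 0 <= (2 * L)^-1 by rewrite invr_ge0 mulr_ge0 ?ltW.
pose tot := mscale (NngNum k0) (measure_add nu1 nu2).
have totE A : tot A = (((2 * L)^-1)%:E * (nu1 A + nu2 A))%E by rewrite -measure_addE.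
have E A : measurable A -> leb A = tot A.
  apply: lebesgue_measure_unique => X /ocitvP[->|[[a b] /= ab ->]].
    by rewrite !measure0.
  apply: (eq_trans _ (esym (totE _))); rewrite /nu1 /nu2 !stieltjes_itv ?(ltW ab)//=.
  rewrite lebesgue_measure_itv/= lte_fin ab; congr (_%:E).
  by field; rewrite gt_eqF.
exists nu1; split => [a b ab|A mA].
  by apply: (eq_trans (stieltjes_itv c1 ab)) => /=; congr (_%:E); ring.
have -> : leb A = (((2 * L)^-1)%:E * (nu1 A + nu2 A))%E by rewrite (E A mA) -totE.
rewrite muleA -EFinM divff ?mul1e ?gt_eqF ?mulr_gt0//.
by rewrite leeDl.
Qed.

(** The density is a Radon-Nikodym derivative; the comparison with 2 L times the Lebesgue
    measure bounds it, and subtracting L recenters it. *)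
Lemma lipschitz_density_global T F L : 0 < T -> 0 < L ->
  (forall s t, `|F s - F t| <= L * `|s - t|) ->
  exists2 h, bmeas h L & forall s, 0 <= s <= T -> F s - F 0 = rI 0 s h.
Proof.
move=> T0 L0 FL; have [nu [nuI nuL]] := lipschitz_measure L0 FL.
pose D : set (measurableTypeR R) := `]0, T]%classic.
have mD : measurable D by exact: measurable_itv.
have Doo : (nu D < +oo)%E by rewrite /D nuI ?ltry// ltW.
pose nuD : {finite_measure set (measurableTypeR R) -> \bar R} := mfrestr mD Doo.
have nuDE A : nuD A = nu (A `&` D) by [].
have dom : nuD `<< leb.
  apply/null_content_dominatesP => A mA A0; apply/eqP; rewrite eq_le measure_ge0 andbT nuDE.
  apply: (le_trans (nuL _ (measurableI _ _ mA mD))).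
  rewrite (_ : leb (A `&` D) = 0%E) ?mule0//; apply/eqP; rewrite eq_le measure_ge0 andbT -A0.
  by apply: le_measure; [exact/mem_set/measurableI|exact/mem_set|exact: subIsetl].
pose k x := fine (Radon_Nikodym_SigmaFinite.f nuD leb x).
have kE x : Radon_Nikodym_SigmaFinite.f nuD leb x = (k x)%:E.
  by rewrite /k fineK// Radon_Nikodym_SigmaFinite.f_fin_num.
have k0 x : 0 <= k x by rewrite -lee_fin -kE; exact: Radon_Nikodym_SigmaFinite.f_ge0.
have ki : leb.-integrable setT (EFin \o k).
  by have := Radon_Nikodym_SigmaFinite.f_integrable dom; rewrite (_ : Radon_Nikodym_SigmaFinite.f nuD leb = EFin \o k)//; apply/funext => x; exact: kE.
have mk : measurable_fun setT k by have := measurable_int _ ki => /measurable_EFinP.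
have kint A : measurable A -> nuD A = (\int[leb]_(x in A) (k x)%:E)%E.
  move=> mA; rewrite (Radon_Nikodym_SigmaFinite.f_integral dom mA).
  by apply: eq_integral => x _; exact: kE.
pose A := [set x | 2 * L < k x].
have mA : measurable A.
  rewrite (_ : A = k @^-1` `]2 * L, +oo[%classic); last by apply/seteqP; split => x; rewrite /A/= in_itv/= andbT.
  by rewrite -[X in measurable X]setTI; exact: mk.
have iA : leb.-integrable A (EFin \o k) by exact: integrableS ki.
pose B := A `&` D.
have mB : measurable B by exact: measurableI.
have iB : leb.-integrable B (EFin \o k) by exact: integrableS ki.
have Bfin : (leb B < +oo)%E.
  apply: (@le_lt_trans _ _ (leb D)); last by rewrite /D lebesgue_measure_itv/= lte_fin T0 ltry.
  by apply: le_measure; [exact/mem_set|exact/mem_set|exact: subIsetr].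
have cB : leb.-integrable B (EFin \o (fun=> 2 * L)).
  apply: measurable_bounded_integrable => //; exists (2 * L); split; first exact: num_real.
  by move=> N LN x _ /=; rewrite ger0_norm ?(ltW LN)// mulr_ge0 ?ltW.
have key : (\int[leb]_(x in B) (k x - 2 * L)%:E <= 0)%E.
  rewrite (eq_integral (fun x => (k x)%:E - (2 * L)%:E)%E) => [|x _]; last by rewrite EFinB.
  rewrite integralB_EFin// integral_cst// -kint// nuDE -setIA setIid.
  have fB : ((2 * L)%:E * leb B)%E \is a fin_num by rewrite fin_numM// ge0_fin_numE.
  rewrite leeBlDr// add0e.
  exact: nuL.
have neg : leb.-negligible B.
  have mk' : measurable_fun B (fun x => (k x - 2 * L)%:E).
    by apply/measurable_EFinP; apply: measurable_funB; [exact: measurable_funTS|exact: measurable_cst].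
  have /(ae_eq_integral_abs _ mB mk') : (\int[leb]_(x in B) `|(k x - 2 * L)%:E| = 0)%E.
    apply/eqP; rewrite eq_le integral_ge0// andbT; apply: le_trans key.
    rewrite le_eqVlt; apply/orP; left; apply/eqP; apply: eq_integral => x /set_mem[kx _].
    by rewrite gee0_abs// lee_fin subr_ge0 ltW.
  apply: negligibleS => x Bx /= /(_ Bx)/eqP; rewrite eqe subr_eq0 => /eqP kx.
  by case: Bx; rewrite /A/= kx ltxx.
have kle : ae_on 0 T (fun x => k x <= 2 * L).
  have h : {ae leb, forall x, ~ B x} by apply: negligibleS neg => x /contrapT.
  have h' : ae_on 0 T (fun x => ~ B x).
    by rewrite /ae_on; apply: (@filterS _ _ (ae_filter_ringOfSetsType leb)) h => x h _.
  apply: (ae_onW _ (ae_on_and (ae_on_neq 0 0 T) h')) => x /andP[x0 xT] [xn nB].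
  rewrite leNgt; apply/negP => kx; apply: nB; split => //.
  by rewrite /D/= in_itv/= xT lt_neqAle eq_sym xn x0.
exists (fun x => Num.min (k x) (2 * L) - L).
  split.
    apply: measurable_funB; last exact: measurable_cst.
    by apply: measurable_minr => //; exact: measurable_cst.
  move=> x; have := k0 x; rewrite ler_norml; case: (leP (k x) (2 * L)) => ? ?; apply/andP; split; lra.
move=> s /andP[s0 sT].
have kis : iI 0 s k by exact: integrableS ki.
have -> : rI 0 s (fun x => Num.min (k x) (2 * L) - L) = rI 0 s (fun x => k x - L).
  by apply: rI_ae; apply: (ae_onW _ (ae_on_sub (lexx 0) sT kle)) => x _ kx; rewrite min_l.
rewrite rIB//; last exact: cst_int.
rewrite rI_cst// subr0.
have -> : rI 0 s k = F s - F 0 + L * s; last by ring.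
apply: EFin_inj; rewrite rI_EFin// integral_itv_bndo_bndc; last by apply: measurable_funTS; exact/measurable_EFinP.
rewrite -kint; last exact: measurable_itv.
rewrite nuDE setIidl; last first.
  by move=> x; rewrite /D/= !in_itv/= => /andP[-> h]; rewrite (le_trans h).
by rewrite nuI//= subr0.
Qed.

Lemma lipschitz_density T F L : 0 < T -> 0 < L ->
  (forall s t, 0 <= s <= T -> 0 <= t <= T -> `|F s - F t| <= L * `|s - t|) ->
  exists2 h, bmeas h L & forall s, 0 <= s <= T -> F s - F 0 = rI 0 s h.
Proof.
move=> T0 L0 FL; pose p s := T / 2 + clampr (T / 2) (s - T / 2).
have T2 : 0 <= T / 2 by rewrite divr_ge0// ltW.
have pT s : 0 <= p s <= T.
  have := clampr_norm (s - T / 2) T2; rewrite ler_norml /p => /andP[h1 h2].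
  by apply/andP; split; lra.
have pid s : 0 <= s <= T -> p s = s.
  move=> /andP[s0 sT]; rewrite /p clampr_id; first by ring.
  by rewrite ler_norml; apply/andP; split; lra.
have pl s t : `|p s - p t| <= `|s - t|.
  have -> : p s - p t = clampr (T / 2) (s - T / 2) - clampr (T / 2) (t - T / 2) by rewrite /p; ring.
  have -> : s - t = (s - T / 2) - (t - T / 2) by ring.
  exact: clampr_lip.
have [|h hb hF] := @lipschitz_density_global T (F \o p) L T0 L0.
  move=> s t; apply: (le_trans (FL _ _ (pT s) (pT t))); rewrite ler_wpM2l ?(ltW L0)//.
exists h => // s sT; rewrite -hF//= !pid// lexx ltW//.
Qed.

End LipschitzDensity.

(** * Compact sets of paths *)

Lemma fmap_ultra (U V : Type) (h : U -> V) (F : set_system U) :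
  UltraFilter F -> UltraFilter (fmap h F).
Proof.
move=> UF; split; first exact: fmap_proper_filter.
move=> E EF FE; apply/seteqP; split => A; last exact: FE.
move=> EA; have [//|FA] := in_ultra_setVsetC (h @^-1` A) UF.
have EA' : E (~` A) by apply: FE.
by have [x []] := filter_ex (filterI EA EA').
Qed.

Section PathSpaceTopology.
Context {R : realType} {n : nat} (T : R).
Hypothesis T0 : 0 < T.
Implicit Types (p z : pathsp T n) (e : R) (s t : R).

Lemma pathsp_nbhsP p (A : set (pathsp T n)) : nbhs p A <->
  exists2 e, 0 < e & forall z, (forall t, 0 <= t <= T -> `|p t - z t| < e) -> A z.
Proof.
rewrite uniform_nbhs; split => [[E [entE EA]]|[e e0 eA]].
  move: entE; rewrite -entourage_from_ballE => -[e /= e0 eE].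
  exists e => // z pz; apply: EA => t; rewrite /= in_itv/= => tT.
  by apply: eE; rewrite /= -ball_normE; exact: pz.
exists [set xy : 'rV[R]_n * 'rV[R]_n | ball xy.1 e xy.2]; split.
  exact: (@entourage_ball _ _ (PosNum e0)).
move=> z pz; apply: eA => t tT; have := pz t; rewrite /= in_itv/= -ball_normE; exact.
Qed.

Lemma pathsp_cvgP (F : set_system (pathsp T n)) p : Filter F ->
  (forall e, 0 < e -> F [set z | forall t, 0 <= t <= T -> `|p t - z t| <= e]) -> F --> p.
Proof.
move=> FF h A /pathsp_nbhsP[e e0 eA]; apply: filterS (h _ (divr_gt0 e0 (ltr0n R 2))) => z hz.
by apply: eA => t tT; apply: (le_lt_trans (hz t tT)); lra.
Qed.

Lemma pathsp_near p e : 0 < e -> \forall z \near p, forall t, 0 <= t <= T -> `|p t - z t| < e.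
Proof. by move=> e0; apply/pathsp_nbhsP; exists e. Qed.

(** Along an ultrafilter the functions converge pointwise by boundedness; a finite grid of
    times and equicontinuity make the convergence uniform on [0, T]. *)
Lemma arzela_ascoli (Z : set (pathsp T n)) (B : R) :
  (forall z, Z z -> forall t, 0 <= t <= T -> `|z t| <= B) ->
  (forall e, 0 < e -> exists2 d, 0 < d & forall z, Z z ->
     forall s t, 0 <= s <= T -> 0 <= t <= T -> `|s - t| < d -> `|z s - z t| <= e) ->
  (forall p, (forall e, 0 < e -> exists2 z, Z z & forall t, 0 <= t <= T -> `|p t - z t| <= e) ->
     (forall t, ~~ (0 <= t <= T) -> p t = 0) -> Z p) ->
  compact Z.
Proof.
move=> ZB Zeq Zcl; rewrite compact_ultra => F UF FZ.
have lim t : exists l : 'rV[R]_n, 0 <= t <= T ->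
    forall e, 0 < e -> F [set z : pathsp T n | `|l - z t| <= e].
  have [tT|tT] := boolP (0 <= t <= T); last by exists 0.
  have /choice[l hl] : forall i, exists l : R,
      (fun z : pathsp T n => z t ord0 i) @ F --> l.
    move=> i; have UG : UltraFilter ((fun z : pathsp T n => z t ord0 i) @ F) by exact: fmap_ultra.
    have FB : F [set z : pathsp T n | `[- B, B]%classic (z t ord0 i)].
      apply: filterS FZ => z Zz; rewrite /= in_itv/= -ler_norml.
      by apply: (le_trans (norm_coord _ _)); exact: ZB.
    have := @segment_compact R (- B) B; rewrite compact_ultra => /(_ _ UG FB)[l [_ h]].
    by exists l.
  exists (\row_i l i) => _ e e0.
  have : F [set z : pathsp T n | forall i, `|l i - z t ord0 i| <= e].
    apply: filter_forall => i; have /cvgrPdist_le/(_ e e0) := hl i.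
    exact.
  apply: filterS => z h; apply: norm_leP => [|i]; first exact: ltW.
  by rewrite subvE mxE; exact: h.
have [p0 hp0] := choice lim.
pose p : pathsp T n := fun t => if 0 <= t <= T then p0 t else 0.
have hp t e : 0 <= t <= T -> 0 < e -> F [set z : pathsp T n | `|p t - z t| <= e].
  by move=> tT e0; rewrite /p tT; exact: hp0.
have key e : 0 < e -> F [set z | forall t, 0 <= t <= T -> `|p t - z t| <= e].
  move=> e0; have e5 : 0 < e / 5 by rewrite divr_gt0.
  have [d d0 hd] := Zeq _ e5.
  pose N := (Num.trunc (T / d)).+1.
  have NT : T / N%:R < d.
    rewrite ltr_pdivrMr ?ltr0n// -ltr_pdivrMl//.
    rewrite mulrC.
    have := @Num.Theory.truncnS_gt R (T / d).
    done.
  pose g (i : 'I_N.+1) : R := T / N%:R * i%:R.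
  have gT i : 0 <= g i <= T.
    rewrite /g mulr_ge0 ?divr_ge0 ?(ltW T0)//= -mulrA ler_piMr ?(ltW T0)//.
    by rewrite mulrC ler_pdivrMr ?ltr0n// mul1r ler_nat -ltnS.
  have FG : F [set z : pathsp T n | forall i, `|p (g i) - z (g i)| <= e / 5].
    by apply: filter_forall => i; exact: hp.
  have near_grid t : 0 <= t <= T -> exists i, `|t - g i| < d.
    move=> /andP[t0 tT].
    have Np : 0 < T / N%:R by rewrite divr_gt0// ltr0n.
    have q0 : 0 <= t / (T / N%:R) by rewrite divr_ge0// ltW.
    have /andP[k1 k2] := Num.Theory.truncn_itv q0.
    have kN : (Num.trunc (t / (T / N%:R)) < N.+1)%N.
      rewrite ltnS -(ler_nat R); apply: (le_trans k1).
      by rewrite ler_pdivrMr// mulrC divfK// pnatr_eq0.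
    exists (Ordinal kN); rewrite /g/=.
    move: k1 k2; set k := Num.trunc _; rewrite ler_pdivlMr// ltr_pdivrMr// -natr1 mulrDl mul1r => k1 k2.
    by rewrite ger0_norm mulrC ?subr_ge0//; lra.
  have pp s t : 0 <= s <= T -> 0 <= t <= T -> `|s - t| < d -> `|p s - p t| <= 3 * (e / 5).
    move=> sT tT st.
    have [z [[zs zt] Zz]] := filter_ex (filterI (filterI (hp s _ sT e5) (hp t _ tT e5)) FZ).
    have h := hd z Zz s t sT tT st.
    have -> : p s - p t = (p s - z s) + (z s - z t) + (z t - p t).
      by rewrite !addrA !subrK.
    apply: (le_trans (ler_normD _ _)); rewrite (distrC (z t)).
    have := ler_normD (p s - z s) (z s - z t); move: zs zt => /= zs zt; lra.
  apply: filterS (filterI FG FZ) => z [hz Zz] t tT.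
  have [i ti] := near_grid t tT.
  have h1 := pp _ _ tT (gT i) ti; have h2 := hd z Zz _ _ tT (gT i) ti; have h3 := hz i.
  have -> : p t - z t = (p t - p (g i)) + (p (g i) - z (g i)) + (z (g i) - z t).
    by rewrite !addrA !subrK.
  apply: (le_trans (ler_normD _ _)); rewrite (distrC (z (g i))).
  have := ler_normD (p t - p (g i)) (p (g i) - z (g i)); lra.
have Fp : F --> p by apply: pathsp_cvgP => e; exact: key.
exists p; split => //; apply: Zcl; last by move=> t tT; rewrite /p (negbTE tT).
move=> e e0; have [z [hz Zz]] := filter_ex (filterI (key e e0) FZ).
by exists z.
Qed.

End PathSpaceTopology.

Lemma dist_chain (R : realType) (V : normedModType R) (a b c d : V) (x y z : R) :
  `|a - b| <= x -> `|b - c| <= y -> `|c - d| <= z -> `|a - d| <= x + y + z.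
Proof.
move=> h1 h2 h3; have -> : a - d = (a - b) + (b - c) + (c - d) by rewrite !addrA !subrK.
apply: (le_trans (ler_normD _ _)); apply: lerD => //.
by apply: (le_trans (ler_normD _ _)); apply: lerD.
Qed.

Section ZeroPaths.
Context {R : realType} {n : nat} (T alpha : R).
Hypothesis T0 : 0 < T.
Hypothesis a01 : 0 < alpha < 1.
Implicit Types (h g x : R -> 'rV[R]_n) (phi : R -> R) (s t e M B : R).
Let a0 : 0 < alpha. Proof. by case/andP: a01. Qed.
Let a1 : 0 < alpha <= 1. Proof. by case/andP: a01 => -> /ltW ->. Qed.
Local Notation mkpath := (mkpath T alpha).

Lemma powR_small e : 0 < e -> exists2 d, 0 < d & forall s, 0 <= s <= d -> s `^ alpha <= e.
Proof.
move=> e0; exists (e `^ (alpha^-1)); first exact: powR_gt0.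
move=> s /andP[s0 sd]; apply: (@le_trans _ _ ((e `^ alpha^-1) `^ alpha)).
  by apply: ge0_ler_powR; rewrite ?nnegrE ?powR_ge0// ltW.
by rewrite -powRrM mulVf ?gt_eqF// powRr1// ltW.
Qed.

Lemma path_vbm x B : 0 <= B -> (forall t, ~~ (0 <= t <= T) -> x t = 0) ->
  vmeasurable `[0, T] x -> (forall t, 0 <= t <= T -> `|x t| <= B) -> vbm x B.
Proof.
move=> B0 x0 mx xB; split; last first.
  move=> t; have [tT|tT] := boolP (0 <= t <= T); first exact: xB.
  by rewrite x0// normr0.
move=> i; rewrite (_ : coordf x i = (fun s => x s ord0 i) \_ (`[0, T]%classic : set R)).
  by apply/(measurable_restrictT _ _).1; [exact: measurable_itv|exact: mx].
apply/funext => s; rewrite /coordf /patch; case: ifPn => //.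
by rewrite notin_setE/= in_itv/= => /negP sT; rewrite x0// mxE.
Qed.

(** By Abel inversion the primitive of [phi] vanishes, hence so do its averages over
    intervals of length [r], which differ from its values by at most C r^alpha. *)
Lemma RL_injective phi B C : bmeas phi B ->
  (forall s t, 0 <= s -> s <= t -> t <= T -> `|phi t - phi s| <= C * (t - s) `^ alpha) ->
  (forall s, 0 <= s <= T -> RL (1 - alpha) s s phi = 0) ->
  forall t, 0 <= t <= T -> phi t = 0.
Proof.
move=> pB pC p0 t /andP[t0 tT].
have a01' : 0 < 1 - alpha < 1 by have := a01; lra.
have int0 s : 0 <= s <= T -> rI 0 s phi = 0.
  move=> /andP[s0 sT]; have := abel_inversion a01' s pB.
  have -> : rI 0 s (fun xi => (s - xi) `^ (- (1 - alpha)) * RL (1 - alpha) xi xi phi) = 0.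
    rewrite (@rI_eq _ 0 s _ (fun=> 0)) ?rI_cst ?mul0r// => xi /andP[xi0 xis].
    by rewrite p0 ?mulr0// xi0 (le_trans xis).
  by move=> /esym/eqP; rewrite mulf_eq0 gt_eqF ?reflection_const_gt0//= => /eqP.
have C0 : 0 <= C.
  have := le_trans (normr_ge0 _) (pC 0 T (lexx 0) (ltW T0) (lexx T)).
  by rewrite pmulr_lge0// powR_gt0// subr0.
apply/eqP; rewrite -normr_le0; apply/ler_addgt0Pr => e e0; rewrite add0r.
have [d d0 hd] : exists2 d, 0 < d & forall s, 0 <= s <= d -> s `^ alpha <= e / (C + 1).
  by apply: powR_small; rewrite divr_gt0// ltr_wpDl.
pose r := Num.min d T; have r0 : 0 < r by rewrite lt_min d0.
have rd : r <= d by rewrite ge_min lexx.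
have rT : r <= T by rewrite ge_min lexx orbT.
(* an interval [a, a + r] inside [0, T] which contains t, also when t is close to T *)
pose a := Num.min t (T - r).
have a_ge0 : 0 <= a by rewrite le_min t0 subr_ge0.
have at_ : a <= t by rewrite ge_min lexx.
have tar : t <= a + r by rewrite /a; case: (leP t (T - r)) => h; lra.
have arT : a + r <= T by rewrite -lerBrDr ge_min lexx orbT.
have iI0 : rI a (a + r) phi = 0.
  have aT : 0 <= a <= T by rewrite a_ge0 (le_trans at_).
  have arTT : 0 <= a + r <= T by rewrite arT addr_ge0// ltW.
  have := rI_chasles (b := a) a_ge0 _ (bmeas_int 0 (a + r) pB).
  by rewrite !int0// add0r lerDl (ltW r0) => /(_ isT).
have cb : bmeas (fun=> phi t) `|phi t| by split => //; exact: measurable_cst.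
have db := bmeasB pB cb.
have h1 : `|rI a (a + r) (fun s => phi s - phi t)| <= C * (e / (C + 1)) * r.
  apply: (le_trans (rI_normr (bmeas_int a (a + r) db))).
  apply: (@le_trans _ _ (rI a (a + r) (fun=> C * (e / (C + 1))))); last first.
    by rewrite rI_cst ?lerDl ?(ltW r0)// addrAC subrr add0r.
  apply: rI_le; [exact/iI_normr/(bmeas_int _ _ db)|exact: cst_int|move=> s /andP[as_ sar]].
  have s0 : 0 <= s := le_trans a_ge0 as_.
  have sT : s <= T := le_trans sar arT.
  have [st|/ltW ts] := leP s t.
    rewrite distrC; apply: (le_trans (pC s t s0 st tT)); apply: (ler_wpM2l C0).
    by apply: hd; rewrite subr_ge0 st/=; lra.
  apply: (le_trans (pC t s t0 ts sT)); apply: (ler_wpM2l C0).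
  by apply: hd; rewrite subr_ge0 ts/=; lra.
move: h1; rewrite rIB; [|exact: bmeas_int pB|exact: bmeas_int cb].
rewrite iI0 sub0r normrN rI_cst ?lerDl ?(ltW r0)// (_ : a + r - a = r); last by ring.
rewrite normrM (ger0_norm (ltW r0)) ler_pM2r// => h1; apply: (le_trans h1).
by rewrite mulrA ler_pdivrMr ?ltr_wpDl// mulrC ler_wpM2l ?(ltW e0)// lerDl.
Qed.

Definition zpaths M : set (pathsp T n) := [set z | exists2 h, vbm h M & z = mkpath 0 h].

Lemma RL_zpath h M i s : vbm h M -> 0 <= s <= T ->
  RL (1 - alpha) s s (fun xi => mkpath 0 h xi ord0 i) = Gamma (1 - alpha) * rI 0 s (coordf h i).
Proof.
move=> hM sT; rewrite -(caputo_primitive T0 a01 0 i hM sT) mxE; apply: rI_eq => xi _.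
rewrite mkpath0// subr0 mxE -powRN; congr (_ `^ _ * _); ring.
Qed.

Lemma zpath_modulus h M s t : vbm h M -> 0 <= s <= T -> 0 <= t <= T ->
  `|mkpath 0 h s - mkpath 0 h t| <= 2 * frac_const alpha * M * `|s - t| `^ alpha.
Proof.
move=> hM /andP[s0 sT] /andP[t0 tT]; have [st|/ltW ts] := leP s t.
  rewrite distrC (distrC s) (ger0_norm (x := t - s)) ?subr_ge0//.
  exact: mkpath_modulus hM s0 st tT.
rewrite (ger0_norm (x := s - t)) ?subr_ge0//.
exact: mkpath_modulus hM t0 ts sT.
Qed.

(** A uniform limit [p] has no density a priori. But its fractional integral of order 1 -
    alpha is a limit of Lipschitz functions with a common constant, hence Lipschitz, hence
    the integral of a bounded function; the path with that density is [p], by injectivity. *)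
Lemma zpaths_closed M (p : pathsp T n) : 0 < M ->
  (forall e, 0 < e -> exists2 z, zpaths M z & forall t, 0 <= t <= T -> `|p t - z t| <= e) ->
  (forall t, ~~ (0 <= t <= T) -> p t = 0) -> zpaths M p.
Proof.
move=> M0 pz p0.
have K0 : 0 <= 2 * frac_const alpha * M by rewrite !mulr_ge0 ?(ltW (frac_const_gt0 a01)) ?(ltW M0).
have pmod s t : 0 <= s <= T -> 0 <= t <= T -> `|p s - p t| <= 2 * frac_const alpha * M * `|s - t| `^ alpha.
  move=> sT tT; apply/ler_addgt0Pr => e e0.
  have [z [h hM ->] hz] := pz _ (divr_gt0 e0 (ltr0n R 2)).
  have h2 := hz t tT; rewrite distrC in h2.
  have := dist_chain (hz s sT) (zpath_modulus hM sT tT) h2.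
  by rewrite addrAC -splitr addrC.
pose B := frac_const alpha * M * T `^ alpha + 1.
have B0 : 0 <= B by rewrite /B !addr_ge0 ?mulr_ge0 ?powR_ge0 ?(ltW (frac_const_gt0 a01)) ?(ltW M0).
have pB t : 0 <= t <= T -> `|p t| <= B.
  move=> tT; have [z [h hM ->] hz] := pz 1 ltr01.
  have h1 := mkpath_bound T0 a01 0 hM tT; rewrite normr0 add0r in h1.
  rewrite -(subrK (mkpath 0 h t) (p t)); apply: (le_trans (ler_normD _ _)).
  by have := hz t tT; rewrite /B; lra.
have half : 0 < 2^-1 :> R by rewrite invr_gt0.
have /choice[h_ hh] : forall k : nat, exists h, vbm h M /\
    forall t, 0 <= t <= T -> `|p t - mkpath 0 h t| <= 2^-1 ^+ k.
  by move=> k; have [z [h hM ->] hz] := pz _ (exprn_gt0 k half); exists h.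
have mp : vmeasurable `[0, T] p.
  move=> i; apply: (measurable_fun_cvg (h := fun k s => mkpath 0 (h_ k) s ord0 i)) => [k|s].
    by have [hk _] := hh k; exact: (mkpath_vmeasurable a01 0 hk i).
  rewrite /= in_itv/= => sT; apply/cvgrPdist_le => e e0; near=> k.
  apply: (@le_trans _ _ (1 * 2^-1 ^+ k)).
    rewrite mul1r -subvE; apply: (le_trans (norm_coord _ _)).
    by have [_] := hh k; exact.
  near: k; have /cvgrPdist_le/(_ e e0) := @geometric0 R 1.
  by apply: filterS => k; rewrite sub0r normrN; apply: le_trans (ler_norm _).
have pb := path_vbm B0 p0 mp pB.
have p00 : p 0 = 0.
  have T00 : 0 <= (0 : R) <= T by rewrite lexx ltW.
  apply/eqP; rewrite -normr_le0; apply/ler_addgt0Pr => e e0; rewrite add0r.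
  by have [z [h hM ->] /(_ 0 T00)] := pz e e0; rewrite mkpath0// subr0.
have A0 : 0 < Gamma (1 - alpha) by apply: Gamma_gt0; have := a01; lra.
have L0 : 0 < Gamma (1 - alpha) * M by rewrite mulr_gt0.
have b0 : 0 < 1 - alpha <= 1 by have := a01; lra.
have /choice[k hk] : forall i, exists k, bmeas k (Gamma (1 - alpha) * M) /\
    forall s, 0 <= s <= T -> RL (1 - alpha) s s (coordf p i) = rI 0 s k.
  move=> i; have pi_ := vbm_coord i pb.
  have Glip s t : 0 <= s <= T -> 0 <= t <= T ->
      `|RL (1 - alpha) s s (coordf p i) - RL (1 - alpha) t t (coordf p i)| <=
      Gamma (1 - alpha) * M * `|s - t|.
    move=> sT tT; apply/ler_addgt0Pr => e e0.
    pose D := T `^ (1 - alpha) / (1 - alpha).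
    have D0 : 0 < D by rewrite /D divr_gt0 ?powR_gt0//; case/andP: b0.
    have [z [h hM ->] hz] := pz _ (divr_gt0 e0 (mulr_gt0 (ltr0n R 2) D0)).
    have hi := vbm_coord i hM.
    have hiB (a b : R) : 0 <= a -> a <= b -> `|rI 0 b (coordf h i) - rI 0 a (coordf h i)| <= M * (b - a).
      move=> a_0 ab; rewrite (rI_chasles a_0 ab (bmeas_int 0 b hi)) addrAC subrr add0r.
      exact: rI_bmeas_le.
    have hiL : `|Gamma (1 - alpha) * rI 0 s (coordf h i) - Gamma (1 - alpha) * rI 0 t (coordf h i)|
        <= Gamma (1 - alpha) * M * `|s - t|.
      rewrite -mulrBr normrM (ger0_norm (ltW A0)) -mulrA; apply: (ler_wpM2l (ltW A0)).
      case/andP: sT => s0 sT; case/andP: tT => t0 tT; have [st|/ltW ts] := leP s t.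
        by rewrite distrC (distrC s) (ger0_norm (x := t - s)) ?subr_ge0//; exact: hiB.
      by rewrite (ger0_norm (x := s - t)) ?subr_ge0//; exact: hiB.
    have close r : 0 <= r <= T -> `|RL (1 - alpha) r r (coordf p i) -
        Gamma (1 - alpha) * rI 0 r (coordf h i)| <= e / 2.
      move=> /andP[r0 rT]; rewrite -(RL_zpath i hM); last by rewrite r0.
      have wb : bmeas (fun xi => mkpath 0 h xi ord0 i) (`|0 : 'rV[R]_n| + frac_const alpha * M * T `^ alpha).
        apply: (vbm_coord i (g := mkpath 0 h)); apply: path_vbm.
        - by rewrite addr_ge0// !mulr_ge0 ?powR_ge0 ?(ltW (frac_const_gt0 a01)) ?(ltW M0).
        - by move=> r'; exact: mkpath_out.
        - exact: (mkpath_vmeasurable a01 0 hM).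
        - by move=> r'; exact: (mkpath_bound T0 a01 0 hM).
      have b00 : 0 < 1 - alpha by case/andP: b0.
      have i1 := @RL_int R (1 - alpha) 0 r r _ _ b00 (lexx r) pi_.
      have i2 := @RL_int R (1 - alpha) 0 r r _ _ b00 (lexx r) wb.
      rewrite -rIB//; apply: (le_trans (rI_normr (iIB i1 i2))).
      have kI := @kern_l_int R (1 - alpha) r b00 0 r (lexx r).
      apply: (@le_trans _ _ (rI 0 r (fun xi => e / (2 * D) * (r - xi) `^ (1 - alpha - 1)))).
        apply: rI_le; [exact/iI_normr/iIB|exact: iIZl|move=> xi /andP[xi0 xir]].
        rewrite -mulrBr normrM (ger0_norm (powR_ge0 _ _)) mulrC.
        apply: ler_wpM2r; first exact: powR_ge0.
        rewrite /coordf -subvE; apply: (le_trans (norm_coord _ _)); apply: hz.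
        by rewrite xi0 (le_trans xir).
      rewrite rIZl// rI_kern_l// subr0 subrr powR0 ?gt_eqF// subr0.
      have -> : e / 2 = e / (2 * D) * D by field; rewrite gt_eqF.
      apply: ler_wpM2l; first by rewrite divr_ge0 ?(ltW e0)// mulr_ge0// ltW.
      rewrite /D ler_wpM2r ?invr_ge0 ?(ltW b00)//.
      by apply: ge0_ler_powR; rewrite ?nnegrE ?(ltW b00) ?(ltW T0).
    have h2 := close t tT; rewrite distrC in h2.
    have := dist_chain (close s sT) hiL h2.
    by rewrite addrAC -splitr addrC.
  have [h hL hE] := lipschitz_density T0 L0 Glip.
  exists h; split => // s sT; rewrite -hE// (_ : RL (1 - alpha) 0 0 _ = 0) ?subr0//.
  exact: RL_neg.
pose h : R -> 'rV[R]_n := fun s => \row_i ((Gamma (1 - alpha))^-1 * k i s).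
have hM : vbm h M.
  split=> [i|s].
    rewrite (_ : coordf h i = fun s => (Gamma (1 - alpha))^-1 * k i s).
      by apply: measurable_funM; [exact: measurable_cst|have [[]] := hk i].
    by apply/funext => s; rewrite /coordf /h mxE.
  apply: norm_leP => [|i]; first exact: ltW.
  rewrite mxE normrM ger0_norm ?invr_ge0 ?(ltW A0)// ler_pdivrMl//.
  by have [[_]] := hk i; exact.
exists h => //; apply/funext => t.
have [tT|tT] := boolP (0 <= t <= T); last by rewrite p0// mkpath_out.
have wb : vbm (mkpath 0 h) (`|0 : 'rV[R]_n| + frac_const alpha * M * T `^ alpha).
  apply: path_vbm.
  - by rewrite addr_ge0// !mulr_ge0 ?powR_ge0 ?(ltW (frac_const_gt0 a01)) ?(ltW M0).
  - by move=> r'; exact: mkpath_out.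
  - exact: (mkpath_vmeasurable a01 0 hM).
  - by move=> r'; exact: (mkpath_bound T0 a01 0 hM).
apply: rv_eqP => i; apply/eqP; rewrite -subr_eq0; apply/eqP.
have pi_ := vbm_coord i pb; have wi := vbm_coord i wb.
pose C := 2 * frac_const alpha * M + 2 * frac_const alpha * M.
apply: (RL_injective (C := C) (bmeasB pi_ wi)) => // [s r s0 sr rT|s sT].
  have sT : 0 <= s <= T by rewrite s0 (le_trans sr).
  have rT' : 0 <= r <= T by rewrite rT (le_trans s0).
  have h1 := le_trans (norm_coord _ i) (pmod r s rT' sT).
  have h2 := le_trans (norm_coord _ i) (zpath_modulus hM rT' sT).
  rewrite (ger0_norm (x := r - s)) ?subr_ge0// in h1, h2.
  have -> (a b a' b' : R) : a - b - (a' - b') = (a - a') - (b - b') by ring.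
  rewrite /C mulrDl /coordf.
  apply: (le_trans (ler_normB _ _)); apply: lerD; rewrite -subvE//.
have b00 : 0 < 1 - alpha by case/andP: b0.
have i1 := @RL_int R (1 - alpha) 0 s s _ _ b00 (lexx s) pi_.
have i2 := @RL_int R (1 - alpha) 0 s s _ _ b00 (lexx s) wi.
have -> : RL (1 - alpha) s s (fun r => coordf p i r - coordf (mkpath 0 h) i r) =
    RL (1 - alpha) s s (coordf p i) - RL (1 - alpha) s s (coordf (mkpath 0 h) i).
  by rewrite -rIB//; apply: rI_eq => r _; rewrite mulrBr.
have [kb kE] := hk i; rewrite kE// (RL_zpath i hM sT) -rIZl; last exact: bmeas_int (vbm_coord i hM).
apply/eqP; rewrite subr_eq0; apply/eqP; apply: rI_eq => r _.
by rewrite /coordf /h mxE mulrA divff ?mul1r// gt_eqF.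
Unshelve. all: by end_near. Qed.

(** Equicontinuity holds because a common bound on the densities gives a common Hoelder
    modulus. *)
Lemma compact_zpaths M : 0 < M -> compact (zpaths M).
Proof.
move=> M0; apply: (arzela_ascoli T0 (B := frac_const alpha * M * T `^ alpha)).
- move=> _ [h hM ->] t tT; have := mkpath_bound T0 a01 0 hM tT; rewrite normr0 add0r; exact.
- move=> e e0.
  have K0 : 0 < 2 * frac_const alpha * M by rewrite !mulr_gt0 ?frac_const_gt0.
  have [d d0 hd] := powR_small (divr_gt0 e0 K0).
  exists d => // _ [h hM ->] s t sT tT st.
  apply: (le_trans (zpath_modulus hM sT tT)); rewrite -ler_pdivlMl// mulrC.
  by apply: hd; rewrite normr_ge0 ltW.
- by move=> p; exact: zpaths_closed.
Qed.

End ZeroPaths.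

Section CompactMotions.
Context {R : realType} {n nP nQ : nat} (T alpha : R)
  (P : set 'rV[R]_nP) (Q : set 'rV[R]_nQ)
  (f : R -> 'rV[R]_n -> 'rV[R]_nP -> 'rV[R]_nQ -> 'rV[R]_n)
  (chi : R -> 'rV[R]_n -> 'rV[R]_nP -> 'rV[R]_nQ -> R) (c : R).
Hypothesis G : admissible_game T alpha P Q f chi c.
Implicit Types (x y w g : R -> 'rV[R]_n) (z : 'rV[R]_n) (u : R -> 'rV[R]_nP) (v : R -> 'rV[R]_nQ) (t s M S : R)
  (X : set (pathsp T n)).

Let T0 : 0 < T := ag_T G.
Let a01 : 0 < alpha < 1 := ag_alpha G.
Let a0 : 0 < alpha. Proof. by case/andP: a01. Qed.
Local Notation mkpath := (mkpath T alpha).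
Local Notation motion := (motion T alpha f).
Local Notation ACpath := (ACpath T alpha).

(** Vanishing outside [0, T] is needed to be a point of [ACpath]. *)
Definition apath t (x : pathsp T n) : pathsp T n :=
  fun tau => if 0 <= tau <= T then afun alpha t x tau else 0.

Lemma apathE t x tau : 0 <= tau <= T -> apath t x tau = afun alpha t x tau.
Proof. by rewrite /apath => ->. Qed.

Lemma apath_mkpath t z g M : vbm g M -> 0 <= t <= T -> apath t (mkpath z g) = mkpath z (cutoff t g).
Proof.
move=> gM tT; apply/funext => tau; rewrite /apath; case: ifPn => tauT; last by rewrite mkpath_out.
exact: (afun_cutoff T0 a01 z gM tT tauT).
Qed.

Lemma mkpath_add z g h M M' tau : vbm g M -> vbm h M' ->
  mkpath z g tau + mkpath 0 h tau = mkpath z (fun s => g s + h s) tau.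
Proof.
move=> gM hM; have [tT|tT] := boolP (0 <= tau <= T); last first.
  by rewrite !(mkpath_out _ _ _ tT) addr0.
rewrite !(mkpath_in _ _ _ tT) add0r -addrA; congr (_ + _); apply/eqP.
rewrite eq_sym -subr_eq -(frac_intB a01 (lexx tau) (vbmD gM hM) hM); apply/eqP.
by congr (frac_int _ _ _ _); apply/funext => s; rewrite addrK.
Qed.

(** The bound near each path and the compactness of the set give a common bound. *)
Lemma compact_paths_bounded X : X `<=` ACpath -> compact X ->
  exists2 B, 0 < B & forall x, X x -> forall s, `|x s| <= B.
Proof.
move=> XA cX; move/compact_near_coveringP : cX => /(_ R +oo%R
  (fun B (x : pathsp T n) => 0 < B /\ forall s, 0 <= s <= T -> `|x s| <= B) _) [|M [Mr hM]].
  move=> x Xx; have [S hS] := ACpath_bounded G (XA _ Xx).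
  exists ([set z | forall s, 0 <= s <= T -> `|x s - z s| < 1], [set B | S + 1 < B]).
    by split; [exact: (pathsp_near x ltr01)|apply: nbhs_pinfty_gt; exact: num_real].
  move=> [z B] [/= hz SB]; have S0 : 0 <= S := le_trans (normr_ge0 _) (hS 0).
  split; first lra.
  move=> s sT; have -> : z s = x s - (x s - z s) by rewrite opprB addrCA subrr addr0.
  apply: (le_trans (ler_normB _ _)); have := hS s; have := hz s sT; lra.
have /hM h : M < M + 1 by rewrite ltrDl.
exists (Num.max 1 (M + 1)); first by rewrite lt_max ltr01.
move=> x Xx s; have [tT|tT] := boolP (0 <= s <= T).
  by have [_ /(_ s tT) h'] := h x Xx; rewrite le_max h' orbT.
by have [x0 _] := XA _ Xx; rewrite (x0 _ tT) normr0 le_max ler01.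
Qed.

(** In the path by the maximum principle, in time because moving the cutoff changes the
    density on a short interval only. *)
Lemma apath_continuous X : X `<=` ACpath ->
  {within (`[0, T]%classic : set R) `*` X, continuous (fun p : R * pathsp T n => apath p.1 p.2)}.
Proof.
move=> XA; apply/subspace_continuousP => -[t0 x0] [/= + Xx0]; rewrite in_itv/= => t0T.
apply: pathsp_cvgP => e e0.
have [g0 [M0 [gM xE]]] := ACpathP (XA _ Xx0).
have K0 : 0 < frac_const alpha * (M0 + M0) + 1.
  by rewrite ltr_wpDl// mulr_ge0 ?(ltW (frac_const_gt0 a01))// addr_ge0 ?(vbm_ge0 gM).
have [d d0 hd] := powR_small a01 (divr_gt0 (divr_gt0 e0 (ltr0n R 2)) K0).
exists (ball t0 d, [set z | forall s, 0 <= s <= T -> `|x0 s - z s| < e / 6]).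
  by split; [exact: nbhsx_ballx|apply: pathsp_near => //; exact: divr_gt0].
move=> [t x] [/= td xx0] [/=]; rewrite in_itv/= => tT Xx tau tauT.
have := XA _ Xx => xA.
rewrite /from_subspace /= !apathE//.
have h1 : `|afun alpha t0 x0 tau - afun alpha t x0 tau| <= e / 2.
  rewrite xE (afun_cutoff T0 a01 _ gM t0T tauT) (afun_cutoff T0 a01 _ gM tT tauT).
  have tt0 : `|t0 - t| < d by [].
  have hcut a b : 0 <= a -> a <= b -> `|mkpath (x0 0) (cutoff a g0) tau -
      mkpath (x0 0) (cutoff b g0) tau| <= frac_const alpha * (M0 + M0) * (b - a) `^ alpha.
    move=> aa ab.
    apply: (mkpath_support T a01 (x0 0) tau aa ab _ _ (vbm_cutoff a gM) (vbm_cutoff b gM)) => s.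
      by move=> _ sa; rewrite /cutoff !mem_set//= in_itv/= ltW// (lt_le_trans sa).
    move=> bs; rewrite /cutoff memNset/=; last by rewrite in_itv/= leNgt (le_lt_trans ab).
    by rewrite memNset//= in_itv/= leNgt bs.
  apply: (@le_trans _ _ (frac_const alpha * (M0 + M0) * `|t0 - t| `^ alpha)).
    case/andP: t0T => t00 _; case/andP: tT => t1 _.
    have [le|/ltW le] := leP t0 t.
      by rewrite (distrC t0) (ger0_norm (x := t - t0)) ?subr_ge0//; exact: hcut.
    by rewrite distrC (ger0_norm (x := t0 - t)) ?subr_ge0//; exact: hcut.
  apply: (@le_trans _ _ ((frac_const alpha * (M0 + M0) + 1) * `|t0 - t| `^ alpha)).
    by rewrite ler_wpM2r ?powR_ge0// lerDl.
  by rewrite -ler_pdivlMl// mulrC; apply: hd; rewrite normr_ge0 ltW.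
have h2 : `|afun alpha t x0 tau - afun alpha t x tau| <= 3 * (e / 6).
  apply: (afun_sup G (XA _ Xx0) xA tT tauT) => s /andP[s0 st].
  by apply/ltW/xx0; rewrite s0 (le_trans st)//; case/andP: tT.
apply: (le_trans (ler_distD (afun alpha t x0 tau) _ _)).
have -> : e = e / 2 + 3 * (e / 6) by field.
exact: lerD h1 h2.
Qed.

(** By [motion_decomposition] the motions lie in the sum of the continuations of the paths
    of [X], a continuous image of [0, T] x X, and a compact set of fractional integrals. *)
Lemma motions_compact X : X `<=` ACpath -> compact X -> exists K : set (pathsp T n),
  [/\ compact K, K `<=` ACpath, X `<=` K &
    forall t x u v y, 0 <= t <= T -> X x -> controls T P t u -> controls T Q t v ->
      motion t x u v y -> K y].
Proof.
move=> XA cX; have [B B0 hB] := compact_paths_bounded XA cX.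
have [C1 C10 hC1] := motion_decomposition G.
pose M := C1 * (1 + B); have M0 : 0 < M by rewrite mulr_gt0// addr_gt0.
pose A := [set apath p.1 p.2 | p in (`[0, T]%classic : set R) `*` X].
have cA : compact A.
  apply: continuous_compact; first exact: apath_continuous.
  by apply: compact_setX => //; exact: segment_compact.
pose add (p : pathsp T n * pathsp T n) : pathsp T n := fun tau => p.1 tau + p.2 tau.
have cadd : continuous add.
  move=> [a z]; apply: pathsp_cvgP => e e0.
  exists ([set a' | forall s, 0 <= s <= T -> `|a s - a' s| < e / 2],
          [set z' | forall s, 0 <= s <= T -> `|z s - z' s| < e / 2]).
    by split; apply: pathsp_near => //; exact: divr_gt0.
  move=> [a' z'] [/= ha hz] s sT; rewrite /add/= opprD addrACA.
  by apply: (le_trans (ler_normD _ _)); have := ha s sT; have := hz s sT; lra.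
pose K := add @` (A `*` @zpaths R n T alpha M).
have inK t x h : 0 <= t <= T -> X x -> vbm h M -> K (add (apath t x, mkpath 0 h)).
  move=> tT Xx hM; exists (apath t x, mkpath 0 h) => //; split => /=; last by exists h.
  by exists (t, x) => //; split => //=; rewrite in_itv.
have T0T : 0 <= T <= T by rewrite lexx ltW.
exists K; split.
- apply: continuous_compact; first exact: continuous_subspaceT.
  by apply: compact_setX => //; exact: compact_zpaths.
- move=> _ [[a z] [/= [[t x] [/= tT Xx] <-] [h hM ->]] <-]; rewrite in_itv/= in tT.
  have [g [N [gN xE]]] := ACpathP (XA _ Xx).
  rewrite (_ : add _ = mkpath (x 0) (fun s => cutoff t g s + h s)).
    exact: (mkpath_ACpath alpha T0 _ (vbmD (vbm_cutoff t gN) hM)).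
  apply/funext => tau; rewrite /add/= {1}xE (apath_mkpath _ gN tT).
  exact: (mkpath_add _ _ (vbm_cutoff t gN) hM).
- move=> x Xx; rewrite (_ : x = add (apath T x, mkpath 0 (fun=> 0))).
    by apply: inK => //; apply: vbm0; exact: ltW.
  apply/funext => tau; rewrite /add/=.
  have [tT|tT] := boolP (0 <= tau <= T); last first.
    by rewrite mkpath_out// /apath (negbTE tT) addr0; have [x0 _] := XA _ Xx; exact: x0.
  rewrite (mkpath_in _ _ _ tT) frac_int_zero !addr0 apathE//.
  by rewrite /afun; case/andP: tT => _ ->.
- move=> t x u v y tT Xx cu cv my.
  have [_ [h [hM yE]]] := hC1 t x u v y B (XA _ Xx) tT cu cv (fun s _ => hB x Xx s) my.
  rewrite (_ : y = add (apath t x, mkpath 0 h)); first exact: inK.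
  apply/funext => tau; rewrite /add/=.
  have [tauT|tauT] := boolP (0 <= tau <= T); first by rewrite yE// apathE.
  by rewrite mkpath_out// /apath (negbTE tauT) addr0; have [h' _] := motion_AC my; rewrite h'.
Qed.

End CompactMotions.

(** * The cost *)

Section Costs.
Context {R : realType} {n nP nQ : nat} (T alpha : R)
  (P : set 'rV[R]_nP) (Q : set 'rV[R]_nQ)
  (f : R -> 'rV[R]_n -> 'rV[R]_nP -> 'rV[R]_nQ -> 'rV[R]_n)
  (chi : R -> 'rV[R]_n -> 'rV[R]_nP -> 'rV[R]_nQ -> R) (c : R).
Hypothesis G : admissible_game T alpha P Q f chi c.
Variable sigma : (R -> 'rV[R]_n) -> R.
Implicit Types (x y w g : R -> 'rV[R]_n) (z : 'rV[R]_n) (u : R -> 'rV[R]_nP) (v : R -> 'rV[R]_nQ) (t s M S : R)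
  (X : set (pathsp T n)).

Let T0 : 0 < T := ag_T G.
Let a01 : 0 < alpha < 1 := ag_alpha G.
Local Notation motion := (motion T alpha f).
Local Notation ACpath := (ACpath T alpha).
Local Notation cost := (cost T alpha f chi sigma).

(** Continuity on a compact set gives the bound at the state 0, and the Lipschitz
    condition extends it to balls. *)
Lemma chi_bound (r : R) : 0 < r -> exists2 B : R, 0 < B &
  forall t (x : 'rV[R]_n) p q, 0 <= t <= T -> `|x| <= r -> P p -> Q q -> `|chi t x p q| <= B.
Proof.
move=> r0; have [L L0 hL] := data_lip G r0.
pose A : set (R * 'rV[R]_n * 'rV[R]_nP * 'rV[R]_nQ) :=
  ((`[0, T]%classic : set R) `*` [set 0]) `*` P `*` Q.
have AD : A `<=` data_domain T P Q.
  by move=> [[[t x] p] q] [[[/= tT _] Pp] Qq]; split => //; rewrite /= in_itv/= in tT.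
have cA : compact A.
  apply: compact_setX; last exact: ag_Q G.
  apply: compact_setX; last exact: ag_P G.
  by apply: compact_setX; [exact: segment_compact|exact: compact_set1].
have := compact_bounded (continuous_compact (continuous_subspaceW AD (ag_chi G)) cA).
move=> [M [Mr hM]].
pose B := Num.max 0 (M + 1).
have B0 : 0 <= B by rewrite le_max lexx.
exists (B + L * r); first by rewrite ltr_wpDl// mulr_gt0.
move=> t x p q tT xr Pp Qq.
have h0 : `|chi t 0 p q| <= B.
  rewrite /B le_max; apply/orP; right; apply: hM; first by rewrite ltrDl.
  by exists (t, 0, p, q) => //; split => //; split => //; split => //=; rewrite in_itv.
have n0 : `|0 : 'rV[R]_n| <= r by rewrite normr0 ltW.
have [_ h1] := hL t x 0 p q tT xr n0 Pp Qq; rewrite subr0 in h1.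
have -> : chi t x p q = chi t 0 p q + (chi t x p q - chi t 0 p q) by rewrite addrC subrK.
apply: (le_trans (ler_normD _ _)); apply: lerD => //; apply: (le_trans h1).
by rewrite ler_wpM2l// ltW.
Qed.

(** Extended by zero outside [t, T], so as to be bounded and measurable on the whole line. *)
Definition running t y u v s : R :=
  if s \in (`[t, T]%classic : set R) then chi s (y s) (u s) (v s) else 0.

Lemma running_in t y u v s : t <= s <= T -> running t y u v s = chi s (y s) (u s) (v s).
Proof. by move=> ts; rewrite /running mem_set//= in_itv. Qed.

Lemma running_bmeas t y u v B r : 0 <= t -> controls T P t u -> controls T Q t v ->
  vmeasurable `[0, T] y -> (forall s, 0 <= s <= T -> `|y s| <= r) ->
  (forall t (x : 'rV[R]_n) p q, 0 <= t <= T -> `|x| <= r -> P p -> Q q -> `|chi t x p q| <= B) ->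
  0 <= B -> bmeas (running t y u v) B.
Proof.
move=> t0 cu cv my yr hB B0; split.
  rewrite (_ : running t y u v =
      (fun s => chi s (y s) (u s) (v s)) \_ (`[t, T]%classic : set R)).
    apply/(measurable_restrictT _ _).1; first exact: measurable_itv.
    apply: (data_measurable (F := chi) (ag_chi G) t0 cu cv) => i.
    apply: (measurable_funS (measurable_itv _) _ (my i)) => s.
    by rewrite /= !in_itv/= => /andP[ts ->]; rewrite (le_trans t0 ts).
  by apply/funext => s; rewrite /running /patch.
move=> s; rewrite /running; case: ifPn => [|_]; last by rewrite normr0.
rewrite inE/= in_itv/= => /andP[ts sT].
have sT' : 0 <= s <= T by rewrite (le_trans t0 ts).
apply: hB => //; first exact: yr.
- by case: cu => _; apply; rewrite ts.
- by case: cv => _; apply; rewrite ts.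
Qed.

Lemma rI_running t a b y u v : t <= a -> b <= T ->
  rI a b (fun s => chi s (y s) (u s) (v s)) = rI a b (running t y u v).
Proof.
move=> ta bT; apply: rI_eq => s /andP[as_ sb].
by rewrite running_in// (le_trans ta as_) (le_trans sb).
Qed.

Lemma running_int t y u v : 0 <= t -> ACpath y -> controls T P t u -> controls T Q t v ->
  exists B, bmeas (running t y u v) B.
Proof.
move=> t0 yA cu cv; have [S hS] := ACpath_bounded G yA.
have S0 : 0 <= S := le_trans (normr_ge0 _) (hS 0).
have r0 : 0 < S + 1 by rewrite ltr_wpDl.
have [B B0 hB] := chi_bound r0; exists B.
apply: (running_bmeas t0 cu cv (ACpath_vmeasurable G yA) _ hB (ltW B0)) => s _.
by apply: (le_trans (hS s)); rewrite lerDl.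
Qed.

Lemma costE t x u v y : ACpath x -> 0 <= t <= T -> controls T P t u -> controls T Q t v ->
  motion t x u v y -> cost t x u v = sigma y + rI t T (fun s => chi s (y s) (u s) (v s)).
Proof.
by move=> xA tT cu cv my; rewrite /Defs.cost (motion_xget G _ xA tT cu cv my).
Qed.

Lemma cost_split t tau x u v y : ACpath x -> 0 <= t <= tau -> tau <= T ->
  controls T P t u -> controls T Q t v -> motion t x u v y ->
  cost t x u v = rI t tau (fun s => chi s (y s) (u s) (v s)) + cost tau y u v.
Proof.
move=> xA /andP[t0 tt] tT cu cv my; have yA := motion_AC my.
have tT' : 0 <= t <= T by rewrite t0 (le_trans tt).
have tauT : 0 <= tau <= T by rewrite (le_trans t0 tt).
rewrite (costE xA tT' cu cv my) (costE yA tauT (controls_sub tt cu) (controls_sub tt cv) (motion_restrict tt my)).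
rewrite addrCA; congr (_ + _); have [B hB] := running_int t0 yA cu cv.
rewrite !(rI_running _ _ _ (lexx t))// (rI_running _ _ _ tt)//.
by apply: rI_chasles => //; exact: bmeas_int hB.
Qed.

(** At the final time every motion is the given path. *)
Lemma cost_final x u v : ACpath x -> controls T P T u -> controls T Q T v -> cost T x u v = sigma x.
Proof.
move=> xA cu cv; have TT : 0 <= T <= T by rewrite lexx ltW.
have [y my] := motion_exists G xA TT cu cv.
rewrite (costE xA TT cu cv my) rI_point// addr0; congr (sigma _); apply/funext => s.
have [sT|sT] := boolP (0 <= s <= T); first exact: motion_initial my sT.
by have [h _] := motion_AC my; have [h' _] := xA; rewrite h// h'.
Qed.

End Costs.

(** * The value and dynamic programming *)

Section Enorm.
Context {R : realType} {n : nat}.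

Lemma enorm_bmeas (d : R -> 'rV[R]_n) M : vbm d M -> bmeas (fun s => enorm (d s)) (n%:R * M).
Proof.
move=> [md dM]; split.
  rewrite /enorm /dotv; apply: (@measurableT_comp _ _ _ _ _ _ (@Num.sqrt R)).
    by apply: continuous_measurable_fun; exact: sqrt_continuous.
  by apply: measurable_sum => i; apply: measurable_funM; exact: (md i).
move=> s; rewrite ger0_norm ?enorm_ge0//; apply: (le_trans (enorm_le_norm _)).
by rewrite ler_wpM2l.
Qed.

End Enorm.

Section Value.
Context {R : realType} {n nP nQ : nat} (T alpha : R)
  (P : set 'rV[R]_nP) (Q : set 'rV[R]_nQ)
  (f : R -> 'rV[R]_n -> 'rV[R]_nP -> 'rV[R]_nQ -> 'rV[R]_n)
  (chi : R -> 'rV[R]_n -> 'rV[R]_nP -> 'rV[R]_nQ -> R) (c : R).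
Hypothesis G : admissible_game T alpha P Q f chi c.
Variable sigma : (R -> 'rV[R]_n) -> R.
Implicit Types (x y w g : R -> 'rV[R]_n) (z : 'rV[R]_n) (u : R -> 'rV[R]_nP) (v : R -> 'rV[R]_nQ) (t s M S : R)
  (X : set (pathsp T n)).

Let T0 : 0 < T := ag_T G.
Let a01 : 0 < alpha < 1 := ag_alpha G.
Local Notation motion := (motion T alpha f).
Local Notation ACpath := (ACpath T alpha).
Local Notation cost := (cost T alpha f chi sigma).
Local Notation value := (value T alpha P Q f chi sigma).
Local Notation strategies1 := (strategies1 T P Q).

Hypothesis hsigma : forall X, X `<=` ACpath -> compact X ->
     exists2 lambda : R, 0 < lambda &
       forall x y : R -> 'rV[R]_n, X x -> X y ->
         `|sigma x - sigma y| <= lambda * (enorm (x T - y T)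
           + rI 0 T (fun tau => enorm (x tau - y tau))).

Lemma ACpath_vbm x B : ACpath x -> (forall s, `|x s| <= B) -> vbm x B.
Proof.
move=> xA xB; apply: (path_vbm (T := T)) => //.
- exact: le_trans (normr_ge0 _) (xB 0).
- by case: xA.
- exact: (ACpath_vmeasurable G xA).
Qed.

Lemma sigma_bound X : X `<=` ACpath -> compact X -> exists2 B, 0 < B &
  forall x, X x -> `|sigma x| <= B.
Proof.
move=> XA cX; have [l l0 hl] := hsigma XA cX.
have [B B0 hB] := compact_paths_bounded G XA cX.
have [[x0 Xx0]|nX] := pselect (exists x, X x); last first.
  by exists 1 => // x Xx; case: nX; exists x.
pose D := n%:R * (B + B); have D0 : 0 <= D by rewrite mulr_ge0// addr_ge0// ltW.
exists (`|sigma x0| + l * (D + D * T) + 1).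
  by rewrite ltr_wpDl// addr_ge0// mulr_ge0 ?(ltW l0)// addr_ge0// mulr_ge0// ltW.
move=> x Xx; have -> : sigma x = sigma x0 + (sigma x - sigma x0) by rewrite addrC subrK.
have db := vbmB (ACpath_vbm (XA _ Xx) (hB x Xx)) (ACpath_vbm (XA _ Xx0) (hB x0 Xx0)).
have eb := enorm_bmeas db.
apply: (le_trans (ler_normD _ _)); rewrite -addrA lerD2l.
apply: (@le_trans _ _ (l * (D + D * T))); last by rewrite lerDl.
apply: (le_trans (hl x x0 Xx Xx0)); apply: (ler_wpM2l (ltW l0)); apply: lerD.
  by have [_ /(_ T)] := eb; rewrite ger0_norm// enorm_ge0.
apply: (le_trans (ler_norm _)); have := rI_bmeas_le (ltW T0) eb.
by rewrite subr0.
Qed.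

Lemma cost_bound X : X `<=` ACpath -> compact X -> exists2 B, 0 < B &
  forall t x u v, 0 <= t <= T -> X x -> controls T P t u -> controls T Q t v ->
  `|cost t x u v| <= B.
Proof.
move=> XA cX; have [K [cK frac_const XK hK]] := motions_compact G XA cX.
have [B1 B10 hB1] := sigma_bound frac_const cK.
have [r r0 hr] := compact_paths_bounded G frac_const cK.
have [B2 B20 hB2] := chi_bound G r0.
exists (B1 + B2 * T); first by rewrite addr_gt0// mulr_gt0.
move=> t x u v tT Xx cu cv; have [y my] := motion_exists G (XA _ Xx) tT cu cv.
have Ky := hK _ _ _ _ _ tT Xx cu cv my; have /andP[t0 tT'] := tT.
rewrite (costE G sigma (XA _ Xx) tT cu cv my); apply: (le_trans (ler_normD _ _)).
apply: lerD; first exact: hB1.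
have yb := running_bmeas G t0 cu cv (ACpath_vmeasurable G (frac_const _ Ky)) (fun s _ => hr y Ky s) hB2 (ltW B20).
rewrite (rI_running chi _ _ _ (lexx t) (lexx T)); apply: (le_trans (rI_bmeas_le tT' yb)).
by rewrite ler_wpM2l ?(ltW B20)// lerBlDr lerDl.
Qed.

Lemma compact_path1 x : ACpath x -> [set (x : pathsp T n)] `<=` ACpath /\ compact [set (x : pathsp T n)].
Proof. by move=> xA; split; [move=> _ ->|exact: compact_set1]. Qed.

Lemma controls_nonempty t : (exists u, controls T P t u) /\ (exists v, controls T Q t v).
Proof.
have [p Pp] := ag_P0 G; have [q Qq] := ag_Q0 G.
by split; [exists (fun=> p)|exists (fun=> q)]; exact: controls_cst.
Qed.

Lemma strategies_cst t u : controls T P t u -> strategies1 t (fun=> u).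
Proof. by move=> cu; split => // *; exact: ae_on_all. Qed.

Lemma upper_ge t x a v : 0 <= t <= T -> ACpath x -> strategies1 t a -> controls T Q t v ->
  cost t x (a v) v <= sup [set cost t x (a v) v | v in controls T Q t].
Proof.
move=> tT xA [aP _] cv; have [h1 h2] := compact_path1 xA.
have [B _ hB] := cost_bound h1 h2.
apply: ub_le_sup; last by exists v.
exists B => _ [w cw <-]; apply: (le_trans (ler_norm _)).
by apply: hB => //; exact: aP.
Qed.

(** Since motions starting at the final time are constant continuations, the expression as
    an infimum of suprema also holds for t = T; dynamic programming up to the final time
    needs no special case. *)
Lemma valueE t x : 0 <= t <= T -> ACpath x -> value t x =
  inf [set sup [set cost t x (a v) v | v in controls T Q t] | a in strategies1 t].
Proof.
move=> /andP[t0 tT] xA; rewrite /Defs.value; case: ltP => // Tt.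
have {tT Tt}tT : t = T by apply/eqP; rewrite eq_le tT Tt.
rewrite tT; have [[u0 cu0] [v0 cv0]] := controls_nonempty T.
rewrite (_ : [set _ | a in _] = [set sigma x]) ?inf1//.
apply/seteqP; split => [_ [a [aP _] <-]|_ ->].
  rewrite (_ : [set _ | v in _] = [set sigma x]) ?sup1//; apply/seteqP; split => [_ [v cv <-]|_ ->].
    by rewrite /= (cost_final G sigma xA (aP _ cv) cv).
  by exists v0 => //; rewrite (cost_final G sigma xA (aP _ cv0) cv0).
exists (fun=> u0); first exact: strategies_cst.
rewrite (_ : [set _ | v in _] = [set sigma x]) ?sup1//; apply/seteqP; split => [_ [v cv <-]|_ ->].
  by rewrite /= (cost_final G sigma xA cu0 cv).
by exists v0 => //; rewrite (cost_final G sigma xA cu0 cv0).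
Qed.

Lemma value_final x : value T x = sigma x.
Proof. by rewrite /Defs.value ltxx. Qed.

Lemma upper_lbound t x : 0 <= t <= T -> ACpath x ->
  has_lbound [set sup [set cost t x (a v) v | v in controls T Q t] | a in strategies1 t].
Proof.
move=> tT xA; have [h1 h2] := compact_path1 xA; have [B _ hB] := cost_bound h1 h2.
have [_ [v0 cv0]] := controls_nonempty t.
exists (- B) => _ [a sa <-]; apply: le_trans (upper_ge tT xA sa cv0).
have [aP _] := sa; have := hB t x (a v0) v0 tT erefl (aP _ cv0) cv0.
by rewrite ler_norml => /andP[].
Qed.

Lemma value_le t x a B : 0 <= t <= T -> ACpath x -> strategies1 t a ->
  (forall v, controls T Q t v -> cost t x (a v) v <= B) -> value t x <= B.
Proof.
move=> tT xA sa hB; rewrite valueE//.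
apply: (@le_trans _ _ (sup [set cost t x (a v) v | v in controls T Q t])).
  by apply: ge_inf; [exact: upper_lbound|exists a].
have [_ [v0 cv0]] := controls_nonempty t.
apply: ge_sup; first by exists (cost t x (a v0) v0); exists v0.
by move=> _ [v cv <-]; exact: hB.
Qed.

Lemma value_near t x e : 0 <= t <= T -> ACpath x -> 0 < e ->
  exists2 a, strategies1 t a & forall v, controls T Q t v -> cost t x (a v) v <= value t x + e.
Proof.
move=> tT xA e0; have [[u0 cu0] _] := controls_nonempty t.
have : has_inf [set sup [set cost t x (a v) v | v in controls T Q t] | a in strategies1 t].
  split; last exact: upper_lbound.
  by exists (sup [set cost t x u0 v | v in controls T Q t]), (fun=> u0) => //; exact: strategies_cst.
move/(inf_adherent e0) => [_ [a sa <-]]; rewrite -valueE// => ha.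
by exists a => // v cv; apply: le_trans (ltW ha); exact: upper_ge.
Qed.

Lemma glue_ae {m : nat} tau (a b : R -> 'rV[R]_m) t : ae_on t tau (fun s => glued tau a b s = a s).
Proof.
by apply: (ae_onW _ (ae_on_neq tau t tau)) => s /andP[_ st] sn; rewrite glue_lt// lt_neqAle sn.
Qed.

(** Suboptimality: after any start of the game, what is left is worth at most what a
    given strategy still guarantees, because the strategy restarts at [tau]. *)
Lemma dpp_ge t tau x a v1 y B : ACpath x -> 0 <= t <= tau -> tau <= T -> strategies1 t a ->
  controls T Q t v1 -> motion t x (a v1) v1 y ->
  (forall v, controls T Q t v -> cost t x (a v) v <= B) ->
  rI t tau (fun s => chi s (y s) (a v1 s) (v1 s)) + value tau y <= B.
Proof.
move=> xA /andP[t0 tt] tT [aP aN] cv1 my hB; have yA := motion_AC my.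
have tT' : 0 <= t <= T by rewrite t0 (le_trans tt).
have tauT : 0 <= tau <= T by rewrite (le_trans t0 tt).
have ttT : t <= tau <= T by rewrite tt.
have cg v : controls T Q tau v -> controls T Q t (glued tau v1 v).
  exact: (controls_glue ttT cv1).
rewrite addrC -lerBrDr.
apply: (@value_le tau y (fun v => a (glued tau v1 v))) => //.
  split=> [v cv|s v v' /andP[ts sT] cv cv' vv]; first exact: (controls_sub tt (aP _ (cg _ cv))).
  apply: (ae_on_sub tt (lexx s)); apply: aN; [by rewrite (le_trans tt)|exact: cg|exact: cg|].
  apply: (@ae_on_cat _ _ tau).
    by apply: ae_onW (ae_on_and (glue_ae tau v1 v t) (glue_ae tau v1 v' t)) => r _ [-> ->].
  by apply: ae_onW vv => r /andP[h _] e; rewrite !glue_ge.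
move=> v cv; rewrite lerBrDr addrC.
have cgv := cg v cv; have ca := aP _ cgv; have ca1 := aP _ cv1.
have cat := controls_sub tt ca.
have [w mw] := motion_exists G yA tauT cat cv.
have t0t : 0 <= t <= tau by rewrite t0.
have mw' := motion_concat t0t tT my mw.
have ae1 : ae_on t tau (fun s => a (glued tau v1 v) s = a v1 s).
  apply: aN => //; exact: glue_ae.
have ae2 : ae_on t T (fun s => glued tau (a v1) (a (glued tau v1 v)) s = a (glued tau v1 v) s).
  apply: (@ae_on_cat _ _ tau).
    by apply: ae_onW (ae_on_and (glue_ae tau (a v1) (a (glued tau v1 v)) t) ae1) => s _ [-> ->].
  by apply: ae_on_all => s /andP[h _]; rewrite glue_ge.
have mw2 : motion t x (a (glued tau v1 v)) (glued tau v1 v) w.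
  by apply: motion_ae mw' => //; exact: ae_on_all.
apply: le_trans (hB _ cgv); rewrite (cost_split G sigma xA t0t tT ca cgv mw2).
have -> : rI t tau (fun s => chi s (w s) (a (glued tau v1 v) s) (glued tau v1 v s)) =
    rI t tau (fun s => chi s (y s) (a v1 s) (v1 s)).
  apply: rI_ae; apply: ae_onW (ae_on_and ae1 (glue_ae tau v1 v t)) => s /andP[ts st] [-> ->].
  by rewrite (motion_initial mw)// (le_trans t0 ts).
rewrite lerD2l le_eqVlt; apply/orP; left; apply/eqP.
have cgs := controls_sub tt cgv.
have ae3 : ae_on tau T (fun s => glued tau v1 v s = v s).
  by apply: ae_on_all => s /andP[h _]; rewrite glue_ge.
have wA := motion_AC mw.
rewrite (costE G sigma yA tauT cat cv mw) (costE G sigma wA tauT cat cgs (motion_restrict tt mw2)).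
by congr (_ + _); apply: rI_ae; apply: ae_onW ae3 => s _ ->.
Qed.

(** Superoptimality: play a fixed control until [tau], and from then on a nearly
    optimal strategy chosen according to the position reached at [tau]. *)
Lemma dpp_le t tau x u1 B : ACpath x -> 0 <= t <= tau -> tau <= T -> controls T P t u1 ->
  (forall v y, controls T Q t v -> motion t x u1 v y ->
     rI t tau (fun s => chi s (y s) (u1 s) (v s)) + value tau y <= B) ->
  value t x <= B.
Proof.
move=> xA t0t tT cu1 hB; have /andP[t0 tt] := t0t.
have tT' : 0 <= t <= T by rewrite t0 (le_trans tt).
have tauT : 0 <= tau <= T by rewrite (le_trans t0 tt).
have ttT : t <= tau <= T by rewrite tt.
apply/ler_addgt0Pr => e e0.
have [_ [v0 cv0]] := controls_nonempty tau.
have cg v : controls T Q t v -> controls T Q t (glued tau v v0).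
  by move=> cv; exact: (controls_glue ttT cv cv0).
(* the second control is frozen after tau, so that this is determined by v before tau *)
pose pos v := xget (fun=> 0) (motion t x u1 (glued tau v v0)).
have posP v : controls T Q t v -> motion t x u1 (glued tau v v0) (pos v).
  move=> cv; have [y my] := motion_exists G xA tT' cu1 (cg v cv).
  by rewrite /pos (motion_xget G _ xA tT' cu1 (cg v cv) my).
(* strategies must be chosen per position, for non-anticipation of the combined strategy *)
have /choice[st hst] : forall y, exists a, ACpath y -> strategies1 tau a /\
    forall v, controls T Q tau v -> cost tau y (a v) v <= value tau y + e.
  move=> y; have [yA|nyA] := pselect (ACpath y); last by exists (fun=> fun=> 0).
  by have [a sa ha] := value_near tauT yA e0; exists a.
pose a v := glued tau u1 (st (pos v) v).
have sta v : controls T Q t v -> controls T P tau (st (pos v) v).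
  move=> cv; have [[h _] _] := hst _ (motion_AC (posP v cv)).
  exact: h (controls_sub tt cv).
have sa : strategies1 t a.
  split=> [v cv|s v v' /andP[ts sT] cv cv' vv]; first exact: (controls_glue ttT cu1 (sta v cv)).
  have [le|/ltW le] := leP s tau.
    have hg (k : R -> 'rV[R]_nP) : ae_on t s (fun r => glued tau u1 k r = u1 r).
      exact: (ae_on_sub (lexx t) le (glue_ae tau u1 k t)).
    by apply: ae_onW (ae_on_and (hg (st (pos v) v)) (hg (st (pos v') v'))) => r _ [h1 h2]; rewrite /a h1 h2.
  (* the position at tau depends on the control before tau only *)
  have e1 : pos v = pos v'.
    have ggv : ae_on t T (fun r => glued tau v v0 r = glued tau v' v0 r).
      apply: (@ae_on_cat _ _ tau).
        have vt := ae_on_sub (lexx t) le vv.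
        by apply: ae_onW (ae_on_and (ae_on_and (glue_ae tau v v0 t) (glue_ae tau v' v0 t)) vt)
          => r _ [[-> ->] ->].
      by apply: ae_on_all => r /andP[h _]; rewrite !glue_ge.
    apply: (motion_unique G xA tT' cu1 (cg v' cv')); last exact: posP.
    by apply: motion_ae (posP v cv) => //; exact: ae_on_all.
  apply: (@ae_on_cat _ _ tau).
    by apply: ae_onW (ae_on_and (glue_ae tau u1 (st (pos v) v) t) (glue_ae tau u1 (st (pos v') v') t))
      => r _ [h1 h2]; rewrite /a h1 h2.
  have [[_ h] _] := hst _ (motion_AC (posP v cv)).
  have := h s v v' _ (controls_sub tt cv) (controls_sub tt cv') (ae_on_sub tt (lexx s) vv).
  rewrite le sT => /(_ isT); apply: ae_onW => r /andP[h1 _] e2.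
  by rewrite /a !glue_ge// -e1.
apply: (value_le tT' xA sa) => v cv.
have my := posP v cv; set y := pos v in my *; have yA := motion_AC my.
have csv : controls T P tau (st y v) := sta v cv.
have cvt := controls_sub tt cv.
have [w mw] := motion_exists G yA tauT csv cvt.
have mw' := motion_concat t0t tT my mw.
have ae1 : ae_on t T (fun s => glued tau (glued tau v v0) v s = v s).
  apply: (@ae_on_cat _ _ tau).
    by apply: ae_onW (ae_on_and (glue_ae tau (glued tau v v0) v t) (glue_ae tau v v0 t)) => s _ [-> ->].
  by apply: ae_on_all => s /andP[h _]; rewrite glue_ge.
have mw2 : motion t x (a v) v w.
  by apply: (motion_ae _ ae1 mw'); exact: ae_on_all.
have ca : controls T P t (a v) by case: sa => h _; exact: h.
rewrite (cost_split G sigma xA t0t tT ca cv mw2).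
have -> : rI t tau (fun s => chi s (w s) (a v s) (v s)) =
    rI t tau (fun s => chi s (y s) (u1 s) (glued tau v v0 s)).
  apply: rI_ae; apply: ae_onW (ae_on_and (glue_ae tau u1 (st y v) t) (glue_ae tau v v0 t))
    => s /andP[ts st_] [h1 ->].
  by rewrite {1}/a -/y h1 (motion_initial mw)// (le_trans t0 ts).
have -> : cost tau w (a v) v = cost tau y (st y v) v.
  have wA := motion_AC mw; have cat := controls_sub tt ca.
  rewrite (costE G sigma yA tauT csv cvt mw) (costE G sigma wA tauT cat cvt (motion_restrict tt mw2)).
  congr (_ + _); apply: rI_eq => s /andP[h _]; by rewrite /a glue_ge.
have h1 := hB _ _ (cg v cv) my.
have [_ h2] := hst y yA; have {}h2 := h2 v cvt.
by apply: (le_trans (lerD (lexx _) h2)); rewrite addrA lerD2r.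
Qed.

End Value.

(** * Condition (L) for the value *)

Section ConditionL.
Context {R : realType} {n nP nQ : nat} (T alpha : R)
  (P : set 'rV[R]_nP) (Q : set 'rV[R]_nQ)
  (f : R -> 'rV[R]_n -> 'rV[R]_nP -> 'rV[R]_nQ -> 'rV[R]_n)
  (chi : R -> 'rV[R]_n -> 'rV[R]_nP -> 'rV[R]_nQ -> R) (c : R).
Hypothesis G : admissible_game T alpha P Q f chi c.
Variable sigma : (R -> 'rV[R]_n) -> R.
Implicit Types (x y w g : R -> 'rV[R]_n) (z : 'rV[R]_n) (u : R -> 'rV[R]_nP) (v : R -> 'rV[R]_nQ) (t s M S : R)
  (X : set (pathsp T n)).

Let T0 : 0 < T := ag_T G.
Let a01 : 0 < alpha < 1 := ag_alpha G.
Let a0 : 0 < alpha. Proof. by case/andP: a01. Qed.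
Local Notation motion := (motion T alpha f).
Local Notation ACpath := (ACpath T alpha).
Local Notation cost := (cost T alpha f chi sigma).
Local Notation value := (value T alpha P Q f chi sigma).

Hypothesis hsigma : forall X, X `<=` ACpath -> compact X ->
     exists2 lambda : R, 0 < lambda &
       forall x y : R -> 'rV[R]_n, X x -> X y ->
         `|sigma x - sigma y| <= lambda * (enorm (x T - y T)
           + rI 0 T (fun tau => enorm (x tau - y tau))).

Lemma norm_bmeas (d : R -> 'rV[R]_n) M : vbm d M -> bmeas (fun s => `|d s|) M.
Proof.
move=> [md dM]; split; last by move=> s; rewrite normr_id.
by apply: vmeasurable_norm => // i; exact: (md i).
Qed.

Lemma apath_AC t x : 0 <= t <= T -> ACpath x -> ACpath (apath alpha t (x : pathsp T n)).
Proof.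
move=> tT xA; have [g [M [gM xE]]] := ACpathP xA.
rewrite xE (apath_mkpath G _ gM tT); exact: (mkpath_ACpath alpha T0 _ (vbm_cutoff t gM)).
Qed.

Lemma AC_difference x y : ACpath x -> ACpath y -> exists M, vbm (fun s => x s - y s) M.
Proof.
move=> xA yA; have [S hS] := ACpath_bounded G xA; have [S' hS'] := ACpath_bounded G yA.
exists (S + S'); exact: vbmB (ACpath_vbm G xA hS) (ACpath_vbm G yA hS').
Qed.

(** The right-hand side of condition (L), up to the constant. *)
Definition afun_gap t x y : R := enorm (afun alpha t x T - afun alpha t y T)
  + rI 0 T (fun tau => enorm (afun alpha t x tau - afun alpha t y tau) / (T - tau) `^ (1 - alpha)).

Lemma gap_integrable t x y : 0 <= t <= T -> ACpath x -> ACpath y ->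
  iI 0 T (fun tau => enorm (afun alpha t x tau - afun alpha t y tau) / (T - tau) `^ (1 - alpha)).
Proof.
move=> tT xA yA; have [M dM] := AC_difference (apath_AC tT xA) (apath_AC tT yA).
apply: iI_eq (bmeas_mul (@kern_l_int R alpha T a0 0 T (lexx T)) (enorm_bmeas dM)) => tau tauT.
by rewrite mulrC !apathE// -powRN opprB.
Qed.

(** The maximum principle bounds both terms by the uniform distance on [0, t]. *)
Lemma gap_le t x y S : 0 <= t <= T -> ACpath x -> ACpath y ->
  (forall s, 0 <= s <= t -> `|x s - y s| <= S) ->
  afun_gap t x y <= n%:R * (3 * S) * (1 + T `^ alpha / alpha).
Proof.
move=> tT xA yA hS.
have h tau : 0 <= tau <= T -> enorm (afun alpha t x tau - afun alpha t y tau) <= n%:R * (3 * S).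
  move=> tauT; apply: (le_trans (enorm_le_norm _)); rewrite ler_wpM2l//.
  exact: (afun_sup G xA yA tT tauT hS).
have TT : 0 <= T <= T by rewrite lexx ltW.
rewrite mulrDr mulr1; apply: lerD; first exact: h.
apply: (@le_trans _ _ (rI 0 T (fun tau => n%:R * (3 * S) * (T - tau) `^ (alpha - 1)))).
  apply: rI_le; [exact: gap_integrable|exact: iIZl (@kern_l_int R alpha T a0 0 T (lexx T))|].
  move=> tau tauT; have -> : ((T - tau) `^ (1 - alpha))^-1 = (T - tau) `^ (alpha - 1).
    by rewrite -powRN opprB.
  by apply: ler_wpM2r; [exact: powR_ge0|exact: h].
rewrite rIZl; last exact: (@kern_l_int R alpha T a0 0 T (lexx T)).
rewrite (rI_kern_l a0 (ltW T0) (lexx T)) subr0 subrr powR0 ?gt_eqF// subr0.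
exact: lexx.
Qed.

(** All motions from [X] under all controls lie in one compact set, so the hypothesis on
    [sigma] applies with a single constant. The difference phi of two motions under the
    same controls satisfies a Gronwall inequality, which controls the integral of (T -
    s)^(alpha - 1) phi (s); the value at [T], the integral of phi and the running cost are
    bounded by this one integral. *)
Lemma cost_lipschitz X : X `<=` ACpath -> compact X -> exists2 L, 0 < L &
  forall t x x' u v, 0 <= t <= T -> X x -> X x' -> controls T P t u -> controls T Q t v ->
  `|cost t x u v - cost t x' u v| <= L * afun_gap t x x'.
Proof.
move=> XA cX; have [K [cK frac_const XK hK]] := motions_compact G XA cX.
have [l l0 hl] := hsigma frac_const cK.
have [r r0 hr] := compact_paths_bounded G frac_const cK.
have [L L0 hL] := data_lip G r0.
have [D D0 hD] := motion_afun_difference G r0.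
have [C C0 hC] := weighted_gronwall a01 T0 (ltW D0).
pose q := T `^ (1 - alpha).
have q0 : 0 <= q by exact: powR_ge0.
have n0 : 0 <= n%:R :> R by [].
pose L1 := l * n%:R; pose L2 := (L1 * (D + q) + L * q) * C.
have L10 : 0 <= L1 by rewrite /L1 mulr_ge0// ltW.
have L20 : 0 <= L2.
  apply: mulr_ge0; last exact: ltW.
  by apply: addr_ge0; apply: mulr_ge0 => //; [apply: addr_ge0 => //; exact: ltW|exact: ltW].
exists (L1 + L2 + 1); first by rewrite ltr_wpDl// addr_ge0.
move=> t x x' u v tT Xx Xx' cu cv; have /andP[t0 tT'] := tT.
have xA := XA _ Xx; have xA' := XA _ Xx'.
have [y my] := motion_exists G xA tT cu cv; have [y' my'] := motion_exists G xA' tT cu cv.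
have Ky := hK _ _ _ _ _ tT Xx cu cv my; have Ky' := hK _ _ _ _ _ tT Xx' cu cv my'.
have yA := frac_const _ Ky; have yA' := frac_const _ Ky'.
have ae0 (m : nat) (k : R -> 'rV[R]_m) : ae_on t T (fun s => k s = k s) by exact: ae_on_all.
have [_ hdiff] := hD t T x x' u v u v y y' xA xA' tT (lexx T) cu cv cu cv (ae0 _ u) (ae0 _ v) my my'
   (fun s _ => hr y Ky s) (fun s _ => hr y' Ky' s).
have [N zN] := AC_difference yA yA'.
have pN := norm_bmeas zN; have eN := enorm_bmeas zN.
have [N' aN] := AC_difference (apath_AC tT xA) (apath_AC tT xA').
have dN := norm_bmeas aN.
pose phi s := `|y s - y' s|.
pose d s := `|apath alpha t (x : pathsp T n) s - apath alpha t (x' : pathsp T n) s|.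
have TT : 0 <= T <= T by rewrite lexx ltW.
have hpd tau : 0 <= tau <= T -> phi tau <= d tau + D * RL alpha tau tau phi.
  by move=> tauT; rewrite /d !apathE//; exact: hdiff.
pose I := RL alpha T T phi.
have I0 : 0 <= I by apply: rI_ge0 => s _; apply: mulr_ge0; [exact: powR_ge0|exact: normr_ge0].
have kI := @kern_l_int R alpha T a0 0 T (lexx T).
have I_le : I <= C * rI 0 T (fun tau => enorm (afun alpha t x tau - afun alpha t x' tau) / (T - tau) `^ (1 - alpha)).
  apply: (le_trans (hC phi d N N' pN dN (fun s => normr_ge0 _) (fun s => normr_ge0 _) hpd)).
  apply: (ler_wpM2l (ltW C0)); apply: rI_le; [exact: bmeas_mul kI dN|exact: gap_integrable|].
  move=> s sT; have -> : ((T - s) `^ (1 - alpha))^-1 = (T - s) `^ (alpha - 1).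
    by rewrite -powRN opprB.
  rewrite mulrC; apply: ler_wpM2r; first exact: powR_ge0.
  rewrite /d !apathE//; exact: norm_le_enorm.
have int_phi : rI 0 T phi <= q * I.
  rewrite /I /RL -rIZl; last exact: bmeas_mul kI pN.
  apply: rI_le_oo; [exact: bmeas_int pN|exact/iIZl/(bmeas_mul kI pN)|move=> s /andP[s0 sT]].
  rewrite mulrA; apply: ler_peMl; first exact: normr_ge0.
  have h : T `^ (alpha - 1) <= (T - s) `^ (alpha - 1).
    by apply: powR_anti; case/andP: a01 => _ a1; lra.
  apply: le_trans (ler_wpM2l q0 h).
  rewrite /q (_ : alpha - 1 = - (1 - alpha)); last by ring.
  by rewrite powRN divff// gt_eqF// powR_gt0.
have phiT : phi T <= enorm (afun alpha t x T - afun alpha t x' T) + D * I.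
  apply: (le_trans (hpd T TT)); rewrite lerD2r /d !apathE//; exact: norm_le_enorm.
have intp0 : 0 <= rI 0 T phi by apply: rI_ge0 => s _; exact: normr_ge0.
rewrite (costE G sigma xA tT cu cv my) (costE G sigma xA' tT cu cv my').
rewrite opprD addrACA; apply: (le_trans (ler_normD _ _)).
have hsig : `|sigma y - sigma y'| <= L1 * (phi T + rI 0 T phi).
  apply: (le_trans (hl y y' Ky Ky')); rewrite /L1 -mulrA; apply: (ler_wpM2l (ltW l0)).
  rewrite mulrDr; apply: lerD; first exact: enorm_le_norm.
  rewrite -rIZl; last exact: bmeas_int pN.
  apply: rI_le; [exact: bmeas_int eN|exact/iIZl/(bmeas_int _ _ pN)|move=> s _].
  exact: enorm_le_norm.
have hchi : `|rI t T (fun s => chi s (y s) (u s) (v s)) - rI t T (fun s => chi s (y' s) (u s) (v s))|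
    <= L * rI 0 T phi.
  have [B1 b1] := running_int G t0 yA cu cv; have [B2 b2] := running_int G t0 yA' cu cv.
  rewrite !(rI_running chi _ _ _ (lexx t) (lexx T)).
  have i1 := bmeas_int t T b1; have i2 := bmeas_int t T b2.
  rewrite -rIB//; apply: (le_trans (rI_normr (iIB i1 i2))).
  apply: (@le_trans _ _ (rI t T (fun s => L * phi s))).
    apply: rI_le; [exact/iI_normr/iIB|exact/iIZl/(bmeas_int _ _ pN)|move=> s /andP[ts sT]].
    have tsT : t <= s <= T by rewrite ts.
    rewrite !running_in//.
    have [_ Pu] := cu; have [_ Qv] := cv.
    have sTT : 0 <= s <= T by rewrite sT (le_trans t0).
    by have [_] := hL s _ _ _ _ sTT (hr y Ky s) (hr y' Ky' s) (Pu s tsT) (Qv s tsT).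
  rewrite rIZl; last exact: bmeas_int pN.
  apply: (ler_wpM2l (ltW L0)); rewrite (rI_chasles t0 tT' (bmeas_int 0 T pN)) lerDr.
  by apply: rI_ge0 => s _; exact: normr_ge0.
apply: (le_trans (lerD hsig hchi)); rewrite /afun_gap.
move: I_le phiT; set E := rI 0 T _; set e := enorm _ => I_le phiT.
have E0 : 0 <= E.
  by apply: rI_ge0 => s _; apply: divr_ge0; [exact: enorm_ge0|exact: powR_ge0].
have e0 : 0 <= e by exact: enorm_ge0.
have h1 : L1 * (phi T + rI 0 T phi) <= L1 * (e + D * I + q * I).
  by apply: (ler_wpM2l L10); exact: lerD.
have h2 : L * rI 0 T phi <= L * (q * I) by apply: ler_wpM2l => //; exact: ltW.
apply: (le_trans (lerD h1 h2)).
have -> : L1 * (e + D * I + q * I) + L * (q * I) = L1 * e + (L1 * (D + q) + L * q) * I by ring.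
have h3 : (L1 * (D + q) + L * q) * I <= L2 * E.
  rewrite /L2 -mulrA; apply: ler_wpM2l => //.
  by apply: addr_ge0; apply: mulr_ge0 => //; [apply: addr_ge0 => //; exact: ltW|exact: ltW].
apply: (le_trans (lerD (lexx _) h3)).
have -> : (L1 + L2 + 1) * (e + E) = L1 * e + L2 * E + ((L1 + 1) * E + (L2 + 1) * e) by ring.
by rewrite lerDl addr_ge0// mulr_ge0// addr_ge0.
Qed.

(** A strategy which is nearly optimal for one initial path is tested on the other. *)
Lemma value_diff t x x' D : 0 <= t <= T -> ACpath x -> ACpath x' ->
  (forall u v, controls T P t u -> controls T Q t v -> `|cost t x u v - cost t x' u v| <= D) ->
  `|value t x - value t x'| <= D.
Proof.
move=> tT xA xA' hD.
have one y y' : ACpath y -> ACpath y' ->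
    (forall u v, controls T P t u -> controls T Q t v -> cost t y u v <= cost t y' u v + D) ->
    value t y <= value t y' + D.
  move=> yA yA' h; apply/ler_addgt0Pr => e e0.
  have [a sa ha] := value_near G hsigma tT yA' e0.
  apply: (value_le G hsigma tT yA sa) => v cv; have [aP _] := sa.
  apply: (le_trans (h _ _ (aP _ cv) cv)); rewrite [leRHS]addrAC lerD2r; exact: ha.
rewrite ler_norml; apply/andP; split.
  rewrite lerBrDr addrC lerBlDr; apply: one => // u v cu cv.
  by have := hD u v cu cv; rewrite ler_norml => /andP[h _]; lra.
rewrite lerBlDr addrC; apply: one => // u v cu cv.
by have := hD u v cu cv; rewrite ler_norml => /andP[_ h]; lra.
Qed.

Lemma value_lipschitz X : X `<=` ACpath -> compact X -> exists2 L, 0 < L &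
  forall t x x', 0 <= t <= T -> X x -> X x' -> `|value t x - value t x'| <= L * afun_gap t x x'.
Proof.
move=> XA cX; have [L L0 hL] := cost_lipschitz XA cX; exists L => // t x x' tT Xx Xx'.
by apply: value_diff => //; [exact: XA|exact: XA|move=> u v; exact: hL].
Qed.

Lemma value_condL : condL T alpha value.
Proof. by move=> X XA cX; have [L L0 hL] := value_lipschitz XA cX; exists L. Qed.

End ConditionL.

(** * Continuity of the value *)

Lemma compact_cvg_range (U : topologicalType) (x_ : nat -> U) (x : U) :
  x_ @ \oo --> x -> compact (x |` range x_).
Proof.
move=> xx; apply/compact_near_coveringP => I F A FF cov.
have near1 y : (x |` range x_) y -> \forall i \near F, A i y.
  move=> /cov [[/= B C] [/= nB FC] BC]; apply: filterS FC => i Ci.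
  by apply: (BC (y, i)); split => //=; exact: nbhs_singleton.
have [|[B C] [/= nB FC] BC] := cov x; first by left.
have [N _ hN] := xx _ nB.
have fin : \forall i \near F, forall k : 'I_N, A i (x_ k).
  by apply: filter_forall => k; apply: near1; right; exists (k : nat).
apply: filterS (filterI FC fin) => i [Ci hi] y [->|[k _ <-]].
  by apply: (BC (x, i)); split => //=; exact: nbhs_singleton.
have [kN|Nk] := ltnP k N; first exact: (hi (Ordinal kN)).
by apply: (BC (x_ k, i)); split => //=; exact: hN.
Qed.

Section ValueContinuity.
Context {R : realType} {n nP nQ : nat} (T alpha : R)
  (P : set 'rV[R]_nP) (Q : set 'rV[R]_nQ)
  (f : R -> 'rV[R]_n -> 'rV[R]_nP -> 'rV[R]_nQ -> 'rV[R]_n)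
  (chi : R -> 'rV[R]_n -> 'rV[R]_nP -> 'rV[R]_nQ -> R) (c : R).
Hypothesis G : admissible_game T alpha P Q f chi c.
Variable sigma : (R -> 'rV[R]_n) -> R.
Implicit Types (x y w g : R -> 'rV[R]_n) (z : 'rV[R]_n) (u : R -> 'rV[R]_nP) (v : R -> 'rV[R]_nQ) (t s M S : R)
  (X : set (pathsp T n)).

Let T0 : 0 < T := ag_T G.
Let a01 : 0 < alpha < 1 := ag_alpha G.
Let a0 : 0 < alpha. Proof. by case/andP: a01. Qed.
Local Notation motion := (motion T alpha f).
Local Notation ACpath := (ACpath T alpha).
Local Notation value := (value T alpha P Q f chi sigma).

Hypothesis hsigma : forall X, X `<=` ACpath -> compact X ->
     exists2 lambda : R, 0 < lambda &
       forall x y : R -> 'rV[R]_n, X x -> X y ->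
         `|sigma x - sigma y| <= lambda * (enorm (x T - y T)
           + rI 0 T (fun tau => enorm (x tau - y tau))).

Lemma motion_modulus x : ACpath x -> exists2 C, 0 < C &
  (forall s s', 0 <= s -> s <= s' -> s' <= T -> `|x s' - x s| <= C * (s' - s) `^ alpha) /\
  forall t u v y, 0 <= t <= T -> controls T P t u -> controls T Q t v -> motion t x u v y ->
  forall s s', 0 <= s -> s <= s' -> s' <= T -> `|y s' - y s| <= C * (s' - s) `^ alpha.
Proof.
move=> xA; have [g [M [gM xE]]] := ACpathP xA; have [S hS] := ACpath_bounded G xA.
have [C1 C10 hC1] := motion_bound G.
have S0 : 0 <= S := le_trans (normr_ge0 _) (hS 0).
have M0 := vbm_ge0 gM.
pose N := M + C1 * (1 + S).
have N0 : 0 < N by rewrite ltr_wpDl// mulr_gt0// ltr_pwDl.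
have K0 := frac_const_gt0 a01.
exists (2 * frac_const alpha * N); first by rewrite !mulr_gt0.
have MN : M <= N by rewrite lerDl mulr_ge0 ?addr_ge0 ?(ltW C10).
split => [s s' s0 ss sT|t u v y tT cu cv my s s' s0 ss sT].
  by rewrite xE; exact: (mkpath_modulus a01 _ (vbmW gM MN) s0 ss sT).
have hS' r : 0 <= r <= t -> `|mkpath T alpha (x 0) g r| <= S by rewrite -xE => _; exact: hS.
have [_ /(_ y)] := hC1 t (x 0) g M S u v gM tT cu cv hS'.
rewrite -xE => /(_ my)[fv yE _].
by rewrite yE; exact: (mkpath_modulus a01 _ (vbm_glue t gM fv) s0 ss sT).
Qed.

(** The motion agrees with [x] up to [t], and on [t, tau] both have moved by at most a
    multiple of (tau - t)^alpha. *)
Lemma motion_close x : ACpath x -> exists2 C, 0 < C &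
  forall t tau u v y, 0 <= t <= tau -> tau <= T -> controls T P t u -> controls T Q t v -> motion t x u v y ->
  forall s, 0 <= s <= tau -> `|y s - x s| <= C * (tau - t) `^ alpha.
Proof.
move=> xA; have [C C0 [hx hy]] := motion_modulus xA; exists (C + C); first exact: addr_gt0.
move=> t tau u v y /andP[t0 tt] tauT cu cv my s /andP[s0 st].
have tT : 0 <= t <= T by rewrite t0 (le_trans tt).
have pw0 : 0 <= (C + C) * (tau - t) `^ alpha.
  by apply: mulr_ge0; [apply: addr_ge0; exact: ltW|exact: powR_ge0].
have [le|/ltW le] := leP s t.
  by rewrite (motion_initial my) ?subrr ?normr0// s0.
have sT := le_trans st tauT.
have mono : (s - t) `^ alpha <= (tau - t) `^ alpha.
  by apply: ge0_ler_powR; rewrite ?nnegrE ?subr_ge0 ?(ltW a0)// lerD2r.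
have h1 := hy t u v y tT cu cv my t s t0 le sT.
have h2 := hx t s t0 le sT.
have e : y t = x t by apply: (motion_initial my); rewrite t0 lexx.
have -> : y s - x s = (y s - y t) - (x s - x t) by rewrite e opprB addrA subrK.
apply: (le_trans (ler_normB _ _)); rewrite mulrDl; apply: lerD.
  by apply: (le_trans h1); rewrite ler_wpM2l// ltW.
by apply: (le_trans h2); rewrite ler_wpM2l// ltW.
Qed.

(** By dynamic programming, value t x is up to a small running cost an extremum of the
    values at the positions reached at [t']. These are close to [x], and condition (L) on
    the compact set of all motions from [x] compares the values. *)
Lemma value_time x : ACpath x -> exists2 C, 0 < C &
  forall t t', 0 <= t <= t' -> t' <= T -> `|value t x - value t' x| <= C * ((t' - t) + (t' - t) `^ alpha).
Proof.
move=> xA; have [XA cX] := compact_path1 xA.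
have [K [cK frac_const XK hK]] := motions_compact G XA cX.
have [r r0 hr] := compact_paths_bounded G frac_const cK.
have [B B0 hB] := chi_bound G r0.
have [L L0 hL] := value_lipschitz G hsigma frac_const cK.
have [C C0 hC] := motion_close xA.
pose D := 1 + T `^ alpha / alpha.
have D0 : 0 <= D by rewrite /D addr_ge0 ?divr_ge0 ?powR_ge0 ?(ltW a0).
pose C' := L * (n%:R * (3 * C) * D).
have C'0 : 0 <= C' by rewrite /C' !mulr_ge0 ?(ltW L0) ?(ltW C0).
exists (B + C'); first by rewrite ltr_pwDl.
move=> t t' /andP[t0 tt] t'T; have tt' : 0 <= t <= t' by rewrite t0.
have tT : 0 <= t <= T by rewrite t0 (le_trans tt).
have t'T' : 0 <= t' <= T by rewrite t'T (le_trans t0).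
pose p := (t' - t) `^ alpha; have p0 : 0 <= p by exact: powR_ge0.
pose E := B * (t' - t) + C' * p.
have key u v y : controls T P t u -> controls T Q t v -> motion t x u v y ->
    `|rI t t' (fun s => chi s (y s) (u s) (v s)) + value t' y - value t' x| <= E.
  move=> cu cv my; have Ky : K y by apply: (hK t x u v y tT erefl).
  rewrite -addrA; apply: (le_trans (ler_normD _ _)); apply: lerD.
    have b := running_bmeas G t0 cu cv (ACpath_vmeasurable G (frac_const _ Ky)) (fun s _ => hr y Ky s) hB (ltW B0).
    by rewrite (rI_running chi _ _ _ (lexx t) t'T); exact: rI_bmeas_le.
  have Kx : K x by apply: XK.
  apply: (le_trans (hL t' y x t'T' Ky Kx)).
  rewrite /C' -mulrA; apply: (ler_wpM2l (ltW L0)).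
  apply: (le_trans (gap_le G t'T' (frac_const _ Ky) xA (hC t t' u v y tt' t'T cu cv my))).
  rewrite -/p -/D le_eqVlt; apply/orP; left; apply/eqP; ring.
have EE : E <= (B + C') * (t' - t + p).
  have d0 : 0 <= t' - t by rewrite subr_ge0.
  have -> : (B + C') * (t' - t + p) = E + (B * p + C' * (t' - t)) by rewrite /E; ring.
  by rewrite lerDl addr_ge0// mulr_ge0// ltW.
apply: le_trans EE; have [[u0 cu0] [v0 cv0]] := controls_nonempty G t.
rewrite ler_norml; apply/andP; split.
  rewrite lerBrDl lerBlDr; apply/ler_addgt0Pr => e e0.
  have [a sa ha] := value_near G hsigma tT xA e0.
  have [aP _] := sa; have [y my] := motion_exists G xA tT (aP _ cv0) cv0.
  have h := dpp_ge G hsigma xA tt' t'T sa cv0 my ha.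
  have := key _ _ _ (aP _ cv0) cv0 my; rewrite ler_norml => /andP[h1 _].
  move: h h1; set A := rI _ _ _; set b := value t' y; set b' := value t' x; set b'' := value t x => h h1.
  lra.
rewrite lerBlDr; apply: (dpp_le G hsigma xA tt' t'T cu0) => v y cv my.
have := key _ _ _ cu0 cv my; rewrite ler_norml => /andP[_ h1].
move: h1; set A := rI _ _ _; set b := value t' y; set b' := value t' x => h1.
lra.
Qed.

(** Condition (L) holds on compact sets only, but a convergent sequence of paths together
    with its limit is compact. *)
Lemma value_continuous : continuous_on_cylinder (@cylinder_closed R n T alpha) value.
Proof.
apply/subspace_continuousP => -[t0 x0] [/= t0T x0A].
apply/cvgrPdist_le => e e0; apply: contrapT => nh.
have /choice[p hp] : forall k : nat, exists p : R * pathsp T n,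
    [/\ 0 <= p.1 <= T, ACpath p.2, `|t0 - p.1| <= 2^-1 ^+ k,
      (forall s, 0 <= s <= T -> `|x0 s - p.2 s| < 2^-1 ^+ k) & e < `|value t0 x0 - value p.1 p.2|].
  move=> k; apply: contrapT => nk; apply: nh.
  have k0 : 0 < 2^-1 ^+ k :> R by rewrite exprn_gt0.
  exists (ball t0 (2^-1 ^+ k), [set z | forall s, 0 <= s <= T -> `|x0 s - z s| < 2^-1 ^+ k]).
    by split; [exact: nbhsx_ballx|exact: pathsp_near].
  move=> [t x] [/= h1 h2] [/= tT xA].
  rewrite leNgt; apply/negP => h3; apply: nk; exists (t, x); split => //; exact: ltW.
pose X : set (pathsp T n) := (x0 : pathsp T n) |` range (fun k => (p k).2).
have XA : X `<=` ACpath by move=> _ [->|[k _ <-]]//; case: (hp k).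
have cX : compact X.
  apply: compact_cvg_range; apply: pathsp_cvgP => d d0.
  have /cvgrPdist_le/(_ d d0) := @geometric0 R 1.
  apply: filterS => k; rewrite sub0r normrN mul1r => hk s sT.
  have [_ _ _ /(_ s sT) h _] := hp k; apply: (le_trans (ltW h)).
  exact: le_trans (ler_norm _) hk.
have [L L0 hL] := value_lipschitz G hsigma XA cX.
have [C C0 hC] := value_time x0A.
pose D := 1 + T `^ alpha / alpha.
have D0 : 0 < D by rewrite /D ltr_pwDl// divr_ge0 ?powR_ge0 ?(ltW a0).
pose E := L * (n%:R * 3 * D).
have E0 : 0 <= E by rewrite /E !mulr_ge0 ?(ltW L0) ?(ltW D0).
have bnd k : e <= E * 2^-1 ^+ k + C * (2^-1 ^+ k + (2^-1 ^+ k) `^ alpha).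
  have [pT pA pt px pe] := hp k; apply: (le_trans (ltW pe)).
  have Xp : X (p k).2 by right; exists k.
  have Xx0 : X x0 by left.
  rewrite distrC; apply: (le_trans (ler_distD (value (p k).1 x0) _ _)); apply: lerD.
    apply: (le_trans (hL _ _ _ pT Xp Xx0)).
    have close s : 0 <= s <= (p k).1 -> `|(p k).2 s - x0 s| <= 2^-1 ^+ k.
      move=> /andP[s0 sp]; rewrite distrC; apply/ltW/px; rewrite s0 (le_trans sp)//.
      by case/andP: pT.
    rewrite /E -mulrA; apply: (ler_wpM2l (ltW L0)).
    apply: (le_trans (gap_le G pT pA x0A close)).
    by rewrite -/D le_eqVlt; apply/orP; left; apply/eqP; ring.
  have mono d : 0 <= d -> d <= 2^-1 ^+ k ->
      C * (d + d `^ alpha) <= C * (2^-1 ^+ k + (2^-1 ^+ k) `^ alpha).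
    move=> d0 dk; apply: (ler_wpM2l (ltW C0)); apply: lerD => //.
    by apply: ge0_ler_powR; rewrite ?nnegrE ?(ltW a0) ?exprn_ge0.
  case/andP: pT => pT1 pT2; case/andP: t0T => t00 t0T.
  have [le|/ltW le] := leP (p k).1 t0.
    apply: (le_trans (hC _ _ _ t0T)); first by rewrite pT1.
    apply: mono; first by rewrite subr_ge0.
    by apply: le_trans pt; exact: ler_norm.
  rewrite distrC; apply: (le_trans (hC _ _ _ pT2)); first by rewrite t00.
  apply: mono; first by rewrite subr_ge0.
  by apply: le_trans pt; rewrite distrC; exact: ler_norm.
have e3 : 0 < e / 3 by rewrite divr_gt0.
have [d d0 hd] := powR_small a01 (divr_gt0 e3 C0).
pose m := Num.min d (Num.min (e / 3 / (E + 1)) (e / 4 / C)).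
have m0 : 0 < m.
  by rewrite !lt_min d0/= !divr_gt0// ltr_wpDl.
have [k hk] : exists k, 2^-1 ^+ k <= m :> R.
  have /cvgrPdist_le/(_ m m0) [N _ hN] := @geometric0 R 1.
  exists N; have := hN N (leqnn N); rewrite /= sub0r normrN mul1r; exact: le_trans (ler_norm _).
have := bnd k; set q := 2^-1 ^+ k in hk *.
have q0 : 0 <= q by rewrite exprn_ge0.
move: hk; rewrite !le_min => /and3P[qd q1 q2].
have h1 : E * q <= e / 3.
  apply: (@le_trans _ _ ((E + 1) * q)); first by rewrite ler_wpM2r// lerDl.
  by move: q1; rewrite ler_pdivlMr ?ltr_wpDl// mulrC.
have h2 : C * q <= e / 4 by move: q2; rewrite ler_pdivlMr// mulrC.
have h3 : C * q `^ alpha <= e / 3.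
  by have := hd q; rewrite q0 qd => /(_ isT); rewrite ler_pdivlMr// mulrC.
rewrite mulrDr; move: h1 h2 h3; set A1 := E * q; set A2 := C * q; set A3 := C * _ => h1 h2 h3 h4.
lra.
Qed.

End ValueContinuity.

(** * Growth of smooth functionals along motions *)

Section RealInduction.
Context {R : realType}.

(** The set of times at which the bound holds contains its supremum by continuity of [D],
    and the local hypothesis moves beyond any time before [b]. *)
Lemma real_induction (D : R -> R) (a b e : R) : a <= b ->
  (forall s, a <= s <= b -> forall r, 0 < r -> exists2 d, 0 < d &
     forall s', a <= s' <= b -> `|s - s'| < d -> `|D s - D s'| <= r) ->
  (forall s, a <= s < b -> exists2 h0, 0 < h0 &
     forall h, 0 < h < h0 -> s + h <= b -> - (e * h) <= D (s + h) - D s) ->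
  - (e * (b - a)) <= D b - D a.
Proof.
move=> ab cD lD.
pose A := [set s | a <= s <= b /\ - (e * (s - a)) <= D s - D a].
have Aa : A a by split; rewrite ?lexx ?ab// !subrr mulr0 oppr0.
have Aub : has_ubound A by exists b => s [/andP[]].
have hA : has_sup A by split; first by exists a.
pose m := sup A.
have am : a <= m by apply: ub_le_sup.
have mb : m <= b by apply: ge_sup; [exists a|move=> s [/andP[]]].
have mab : a <= m <= b by rewrite am.
have Am : A m.
  split => //; apply/ler_addgt0Pr => r r0.
  have r2 : 0 < r / 2 by rewrite divr_gt0.
  have [d d0 hd] := cD m mab _ r2.
  (* so close to m that both D and the affine bound change by at most r / 2 *)
  pose q := Num.min d (r / 2 / (`|e| + 1)).
  have e1 : 0 < `|e| + 1 by rewrite ltr_wpDl.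
  have q0 : 0 < q by rewrite lt_min d0 divr_gt0.
  have [s [sab sA] ms] := sup_adherent q0 hA.
  have sm : s <= m by apply: ub_le_sup => //.
  have dm : `|m - s| < d.
    rewrite ger0_norm ?subr_ge0//; apply: (@lt_le_trans _ _ q); last by rewrite ge_min lexx.
    by rewrite -/m in ms; lra.
  have h1 := hd s sab dm.
  have h2 : `|e| * (m - s) <= r / 2.
    apply: (@le_trans _ _ ((`|e| + 1) * q)).
      apply: ler_pM => //; [by rewrite subr_ge0|by rewrite lerDl|rewrite -/m in ms; lra].
    by rewrite mulrC -ler_pdivlMr// ge_min lexx orbT.
  have h3 : - (e * (m - a)) <= - (e * (s - a)) + r / 2.
    have : - (e * (m - s)) <= r / 2.
      apply: le_trans h2; apply: (le_trans (ler_norm _)); rewrite normrN normrM.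
      by rewrite (ger0_norm (x := m - s)) ?subr_ge0.
    have -> : e * (m - a) = e * (m - s) + e * (s - a) by ring.
    set X := e * (m - s); set Y := e * (s - a); lra.
  move: h1; rewrite ler_norml => /andP[h1 _].
  move: h3 sA; set X := e * (m - a); set Y := e * (s - a) => h3 sA; lra.
have [mb'|bm] := ltP m b; last first.
  have mE : m = b by apply/eqP; rewrite eq_le mb bm.
  by rewrite -mE; case: Am.
have [|h0 h00 hh] := lD m; first by rewrite am.
pose h := Num.min (h0 / 2) (b - m).
have hp : 0 < h by rewrite lt_min divr_gt0//= subr_gt0.
have hh0 : 0 < h < h0.
  rewrite hp/=; apply: (@le_lt_trans _ _ (h0 / 2)); first by rewrite ge_min lexx.
  by rewrite ltr_pdivrMr// ltr_pMr// ltrDl.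
have hb : m + h <= b by rewrite -lerBrDl ge_min lexx orbT.
have : A (m + h).
  split; first by rewrite hb andbT (le_trans am)// lerDl ltW.
  have := hh h hh0 hb; have [_ h2] := Am.
  have -> : e * (m + h - a) = e * h + e * (m - a) by ring.
  move: h2; set X := e * h; set Y := e * (m - a) => h2 h3; lra.
by move=> /(ub_le_sup Aub); rewrite -/m gerDl leNgt hp.
Qed.

End RealInduction.

Section Smooth.
Context {R : realType} {n : nat} (T alpha : R).
Implicit Types (x y : R -> 'rV[R]_n) (t s e d : R).

Lemma cylinder_continuous (V : normedModType R) (D : set (R * pathsp T n))
  (F : R -> (R -> 'rV[R]_n) -> V) t x e : continuous_on_cylinder D F ->
  D (t, x) -> 0 < e -> exists2 d, 0 < d & forall t' x', D (t', x') -> `|t - t'| < d ->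
    (forall s, 0 <= s <= T -> `|x s - x' s| < d) -> `|F t x - F t' x'| <= e.
Proof.
move=> /subspace_continuousP cF Dtx e0; have /cvgrPdist_le/(_ e e0) := cF _ Dtx.
move=> [[A B] [/= nA /pathsp_nbhsP[d2 d20 hB]] AB].
have /nbhs_ballP[d1 /= d10 hA] := nA.
exists (Num.min d1 d2); first by rewrite lt_min d10.
move=> t' x' Dt tt xx; apply: (AB (t', x')) => //; split => /=.
  by apply: hA; rewrite /ball/=; apply: (lt_le_trans tt); rewrite ge_min lexx.
by apply: hB => s sT; apply: (lt_le_trans (xx s sT)); rewrite ge_min lexx orbT.
Qed.

Lemma dotv_bmeas (a : 'rV[R]_n) (d : R -> 'rV[R]_n) N : vbm d N ->
  bmeas (fun s => dotv a (d s)) (n%:R * (`|a| * N)).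
Proof.
move=> [md dN]; split; last first.
  move=> s; apply: (le_trans (dotv_norm_le _ _)); rewrite ler_wpM2l// ler_wpM2l//.
rewrite /dotv; apply: measurable_sum => i; apply: measurable_funM; first exact: measurable_cst.
exact: (md i).
Qed.

End Smooth.

Section DataUniform.
Context {R : realType} {n nP nQ : nat} (T alpha : R)
  (P : set 'rV[R]_nP) (Q : set 'rV[R]_nQ)
  (f : R -> 'rV[R]_n -> 'rV[R]_nP -> 'rV[R]_nQ -> 'rV[R]_n)
  (chi : R -> 'rV[R]_n -> 'rV[R]_nP -> 'rV[R]_nQ -> R) (c : R).
Hypothesis G : admissible_game T alpha P Q f chi c.

(** Uniformity in the controls comes from the compactness of P x Q. *)
Lemma data_uniform (V : normedModType R) (F : R -> 'rV[R]_n -> 'rV[R]_nP -> 'rV[R]_nQ -> V) t0 x0 (e : R) :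
  {within data_domain T P Q, continuous
     (fun z : R * 'rV[R]_n * 'rV[R]_nP * 'rV[R]_nQ => F z.1.1.1 z.1.1.2 z.1.2 z.2)} ->
  0 <= t0 <= T -> 0 < e -> exists2 d, 0 < d &
  forall t x p q, 0 <= t <= T -> `|t0 - t| < d -> `|x0 - x| < d -> P p -> Q q ->
    `|F t x p q - F t0 x0 p q| <= e.
Proof.
move=> /subspace_continuousP cF t0T e0.
have cPQ : compact (P `*` Q) by apply: compact_setX; [exact: ag_P G|exact: ag_Q G].
move/compact_near_coveringP : cPQ => /(_ (R * 'rV[R]_n)%type (nbhs (t0, x0))
  (fun i pq => 0 <= i.1 <= T -> P pq.1 -> Q pq.2 ->
     `|F i.1 i.2 pq.1 pq.2 - F t0 x0 pq.1 pq.2| <= e) _) [|].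
  move=> [p0 q0] [/= Pp0 Qq0].
  have dom0 : data_domain T P Q (t0, x0, p0, q0) by [].
  have /cvgrPdist_le/(_ _ (divr_gt0 e0 (ltr0n R 2))) := cF _ dom0.
  move=> /nbhs_ballP[r /= r0 hr].
  exists (ball (p0, q0) r, ball (t0, x0) r); first by split; exact: nbhsx_ballx.
  move=> [[p q] [t x]] [/= [bp bq] [bt bx]] tT Pp Qq.
  have d1 : data_domain T P Q (t, x, p, q) by [].
  have d2 : data_domain T P Q (t0, x0, p, q) by [].
  have h1 := hr (t, x, p, q) (conj (conj (conj bt bx) bp) bq) d1.
  have h2 := hr (t0, x0, p, q) (conj (conj (conj (ballxx _ r0) (ballxx _ r0)) bp) bq) d2.
  rewrite /from_subspace/= distrC in h1; rewrite /from_subspace/= in h2.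
  by apply: (le_trans (ler_distD (F t0 x0 p0 q0) _ _)); rewrite [e]splitr; exact: lerD.
move=> [A B] [/= /nbhs_ballP[d1 /= d10 hA] /nbhs_ballP[d2 /= d20 hB]] hAB.
exists (Num.min d1 d2); first by rewrite lt_min d10.
move=> t x p q tT tt xx Pp Qq.
apply: (hAB (t, x) _ (p, q)) => //; split => /=.
  by apply: hA; rewrite /ball/=; apply: (lt_le_trans tt); rewrite ge_min lexx.
apply: hB; rewrite -ball_normE /ball_/=; apply: (lt_le_trans xx).
by rewrite ge_min lexx orbT.
Qed.

End DataUniform.

Section ChainRule.
Context {R : realType} {n nP nQ : nat} (T alpha : R)
  (P : set 'rV[R]_nP) (Q : set 'rV[R]_nQ)
  (f : R -> 'rV[R]_n -> 'rV[R]_nP -> 'rV[R]_nQ -> 'rV[R]_n)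
  (chi : R -> 'rV[R]_n -> 'rV[R]_nP -> 'rV[R]_nQ -> R) (c : R).
Hypothesis G : admissible_game T alpha P Q f chi c.
Implicit Types (x y w g : R -> 'rV[R]_n) (z : 'rV[R]_n) (u : R -> 'rV[R]_nP) (v : R -> 'rV[R]_nQ) (t s M S : R)
  (X : set (pathsp T n)).

Let T0 : 0 < T := ag_T G.
Let a01 : 0 < alpha < 1 := ag_alpha G.
Let a0 : 0 < alpha. Proof. by case/andP: a01. Qed.
Local Notation mkpath := (mkpath T alpha).
Local Notation motion := (motion T alpha f).
Local Notation ACpath := (ACpath T alpha).

(** The continuation of a motion after [s] by the density of the original path is close
    to that path on the whole of [0, T], although the motion itself is close to it only
    for a short time. *)
Lemma motion_branch x : ACpath x -> exists2 C, 0 < C &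
  forall t u v y, 0 <= t <= T -> controls T P t u -> controls T Q t v -> motion t x u v y ->
  vbm (fdyn T f t y u v) C /\
  forall s, t <= s <= T -> exists yh, [/\ ACpath yh, forall r, 0 <= r <= s -> yh r = y r &
    forall tau, `|x tau - yh tau| <= C * (s - t) `^ alpha].
Proof.
move=> xA; have [g [M [gM xE]]] := ACpathP xA; have [S hS] := ACpath_bounded G xA.
have [C1 C10 hC1] := motion_bound G.
have S0 : 0 <= S := le_trans (normr_ge0 _) (hS 0).
have M0 := vbm_ge0 gM.
pose N := C1 * (1 + S); have N0 : 0 < N by rewrite mulr_gt0// ltr_pwDl.
have K0 := frac_const_gt0 a01.
pose C := N + frac_const alpha * (M + (M + N + M)).
have C0 : 0 < C by rewrite ltr_pwDl// mulr_ge0 ?(ltW K0)// !addr_ge0 ?(ltW N0).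
exists C => // t u v y tT cu cv my.
have hS' r : 0 <= r <= t -> `|mkpath (x 0) g r| <= S by rewrite -xE => _; exact: hS.
have [_ /(_ y)] := hC1 t (x 0) g M S u v gM tT cu cv hS'.
rewrite -xE => /(_ my)[fv yE _].
split; first by apply: (vbmW fv); rewrite /C lerDl mulr_ge0 ?(ltW K0)// !addr_ge0 ?(ltW N0).
move=> s /andP[ts sT]; have /andP[t0 tT'] := tT.
have yg := vbm_glue t gM fv; have hg := vbm_glue s yg gM.
have sT' : 0 <= s <= T by rewrite sT (le_trans t0).
exists (mkpath (x 0) (glued s (glued t g (fdyn T f t y u v)) g)).
have [yhA yhE] := mkpath_glue_Yset alpha T0 (x 0) yg gM sT'.
split => // [r rs|tau]; first by rewrite yhE// -yE.
rewrite {1}xE.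
apply: (@le_trans _ _ (frac_const alpha * (M + (M + N + M)) * (s - t) `^ alpha)).
  apply: (mkpath_support T a01 (x 0) tau t0 ts _ _ gM hg) => r.
    by move=> _ rt; rewrite !glue_lt// (lt_le_trans rt).
  by move=> sr; rewrite glue_ge// ltW.
by rewrite ler_wpM2r ?powR_ge0// /C lerDr ltW.
Qed.

Section Functional.
Variables (psi dt : R -> (R -> 'rV[R]_n) -> R) (grad : R -> (R -> 'rV[R]_n) -> 'rV[R]_n).
Hypothesis smooth : ci_smooth T alpha psi dt grad.

Let psi_cont : continuous_on_cylinder (@cylinder_closed R n T alpha) psi.
Proof. by case: smooth. Qed.

Lemma psi_time_continuous y s e : ACpath y -> 0 <= s <= T -> 0 < e ->
  exists2 d, 0 < d & forall s', 0 <= s' <= T -> `|s - s'| < d -> `|psi s y - psi s' y| <= e.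
Proof.
move=> yA sT e0.
have Dsy : @cylinder_closed R n T alpha (s, y) by [].
have [d d0 hd] := cylinder_continuous psi_cont Dsy e0.
exists d => // s' sT' ss; apply: (hd s' y) => // r _.
by rewrite subrr normr0.
Qed.

(** The Caputo derivative under the integral is replaced by a bounded Borel density. *)
Lemma ci_expansion s yh y g N e : 0 <= s < T -> ACpath yh -> ACpath y ->
  (forall r, 0 <= r <= s -> yh r = y r) -> vbm g N -> ae_on s T (fun xi => caputo alpha y xi = g xi) ->
  0 < e -> exists2 h0, 0 < h0 & forall h, 0 < h < h0 -> s + h < T ->
   `|psi (s + h) y - psi s yh - (dt s yh * h + rI s (s + h) (fun xi => dotv (grad s yh) (g xi)))| <= e * h.
Proof.
move=> s0T yhA yA yhE gN yg e0; have /andP[s0 sT] := s0T.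
have [_ hci _ _] := smooth.
have yY : Yset T alpha s yh y by split => // r rs; rewrite yhE.
have [rem [rem0 ho]] := hci s yh s0T yhA y yY.
have /cvgrPdist_le/(_ e e0) := rem0; rewrite /at_right near_withinE.
move=> /nbhs_ballP[h0 /= h00 hh]; exists h0 => // h /andP[hp hlt] stT.
rewrite ho ?ltrDl ?hp//.
have -> : rI s (s + h) (fun xi => dotv (grad s yh) (caputo alpha y xi)) =
    rI s (s + h) (fun xi => dotv (grad s yh) (g xi)).
  by apply: rI_ae; apply: ae_onW (ae_on_sub (lexx s) (ltW stT) yg) => xi _ ->.
rewrite (_ : s + h - s = h); last by ring.
rewrite addrAC subrr add0r.
have := hh h; rewrite /ball/= sub0r normrN (ger0_norm (ltW hp)) => /(_ hlt hp).
by rewrite sub0r normrN normrM normfV (ger0_norm (ltW hp)) ler_pdivrMr.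
Qed.

(** The expansion at [s] forces psi tau y to tend to psi s yh as [tau] decreases to [s],
    while continuity gives the limit psi s y. *)
Lemma smooth_nonanticipative s yh y : 0 <= s < T -> ACpath yh -> ACpath y ->
  (forall r, 0 <= r <= s -> yh r = y r) -> psi s yh = psi s y.
Proof.
move=> s0T yhA yA yhE; have /andP[s0 sT] := s0T.
have [g [N [gN yE]]] := ACpathP yA.
have yg : ae_on s T (fun xi => caputo alpha y xi = g xi).
  by rewrite {1}yE; exact: ae_on_sub s0 (lexx T) (caputo_mkpath T0 a01 (y 0) gN).
have [h1 h10 hh1] := ci_expansion s0T yhA yA yhE gN yg ltr01.
set a := dt s yh in hh1; set b := grad s yh in hh1.
have bb := dotv_bmeas b gN.
set B := n%:R * (`|b| * N) in bb.
have B0 : 0 <= B := bmeas_ge0 bb.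
apply/eqP; rewrite -subr_eq0 -normr_le0; apply/ler_addgt0Pr => q q0; rewrite add0r.
have q2 : 0 < q / 2 by rewrite divr_gt0.
have sTT : 0 <= s <= T by rewrite s0 ltW.
have [d d0 hd] := psi_time_continuous yA sTT q2.
pose L := `|a| + B + 1; have L0 : 0 < L by rewrite ltr_wpDl// addr_ge0.
pose h := Num.min (Num.min (d / 2) (h1 / 2)) (Num.min ((T - s) / 2) (q / 2 / L)).
have hp : 0 < h by rewrite !lt_min !divr_gt0// subr_gt0.
have : h <= h by []; rewrite {2}/h !le_min => /andP[/andP[hd2 hh2] /andP[hT hq]].
have stT : s + h < T by lra.
have e2 : `|psi s y - psi (s + h) y| <= q / 2.
  apply: hd; first by rewrite addr_ge0 ?(ltW hp)//= ltW.
  by rewrite opprD addrA subrr add0r normrN ger0_norm ?(ltW hp)//; lra.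
have e3 : `|psi (s + h) y - psi s yh| <= q / 2.
  apply: (@le_trans _ _ (L * h)); last by rewrite mulrC -ler_pdivlMr.
  have hlt : h < h1 by lra.
  have := hh1 h; rewrite hp hlt => /(_ isT stT) h2.
  set J := rI s (s + h) _ in h2.
  have -> : psi (s + h) y - psi s yh = a * h + J + (psi (s + h) y - psi s yh - (a * h + J)) by ring.
  apply: (le_trans (ler_normD _ _)); rewrite /L !mulrDl; apply: lerD => //.
  apply: (le_trans (ler_normD _ _)); apply: lerD.
    by rewrite normrM (ger0_norm (ltW hp)).
  have := @rI_bmeas_le R s (s + h) _ _ _ bb; rewrite lerDl => /(_ (ltW hp)).
  by rewrite (_ : s + h - s = h)//; ring.
rewrite distrC; apply: (le_trans (ler_distD (psi (s + h) y) _ _)).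
by rewrite [q]splitr; exact: lerD.
Qed.

(** Over a short time, [psi] plus the running cost grows along any motion at the rate given
    by the derivatives at the initial position, uniformly in the controls.  The sign [sg]
    yields both inequalities. *)
Lemma chain_estimate t x e : 0 <= t < T -> ACpath x -> 0 < e ->
  exists delta, [/\ 0 < delta, t + delta < T &
  forall sg kappa u v y, `|sg| <= 1 -> controls T P t u -> controls T Q t v -> motion t x u v y ->
   (forall s, t <= s <= T -> kappa <= sg * (dt t x + dotv (grad t x) (f t (x t) (u s) (v s)) + chi t (x t) (u s) (v s))) ->
   (kappa - e) * delta <= sg * (psi (t + delta) y - psi t x + rI t (t + delta) (fun s => chi s (y s) (u s) (v s)))].
Proof.
move=> /andP[t0 tT] xA e0; have tTT : 0 <= t <= T by rewrite t0 ltW.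
have [C C0 hC] := motion_branch xA.
have [C' C'0 [_ hC']] := motion_modulus G xA.
have [_ _ cdt cgrad] := smooth.
have Dtx : @cylinder_open R n T alpha (t, x) by split => //=; rewrite t0.
pose g0 := grad t x.
(* the four error terms below add up to m * e1 = e / 2 *)
pose m := 2 + n%:R * C + n%:R * `|g0|.
have m0 : 0 < m.
  by rewrite /m ltr_pwDl// ?mulr_ge0// ltr_pwDl// mulr_ge0// ltW.
pose e1 := e / 2 / m; have e10 : 0 < e1 by rewrite !divr_gt0.
have [d1 d10 hd1] := cylinder_continuous cdt Dtx e10.
have [d2 d20 hd2] := cylinder_continuous cgrad Dtx e10.
have [d3 d30 hd3] := data_uniform G (x t) (ag_f G) tTT e10.
have [d4 d40 hd4] := data_uniform G (V := R^o) (x t) (ag_chi G) tTT e10.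
pose d := Num.min (Num.min d1 d2) (Num.min d3 d4).
have d0 : 0 < d by rewrite !lt_min d10 d20 d30 d40.
have dd : [/\ d <= d1, d <= d2, d <= d3 & d <= d4].
  by have : d <= d by []; rewrite {2}/d !le_min => /andP[/andP[-> ->] /andP[-> ->]].
have [dl1 dl2 dl3 dl4] := dd.
have CC : 0 < C + C' by rewrite addr_gt0.
have dC : 0 < d / 2 / (C + C') by rewrite !divr_gt0.
have [r r0 hr] := powR_small a01 dC.
pose delta := Num.min (Num.min r (d / 2)) ((T - t) / 2).
have del0 : 0 < delta by rewrite !lt_min r0 !divr_gt0// subr_gt0.
have : delta <= delta by []; rewrite {2}/delta !le_min => /andP[/andP[delr deld] delT].
have tdT : t + delta < T by lra.
have small s : t <= s <= t + delta -> `|t - s| < d /\ (C + C') * (s - t) `^ alpha < d.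
  move=> /andP[ts sd]; split; first by rewrite distrC ger0_norm ?subr_ge0//; lra.
  apply: (@le_lt_trans _ _ (d / 2)); last lra.
  rewrite mulrC -ler_pdivlMr//; apply: hr; rewrite subr_ge0 ts/=; lra.
exists delta; split => // sg kappa u v y sg1 cu cv my hk.
have yA := motion_AC my; have [fC hbr] := hC t u v y tTT cu cv my.
have [B rB] := running_int G t0 yA cu cv.
have td0 : t <= t + delta by rewrite lerDl ltW.
pose run s := running T chi t y u v s.
(* its lower right derivative is at least - e, by the expansion at a path which agrees
   with y up to s and is close to x everywhere *)
pose D s := sg * (psi s y + rI t s run) - kappa * (s - t).
have Bge0 := bmeas_ge0 rB.
have ytx : psi t y = psi t x.
  apply: smooth_nonanticipative => //; first by rewrite t0.
  by move=> r0' rt; exact: motion_initial my rt.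
have main : - (e * (t + delta - t)) <= D (t + delta) - D t.
  apply: real_induction => //.
    move=> s /andP[ts sd] q q0.
    have sT : 0 <= s <= T by rewrite (le_trans t0 ts) (le_trans sd (ltW tdT)).
    have q2 : 0 < q / 2 by rewrite divr_gt0.
    have [d5 d50 hd5] := psi_time_continuous yA sT q2.
    pose L := B + `|kappa| + 1; have L0 : 0 < L by rewrite ltr_wpDl// addr_ge0.
    exists (Num.min d5 (q / 2 / L)); first by rewrite lt_min d50 divr_gt0.
    move=> s' /andP[ts' sd']; rewrite lt_min => /andP[sd5 sq].
    have sT' : 0 <= s' <= T by rewrite (le_trans t0 ts') (le_trans sd' (ltW tdT)).
    have h1 := hd5 s' sT' sd5.
    have Iss (a b : R) : t <= a -> a <= b -> rI t b run - rI t a run = rI a b run.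
      by move=> ta ab; rewrite (rI_chasles ta ab (bmeas_int t b rB)) addrAC subrr add0r.
    have h2 : `|rI t s run - rI t s' run| <= B * `|s - s'|.
      have [le|/ltW le] := leP s s'.
        rewrite distrC (distrC s) (ger0_norm (x := s' - s)) ?subr_ge0// Iss//.
        exact: rI_bmeas_le.
      by rewrite (ger0_norm (x := s - s')) ?subr_ge0// Iss//; exact: rI_bmeas_le.
    have -> : D s - D s' = sg * (psi s y - psi s' y) + (sg * (rI t s run - rI t s' run) - kappa * (s - s')).
      by rewrite /D; ring.
    apply: (le_trans (ler_normD _ _)); rewrite [q]splitr; apply: lerD.
      rewrite normrM; apply: le_trans h1; exact: ler_piMl.
    apply: (@le_trans _ _ (L * `|s - s'|)); last by rewrite mulrC -ler_pdivlMr// ltW.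
    apply: (le_trans (ler_normB _ _)); rewrite !normrM /L -addrA mulrDl; apply: lerD.
      by apply: le_trans h2; exact: ler_piMl.
    by rewrite ler_wpM2r// lerDl.
  move=> s /andP[ts sd].
  have sdl : t <= s <= t + delta by rewrite ts ltW.
  have sT : s < T := lt_trans sd tdT.
  have tsT : t <= s <= T by rewrite ts ltW.
  have [yh [yhA yhE yhx]] := hbr s tsT.
  have [ss1 ss2] := small s sdl.
  have e2 : 0 < e / 2 by rewrite divr_gt0.
  have s0T : 0 <= s < T by rewrite sT (le_trans t0).
  have yg : ae_on s T (fun xi => caputo alpha y xi = fdyn T f t y u v xi).
    have [_ yf] := my; apply: (ae_onW _ (ae_on_sub ts (lexx T) yf)) => xi /andP[sx xt] ->.
    by rewrite fdyn_in// (le_trans ts sx).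
  have [h0 h00 hh] := ci_expansion s0T yhA yA yhE fC yg e2.
  rewrite (smooth_nonanticipative s0T yhA yA yhE) in hh.
  have Dsy : @cylinder_open R n T alpha (s, yh) by split => //=; rewrite (le_trans t0 ts).
  have cl q : 0 <= q <= T -> `|x q - yh q| < d.
    move=> _; apply: le_lt_trans ss2; apply: (le_trans (yhx q)).
    by rewrite ler_wpM2r ?powR_ge0// lerDl ltW.
  have adt : `|dt t x - dt s yh| <= e1.
    apply: hd1 => //; first exact: lt_le_trans ss1 dl1.
    by move=> q qT; exact: lt_le_trans (cl q qT) dl1.
  have agrad : `|g0 - grad s yh| <= e1.
    apply: hd2 => //; first exact: lt_le_trans ss1 dl2.
    by move=> q qT; exact: lt_le_trans (cl q qT) dl2.
  exists h0 => // h /andP[hp hlt] shd.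
  have shT : s + h <= T := le_trans shd (ltW tdT).
  have hph : 0 < h < h0 by rewrite hp.
  have := hh h hph (le_lt_trans shd tdT); set FD := fdyn T f t y u v in fC *; set b := grad s yh in agrad *; set a := dt s yh in adt *.
  have bb := dotv_bmeas b fC => hexp.
  pose A xi := a + dotv b (FD xi) + run xi.
  have Ai : iI s (s + h) A.
    by apply: iID; [apply: iID; [exact: cst_int|exact: bmeas_int bb]|exact: bmeas_int rB].
  have Aint : rI s (s + h) A = a * h + rI s (s + h) (fun xi => dotv b (FD xi)) + rI s (s + h) run.
    rewrite rID; [|by apply: iID; [exact: cst_int|exact: bmeas_int bb]|exact: bmeas_int rB].
    rewrite rID; [|exact: cst_int|exact: bmeas_int bb].
    by rewrite rI_cst ?lerDl ?(ltW hp)// (_ : s + h - s = h)//; ring.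
  have low : (kappa - e / 2) * h <= sg * rI s (s + h) A.
    rewrite -rIZl//.
    apply: (@le_trans _ _ (rI s (s + h) (fun=> kappa - e / 2))).
      by rewrite rI_cst ?lerDl ?(ltW hp)// (_ : s + h - s = h)//; ring.
    apply: rI_le; [exact: cst_int|exact: iIZl|move=> xi /andP[sx xs]].
    have xd : t <= xi <= t + delta by rewrite (le_trans ts sx) (le_trans xs).
    have xT : t <= xi <= T.
      by case/andP: xd => -> xi1; rewrite (le_trans xi1)// ltW.
    have xT' : 0 <= xi <= T by case/andP: xT => h1 ->; rewrite (le_trans t0 h1).
    have [x1 x2] := small xi xd.
    have [_ Pu] := cu; have [_ Qv] := cv; have Pux := Pu xi xT; have Qvx := Qv xi xT.
    have yx : `|x t - y xi| < d.
      have -> : x t = y t by rewrite (motion_initial my)// t0 lexx.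
      rewrite distrC; apply: le_lt_trans x2; case/andP: xT => h1 h2.
      apply: (le_trans (hC' t u v y tTT cu cv my t xi t0 h1 h2)).
      by rewrite ler_wpM2r ?powR_ge0// lerDr ltW.
    have af := hd3 xi (y xi) (u xi) (v xi) xT' (lt_le_trans x1 dl3) (lt_le_trans yx dl3) Pux Qvx.
    have ac := hd4 xi (y xi) (u xi) (v xi) xT' (lt_le_trans x1 dl4) (lt_le_trans yx dl4) Pux Qvx.
    have hkx := hk xi xT.
    have FC : `|FD xi| <= C by case: fC.
    have FE : FD xi = f xi (y xi) (u xi) (v xi) by rewrite /FD fdyn_in.
    rewrite -FE in af.
    set f0 := f t (x t) (u xi) (v xi) in af hkx; set c0 := chi t (x t) (u xi) (v xi) in ac hkx.
    rewrite /A /run running_in//; set c1 := chi xi _ _ _ in ac *.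
    have bound : `|a + dotv b (FD xi) + c1 - (dt t x + dotv g0 f0 + c0)| <= e / 2.
      have -> : a + dotv b (FD xi) + c1 - (dt t x + dotv g0 f0 + c0) =
         (a - dt t x) + (c1 - c0) + (dotv (b - g0) (FD xi) + dotv g0 (FD xi - f0)).
        by rewrite dotvBl dotvBr; ring.
      have n0 : 0 <= n%:R :> R by [].
      have k1 : `|dotv (b - g0) (FD xi)| <= n%:R * C * e1.
        apply: (le_trans (dotv_norm_le _ _)); rewrite -mulrA ler_wpM2l// mulrC.
        by apply: ler_pM => //; rewrite distrC.
      have k2 : `|dotv g0 (FD xi - f0)| <= n%:R * `|g0| * e1.
        by apply: (le_trans (dotv_norm_le _ _)); rewrite -mulrA ler_wpM2l// ler_wpM2l.
      have -> : e / 2 = (e1 + e1) + (n%:R * C * e1 + n%:R * `|g0| * e1).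
        have -> : (e1 + e1) + (n%:R * C * e1 + n%:R * `|g0| * e1) = m * e1 by rewrite /m; ring.
        by rewrite /e1 [RHS]mulrCA divff ?mulr1// gt_eqF.
      apply: (le_trans (ler_normD _ _)); apply: lerD.
        by apply: (le_trans (ler_normD _ _)); apply: lerD => //; rewrite distrC.
      by apply: (le_trans (ler_normD _ _)); apply: lerD.
    have sb : - (e / 2) <= sg * (a + dotv b (FD xi) + c1 - (dt t x + dotv g0 f0 + c0)).
      rewrite lerNl; apply: le_trans bound; rewrite -mulrN.
      apply: (le_trans (ler_norm _)); rewrite normrM normrN; exact: ler_piMl.
    rewrite mulrBr in sb; rewrite -/g0 in hkx.
    move: sb hkx; set X1 := sg * _; set X2 := sg * _ => sb hkx; lra.
  have -> : D (s + h) - D s = sg * rI s (s + h) A - kappa * h +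
      sg * (psi (s + h) y - psi s y - (a * h + rI s (s + h) (fun xi => dotv b (FD xi)))).
    rewrite Aint /D (rI_chasles ts _ (bmeas_int t (s + h) rB)); first by ring.
    by rewrite lerDl ltW.
  have sge : - (e / 2 * h) <= sg * (psi (s + h) y - psi s y - (a * h + rI s (s + h) (fun xi => dotv b (FD xi)))).
    rewrite lerNl; apply: le_trans hexp; rewrite -mulrN.
    apply: (le_trans (ler_norm _)); rewrite normrM normrN; exact: ler_piMl.
  move: low sge; rewrite mulrBl; set X1 := sg * _; set X2 := sg * _; set X3 := kappa * h.
  have -> : e * h = e / 2 * h + e / 2 * h by field.
  set X4 := e / 2 * h => low sge; lra.
move: main; rewrite /D (rI_point (b := t)) ?lexx// subrr mulr0 subr0 addr0.
rewrite (_ : t + delta - t = delta); last by ring.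
rewrite (rI_running chi _ _ _ (lexx t) (ltW tdT)) ytx => main.
have -> : sg * (psi (t + delta) y - psi t x + rI t (t + delta) (running T chi t y u v)) =
  sg * (psi (t + delta) y + rI t (t + delta) run) - sg * psi t x by rewrite /run; ring.
rewrite mulrBl; move: main; set X1 := sg * _; set X2 := sg * _; set X3 := kappa * _; set X4 := e * _ => main.
lra.
Qed.

End Functional.

End ChainRule.

(** * The viscosity inequalities *)

Section Hamiltonian.
Context {R : realType} {n nP nQ : nat} (T alpha : R)
  (P : set 'rV[R]_nP) (Q : set 'rV[R]_nQ)
  (f : R -> 'rV[R]_n -> 'rV[R]_nP -> 'rV[R]_nQ -> 'rV[R]_n)
  (chi : R -> 'rV[R]_n -> 'rV[R]_nP -> 'rV[R]_nQ -> R) (c : R).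
Hypothesis G : admissible_game T alpha P Q f chi c.
Variables (t : R) (x s : 'rV[R]_n).
Hypothesis tT : 0 <= t <= T.

Let ham p q := dotv s (f t x p q) + chi t x p q.

Lemma ham_bounded : exists B, forall p q, P p -> Q q -> `|ham p q| <= B.
Proof.
have r0 : 0 < `|x| + 1 by rewrite ltr_wpDl.
have [B B0 hB] := chi_bound G r0; have [C C0 hC] := data_growth G.
exists (n%:R * (`|s| * (C * (1 + `|x|))) + B) => p q Pp Qq.
apply: (le_trans (ler_normD _ _)); apply: lerD; last by apply: hB => //; rewrite lerDl.
apply: (le_trans (dotv_norm_le _ _)); rewrite ler_wpM2l// ler_wpM2l//; exact: hC.
Qed.

(** The Hamiltonian is bounded over P x Q, so near-extremal controls exist. *)
Lemma minmax_near e : 0 < e -> exists2 p, P p & forall q, Q q -> ham p q <= minmax P Q f chi t x s + e.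
Proof.
move=> e0; have [B hB] := ham_bounded; have [p0 Pp0] := ag_P0 G; have [q0 Qq0] := ag_Q0 G.
have le_sup p q : P p -> Q q -> ham p q <= sup [set ham p q' | q' in Q].
  move=> Pp Qq; apply: ub_le_sup; last by exists q.
  by exists B => _ [q' Qq' <-]; apply: (le_trans (ler_norm _)); exact: hB.
have hi : has_inf [set sup [set ham p q | q in Q] | p in P].
  split; first by exists (sup [set ham p0 q | q in Q]), p0.
  exists (- B) => _ [p Pp <-]; apply: le_trans (le_sup p q0 Pp Qq0).
  by have := hB p q0 Pp Qq0; rewrite ler_norml => /andP[].
have [_ [p Pp <-] hp] := inf_adherent e0 hi.
by exists p => // q Qq; apply: (le_trans (le_sup p q Pp Qq)); exact: ltW.
Qed.

Lemma maxmin_near e : 0 < e -> exists2 q, Q q & forall p, P p -> maxmin P Q f chi t x s - e <= ham p q.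
Proof.
move=> e0; have [B hB] := ham_bounded; have [p0 Pp0] := ag_P0 G; have [q0 Qq0] := ag_Q0 G.
have inf_le p q : P p -> Q q -> inf [set ham p' q | p' in P] <= ham p q.
  move=> Pp Qq; apply: ge_inf; last by exists p.
  exists (- B) => _ [p' Pp' <-]; by have := hB p' q Pp' Qq; rewrite ler_norml => /andP[].
have hs : has_sup [set inf [set ham p q | p in P] | q in Q].
  split; first by exists (inf [set ham p q0 | p in P]), q0.
  exists B => _ [q Qq <-]; apply: (le_trans (inf_le p0 q Pp0 Qq)).
  by apply: (le_trans (ler_norm _)); exact: hB.
have [_ [q Qq <-] hq] := sup_adherent e0 hs.
by exists q => // p Pp; apply: le_trans (inf_le p q Pp Qq); exact: ltW.
Qed.

End Hamiltonian.

Section Viscosity.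
Context {R : realType} {n nP nQ : nat} (T alpha : R)
  (P : set 'rV[R]_nP) (Q : set 'rV[R]_nQ)
  (f : R -> 'rV[R]_n -> 'rV[R]_nP -> 'rV[R]_nQ -> 'rV[R]_n)
  (chi : R -> 'rV[R]_n -> 'rV[R]_nP -> 'rV[R]_nQ -> R) (c : R).
Hypothesis G : admissible_game T alpha P Q f chi c.
Variable sigma : (R -> 'rV[R]_n) -> R.
Implicit Types (x y w g : R -> 'rV[R]_n) (z : 'rV[R]_n) (u : R -> 'rV[R]_nP) (v : R -> 'rV[R]_nQ) (t s M S : R)
  (X : set (pathsp T n)).

Let T0 : 0 < T := ag_T G.
Let a01 : 0 < alpha < 1 := ag_alpha G.
Local Notation motion := (motion T alpha f).
Local Notation ACpath := (ACpath T alpha).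
Local Notation value := (value T alpha P Q f chi sigma).
Local Notation Xset := (Xset T alpha c).

Hypothesis hsigma : forall X, X `<=` ACpath -> compact X ->
     exists2 lambda : R, 0 < lambda &
       forall x y : R -> 'rV[R]_n, X x -> X y ->
         `|sigma x - sigma y| <= lambda * (enorm (x T - y T)
           + rI 0 T (fun tau => enorm (x tau - y tau))).

(** The growth condition makes the sets of test paths invariant under the dynamics. *)
Lemma motion_Xset k t x u v y : (0 < k)%N -> 0 <= t <= T -> controls T P t u -> controls T Q t v ->
  Xset k x -> motion t x u v y -> Xset k y.
Proof.
move=> k0 /andP[t0 tT] [_ Pu] [_ Qv] [xA x0k xg] my; have yA := motion_AC my; split => //.
  by rewrite (motion_initial my) ?lexx.
have yx s : 0 <= s <= t -> y s = x s by exact: motion_initial my.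
apply: (@ae_on_cat _ _ t).
  apply: (ae_onW _ (ae_on_and (caputo_ae_local alpha yx) (ae_on_sub (lexx 0) tT xg))) => s st [-> h].
  by rewrite yx.
have [_ yf] := my; apply: (ae_onW _ yf) => s /andP[ts sT] ->.
have sT' : 0 <= s <= T by rewrite sT (le_trans t0).
have tsT : t <= s <= T by rewrite ts.
apply: (le_trans (ag_growth G (y s) sT' (Pu s tsT) (Qv s tsT))).
rewrite -mulrA ler_peMl ?ler1n//.
by rewrite mulr_ge0 ?(ltW (ag_c G))// addr_ge0// enorm_ge0.
Qed.

Section TestFunctional.
Variables (psi dt : R -> (R -> 'rV[R]_n) -> R) (grad : R -> (R -> 'rV[R]_n) -> 'rV[R]_n).
Hypothesis smooth : ci_smooth T alpha psi dt grad.
Variables (k : nat) (t : R) (x : R -> 'rV[R]_n).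
Hypotheses (k0 : (0 < k)%N) (tT : 0 <= t < T) (xX : Xset k x).

Let t0 : 0 <= t. Proof. by case/andP: tT. Qed.
Let tTT : 0 <= t <= T. Proof. by case/andP: tT => -> /ltW ->. Qed.
Let xA : ACpath x. Proof. by case: xX. Qed.

(** If the inequality failed, the second player could keep a constant control for which
    the value exceeds what a nearly optimal strategy of the first player guarantees. *)
Lemma viscosity_min : maxmin P Q f chi t (x t) (grad t x) = minmax P Q f chi t (x t) (grad t x) ->
  (forall s y, 0 <= s <= T -> Xset k y -> value t x - psi t x <= value s y - psi s y) ->
  dt t x + minmax P Q f chi t (x t) (grad t x) <= 0.
Proof.
move=> isaacs hmin; rewrite leNgt; apply/negP; set th := dt t x + _ => th0.
have th4 : 0 < th / 4 by rewrite divr_gt0.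
have [q Qq hq] := maxmin_near G (x t) (grad t x) tTT th4; rewrite isaacs in hq.
have [d [d0 tdT hd]] := chain_estimate G smooth tT xA th4.
have cq : controls T Q t (fun=> q) by exact: controls_cst.
have e0 : 0 < th / 4 * d by rewrite mulr_gt0.
have [a sa ha] := value_near G hsigma tTT xA e0; have [aP _] := sa.
have ca := aP _ cq; have [y my] := motion_exists G xA tTT ca cq.
have ttd : 0 <= t <= t + d by rewrite t0 lerDl ltW.
have h1 := dpp_ge G hsigma xA ttd (ltW tdT) sa cq my ha.
have tdT' : 0 <= t + d <= T by rewrite (ltW tdT) andbT addr_ge0// ltW.
have h2 := hmin (t + d) y tdT' (motion_Xset k0 tTT ca cq xX my).
have [_ Pa] := ca.
have := hd 1 (th / 4 * 3) (a (fun=> q)) (fun=> q) y _ ca cq my.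
rewrite normr1 !mul1r => /(_ (lexx 1)) h3.
have {}h3 : (th / 4 * 3 - th / 4) * d <=
    psi (t + d) y - psi t x + rI t (t + d) (fun s => chi s (y s) (a (fun=> q) s) q).
  apply: h3 => s sT; rewrite mul1r; have := hq _ (Pa s sT).
  rewrite -addrA; set Hm := _ + chi _ _ _ _; rewrite /th; lra.
have E : (th / 4 * 3 - th / 4) * d = th / 4 * d + th / 4 * d by ring.
rewrite E in h3; move: h1 h2 h3 e0; set X1 := th / 4 * d; set X2 := rI _ _ _.
set X3 := value t x; set X4 := value _ y; set X5 := psi _ y; set X6 := psi t x.
move=> h1 h2 h3 e0; lra.
Qed.

(** If the inequality failed, the first player could keep a constant control until a small
    time, and superoptimality would bound the value strictly below itself. *)
Lemma viscosity_max :
  (forall s y, 0 <= s <= T -> Xset k y -> value s y - psi s y <= value t x - psi t x) ->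
  0 <= dt t x + minmax P Q f chi t (x t) (grad t x).
Proof.
move=> hmax; rewrite leNgt; apply/negP; set th := dt t x + _ => th0.
have th4 : 0 < - th / 4 by rewrite divr_gt0// oppr_gt0.
have [p Pp hp] := minmax_near G (x t) (grad t x) tTT th4.
have [d [d0 tdT hd]] := chain_estimate G smooth tT xA th4.
have cp : controls T P t (fun=> p) by exact: controls_cst.
have ttd : 0 <= t <= t + d by rewrite t0 lerDl ltW.
have tdT' : 0 <= t + d <= T by rewrite (ltW tdT) andbT addr_ge0// ltW.
have e0 : 0 < - th / 4 * d by rewrite mulr_gt0.
suff : value t x <= value t x - (- th / 4 * d + - th / 4 * d).
  by rewrite leNgt gtrBl addr_gt0.
apply: (dpp_le G hsigma xA ttd (ltW tdT) cp) => v y cv my.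
have h2 := hmax (t + d) y tdT' (motion_Xset k0 tTT cp cv xX my).
have [_ Qv] := cv.
have := hd (- 1) (- th / 4 * 3) (fun=> p) v y _ cp cv my.
rewrite normrN normr1 => /(_ (lexx 1)) h3.
have {}h3 : (- th / 4 * 3 - - th / 4) * d <=
    - 1 * (psi (t + d) y - psi t x + rI t (t + d) (fun s => chi s (y s) p (v s))).
  apply: h3 => s sT; have := hp _ (Qv s sT).
  rewrite -(addrA (dt t x)); set Hm := _ + chi _ _ _ _; rewrite /th; lra.
have E : (- th / 4 * 3 - - th / 4) * d = - th / 4 * d + - th / 4 * d by ring.
rewrite E in h3; move: h2 h3; set X1 := - th / 4 * d; set X2 := rI _ _ _.
set X3 := value t x; set X4 := value _ y; set X5 := psi _ y; set X6 := psi t x.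
move=> h2 h3; lra.
Qed.

End TestFunctional.

End Viscosity.

Theorem theorem4p2 (R : realType) (n nP nQ : nat)
  (hn : (0 < n)%N) (hnP : (0 < nP)%N) (hnQ : (0 < nQ)%N)
  (T alpha : R) (hT : 0 < T) (halpha : 0 < alpha < 1)
  (P : set 'rV[R]_nP) (Q : set 'rV[R]_nQ)
  (hP : compact P) (hQ : compact Q) (hP0 : P !=set0) (hQ0 : Q !=set0)
  (f : R -> 'rV[R]_n -> 'rV[R]_nP -> 'rV[R]_nQ -> 'rV[R]_n)
  (chi : R -> 'rV[R]_n -> 'rV[R]_nP -> 'rV[R]_nQ -> R)
  (sigma : (R -> 'rV[R]_n) -> R)
  (hf : {within data_domain T P Q, continuous
     (fun z : R * 'rV[R]_n * 'rV[R]_nP * 'rV[R]_nQ => f z.1.1.1 z.1.1.2 z.1.2 z.2)})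
  (hchi : {within data_domain T P Q, continuous
     (fun z : R * 'rV[R]_n * 'rV[R]_nP * 'rV[R]_nQ => chi z.1.1.1 z.1.1.2 z.1.2 z.2)})
  (hlip : forall r : R, 0 < r -> exists2 lambda : R, 0 < lambda &
     forall (t : R) (x y : 'rV[R]_n) u v, 0 <= t <= T -> enorm x <= r -> enorm y <= r -> P u -> Q v ->
       enorm (f t x u v - f t y u v) + `|chi t x u v - chi t y u v|
         <= lambda * enorm (x - y))
  (c : R) (hc : 0 < c)
  (hgrowth : forall (t : R) (x : 'rV[R]_n) u v, 0 <= t <= T -> P u -> Q v ->
     enorm (f t x u v) <= c * (1 + enorm x))
  (hisaacs : forall (t : R) (x s : 'rV[R]_n), 0 <= t <= T ->
     minmax P Q f chi t x s = maxmin P Q f chi t x s)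
  (hsigma : forall X : set (pathsp T n), X `<=` ACpath T alpha -> compact X ->
     exists2 lambda : R, 0 < lambda &
       forall x y : R -> 'rV[R]_n, X x -> X y ->
         `|sigma x - sigma y| <= lambda * (enorm (x T - y T)
           + \int[lebesgue_measure]_(tau in `[0, T]) enorm (x tau - y tau))) :
  viscosity_solution T alpha c (minmax P Q f chi) sigma
    (value T alpha P Q f chi sigma).
Proof.
have G := AdmissibleGame hn hT halpha hP hQ hP0 hQ0 hf hchi hlip hc hgrowth.
split.
- exact: (value_continuous G hsigma).
- exact: (value_condL G hsigma).
- by move=> x _; exact: value_final.
- move=> psi dt grad k smooth k0 t x tT xX; split => hx.
    apply: (viscosity_min G hsigma smooth k0 tT xX _ hx).
    by apply/esym/hisaacs; case/andP: tT => -> /ltW.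
  exact: (viscosity_max G hsigma smooth k0 tT xX hx).
Qed.
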